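(* The map $$\chi:u\in H^{1/2}_{+,\rm gen}\mapsto\Big((\zeta_j:=\lambda_je^{-i\varphi_j})_{j\ge1},\ (\gamma_m:=\mu_me^{-i\theta_m})_{m\ge1}\Big)$$ is a homeomorphism from $H^{1/2}_{+,\rm gen}$ (with the $H^{1/2}$ topology) onto the subset of $\ell^2\times\ell^2$ $$\Xi=\{((\zeta_j)_{j\ge1},(\gamma_m)_{m\ge1})\in\ell^2\times\ell^2:\ |\zeta_1|>|\gamma_1|>|\zeta_2|>|\gamma_2|>\dots>0\}.$$ Moreover, if $u(t)$ is the solution of $i\partial_tu=\Pi(|u|^2u)$ with $u(0)\in H^{1/2}_{+,\rm gen}$, then $u(t)\in H^{1/2}_{+,\rm gen}$ for all $t$ and $\zeta_j(t)=\zeta_j(u(t))$, $\gamma_m(t)=\gamma_m(u(t))$ satisfy $i\dot\zeta_j=\lambda_j^2\zeta_j$, $i\dot\gamma_m=-\mu_m^2\gamma_m$.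
   Context: $L^2_+$ is the Hardy space of the circle (functions $\sum_{k\ge0}\hat u(k)e^{ik\theta}$ in $L^2$), $(u|v)=\int u\bar v\frac{d\theta}{2\pi}$, $H^s_+=H^s\cap L^2_+$, $\Pi$ the Szegő projector onto $L^2_+$. The cubic Szegő equation $i\partial_tu=\Pi(|u|^2u)$ is globally well-posed on $H^{1/2}_+$. For $u\in H^{1/2}_+$, $H_u(h)=\Pi(u\bar h)$ (antilinear Hankel operator), $K_u=H_uT_z$ with $T_z$ multiplication by $z$; $H_u^2$ and $K_u^2$ are positive self-adjoint trace class operators. $H^{1/2}_{+,\rm gen}$ is the set of $u\in H^{1/2}_+$ such that all positive eigenvalues of $H_u^2$ are simple, listed as $\lambda_1^2>\lambda_2^2>\dots$ ($\lambda_j>0$), and $\nu_j:=\|P_j(1)\|\ne0$ for every $j$, where $P_j$ is the orthogonal projector onto the eigenspace of $\lambda_j^2$. For such $u$, the positive eigenvalues $\mu_1^2>\mu_2^2>\dots$ ($\mu_m>0$) of $K_u^2$ are simple and satisfy $\lambda_1>\mu_1>\lambda_2>\mu_2>\dots$; $(e_j)$ and $(f_m)$ are orthonormal systems with $H_ue_j=\lambda_je_j$, $K_uf_m=\mu_mf_m$ (unique up to signs), and $\varphi_j=\arg(1|e_j)^2$, $\theta_m=\arg(u|f_m)^2$. *)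

(* Defs.v *)
(* classical reals.  Everything is encoded on Fourier
   coefficients: a function u in L^2_+ is its coefficient sequence
   (u k)_{k>=0} (u = sum_k u k e^{ik theta}). *)
From Stdlib Require Import Reals ClassicalEpsilon.
Open Scope R_scope.

Definition C := (R * R)%type.
Definition C0 : C := (0, 0).
Definition C1 : C := (1, 0).
Definition Ci : C := (0, 1).
Definition Cadd (z w : C) : C := (fst z + fst w, snd z + snd w).
Definition Copp (z : C) : C := (- fst z, - snd z).
Definition Csub (z w : C) : C := Cadd z (Copp w).
Definition Cmul (z w : C) : C :=
  (fst z * fst w - snd z * snd w, fst z * snd w + snd z * fst w).
Definition Cconj (z : C) : C := (fst z, - snd z).
Definition Cscale (r : R) (z : C) : C := (r * fst z, r * snd z).
Definition Cnorm2 (z : C) : R := fst z * fst z + snd z * snd z.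
Definition Cabs (z : C) : R := sqrt (Cnorm2 z).
(* e^{-i arg w} = conj(w)/|w| for w <> 0 *)
Definition Cexp_minus_i_arg (w : C) : C := Cscale (/ Cabs w) (Cconj w).

Definition CSeries (f : nat -> C) (l : C) : Prop :=
  infinite_sum (fun k => fst (f k)) (fst l) /\
  infinite_sum (fun k => snd (f k)) (snd l).
Definition Csum (f : nat -> C) : C :=
  epsilon (inhabits C0) (fun l => CSeries f l).
Definition Rsum (f : nat -> R) : R :=
  epsilon (inhabits 0) (fun l => infinite_sum f l).

Definition Cderiv (f : R -> C) (t : R) (z : C) : Prop :=
  derivable_pt_lim (fun s => fst (f s)) t (fst z) /\
  derivable_pt_lim (fun s => snd (f s)) t (snd z).

Definition seqC := nat -> C.
Definition is_l2 (h : seqC) : Prop :=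
  exists l, infinite_sum (fun k => Cnorm2 (h k)) l.
Definition is_H12 (u : seqC) : Prop :=
  exists l, infinite_sum (fun k => (1 + INR k) * Cnorm2 (u k)) l.
Definition dH12 (u v : seqC) : R :=
  sqrt (Rsum (fun k => (1 + INR k) * Cnorm2 (Csub (u k) (v k)))).
Definition l2norm2 (h : seqC) : R := Rsum (fun k => Cnorm2 (h k)).
Definition nonzero (h : seqC) : Prop := exists n, h n <> C0.

(* (h|g) = int h conj(g) dtheta/2pi = sum_k h_k conj(g_k) *)
Definition inner (h g : seqC) : C := Csum (fun k => Cmul (h k) (Cconj (g k))).
Definition one : seqC := fun n => match n with O => C1 | S _ => C0 end.

(* H_u h = Pi(u conj h): (H_u h)_n = sum_k u_{n+k} conj(h_k) *)
Definition hankel (u h : seqC) : seqC :=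
  fun n => Csum (fun k => Cmul (u (n + k)%nat) (Cconj (h k))).
(* T_z : multiplication by z *)
Definition Tz (h : seqC) : seqC :=
  fun n => match n with O => C0 | S m => h m end.
Definition kop (u h : seqC) : seqC := hankel u (Tz h).

Definition eigsp2 (A : seqC -> seqC) (s : R) (h : seqC) : Prop :=
  is_l2 h /\ forall n, A (A h) n = Cscale s (h n).
Definition is_eigval2 (A : seqC -> seqC) (s : R) : Prop :=
  exists h, eigsp2 A s h /\ nonzero h.
Definition simple_space (E : seqC -> Prop) : Prop :=
  forall h g, E h -> nonzero h -> E g -> exists c : C, forall n, g n = Cmul c (h n).
Definition proj_nonzero (E : seqC -> Prop) (v : seqC) : Prop :=
  forall p, E p -> (forall h, E h -> inner (fun n => Csub (v n) (p n)) h = C0) ->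
  nonzero p.

(* lam : nat -> R (index 0 = paper's index 1) is a strictly decreasing
   enumeration by positive reals whose squares are exactly the positive
   eigenvalues of A^2 *)
Definition enumerates (A : seqC -> seqC) (lam : nat -> R) : Prop :=
  (forall j, 0 < lam j) /\ (forall j, lam (S j) < lam j) /\
  (forall s, 0 < s -> (is_eigval2 A s <-> exists j, s = lam j ^ 2)).

Definition gen (u : seqC) : Prop :=
  is_H12 u /\
  exists lam : nat -> R, enumerates (hankel u) lam /\
    forall j, simple_space (eigsp2 (hankel u) (lam j ^ 2)) /\
              proj_nonzero (eigsp2 (hankel u) (lam j ^ 2)) one.

Definition chi_rel (u : seqC) (p : seqC * seqC) : Prop :=
  exists (lam mu : nat -> R) (e f : nat -> seqC),
    enumerates (hankel u) lam /\ enumerates (kop u) mu /\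
    (forall j, is_l2 (e j) /\ l2norm2 (e j) = 1 /\
               forall n, hankel u (e j) n = Cscale (lam j) (e j n)) /\
    (forall m, is_l2 (f m) /\ l2norm2 (f m) = 1 /\
               forall n, kop u (f m) n = Cscale (mu m) (f m n)) /\
    (forall j, let w := Cmul (inner one (e j)) (inner one (e j)) in
               w <> C0 /\ fst p j = Cscale (lam j) (Cexp_minus_i_arg w)) /\
    (forall m, let w := Cmul (inner u (f m)) (inner u (f m)) in
               w <> C0 /\ snd p m = Cscale (mu m) (Cexp_minus_i_arg w)).

Definition chi (u : seqC) : seqC * seqC :=
  epsilon (inhabits ((fun _ => C0), (fun _ => C0))) (chi_rel u).

Definition Xi (p : seqC * seqC) : Prop :=
  is_l2 (fst p) /\ is_l2 (snd p) /\
  forall j, Cabs (fst p j) > Cabs (snd p j) /\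
            Cabs (snd p j) > Cabs (fst p (S j)) /\
            Cabs (snd p j) > 0.

Definition dXi (p q : seqC * seqC) : R :=
  sqrt (Rsum (fun j => Cnorm2 (Csub (fst p j) (fst q j))) +
        Rsum (fun m => Cnorm2 (Csub (snd p m) (snd q m)))).

(* Fourier coefficient k >= 0 of |u|^2 u = u * w with w = u conj(u):
   w_n = sum_q u_{q+n} conj(u_q) (n in Z, u_m = 0 for m < 0). *)
Definition wcoef (u : seqC) (k p : nat) : C :=
  if Nat.leb p k
  then Csum (fun q => Cmul (u (q + (k - p))%nat) (Cconj (u q)))
  else Csum (fun q => Cmul (u q) (Cconj (u (q + (p - k))%nat))).
Definition szego_nl (u : seqC) (k : nat) : C :=
  Csum (fun p => Cmul (u p) (wcoef u k p)).

Definition szego_solution (U : R -> seqC) : Prop :=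
  (forall t, is_H12 (U t)) /\
  (forall t eps, 0 < eps -> exists delta, 0 < delta /\
     forall s, Rabs (s - t) < delta -> dH12 (U s) (U t) < eps) /\
  (forall t k, exists z, Cderiv (fun s => U s k) t z /\
     Cmul Ci z = szego_nl (U t) k).

(* Main.v *)
Require Import Defs.
From Stdlib Require Import Reals Lra Lia Psatz Arith ClassicalEpsilon FunctionalExtensionality ProofIrrelevance.
From Coquelicot Require Import Coquelicot.
Local Open Scope R_scope.

(** The phases are absorbed by normalising eigenvectors differently from the paper:
    [H_u e_j = conj zeta_j e_j] with [(u|e_j) = alpha_j > 0], and [K_u f_m = gamma_m f_m] with
    [(u|f_m) = beta_m > 0].  Since [K_u^2 = H_u^2 - (.|u)u], the squares [x_j = |zeta_j|^2],
    [y_m = |gamma_m|^2] interlace and satisfy the secular equations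
    [sum_j alpha_j^2 / (x_j - y_m) = 1], which determine the weights [alpha_j], continuously in
    [(x, y)]; the overlaps are [(f_m|e_j) = alpha_j beta_m / (x_j - y_m)].
    As [K_u] is [H_u] followed by the backward shift, all Fourier coefficients of the [e_j], [f_m] and [u]
    follow recursively from [(zeta, gamma)]: this gives injectivity and, with
    [|u|_{H^{1/2}}^2 = sum_j x_j], continuity of the inverse.  Forward continuity is perturbation theory
    for compact operators.
    For surjectivity, solve the secular equations, build the operators [H] and [K] on [l^2], and check that
    the contraction [A] with [A H = K] has [A^n -> 0]; it is then a backward shift and [H] becomes a
    Hankel operator.
    For the dynamics, the function built from [zeta_j e^{-i x_j t}], [gamma_m e^{i y_m t}] is shown to
    solve the equation; it equals [u(t)] by uniqueness in [C(R, H^{1/2})], obtained from a Gronwall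
    argument in [L^2] where a frequency cut-off at [N] costs only [log N]. *)

(** H^{1/2} just fails to embed in L^infinity, so the nonlinearity is not Lipschitz in L^2: the
    squared L^2 distance g of two solutions bounded by M only satisfies g' <= C M (1 + log N) g + C
    M^2 N^(-1/4), for every N. With N = 2^(4p) and times of order 1/M the exponential grows like
    e^(p/2) and the error decays like 2^(-p); letting p grow gives g = 0, and short intervals are
    chained. In the construction the weights are limits of residues of finite products, and the
    value of these products at 0 gives sum_j alpha_j^2 / x_j <= 1. This makes H^2 - (.|u)u
    nonnegative, as K^2 must be. That A^n tends to 0 combines three facts: the Hilbert-Schmidt norm
    of the future Hankel operator is finite, so A^n u tends to 0; a vector on which A acts
    isometrically forwards and backwards is orthogonal to all H^(2k) 1; since the x_j are distinct,
    moments then annihilate it. In both continuity statements, norm convergence comes from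
    convergence of coordinates and of norms, the norms being traces. *)

Ltac cring := match goal with |- ?a = ?b => change (@eq Complex.C a b); ring end.

(** * Series of real numbers *)

Fixpoint psum (f : nat -> R) (n : nat) : R :=
  match n with O => 0 | S k => psum f k + f k end.

Lemma psum_sum_n f n : psum f (S n) = sum_n f n.
Proof.
  induction n as [|n IH].
  - rewrite sum_O. simpl. ring.
  - rewrite sum_Sn, <- IH. reflexivity.
Qed.

Lemma is_series_psum f (l : R) : is_series f l <-> is_lim_seq (psum f) l.
Proof.
  rewrite (is_lim_seq_incr_1 (psum f)).
  split; intro H.
  - apply is_lim_seq_ext with (sum_n f); [intro n; symmetry; apply psum_sum_n | exact H].
  - apply (is_lim_seq_ext _ (sum_n f) l (psum_sum_n f)) in H. exact H.
Qed.

Lemma psum_ext f g n : (forall k, (k < n)%nat -> f k = g k) -> psum f n = psum g n.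
Proof.
  induction n as [|n IH]; intro H; simpl; auto.
  rewrite IH, (H n); auto.
Qed.

Lemma psum_plus f g n : psum (fun k => f k + g k) n = psum f n + psum g n.
Proof. induction n as [|n IH]; simpl; [ring | rewrite IH; ring]. Qed.

Lemma psum_scal c f n : psum (fun k => c * f k) n = c * psum f n.
Proof. induction n as [|n IH]; simpl; [ring | rewrite IH; ring]. Qed.

Lemma psum_minus f g n : psum (fun k => f k - g k) n = psum f n - psum g n.
Proof. induction n as [|n IH]; simpl; [ring | rewrite IH; ring]. Qed.

Lemma psum_le f g n : (forall k, (k < n)%nat -> f k <= g k) -> psum f n <= psum g n.
Proof.
  induction n as [|n IH]; intro H; simpl; [lra|].
  apply Rplus_le_compat; auto.
Qed.

Lemma psum_pos f n : (forall k, (k < n)%nat -> 0 <= f k) -> 0 <= psum f n.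
Proof.
  induction n as [|n IH]; intro H; simpl; [lra|].
  apply Rplus_le_le_0_compat; auto.
Qed.

Lemma psum_le_n f n m : (forall k, 0 <= f k) -> (n <= m)%nat -> psum f n <= psum f m.
Proof. intros H L; induction L; [lra | simpl; specialize (H m); lra]. Qed.

Lemma psum_single f n k : (k < n)%nat -> (forall i, (i < n)%nat -> i <> k -> f i = 0) -> psum f n = f k.
Proof.
  revert k; induction n as [|n IH]; intros k L H; [lia|].
  simpl. destruct (Nat.eq_dec k n) as [->|ne].
  - replace (psum f n) with 0; [ring|].
    symmetry. rewrite (psum_ext f (fun _ => 0)).
    + clear. induction n; simpl; lra.
    + intros i Hi; apply H; lia.
  - rewrite (IH k), (H n); try lia; [ring|]. intros i Hi ?; apply H; lia.
Qed.

Lemma psum_swap (f : nat -> nat -> R) n m :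
  psum (fun i => psum (fun j => f i j) m) n = psum (fun j => psum (fun i => f i j) n) m.
Proof.
  induction n as [|n IH]; simpl.
  - induction m; simpl; lra.
  - rewrite IH, <- psum_plus. reflexivity.
Qed.

Lemma psum_le_Series f n : (forall k, 0 <= f k) -> ex_series f -> psum f n <= Series f.
Proof.
  intros H E.
  apply Series_correct, is_series_psum in E.
  apply (is_lim_seq_incr_compare (psum f) (Series f) E).
  intro k; simpl; specialize (H k); lra.
Qed.

Lemma Series_pos f : (forall k, 0 <= f k) -> ex_series f -> 0 <= Series f.
Proof. intros H E. apply (psum_le_Series f 0 H E). Qed.

Lemma term_le_Series f k : (forall k, 0 <= f k) -> ex_series f -> f k <= Series f.
Proof.
  intros H E. eapply Rle_trans; [|apply (psum_le_Series f (S k) H E)].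
  simpl. assert (0 <= psum f k) by (apply psum_pos; auto). lra.
Qed.

Lemma ex_series_bdd f M : (forall k, 0 <= f k) -> (forall n, psum f n <= M) ->
  ex_series f /\ Series f <= M.
Proof.
  intros H B.
  destruct (ex_finite_lim_seq_incr (psum f) M) as [l Hl]; auto.
  { intro n; simpl; specialize (H n); lra. }
  assert (is_series f l) by (apply is_series_psum; exact Hl).
  split; [exists l; auto|]. rewrite (is_series_unique f l) by auto.
  apply (is_lim_seq_le (psum f) (fun _ => M) l M B Hl (is_lim_seq_const M)).
Qed.

Lemma ex_series_le' (a b : nat -> R) : (forall n, Rabs (a n) <= b n) -> ex_series b -> ex_series a.
Proof. intros H E. apply (ex_series_le a b); auto. Qed.

Lemma Series_le' a b : (forall n, a n <= b n) -> ex_series a -> ex_series b -> Series a <= Series b.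
Proof.
  intros H Ea Eb.
  apply Series_correct, is_series_psum in Ea. apply Series_correct, is_series_psum in Eb.
  apply (is_lim_seq_le (psum a) (psum b) (Series a) (Series b)); auto.
  intro n; apply psum_le; auto.
Qed.

Lemma Series_split f n : ex_series f ->
  Series f = psum f n + Series (fun k => f (n + k)%nat) /\ ex_series (fun k => f (n + k)%nat).
Proof.
  intros E. split.
  - destruct n as [|n].
    + simpl. rewrite Rplus_0_l. apply Series_ext; auto.
    + rewrite (Series_incr_n f (S n)); auto; [|lia]. simpl pred.
      rewrite <- sum_n_Reals, psum_sum_n. reflexivity.
  - apply (ex_series_incr_n f n); auto.
Qed.

Lemma Series_tail_abs f g n : (forall k, Rabs (f k) <= g k) -> ex_series g ->
  Rabs (Series f - psum f n) <= Series g - psum g n.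
Proof.
  intros H E.
  assert (Ef : ex_series f) by (apply ex_series_le' with g; auto).
  destruct (Series_split f n Ef) as [-> E1].
  destruct (Series_split g n E) as [-> E2].
  replace (psum f n + Series (fun k => f (n + k)%nat) - psum f n) with (Series (fun k => f (n + k)%nat)) by ring.
  replace (psum g n + Series (fun k => g (n + k)%nat) - psum g n) with (Series (fun k => g (n + k)%nat)) by ring.
  eapply Rle_trans; [apply Series_Rabs|].
  - apply ex_series_le' with (fun k => g (n + k)%nat); auto. intro; rewrite Rabs_Rabsolu; auto.
  - apply Series_le; auto. intro k; split; [apply Rabs_pos | auto].
Qed.

Lemma is_lim_seq_psum (f : nat -> nat -> R) (g : nat -> R) n :
  (forall k, is_lim_seq (fun N => f N k) (g k)) -> is_lim_seq (fun N => psum (f N) n) (psum g n).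
Proof.
  intro H; induction n as [|n IH]; simpl; [apply is_lim_seq_const|].
  apply is_lim_seq_plus'; auto.
Qed.

Lemma lim_eps (u : nat -> R) (l : R) :
  is_lim_seq u l <-> forall eps, 0 < eps -> exists N, forall n, (N <= n)%nat -> Rabs (u n - l) < eps.
Proof.
  rewrite <- is_lim_seq_spec. split.
  - intros H eps he. destruct (H (mkposreal eps he)) as [N HN]. exists N; intros; apply HN; auto.
  - intros H eps. destruct (H eps (cond_pos eps)) as [N HN]. exists N; intros; apply HN; auto.
Qed.

(* Pratt's form of dominated convergence: the dominating series may move with N. *)
Lemma dominated_series (f g : nat -> nat -> R) (f0 g0 : nat -> R) :
  (forall k, is_lim_seq (fun N => f N k) (f0 k)) ->
  (forall k, is_lim_seq (fun N => g N k) (g0 k)) ->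
  (forall N k, Rabs (f N k) <= g N k) ->
  (forall N, ex_series (g N)) -> ex_series g0 ->
  is_lim_seq (fun N => Series (g N)) (Series g0) ->
  ex_series f0 /\ is_lim_seq (fun N => Series (f N)) (Series f0).
Proof.
  intros Hf Hg B E E0 S.
  assert (B0 : forall k, Rabs (f0 k) <= g0 k).
  { intro k. assert (L : is_lim_seq (fun N => Rabs (f N k)) (Rabs (f0 k))) by apply (is_lim_seq_abs _ (f0 k) (Hf k)).
    apply (is_lim_seq_le _ _ (Rabs (f0 k)) (g0 k) (fun N => B N k) L (Hg k)). }
  split; [apply ex_series_le' with g0; auto|].
  apply lim_eps; intros eps he.
  assert (T := Series_correct _ E0). apply is_series_psum in T.
  (* The five parts: the tail of [g0] twice, once for [f0] and once inside the tail of [g N], then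
     the change of the sum of [g], of its head, and of the head of [f]. *)
  destruct (proj1 (lim_eps _ _) T (eps / 5)) as [n Hn]; [lra|]. specialize (Hn n (le_n n)).
  destruct (proj1 (lim_eps _ _) S (eps / 5)) as [N1 H1]; [lra|].
  destruct (proj1 (lim_eps _ _) (is_lim_seq_psum f f0 n Hf) (eps / 5)) as [N2 H2]; [lra|].
  destruct (proj1 (lim_eps _ _) (is_lim_seq_psum g g0 n Hg) (eps / 5)) as [N3 H3]; [lra|].
  exists (N1 + N2 + N3)%nat; intros N HN.
  specialize (H1 N ltac:(lia)); specialize (H2 N ltac:(lia)); specialize (H3 N ltac:(lia)).
  assert (T1 := Series_tail_abs (f N) (g N) n (B N) (E N)).
  assert (T2 := Series_tail_abs f0 g0 n B0 E0).
  revert H1 H2 H3 Hn T1 T2. unfold Rabs; repeat destruct Rcase_abs; lra.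
Qed.

Lemma Series_single f k : (forall i, i <> k -> f i = 0) -> is_series f (f k).
Proof.
  intro H. apply is_series_psum. apply is_lim_seq_ext_loc with (fun _ => f k); [|apply is_lim_seq_const].
  exists (S k); intros n Hn. symmetry; apply psum_single; auto.
Qed.

(** The inequality [main] bounds the sum by columns by the sum by rows; applied also to the
    transposed array it gives equality. *)
Lemma tonelli (f : nat -> nat -> R) (r : nat -> R) l :
  (forall i j, 0 <= f i j) -> (forall i, is_series (f i) (r i)) -> is_series r l ->
  (forall j, ex_series (fun i => f i j)) /\ is_series (fun j => Series (fun i => f i j)) l.
Proof.
  assert (main : forall (f : nat -> nat -> R) (r : nat -> R) l,
    (forall i j, 0 <= f i j) -> (forall i, is_series (f i) (r i)) -> is_series r l ->
    (forall j, ex_series (fun i => f i j)) /\ ex_series (fun j => Series (fun i => f i j)) /\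
    Series (fun j => Series (fun i => f i j)) <= l).
  { clear f r l. intros f r l P Hr Hl.
    assert (Pr : forall i, 0 <= r i).
    { intro i. rewrite <- (is_series_unique _ _ (Hr i)). apply Series_pos; auto. exists (r i); auto. }
    assert (Bp : forall n, psum r n <= l).
    { intro n. rewrite <- (is_series_unique _ _ Hl). apply psum_le_Series; auto. exists l; auto. }
    assert (Bf : forall i j, f i j <= r i).
    { intros i j. rewrite <- (is_series_unique _ _ (Hr i)). apply term_le_Series; auto. exists (r i); auto. }
    assert (E1 : forall j, ex_series (fun i => f i j)).
    { intro j. apply (ex_series_bdd _ l); auto. intro n. eapply Rle_trans; [|apply (Bp n)]. apply psum_le; auto. }
    split; auto.
    apply ex_series_bdd.
    - intro j; apply Series_pos; auto.
    - intro n.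
      assert (L : is_lim_seq (fun m => psum (fun j => psum (fun i => f i j) m) n) (psum (fun j => Series (fun i => f i j)) n)).
      { apply is_lim_seq_psum. intro k. apply is_series_psum, Series_correct; auto. }
      apply (is_lim_seq_le _ _ (psum (fun j => Series (fun i => f i j)) n) l) with (2 := L) (3 := is_lim_seq_const l).
      intro m. rewrite <- psum_swap. eapply Rle_trans; [|apply (Bp m)].
      apply psum_le; intros i _. rewrite <- (is_series_unique _ _ (Hr i)). apply psum_le_Series; auto. exists (r i); auto. }
  intros P Hr Hl.
  destruct (main f r l P Hr Hl) as (E1 & E2 & L1).
  split; auto.
  destruct (main (fun j i => f i j) (fun j => Series (fun i => f i j)) (Series (fun j => Series (fun i => f i j))))
    as (_ & _ & L2); auto.
  { intro j; apply Series_correct; auto. }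
  { apply Series_correct; auto. }
  rewrite (Series_ext _ r) in L2 by (intro i; apply is_series_unique; auto).
  rewrite (is_series_unique _ _ Hl) in L2.
  replace l with (Series (fun j => Series (fun i => f i j))) by lra.
  apply Series_correct; auto.
Qed.

(** * Subsequences and compactness of bounded sequences *)

Definition incr (phi : nat -> nat) := forall n, (phi n < phi (S n))%nat.

Lemma incr_lt phi : incr phi -> forall n m, (n < m)%nat -> (phi n < phi m)%nat.
Proof. intros H n m L; induction L; [apply H | specialize (H m); lia]. Qed.

Lemma incr_ge phi : incr phi -> forall n, (n <= phi n)%nat.
Proof. intros H n; induction n as [|n IH]; [lia | specialize (H n); lia]. Qed.

Lemma incr_comp phi psi : incr phi -> incr psi -> incr (fun n => phi (psi n)).
Proof. intros H1 H2 n. apply incr_lt; auto. Qed.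

Lemma lim_subseq u (l : Rbar) phi : (forall n, (n <= phi n)%nat) -> is_lim_seq u l -> is_lim_seq (fun n => u (phi n)) l.
Proof.
  intros H L. apply is_lim_seq_subseq; auto.
  intros P [N HN]. exists N; intros n Hn. apply HN. specialize (H n); lia.
Qed.

Lemma bounded_subseq (u : nat -> R) M : (forall n, Rabs (u n) <= M) ->
  exists phi, incr phi /\ ex_finite_lim_seq (fun n => u (phi n)).
Proof.
  intro B.
  destruct (Bolzano_Weierstrass u (fun x => -M <= x <= M)) as [l Hl].
  { apply compact_P3. }
  { intro n. specialize (B n). apply Rabs_le_between; auto. }
  assert (H : forall n N, exists p, (N <= p)%nat /\ Rabs (u p - l) < / INR (S n)).
  { intros n N. apply (Hl (fun x => Rabs (x - l) < / INR (S n)) N).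
    assert (0 < / INR (S n)) by (apply Rinv_0_lt_compat, lt_0_INR; lia).
    exists (mkposreal _ H). intros y Hy. exact Hy. }
  set (nx := fun n N => proj1_sig (constructive_indefinite_description _ (H n N))).
  assert (Hnx : forall n N, (N <= nx n N)%nat /\ Rabs (u (nx n N) - l) < / INR (S n)).
  { intros n N. unfold nx. apply (proj2_sig (constructive_indefinite_description _ (H n N))). }
  set (phi := fix phi n := match n with O => nx O O | S k => nx (S k) (S (phi k)) end).
  assert (Hp : forall n, Rabs (u (phi n) - l) < / INR (S n)) by (destruct n; apply Hnx).
  exists phi; split.
  - intro n. change (phi (S n)) with (nx (S n) (S (phi n))). destruct (Hnx (S n) (S (phi n))). lia.
  - exists l. apply lim_eps. intros eps he.
    destruct (archimed_cor1 eps he) as [N [HN1 HN2]].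
    exists N; intros n Hn. eapply Rlt_trans; [apply Hp|].
    eapply Rle_lt_trans; [|apply HN1]. apply Rinv_le_contravar; [apply lt_0_INR; lia | apply le_INR; lia].
Qed.

Lemma diagonal_subseq (f : nat -> nat -> R) M : (forall n k, Rabs (f n k) <= M) ->
  exists phi, incr phi /\ forall k, ex_finite_lim_seq (fun n => f (phi n) k).
Proof.
  intro B.
  set (T := {phi : nat -> nat | incr phi}).
  assert (H : forall (p : T) k, exists rho, incr rho /\ ex_finite_lim_seq (fun n => f (proj1_sig p (rho n)) k)).
  { intros p k. apply (bounded_subseq (fun n => f (proj1_sig p n) k) M). intro; apply B. }
  set (nx := fun p k => proj1_sig (constructive_indefinite_description _ (H p k))).
  assert (Hnx : forall p k, incr (nx p k) /\ ex_finite_lim_seq (fun n => f (proj1_sig p (nx p k n)) k)).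
  { intros p k. apply (proj2_sig (constructive_indefinite_description _ (H p k))). }
  (* [psi k] is an extraction along which the first [k] coordinates converge; carrying the
     monotonicity proof in the type lets each stage extract from the previous one. *)
  set (step := fun (p : T) k => exist incr (fun n => proj1_sig p (nx p k n))
                 (incr_comp _ _ (proj2_sig p) (proj1 (Hnx p k))) : T).
  assert (Hid : incr (fun n => n)) by (intro n; lia).
  set (psi := fix psi k : T := match k with O => exist incr _ Hid | S j => step (psi j) j end).
  assert (Hpsi : forall k d, exists rho, incr rho /\ forall n, proj1_sig (psi (d + k)%nat) n = proj1_sig (psi k) (rho n)).
  { intros k d; induction d as [|d [rho [Hr E]]]; [exists (fun n => n); auto|].
    exists (fun n => rho (nx (psi (d + k)%nat) (d + k)%nat n)). split.
    - apply incr_comp; auto. apply Hnx.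
    - intro n. simpl. apply E. }
  exists (fun n => proj1_sig (psi n) n). split.
  - intro n. simpl. apply incr_lt; [apply (proj2_sig (psi n))|].
    pose proof (incr_ge _ (proj1 (Hnx (psi n) n)) (S n)). lia.
  - intro k. destruct (proj2 (Hnx (psi k) k)) as [l Hl]. exists l.
    assert (D : forall n, (S k <= n)%nat -> exists m, (n <= m)%nat /\ proj1_sig (psi n) n = proj1_sig (psi (S k)) m).
    { intros n Hn. destruct (Hpsi (S k) (n - S k)%nat) as [rho [Hr E]].
      replace (n - S k + S k)%nat with n in E by lia.
      exists (rho n). split; [apply incr_ge; auto | apply E]. }
    rewrite lim_eps in Hl |- *. intros eps he. destruct (Hl eps he) as [N HN].
    exists (N + S k)%nat. intros n Hn. destruct (D n) as [m [Hm ->]]; [lia|]. apply HN. lia.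
Qed.

(** * Limits of complex sequences *)

Definition clim (f : nat -> C) (l : C) :=
  is_lim_seq (fun n => fst (f n)) (fst l) /\ is_lim_seq (fun n => snd (f n)) (snd l).

Lemma clim_ext f g l : (forall n, f n = g n) -> clim f l -> clim g l.
Proof. intros H [A B]; split; [apply is_lim_seq_ext with (2 := A) | apply is_lim_seq_ext with (2 := B)]; intro; rewrite H; auto. Qed.

Lemma clim_eq f l m : clim f l -> l = m -> clim f m.
Proof. intros H <-; exact H. Qed.

Lemma clim_const l : clim (fun _ => l) l.
Proof. split; apply is_lim_seq_const. Qed.

Lemma clim_plus f g l m : clim f l -> clim g m -> clim (fun n => f n + g n)%C (l + m)%C.
Proof. intros [A B] [A' B']; split; apply is_lim_seq_plus'; auto. Qed.

Lemma clim_opp f l : clim f l -> clim (fun n => - f n)%C (- l)%C.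
Proof. intros [A B]; split; [apply (is_lim_seq_opp _ (fst l)) in A | apply (is_lim_seq_opp _ (snd l)) in B]; auto. Qed.

Lemma clim_minus f g l m : clim f l -> clim g m -> clim (fun n => f n - g n)%C (l - m)%C.
Proof. intros; apply clim_plus; auto. apply clim_opp; auto. Qed.

Lemma clim_mult f g l m : clim f l -> clim g m -> clim (fun n => f n * g n)%C (l * m)%C.
Proof.
  intros [A B] [A' B']; split; simpl.
  - apply is_lim_seq_minus'; apply is_lim_seq_mult'; auto.
  - apply is_lim_seq_plus'; apply is_lim_seq_mult'; auto.
Qed.

Lemma clim_conj f l : clim f l -> clim (fun n => Cconj (f n)) (Cconj l).
Proof. intros [A B]; split; auto. apply (is_lim_seq_opp _ (snd l)) in B; auto. Qed.

Lemma clim_RtoC f (l : R) : is_lim_seq f l -> clim (fun n => RtoC (f n)) (RtoC l).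
Proof. intro; split; auto; apply is_lim_seq_const. Qed.

Lemma clim_unique f l m : clim f l -> clim f m -> l = m.
Proof.
  intros [A B] [A' B'].
  apply injective_projections.
  - apply is_lim_seq_unique in A. apply is_lim_seq_unique in A'. congruence.
  - apply is_lim_seq_unique in B. apply is_lim_seq_unique in B'. congruence.
Qed.

Lemma clim_subseq f l phi : (forall n, (n <= phi n)%nat) -> clim f l -> clim (fun n => f (phi n)) l.
Proof.
  intros H [A B]; split.
  - apply (lim_subseq (fun n => fst (f n))); auto.
  - apply (lim_subseq (fun n => snd (f n))); auto.
Qed.

Lemma Cnorm2_ge0 z : 0 <= Cnorm2 z.
Proof. unfold Cnorm2; nra. Qed.

Lemma Cnorm2_mult (z w : C) : Cnorm2 (z * w)%C = Cnorm2 z * Cnorm2 w.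
Proof. unfold Cnorm2; simpl; ring. Qed.

Lemma Cnorm2_conj (z : C) : Cnorm2 (Cconj z) = Cnorm2 z.
Proof. unfold Cnorm2; simpl; ring. Qed.

Lemma Cnorm2_RtoC r : Cnorm2 (RtoC r) = r * r.
Proof. unfold Cnorm2; simpl; ring. Qed.

Lemma Cnorm2_plus_le (z w : C) : Cnorm2 (z + w)%C <= 2 * Cnorm2 z + 2 * Cnorm2 w.
Proof.
  unfold Cnorm2; simpl. destruct z as [a b], w as [c d]; simpl.
  pose proof (Rle_0_sqr (a - c)); pose proof (Rle_0_sqr (a + c)); pose proof (Rle_0_sqr (b - d));
  pose proof (Rle_0_sqr (b + d)). unfold Rsqr in *. lra.
Qed.

Lemma Cnorm2_minus_le (z w : C) : Cnorm2 (z - w)%C <= 2 * Cnorm2 z + 2 * Cnorm2 w.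
Proof.
  unfold Cnorm2; simpl. destruct z as [a b], w as [c d]; simpl.
  pose proof (Rle_0_sqr (a - c)); pose proof (Rle_0_sqr (a + c)); pose proof (Rle_0_sqr (b - d));
  pose proof (Rle_0_sqr (b + d)). unfold Rsqr in *. lra.
Qed.

Lemma Cnorm2_eq0 (z : C) : Cnorm2 z = 0 -> z = RtoC 0.
Proof.
  unfold Cnorm2; intro H. destruct z as [a b]; simpl in *.
  assert (a * a = 0 /\ b * b = 0) as [A B] by (pose proof (Rle_0_sqr a); pose proof (Rle_0_sqr b); unfold Rsqr in *; lra).
  apply Rmult_integral in A. apply Rmult_integral in B. apply injective_projections; simpl; tauto.
Qed.

Lemma Cnorm2_pos (z : C) : z <> RtoC 0 -> 0 < Cnorm2 z.
Proof. intro H. destruct (Cnorm2_ge0 z) as [|E]; auto. elim H. apply Cnorm2_eq0; auto. Qed.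

Lemma Cmult_conj_norm2 (z : C) : (z * Cconj z)%C = RtoC (Cnorm2 z).
Proof. unfold Cnorm2; apply injective_projections; simpl; ring. Qed.

Lemma Cmod_sqr (z : C) : Cmod z * Cmod z = Cnorm2 z.
Proof. unfold Cmod, Cnorm2. rewrite sqrt_sqrt; [ring|nra]. Qed.

Lemma Cabs_Cmod (z : C) : Cabs z = Cmod z.
Proof. unfold Cabs, Cmod, Cnorm2. f_equal; ring. Qed.

Lemma Cmod_sqrt_norm2 (z : C) : Cmod z = sqrt (Cnorm2 z).
Proof. unfold Cmod, Cnorm2. f_equal; ring. Qed.

Lemma clim_norm2 f l : clim f l -> is_lim_seq (fun n => Cnorm2 (f n)) (Cnorm2 l).
Proof. intros [A B]; unfold Cnorm2. apply is_lim_seq_plus'; apply is_lim_seq_mult'; auto. Qed.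

Lemma Rabs_lt_of_sqr a e : 0 < e -> a * a < e * e -> Rabs a < e.
Proof.
  intros He H. apply Rsqr_lt_abs_0 in H. rewrite (Rabs_pos_eq e) in H; lra.
Qed.

Lemma clim_of_norm2 f l : is_lim_seq (fun n => Cnorm2 (f n - l)%C) 0 -> clim f l.
Proof.
  intro H. rewrite lim_eps in H.
  assert (A : forall eps, 0 < eps -> exists N, forall n, (N <= n)%nat -> Cnorm2 (f n - l)%C < eps * eps).
  { intros eps he. destruct (H (eps * eps)) as [N HN]; [nra|]. exists N; intros n Hn. specialize (HN n Hn).
    rewrite Rminus_0_r in HN. apply Rabs_def2 in HN. lra. }
  split; apply lim_eps; intros eps he; destruct (A eps he) as [N HN]; exists N; intros n Hn; specialize (HN n Hn);
    unfold Cnorm2 in HN; simpl in HN; apply Rabs_lt_of_sqr; auto.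
  - pose proof (Rle_0_sqr (snd (f n) + - snd l)); unfold Rsqr in *; simpl; unfold Rminus; lra.
  - pose proof (Rle_0_sqr (fst (f n) + - fst l)); unfold Rsqr in *; simpl; unfold Rminus; lra.
Qed.

Lemma clim_cont_sqrt u l : is_lim_seq u (Finite l) -> is_lim_seq (fun n => sqrt (u n)) (sqrt l).
Proof. intro H. apply (is_lim_seq_continuous sqrt); auto. apply continuity_pt_filterlim, continuous_sqrt. Qed.

Lemma clim_norm2_0 (f : nat -> C) : is_lim_seq (fun n => Cnorm2 (f n)) 0 <-> clim f (RtoC 0).
Proof.
  split; intro H.
  - apply clim_of_norm2. apply is_lim_seq_ext with (2 := H). intro n. f_equal. cring.
  - apply clim_norm2 in H. unfold Cnorm2 in H at 2. simpl in H. rewrite !Rmult_0_l, Rplus_0_l in H. exact H.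
Qed.

Lemma lim0_le u v : (forall n, 0 <= u n <= v n) -> is_lim_seq v 0 -> is_lim_seq u 0.
Proof. intros H L. apply is_lim_seq_le_le with (fun _ => 0) v; auto. apply is_lim_seq_const. Qed.

Lemma lim_scal0 c u : is_lim_seq u 0 -> is_lim_seq (fun n => c * u n) 0.
Proof. intro H. apply (is_lim_seq_scal_l u c 0) in H. simpl in H. rewrite Rmult_0_r in H. exact H. Qed.

(** Since |f - f0|^2 <= 2|f|^2 + 2|f0|^2, there is a moving dominating series whose sum converges
    with the norms. It is the device that turns coordinatewise limits into norm limits. *)
Lemma scheffe_l2 (w : nat -> R) (f : nat -> nat -> C) (f0 : nat -> C) :
  (forall k, 0 <= w k) ->
  (forall k, clim (fun N => f N k) (f0 k)) ->
  (forall N, ex_series (fun k => w k * Cnorm2 (f N k))) ->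
  ex_series (fun k => w k * Cnorm2 (f0 k)) ->
  is_lim_seq (fun N => Series (fun k => w k * Cnorm2 (f N k))) (Series (fun k => w k * Cnorm2 (f0 k))) ->
  is_lim_seq (fun N => Series (fun k => w k * Cnorm2 (f N k - f0 k)%C)) 0.
Proof.
  intros W L E E0 S.
  assert (X : forall N, Series (fun k => 2 * (w k * Cnorm2 (f N k)) + 2 * (w k * Cnorm2 (f0 k))) =
    2 * Series (fun k => w k * Cnorm2 (f N k)) + 2 * Series (fun k => w k * Cnorm2 (f0 k))).
  { intro N. rewrite Series_plus, !Series_scal_l; auto; apply (@ex_series_scal R_AbsRing R_NormedModule 2); auto. }
  destruct (dominated_series (fun N k => w k * Cnorm2 (f N k - f0 k)%C)
    (fun N k => 2 * (w k * Cnorm2 (f N k)) + 2 * (w k * Cnorm2 (f0 k))) (fun k => 0)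
    (fun k => 2 * (w k * Cnorm2 (f0 k)) + 2 * (w k * Cnorm2 (f0 k)))) as [_ R].
  - intro k. apply lim_scal0. apply clim_norm2_0.
    replace (RtoC 0) with (f0 k - f0 k)%C by ring. apply clim_minus; auto. apply clim_const.
  - intro k. apply is_lim_seq_plus'; [|apply is_lim_seq_const].
    apply is_lim_seq_mult'; [apply is_lim_seq_const|]. apply is_lim_seq_mult'; [apply is_lim_seq_const|].
    apply clim_norm2; auto.
  - intros N k. rewrite Rabs_pos_eq by (apply Rmult_le_pos; auto; apply Cnorm2_ge0).
    pose proof (Cnorm2_minus_le (f N k) (f0 k)). specialize (W k). nra.
  - intro N. apply (ex_series_plus (V := R_NormedModule)); apply (@ex_series_scal R_AbsRing R_NormedModule 2); auto.
  - apply (ex_series_plus (V := R_NormedModule)); apply (@ex_series_scal R_AbsRing R_NormedModule 2); auto.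
  - rewrite Series_plus, !Series_scal_l; try (apply (@ex_series_scal R_AbsRing R_NormedModule 2); auto).
    apply is_lim_seq_ext with (1 := fun N => eq_sym (X N)).
    apply is_lim_seq_plus'; [|apply is_lim_seq_const].
    apply is_lim_seq_mult'; [apply is_lim_seq_const|]; auto.
  - replace (Series (fun _ => 0)) with 0 in R; auto.
    symmetry. apply is_series_unique. apply is_series_psum.
    apply is_lim_seq_ext with (fun _ => 0); [|apply is_lim_seq_const].
    induction n; simpl; lra.
Qed.

(** * The Hilbert space l^2 *)

Definition l2 : Type := {h : nat -> C | ex_series (fun k => Cnorm2 (h k))}.
Definition lval (x : l2) : nat -> C := proj1_sig x.
Coercion lval : l2 >-> Funclass.
Definition mkl2 (h : nat -> C) (H : ex_series (fun k => Cnorm2 (h k))) : l2 := exist _ h H.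

Lemma l2_ex (x : l2) : ex_series (fun k => Cnorm2 (x k)).
Proof. exact (proj2_sig x). Qed.

Lemma l2_ext (x y : l2) : (forall k, x k = y k) -> x = y.
Proof.
  intro H. destruct x as [x Hx], y as [y Hy]. simpl in H.
  assert (x = y) as -> by (apply functional_extensionality; exact H).
  f_equal. apply proof_irrelevance.
Qed.

Lemma ladd_ex (x y : l2) : ex_series (fun k => Cnorm2 (x k + y k)%C).
Proof.
  apply ex_series_le' with (fun k => 2 * Cnorm2 (x k) + 2 * Cnorm2 (y k)).
  - intro k. rewrite Rabs_pos_eq by apply Cnorm2_ge0. apply Cnorm2_plus_le.
  - apply (ex_series_plus (V := R_NormedModule));
      apply (@ex_series_scal R_AbsRing R_NormedModule 2), l2_ex.
Qed.
Definition ladd (x y : l2) : l2 := mkl2 _ (ladd_ex x y).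

Lemma lscal_ex c (x : l2) : ex_series (fun k => Cnorm2 (c * x k)%C).
Proof.
  apply ex_series_ext with (fun k => Cnorm2 c * Cnorm2 (x k)).
  - intro; rewrite Cnorm2_mult; auto.
  - apply (@ex_series_scal R_AbsRing R_NormedModule (Cnorm2 c)), l2_ex.
Qed.
Definition lscal (c : C) (x : l2) : l2 := mkl2 _ (lscal_ex c x).
Definition lsub (x y : l2) : l2 := ladd x (lscal (- (1))%C y).

Lemma finite_ex (h : nat -> C) n : (forall k, (n <= k)%nat -> h k = RtoC 0) -> ex_series (fun k => Cnorm2 (h k)).
Proof.
  intro H. apply (ex_series_bdd _ (psum (fun k => Cnorm2 (h k)) n)).
  - intro; apply Cnorm2_ge0.
  - intro m. destruct (Nat.le_ge_cases m n) as [L|L].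
    + apply psum_le_n; auto. intro; apply Cnorm2_ge0.
    + induction L as [|m L IH]; [lra|]. simpl. rewrite (H m) by auto.
      replace (Cnorm2 (RtoC 0)) with 0 by (unfold Cnorm2; simpl; ring). lra.
Qed.

Definition ldelta (k : nat) : l2.
  refine (mkl2 (fun i => if Nat.eq_dec i k then RtoC 1 else RtoC 0) (finite_ex _ (S k) _)).
  intros i Hi. destruct Nat.eq_dec; auto; lia.
Defined.

Definition lzero : l2 := mkl2 (fun _ => RtoC 0) (finite_ex _ O (fun _ _ => eq_refl)).

Definition trunc (n : nat) (x : l2) : l2.
  refine (mkl2 (fun i => if lt_dec i n then x i else RtoC 0) (finite_ex _ n _)).
  intros i Hi. destruct lt_dec; auto; lia.
Defined.

Definition n2 (x : l2) : R := Series (fun k => Cnorm2 (x k)).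
Definition ip (x y : l2) : C :=
  (Series (fun k => fst (x k * Cconj (y k))%C), Series (fun k => snd (x k * Cconj (y k))%C)).

Lemma ip_ex (x y : l2) : ex_series (fun k => fst (x k * Cconj (y k))%C) /\ ex_series (fun k => snd (x k * Cconj (y k))%C).
Proof.
  split; apply ex_series_le' with (fun k => Cnorm2 (x k) + Cnorm2 (y k));
    try (apply (ex_series_plus (V := R_NormedModule)); apply l2_ex);
    intro k; unfold Cnorm2; simpl; destruct (x k) as [a b], (y k) as [c d]; simpl;
    pose proof (Rle_0_sqr (a - c)); pose proof (Rle_0_sqr (a + c)); pose proof (Rle_0_sqr (b - d));
    pose proof (Rle_0_sqr (b + d)); pose proof (Rle_0_sqr (a - d)); pose proof (Rle_0_sqr (a + d)); pose proof (Rle_0_sqr (b - c));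
    pose proof (Rle_0_sqr (b + c)); unfold Rsqr in *; apply Rabs_le; split; lra.
Qed.

Lemma ip_add_l x y z : ip (ladd x y) z = (ip x z + ip y z)%C.
Proof.
  destruct (ip_ex x z), (ip_ex y z).
  apply injective_projections; simpl.
  - rewrite <- Series_plus by auto. apply Series_ext; intro; simpl; ring.
  - rewrite <- Series_plus by auto. apply Series_ext; intro; simpl; ring.
Qed.

Lemma ip_scal_l c x y : ip (lscal c x) y = (c * ip x y)%C.
Proof.
  destruct (ip_ex x y) as [E1 E2].
  apply injective_projections; simpl.
  - rewrite <- !Series_scal_l, <- Series_minus by (apply (@ex_series_scal R_AbsRing R_NormedModule); auto).
    apply Series_ext; intro; simpl; ring.
  - rewrite <- !Series_scal_l, <- Series_plus by (apply (@ex_series_scal R_AbsRing R_NormedModule); auto).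
    apply Series_ext; intro; simpl; ring.
Qed.

Lemma ip_conj x y : ip y x = Cconj (ip x y).
Proof.
  apply injective_projections; simpl.
  - apply Series_ext; intro; simpl; ring.
  - rewrite <- Series_opp. apply Series_ext; intro; simpl; ring.
Qed.

Lemma ip_add_r x y z : ip x (ladd y z) = (ip x y + ip x z)%C.
Proof. rewrite (ip_conj _ x), ip_add_l, Cplus_conj, <- !ip_conj; auto. Qed.

Lemma ip_scal_r c x y : ip x (lscal c y) = (Cconj c * ip x y)%C.
Proof. rewrite (ip_conj _ x), ip_scal_l, Cmult_conj, <- !ip_conj; auto. Qed.

Lemma Cconj_R (r : R) : Cconj (RtoC r) = RtoC r.
Proof. apply injective_projections; simpl; ring. Qed.

Lemma Cconj_m1 : Cconj (- (1))%C = (- (1))%C.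
Proof. apply injective_projections; simpl; ring. Qed.

Lemma ip_sub_l x y z : ip (lsub x y) z = (ip x z - ip y z)%C.
Proof. unfold lsub. rewrite ip_add_l, ip_scal_l. ring. Qed.

Lemma ip_sub_r x y z : ip x (lsub y z) = (ip x y - ip x z)%C.
Proof. unfold lsub. rewrite ip_add_r, ip_scal_r, Cconj_m1. ring. Qed.

Lemma ip_self x : ip x x = RtoC (n2 x).
Proof.
  apply injective_projections; simpl.
  - apply Series_ext; intro; unfold Cnorm2; simpl; ring.
  - rewrite (Series_ext _ (fun k => 0 * 0)) by (intro; ring). rewrite Series_scal_l. ring.
Qed.

Lemma n2_ge0 x : 0 <= n2 x.
Proof. apply Series_pos; [intro; apply Cnorm2_ge0 | apply l2_ex]. Qed.

Lemma coord_le_n2 (x : l2) k : Cnorm2 (x k) <= n2 x.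
Proof. apply (term_le_Series (fun k => Cnorm2 (x k))); [intro; apply Cnorm2_ge0 | apply l2_ex]. Qed.

Lemma n2_eq0 x : n2 x = 0 -> x = lzero.
Proof.
  intro H. apply l2_ext; intro k. apply Cnorm2_eq0.
  pose proof (coord_le_n2 x k). pose proof (Cnorm2_ge0 (x k)). lra.
Qed.

Lemma n2_scal c x : n2 (lscal c x) = Cnorm2 c * n2 x.
Proof. unfold n2. rewrite <- Series_scal_l. apply Series_ext; intro; apply Cnorm2_mult. Qed.

Lemma n2_add x y : n2 (ladd x y) = n2 x + n2 y + 2 * fst (ip x y).
Proof.
  assert (H : ip (ladd x y) (ladd x y) = (ip x x + ip y y + (ip x y + Cconj (ip x y)))%C).
  { rewrite ip_add_l, !ip_add_r, <- (ip_conj x y). ring. }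
  rewrite !ip_self in H. apply (f_equal fst) in H. simpl in H. simpl. lra.
Qed.

Lemma n2_sub x y : n2 (lsub x y) = n2 x + n2 y - 2 * fst (ip x y).
Proof.
  unfold lsub. rewrite n2_add, n2_scal, ip_scal_r, Cconj_m1. unfold Cnorm2; simpl. ring.
Qed.

Lemma ip_zero_l x : ip lzero x = RtoC 0.
Proof.
  replace lzero with (lscal (RtoC 0) lzero) by (apply l2_ext; intro; simpl; ring).
  rewrite ip_scal_l. ring.
Qed.

Lemma ip_zero_r x : ip x lzero = RtoC 0.
Proof. rewrite ip_conj, ip_zero_l. apply Cconj_R. Qed.

Lemma n2_zero : n2 lzero = 0.
Proof. pose proof (ip_self lzero) as H. rewrite ip_zero_l in H. apply (f_equal fst) in H. simpl in H. lra. Qed.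

Lemma n2_pos x : x <> lzero -> 0 < n2 x.
Proof. intro H. destruct (n2_ge0 x) as [|E]; auto. elim H; apply n2_eq0; auto. Qed.

Lemma cauchy_schwarz x y : Cnorm2 (ip x y) <= n2 x * n2 y.
Proof.
  destruct (classic (y = lzero)) as [->|Hy].
  - rewrite ip_zero_r, n2_zero. unfold Cnorm2; simpl; lra.
  - apply n2_pos in Hy.
    pose proof (n2_ge0 (lsub x (lscal (ip x y * RtoC (/ n2 y))%C y))) as H.
    rewrite n2_sub, n2_scal, ip_scal_r, Cnorm2_mult, Cnorm2_RtoC in H.
    assert (E : fst (Cconj (ip x y * RtoC (/ n2 y)) * ip x y)%C = Cnorm2 (ip x y) * / n2 y).
    { unfold Cnorm2; simpl. ring. }
    rewrite E in H. clear E.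
    apply Rmult_le_reg_r with (/ n2 y); [apply Rinv_0_lt_compat; auto|].
    replace (n2 x * n2 y * / n2 y) with (n2 x) by (field; lra).
    replace (Cnorm2 (ip x y) * (/ n2 y * / n2 y) * n2 y) with (Cnorm2 (ip x y) * / n2 y) in H by (field; lra).
    lra.
Qed.

Definition nrm (x : l2) : R := sqrt (n2 x).

Lemma nrm_ge0 x : 0 <= nrm x.
Proof. apply sqrt_pos. Qed.

Lemma nrm_sqr x : nrm x * nrm x = n2 x.
Proof. apply sqrt_sqrt, n2_ge0. Qed.

Lemma Cmod_ip_le x y : Cmod (ip x y) <= nrm x * nrm y.
Proof.
  rewrite Cmod_sqrt_norm2. unfold nrm. rewrite <- sqrt_mult by apply n2_ge0.
  apply sqrt_le_1_alt, cauchy_schwarz.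
Qed.

Lemma fst_le_Cmod (z : C) : Rabs (fst z) <= Cmod z.
Proof. apply re_le_Cmod. Qed.

Lemma nrm_scal c x : nrm (lscal c x) = Cmod c * nrm x.
Proof. unfold nrm. rewrite n2_scal, sqrt_mult, Cmod_sqrt_norm2; auto using n2_ge0, Cnorm2_ge0. Qed.

Lemma nrm_triang x y : nrm (ladd x y) <= nrm x + nrm y.
Proof.
  pose proof (nrm_ge0 x). pose proof (nrm_ge0 y).
  apply Rsqr_incr_0_var; [|lra]. unfold Rsqr. rewrite nrm_sqr, n2_add.
  pose proof (nrm_sqr x). pose proof (nrm_sqr y).
  assert (fst (ip x y) <= nrm x * nrm y).
  { eapply Rle_trans; [apply Rle_abs|]. eapply Rle_trans; [apply fst_le_Cmod | apply Cmod_ip_le]. }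
  nra.
Qed.

Lemma nrm_triang_sub x y : nrm (lsub x y) <= nrm x + nrm y.
Proof.
  unfold lsub. eapply Rle_trans; [apply nrm_triang|]. rewrite nrm_scal, Cmod_m1. lra.
Qed.

Lemma n2_add_le x y : n2 (ladd x y) <= 2 * n2 x + 2 * n2 y.
Proof. pose proof (n2_ge0 (lsub x y)) as H. rewrite n2_sub in H. rewrite n2_add. lra. Qed.

Lemma n2_sub_le x y : n2 (lsub x y) <= 2 * n2 x + 2 * n2 y.
Proof. pose proof (n2_ge0 (ladd x y)) as H. rewrite n2_add in H. rewrite n2_sub. lra. Qed.

Lemma ip_ext x y : (forall z, ip x z = ip y z) -> x = y.
Proof.
  intro H. assert (n2 (lsub x y) = 0).
  { pose proof (ip_self (lsub x y)) as E. rewrite ip_sub_l, H in E.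
    apply (f_equal fst) in E. simpl in E. lra. }
  apply n2_eq0 in H0. apply l2_ext; intro k.
  apply (f_equal (fun z : l2 => z k)) in H0. simpl in H0.
  replace (x k) with (x k + - (1) * y k + y k)%C by ring. rewrite H0. ring.
Qed.

Lemma ip_delta (x : l2) k : ip x (ldelta k) = x k.
Proof.
  apply injective_projections; simpl.
  - rewrite (is_series_unique _ (fst (x k * Cconj (ldelta k k))%C)).
    + simpl. destruct Nat.eq_dec; [simpl; ring | congruence].
    + apply (Series_single (fun i => fst (x i * Cconj (ldelta k i))%C) k). intros i Hi. simpl. destruct Nat.eq_dec; [congruence | simpl; ring].
  - rewrite (is_series_unique _ (snd (x k * Cconj (ldelta k k))%C)).
    + simpl. destruct Nat.eq_dec; [simpl; ring | congruence].
    + apply (Series_single (fun i => snd (x i * Cconj (ldelta k i))%C) k). intros i Hi. simpl. destruct Nat.eq_dec; [congruence | simpl; ring].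
Qed.

Lemma ip_delta_l (x : l2) k : ip (ldelta k) x = Cconj (x k).
Proof. rewrite ip_conj, ip_delta; auto. Qed.

Lemma n2_delta k : n2 (ldelta k) = 1.
Proof.
  pose proof (ip_self (ldelta k)) as H. rewrite ip_delta in H. apply (f_equal fst) in H.
  simpl in H. destruct Nat.eq_dec; [simpl in H; lra | congruence].
Qed.

Lemma n2_trunc n (x : l2) : n2 (trunc n x) = psum (fun k => Cnorm2 (x k)) n.
Proof.
  unfold n2. apply is_series_unique, is_series_psum.
  apply is_lim_seq_ext_loc with (fun _ => psum (fun k => Cnorm2 (x k)) n); [|apply is_lim_seq_const].
  exists n. intros m Hm. induction Hm as [|m Hm IH].
  - apply psum_ext. intros k Hk. simpl. destruct lt_dec; [auto|lia].
  - cbn [psum]. rewrite <- IH. simpl. destruct lt_dec; [lia|]. unfold Cnorm2; simpl; lra.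
Qed.

Lemma n2_trunc_le n x : n2 (trunc n x) <= n2 x.
Proof. rewrite n2_trunc. apply psum_le_Series; [intro; apply Cnorm2_ge0 | apply l2_ex]. Qed.

Lemma ip_trunc n (x y : l2) : ip (trunc n x) y = ip x (trunc n y).
Proof.
  apply injective_projections; simpl; apply Series_ext; intro k; destruct lt_dec; simpl; ring.
Qed.

Lemma n2_sub_trunc n x : n2 (lsub x (trunc n x)) = n2 x - n2 (trunc n x).
Proof.
  rewrite n2_sub. assert (ip x (trunc n x) = RtoC (n2 (trunc n x))) as ->; [|simpl; ring].
  rewrite <- ip_self, ip_trunc. f_equal. apply l2_ext; intro k. simpl. destruct lt_dec; auto.
Qed.

Lemma trunc_lim x : is_lim_seq (fun n => n2 (lsub x (trunc n x))) 0.
Proof.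
  replace (Finite 0) with (Finite (n2 x - n2 x)) by (f_equal; ring).
  apply is_lim_seq_ext with (fun n => n2 x - psum (fun k => Cnorm2 (x k)) n).
  { intro n. rewrite n2_sub_trunc, n2_trunc; auto. }
  apply is_lim_seq_minus'; [apply is_lim_seq_const|].
  apply is_series_psum, Series_correct, l2_ex.
Qed.

Lemma trunc_S n x : trunc (S n) x = ladd (trunc n x) (lscal (x n) (ldelta n)).
Proof.
  apply l2_ext; intro k. simpl. repeat destruct lt_dec; try destruct Nat.eq_dec; subst; try lia; ring.
Qed.

Fixpoint csum (f : nat -> C) (n : nat) : C :=
  match n with O => RtoC 0 | S k => (csum f k + f k)%C end.

Lemma csum_ext f g n : (forall k, (k < n)%nat -> f k = g k) -> csum f n = csum g n.
Proof. induction n as [|n IH]; intro H; simpl; auto. rewrite IH, (H n); auto. Qed.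

Lemma fst_csum f n : fst (csum f n) = psum (fun k => fst (f k)) n.
Proof. induction n as [|n IH]; simpl; auto. rewrite IH; auto. Qed.
Lemma snd_csum f n : snd (csum f n) = psum (fun k => snd (f k)) n.
Proof. induction n as [|n IH]; simpl; auto. rewrite IH; auto. Qed.

Lemma csum_RtoC f n : csum (fun k => RtoC (f k)) n = RtoC (psum f n).
Proof. induction n as [|n IH]; simpl; auto. rewrite IH. apply injective_projections; simpl; ring. Qed.

Lemma csum_plus f g n : csum (fun k => f k + g k)%C n = (csum f n + csum g n)%C.
Proof. induction n as [|n IH]; simpl; [ring | rewrite IH; ring]. Qed.

Lemma csum_scal c f n : csum (fun k => c * f k)%C n = (c * csum f n)%C.
Proof. induction n as [|n IH]; simpl; [ring | rewrite IH; ring]. Qed.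

Lemma clim_csum (f : nat -> nat -> C) (g : nat -> C) n :
  (forall k, clim (fun N => f N k) (g k)) -> clim (fun N => csum (f N) n) (csum g n).
Proof.
  intro H; induction n as [|n IH]; simpl; [apply clim_const|]. apply clim_plus; auto.
Qed.

Lemma ip_lim (x y : l2) : clim (csum (fun k => x k * Cconj (y k))%C) (ip x y).
Proof.
  destruct (ip_ex x y) as [A B]. apply Series_correct, is_series_psum in A. apply Series_correct, is_series_psum in B.
  split; [apply is_lim_seq_ext with (2 := A) | apply is_lim_seq_ext with (2 := B)]; intro n;
  [rewrite fst_csum | rewrite snd_csum]; auto.
Qed.

Lemma linear_trunc (phi : l2 -> C) :
  (forall x y, phi (ladd x y) = (phi x + phi y)%C) -> (forall c x, phi (lscal c x) = (c * phi x)%C) ->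
  forall n x, phi (trunc n x) = csum (fun k => x k * phi (ldelta k))%C n.
Proof.
  intros A S n x. induction n as [|n IH]; simpl.
  - replace (trunc 0 x) with (lscal (RtoC 0) x) by (apply l2_ext; intro k; simpl; ring).
    rewrite S. ring.
  - rewrite trunc_S, A, S, IH. auto.
Qed.

(** The representing vector has the coordinates [Cconj (phi (ldelta k))]. Evaluating [phi] at its
    truncations gives P^2 <= M P for each partial sum P of its squared norm, hence square
    summability with the bound [M]. *)
Lemma riesz (phi : l2 -> C) M :
  (forall x y, phi (ladd x y) = (phi x + phi y)%C) -> (forall c x, phi (lscal c x) = (c * phi x)%C) ->
  (forall x, Cnorm2 (phi x) <= M * n2 x) -> exists s, n2 s <= M /\ forall y, phi y = ip y s.
Proof.
  intros A S B.
  set (h := fun k => Cconj (phi (ldelta k))).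
  assert (P : forall n, psum (fun k => Cnorm2 (h k)) n <= M).
  { intro n.
    assert (F : forall i, (n <= i)%nat -> (if lt_dec i n then h i else RtoC 0) = RtoC 0)
      by (intros i Hi; destruct lt_dec; [lia | auto]).
    set (s := mkl2 (fun i => if lt_dec i n then h i else RtoC 0) (finite_ex _ n F)).
    assert (Ts : trunc n s = s) by (apply l2_ext; intro k; simpl; destruct lt_dec; auto).
    assert (E : phi s = RtoC (psum (fun k => Cnorm2 (h k)) n)).
    { rewrite <- Ts at 1. rewrite (linear_trunc phi A S), <- csum_RtoC. apply csum_ext.
      intros k Hk. rewrite <- Cmult_conj_norm2. unfold h at 2. rewrite Cconj_conj. simpl. destruct lt_dec; [auto|lia]. }
    assert (E2 : n2 s = psum (fun k => Cnorm2 (h k)) n).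
    { rewrite <- Ts, n2_trunc. apply psum_ext. intros k Hk. simpl. destruct lt_dec; [auto|lia]. }
    pose proof (B s) as Bs. rewrite E, E2, Cnorm2_RtoC in Bs.
    pose proof (psum_pos (fun k => Cnorm2 (h k)) n (fun k _ => Cnorm2_ge0 _)) as Q.
    destruct Q as [Q|Q]; [apply (Rmult_le_reg_r _ _ _ Q); auto|].
    (* When the partial sum vanishes, 0 <= M comes from a unit vector. *)
    rewrite <- Q. pose proof (B (ldelta 0)) as B0. rewrite n2_delta in B0. pose proof (Cnorm2_ge0 (phi (ldelta 0))). lra. }
  destruct (ex_series_bdd _ M (fun k => Cnorm2_ge0 _) P) as [E L].
  exists (mkl2 h E). split; [exact L|]. intro y.
  apply clim_unique with (fun n => phi (trunc n y)).
  - apply clim_of_norm2.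
    apply lim0_le with (fun n => M * n2 (lsub y (trunc n y))); [|apply lim_scal0, trunc_lim].
    intro n; split; [apply Cnorm2_ge0|].
    replace (phi (trunc n y) - phi y)%C with (phi (lscal (- (1))%C (lsub y (trunc n y)))).
    + eapply Rle_trans; [apply B|]. rewrite n2_scal. unfold Cnorm2; simpl. lra.
    + rewrite S. unfold lsub. rewrite A, S. ring.
  - apply clim_ext with (2 := ip_lim y (mkl2 h E)). intro n.
    rewrite (linear_trunc phi A S). apply csum_ext. intros k _. simpl. unfold h. rewrite Cconj_conj; auto.
Qed.

Definition wlim (x : nat -> l2) (l : l2) := forall y, clim (fun n => ip (x n) y) (ip l y).
Definition slim (x : nat -> l2) (l : l2) := is_lim_seq (fun n => n2 (lsub (x n) l)) 0.

(** Truncating the test vector leaves finitely many coordinates, and boundedness controls the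
    remainder. *)
Lemma wlim_of_coord (z : nat -> l2) M : (forall n, n2 (z n) <= M) ->
  (forall k, clim (fun n => z n k) (RtoC 0)) -> forall y, clim (fun n => ip (z n) y) (RtoC 0).
Proof.
  intros B H y. apply clim_norm2_0, lim_eps. intros eps he.
  assert (M0 : 0 <= M) by (eapply Rle_trans; [apply (n2_ge0 (z O)) | apply B]).
  destruct (proj1 (lim_eps _ _) (trunc_lim y) (eps / (4 * (M + 1)))) as [m Hm].
  { apply Rdiv_lt_0_compat; lra. }
  specialize (Hm m (le_n m)). rewrite Rminus_0_r, Rabs_pos_eq in Hm by apply n2_ge0.
  assert (L : clim (fun n => ip (z n) (trunc m y)) (RtoC 0)).
  { apply clim_ext with (fun n => csum (fun k => (z n) k * Cconj (y k))%C m).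
    - intro n. rewrite <- ip_trunc. rewrite (linear_trunc (fun x => ip x y)).
      + apply csum_ext. intros k _. rewrite ip_delta_l; auto.
      + intros; apply ip_add_l.
      + intros; apply ip_scal_l.
    - replace (RtoC 0) with (csum (fun k => RtoC 0 * Cconj (y k))%C m) by (clear; induction m; simpl; [auto | rewrite IHm; ring]).
      apply clim_csum with (f := fun n k => (z n k * Cconj (y k))%C) (g := fun k => (RtoC 0 * Cconj (y k))%C).
      intro k. apply clim_mult; auto. apply clim_const. }
  apply clim_norm2_0 in L. destruct (proj1 (lim_eps _ _) L (eps / 4)) as [N HN]; [lra|].
  exists N. intros n Hn. specialize (HN n Hn). rewrite Rminus_0_r in *.
  rewrite Rabs_pos_eq in * by apply Cnorm2_ge0.
  replace (ip (z n) y) with (ip (z n) (trunc m y) + ip (z n) (lsub y (trunc m y)))%C by (rewrite ip_sub_r; ring).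
  eapply Rle_lt_trans; [apply Cnorm2_plus_le|].
  assert (Cnorm2 (ip (z n) (lsub y (trunc m y))) <= eps / 4).
  { eapply Rle_trans; [apply cauchy_schwarz|].
    apply Rle_trans with ((M + 1) * (eps / (4 * (M + 1)))).
    - apply Rmult_le_compat; try apply n2_ge0; try lra. specialize (B n); lra.
    - right. field. lra. }
  lra.
Qed.

(** Testing against the limit itself gives |l|^4 <= M |l|^2. *)
Lemma wlim_bound x l M : wlim x l -> (forall n, n2 (x n) <= M) -> n2 l <= M.
Proof.
  intros W B. specialize (W l). apply clim_norm2 in W. rewrite ip_self, Cnorm2_RtoC in W.
  assert (L : n2 l * n2 l <= M * n2 l).
  { apply (is_lim_seq_le _ (fun _ => M * n2 l) (n2 l * n2 l) (M * n2 l)) with (2 := W) (3 := is_lim_seq_const _).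
    intro n. eapply Rle_trans; [apply cauchy_schwarz|]. apply Rmult_le_compat_r; auto. apply n2_ge0. }
  destruct (n2_ge0 l) as [Q|Q]; [apply (Rmult_le_reg_r _ _ _ Q); auto|].
  rewrite <- Q. eapply Rle_trans; [apply (n2_ge0 (x O)) | apply B].
Qed.

Lemma weak_compactness (x : nat -> l2) M : (forall n, n2 (x n) <= M) ->
  exists phi l, incr phi /\ wlim (fun n => x (phi n)) l.
Proof.
  intro B.
  assert (M0 : 0 <= M) by (eapply Rle_trans; [apply (n2_ge0 (x O)) | apply B]).
  (* Real and imaginary parts are interleaved so that one diagonal extraction for real arrays treats
     both. *)
  set (f := fun n k => if Nat.even k then fst (x n (Nat.div2 k)) else snd (x n (Nat.div2 k))).
  destruct (diagonal_subseq f (M + 1)) as [phi [Hp L]].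
  { intros n k. apply Rlt_le, Rabs_lt_of_sqr; [lra|].
    assert (f n k * f n k <= Cnorm2 (x n (Nat.div2 k))).
    { unfold f, Cnorm2. destruct Nat.even;
        [pose proof (Rle_0_sqr (snd (x n (Nat.div2 k)))) | pose proof (Rle_0_sqr (fst (x n (Nat.div2 k))))]; unfold Rsqr in *; lra. }
    pose proof (coord_le_n2 (x n) (Nat.div2 k)). specialize (B n). nra. }
  assert (K : forall k, exists l, clim (fun n => x (phi n) k) l).
  { intro k. destruct (L (2 * k)%nat) as [a Ha], (L (2 * k + 1)%nat) as [b Hb].
    exists (a, b). split.
    - apply is_lim_seq_ext with (2 := Ha). intro n. unfold f. rewrite Nat.even_even, Nat.div2_even; auto.
    - apply is_lim_seq_ext with (2 := Hb). intro n. unfold f. rewrite Nat.even_odd, Nat.div2_odd'; auto. }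
  set (h := fun k => proj1_sig (constructive_indefinite_description _ (K k))).
  assert (Hh : forall k, clim (fun n => x (phi n) k) (h k)).
  { intro k. apply (proj2_sig (constructive_indefinite_description _ (K k))). }
  destruct (ex_series_bdd (fun k => Cnorm2 (h k)) M) as [E _].
  { intro; apply Cnorm2_ge0. }
  { intro m.
    assert (Q : is_lim_seq (fun n => psum (fun k => Cnorm2 (x (phi n) k)) m) (psum (fun k => Cnorm2 (h k)) m)).
    { apply is_lim_seq_psum. intro k. apply clim_norm2, Hh. }
    apply (is_lim_seq_le _ (fun _ => M) (psum (fun k => Cnorm2 (h k)) m) M) with (2 := Q) (3 := is_lim_seq_const _).
    intro n. rewrite <- n2_trunc. eapply Rle_trans; [apply n2_trunc_le | apply B]. }
  exists phi, (mkl2 h E). split; auto. intro y.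
  apply clim_ext with (fun n => ip (lsub (x (phi n)) (mkl2 h E)) y + ip (mkl2 h E) y)%C.
  { intro n. rewrite ip_sub_l. ring. }
  apply clim_eq with (RtoC 0 + ip (mkl2 h E) y)%C; [|ring].
  apply clim_plus; [|apply clim_const].
  apply wlim_of_coord with (2 * M + 2 * n2 (mkl2 h E)).
  - intro n. eapply Rle_trans; [apply n2_sub_le|]. specialize (B (phi n)). lra.
  - intro k. simpl. replace (RtoC 0) with (h k + - (1) * h k)%C by ring.
    apply clim_plus; [apply Hh | apply clim_const].
Qed.

Lemma wlim_coord x l : wlim x l -> forall k, clim (fun n => x n k) (l k).
Proof. intros W k. rewrite <- ip_delta. apply clim_ext with (2 := W (ldelta k)). intro; apply ip_delta. Qed.

Lemma slim_ip x l y m : slim x l -> slim y m -> clim (fun n => ip (x n) (y n)) (ip l m).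
Proof.
  intros X Y.
  assert (A : clim (fun n => ip (lsub (x n) l) (lsub (y n) m)) (RtoC 0)).
  { apply clim_norm2_0. apply lim0_le with (fun n => n2 (lsub (x n) l) * n2 (lsub (y n) m)).
    - intro; split; [apply Cnorm2_ge0 | apply cauchy_schwarz].
    - replace (Finite 0) with (Finite (0 * 0)) by (f_equal; ring). apply is_lim_seq_mult'; auto. }
  assert (B : clim (fun n => ip (lsub (x n) l) m) (RtoC 0)).
  { apply clim_norm2_0. apply lim0_le with (fun n => n2 m * n2 (lsub (x n) l)).
    - intro; split; [apply Cnorm2_ge0 | rewrite Rmult_comm; apply cauchy_schwarz].
    - apply lim_scal0; auto. }
  assert (D : clim (fun n => ip l (lsub (y n) m)) (RtoC 0)).
  { apply clim_norm2_0. apply lim0_le with (fun n => n2 l * n2 (lsub (y n) m)).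
    - intro; split; [apply Cnorm2_ge0 | apply cauchy_schwarz].
    - apply lim_scal0; auto. }
  replace (ip l m) with (RtoC 0 + RtoC 0 + RtoC 0 + ip l m)%C by ring.
  apply clim_ext with (fun n => ip (lsub (x n) l) (lsub (y n) m) + ip (lsub (x n) l) m + ip l (lsub (y n) m) + ip l m)%C.
  { intro n. rewrite !ip_sub_l, !ip_sub_r. ring. }
  apply clim_plus; [|apply clim_const]. apply clim_plus; [|exact D]. apply clim_plus; [exact A | exact B].
Qed.

Lemma slim_const x : slim (fun _ => x) x.
Proof.
  apply is_lim_seq_ext with (fun _ => 0); [|apply is_lim_seq_const].
  intro. rewrite n2_sub, ip_self. simpl. ring.
Qed.

Lemma slim_n2 x l : slim x l -> is_lim_seq (fun n => n2 (x n)) (n2 l).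
Proof.
  intro X. destruct (slim_ip x l x l X X) as [A _]. rewrite ip_self in A.
  apply is_lim_seq_ext with (2 := A). intro; rewrite ip_self; auto.
Qed.

Lemma slim_subseq x l phi : (forall n, (n <= phi n)%nat) -> slim x l -> slim (fun n => x (phi n)) l.
Proof. intros H S. apply (lim_subseq (fun n => n2 (lsub (x n) l))); auto. Qed.

Lemma slim_wlim x l : slim x l -> wlim x l.
Proof. intros S y. apply (slim_ip x l (fun _ => y) y S (slim_const y)). Qed.

Lemma n2_Series (x : l2) : n2 x = Series (fun k => Cnorm2 (x k)).
Proof. reflexivity. Qed.

Lemma fst_ip (x y : l2) : fst (ip x y) = Series (fun k => fst (x k * Cconj (y k))%C).
Proof. reflexivity. Qed.

Lemma snd_ip (x y : l2) : snd (ip x y) = Series (fun k => snd (x k * Cconj (y k))%C).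
Proof. reflexivity. Qed.

Lemma lval_mkl2 h H k : mkl2 h H k = h k.
Proof. reflexivity. Qed.

Lemma ladd_k (x y : l2) k : ladd x y k = (x k + y k)%C.
Proof. reflexivity. Qed.

Lemma lscal_k c (x : l2) k : lscal c x k = (c * x k)%C.
Proof. reflexivity. Qed.

Lemma lsub_k (x y : l2) k : lsub x y k = (x k - y k)%C.
Proof. change (x k + - (1) * y k = x k - y k)%C. ring. Qed.

Lemma ldelta_k i k : ldelta i k = if Nat.eq_dec k i then RtoC 1 else RtoC 0.
Proof. reflexivity. Qed.

Lemma trunc_k n (x : l2) k : trunc n x k = if lt_dec k n then x k else RtoC 0.
Proof. reflexivity. Qed.

Lemma lzero_k k : lzero k = RtoC 0.
Proof. reflexivity. Qed.

Global Opaque ip n2 ladd lscal mkl2 lval.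

(** * Orthonormal systems and compact operators *)

Definition on (e : nat -> l2) := forall i j, ip (e i) (e j) = if Nat.eq_dec i j then RtoC 1 else RtoC 0.

Lemma on_n2 e j : on e -> n2 (e j) = 1.
Proof.
  intro H. specialize (H j j). rewrite ip_self in H. destruct Nat.eq_dec; [|congruence].
  apply (f_equal fst) in H. exact H.
Qed.

Fixpoint residue (e : nat -> l2) (x : l2) (n : nat) : l2 :=
  match n with O => x | S k => lsub (residue e x k) (lscal (ip x (e k)) (e k)) end.

Lemma residue_ip e x n : on e -> forall j,
  ip (residue e x n) (e j) = if lt_dec j n then RtoC 0 else ip x (e j).
Proof.
  intros He j. induction n as [|n IH]; simpl residue.
  - destruct lt_dec; [lia | auto].
  - rewrite ip_sub_l, ip_scal_l, IH, He.
    repeat destruct lt_dec; try destruct Nat.eq_dec; subst; try lia; ring.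
Qed.

Lemma residue_n2 e x n : on e ->
  n2 (residue e x n) = n2 x - psum (fun j => Cnorm2 (ip x (e j))) n.
Proof.
  intro He. induction n as [|n IH]; simpl; [ring|].
  rewrite n2_sub, n2_scal, IH, on_n2, ip_scal_r, residue_ip by auto.
  destruct lt_dec; [lia|]. unfold Cnorm2; simpl. ring.
Qed.

Lemma bessel e x n : on e -> psum (fun j => Cnorm2 (ip x (e j))) n <= n2 x.
Proof. intro He. pose proof (n2_ge0 (residue e x n)). rewrite residue_n2 in H by auto. lra. Qed.

Lemma bessel_ex e x : on e -> ex_series (fun j => Cnorm2 (ip x (e j))).
Proof. intro He. apply (ex_series_bdd _ (n2 x)); [intro; apply Cnorm2_ge0 | intro; apply bessel; auto]. Qed.

Definition coords e (He : on e) (x : l2) : l2 := mkl2 _ (bessel_ex e x He).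

Lemma coords_k e He x k : coords e He x k = ip x (e k).
Proof. exact (lval_mkl2 _ _ _). Qed.

Lemma n2_coords_le e He x : n2 (coords e He x) <= n2 x.
Proof.
  rewrite n2_Series. rewrite (Series_ext _ (fun j => Cnorm2 (ip x (e j)))) by (intro; rewrite coords_k; auto).
  apply (ex_series_bdd _ (n2 x)); [intro; apply Cnorm2_ge0 | intro; apply bessel; auto].
Qed.

Lemma coords_add e He x y : coords e He (ladd x y) = ladd (coords e He x) (coords e He y).
Proof. apply l2_ext; intro k. rewrite ladd_k, !coords_k. apply ip_add_l. Qed.

Lemma coords_scal e He c x : coords e He (lscal c x) = lscal c (coords e He x).
Proof. apply l2_ext; intro k. rewrite lscal_k, !coords_k. apply ip_scal_l. Qed.

Lemma syn_exists e (He : on e) (c : l2) : exists s, n2 s <= n2 c /\ forall y, ip (coords e He y) c = ip y s.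
Proof.
  apply (riesz (fun y => ip (coords e He y) c)).
  - intros x y. rewrite coords_add, ip_add_l; auto.
  - intros a x. rewrite coords_scal, ip_scal_l; auto.
  - intro x. eapply Rle_trans; [apply cauchy_schwarz|]. rewrite Rmult_comm.
    apply Rmult_le_compat_l; [apply n2_ge0 | apply n2_coords_le].
Qed.

(* The vector of coordinates [c] in the orthonormal system [e], i.e. the adjoint of [coords]. *)
Definition syn e He c : l2 := proj1_sig (constructive_indefinite_description _ (syn_exists e He c)).

Lemma ip_syn_r e He c y : ip y (syn e He c) = ip (coords e He y) c.
Proof. unfold syn. destruct constructive_indefinite_description as [s [? H]]; simpl. auto. Qed.

Lemma ip_syn_l e He c y : ip (syn e He c) y = ip c (coords e He y).
Proof. rewrite ip_conj, ip_syn_r, <- ip_conj; auto. Qed.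

Lemma coords_e e He j : coords e He (e j) = ldelta j.
Proof. apply l2_ext; intro k. rewrite coords_k, He, ldelta_k. destruct Nat.eq_dec, Nat.eq_dec; congruence. Qed.

Lemma coords_syn e He c : coords e He (syn e He c) = c.
Proof. apply l2_ext; intro k. rewrite coords_k, ip_syn_l, coords_e, ip_delta; auto. Qed.

Lemma n2_syn e He c : n2 (syn e He c) = n2 c.
Proof.
  pose proof (ip_self (syn e He c)) as H. rewrite ip_syn_l, coords_syn, ip_self in H.
  apply (f_equal fst) in H. simpl in H. auto.
Qed.

(** Membership in the closed span, expressed as membership in the double orthogonal complement. *)
Definition inspan (e : nat -> l2) (x : l2) :=
  forall r, (forall j, ip r (e j) = RtoC 0) -> ip x r = RtoC 0.

Lemma lsub_eq0 x y : lsub x y = lzero -> x = y.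
Proof.
  intro H. apply l2_ext; intro k. apply (f_equal (fun z : l2 => z k)) in H.
  rewrite lsub_k in H. replace (x k) with (x k - y k + y k)%C by ring. rewrite H. rewrite lzero_k. ring.
Qed.

Lemma inspan_syn e He x : inspan e x -> syn e He (coords e He x) = x.
Proof.
  intro H. symmetry. apply lsub_eq0, n2_eq0.
  set (r := lsub x (syn e He (coords e He x))).
  assert (R : forall j, ip r (e j) = RtoC 0).
  { intro j. unfold r. rewrite ip_sub_l, ip_syn_l, coords_e, ip_delta, coords_k. ring. }
  assert (Z : coords e He r = lzero) by (apply l2_ext; intro j; rewrite coords_k, R; rewrite lzero_k; auto).
  pose proof (ip_self r) as E. unfold r in E at 1. rewrite ip_sub_l, (H r R), ip_syn_l, Z, ip_zero_r in E.
  apply (f_equal fst) in E. simpl in E. lra.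
Qed.

Lemma parseval e He x y : inspan e x -> ip x y = ip (coords e He x) (coords e He y).
Proof. intro H. rewrite <- (inspan_syn e He x H) at 1. apply ip_syn_l. Qed.

Lemma parseval_n2 e He x : inspan e x -> n2 x = n2 (coords e He x).
Proof. intro H. rewrite <- (inspan_syn e He x H) at 1. apply n2_syn. Qed.

Lemma functional_ext (phi psi : l2 -> C) M :
  (forall x y, phi (ladd x y) = (phi x + phi y)%C) -> (forall c x, phi (lscal c x) = (c * phi x)%C) ->
  (forall x, Cnorm2 (phi x) <= M * n2 x) ->
  (forall x y, psi (ladd x y) = (psi x + psi y)%C) -> (forall c x, psi (lscal c x) = (c * psi x)%C) ->
  (forall x, Cnorm2 (psi x) <= M * n2 x) ->
  (forall k, phi (ldelta k) = psi (ldelta k)) -> forall x, phi x = psi x.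
Proof.
  intros A S B A' S' B' H x.
  destruct (riesz phi M A S B) as [s [_ Es]], (riesz psi M A' S' B') as [t [_ Et]].
  rewrite Es, Et. f_equal. apply l2_ext; intro k.
  specialize (H k). rewrite Es, Et, !ip_delta_l in H.
  rewrite <- (Cconj_conj (s k)), H, Cconj_conj; auto.
Qed.

(** For c = -t z the expression equals |z|^2 (t^2 q - 2t), which is at most -t |z|^2 as soon as t q
    <= 1. *)
Lemma quadratic_nonneg_zero (z : C) q :
  (forall c : C, 0 <= 2 * fst (Cconj c * z)%C + Cnorm2 c * q) -> z = RtoC 0.
Proof.
  intro H. apply Cnorm2_eq0.
  set (t := / (Rabs q + 1)).
  assert (Q : 0 < Rabs q + 1) by (pose proof (Rabs_pos q); lra).
  assert (T : 0 < t) by (apply Rinv_0_lt_compat; auto).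
  specialize (H (RtoC (- t) * z)%C).
  rewrite Cnorm2_mult, Cnorm2_RtoC in H.
  replace (fst (Cconj (RtoC (- t) * z) * z)%C) with (- t * Cnorm2 z) in H by (unfold Cnorm2; simpl; ring).
  pose proof (Cnorm2_ge0 z) as P.
  assert (t * q <= 1).
  { apply Rmult_le_reg_l with (1 := Q). unfold t. rewrite <- Rmult_assoc, Rinv_r by lra.
    pose proof (Rle_abs q). lra. }
  assert (0 <= t * Cnorm2 z) by nra.
  assert (t * Cnorm2 z * (t * q) <= t * Cnorm2 z * 1) by (apply Rmult_le_compat_l; auto).
  assert (t * Cnorm2 z = 0) by nra.
  apply Rmult_integral in H3. lra.
Qed.

(** Cauchy-Schwarz for a nonnegative form, at a vector where it vanishes. Nonnegativity is asked
    only at the points [x + c y], because in the spectral theorem the form is nonnegative only on an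
    invariant subspace. *)
Lemma psd_zero (G : l2 -> l2) x y :
  (forall x y, G (ladd x y) = ladd (G x) (G y)) -> (forall c x, G (lscal c x) = lscal c (G x)) ->
  (forall x y, ip (G x) y = ip x (G y)) ->
  (forall c, 0 <= fst (ip (G (ladd x (lscal c y))) (ladd x (lscal c y)))) ->
  fst (ip (G x) x) = 0 -> ip (G x) y = RtoC 0.
Proof.
  intros A S Sy P Z. apply quadratic_nonneg_zero with (fst (ip (G y) y)).
  intro c. specialize (P c).
  rewrite A, S, ip_add_l, !ip_add_r, ip_scal_l, !ip_scal_r, ip_scal_l in P.
  assert (E : ip (G y) x = Cconj (ip (G x) y)) by (rewrite Sy, ip_conj; auto). rewrite E in P.
  unfold Cnorm2. destruct (ip (G x) y), (ip (G x) x), (ip (G y) y), c. simpl in *. nra.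
Qed.

Section Spectral.
Variable B : l2 -> l2.
Hypothesis B_add : forall x y, B (ladd x y) = ladd (B x) (B y).
Hypothesis B_scal : forall c x, B (lscal c x) = lscal c (B x).
Hypothesis B_sym : forall x y, ip (B x) y = ip x (B y).
Hypothesis B_pos : forall x, 0 <= fst (ip (B x) x).
Hypothesis B_bdd : exists M, forall x, fst (ip (B x) x) <= M * n2 x.
Hypothesis B_cpt : forall x l M, (forall n, n2 (x n) <= M) -> wlim x l ->
  is_lim_seq (fun n => fst (ip (B (x n)) (x n))) (fst (ip (B l) l)).

(** The orthogonal complement of the eigenvectors with positive eigenvalue; [B] maps it to itself
    because it is symmetric. *)
Let M x := forall s e, 0 < s -> B e = lscal (RtoC s) e -> ip x e = RtoC 0.

Let M_add x y : M x -> M y -> M (ladd x y).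
Proof. intros Hx Hy s e Hs He. rewrite ip_add_l, (Hx s e), (Hy s e) by auto. ring. Qed.
Let M_scal c x : M x -> M (lscal c x).
Proof. intros Hx s e Hs He. rewrite ip_scal_l, (Hx s e) by auto. ring. Qed.
Let M_B x : M x -> M (B x).
Proof. intros Hx s e Hs He. rewrite B_sym, He, ip_scal_r, (Hx s e) by auto. ring. Qed.

(** Let [S] be the supremum of the quadratic form on the unit ball of [M]. If it were positive, a
    weak limit of a maximising sequence would attain it and be an eigenvector in [M] for the
    eigenvalue [S], hence orthogonal to itself. So the form vanishes on [M], and a nonnegative form
    vanishes at [x] only if [B x = 0]. *)
Lemma spectral_theorem x : M x -> B x = lzero.
Proof.
  intro Mx.
  set (E := fun r => exists x, M x /\ n2 x <= 1 /\ r = fst (ip (B x) x)).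
  assert (M0 : M lzero) by (intros s e _ _; apply ip_zero_l).
  assert (q0 : fst (ip (B lzero) lzero) = 0) by (rewrite ip_zero_r; auto).
  destruct (completeness E) as [S [HS1 HS2]].
  { destruct B_bdd as [m Hm]. exists (Rabs m). intros r (y & _ & Hy & ->).
    eapply Rle_trans; [apply Hm|]. pose proof (n2_ge0 y). pose proof (Rle_abs m). pose proof (Rabs_pos m). nra. }
  { exists 0. exists lzero. rewrite n2_zero, q0. auto with real. }
  assert (S0 : 0 <= S) by (apply HS1; exists lzero; rewrite n2_zero, q0; auto with real).
  assert (Hq : forall y, M y -> fst (ip (B y) y) <= S * n2 y).
  { intros y My. destruct (classic (y = lzero)) as [->|Hy]; [rewrite q0, n2_zero; lra|].
    apply n2_pos in Hy.
    assert (Hs : 0 < / sqrt (n2 y)) by (apply Rinv_0_lt_compat, sqrt_lt_R0; auto).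
    assert (Hss : / sqrt (n2 y) * / sqrt (n2 y) = / n2 y) by (rewrite <- Rinv_mult, sqrt_sqrt; lra).
    assert (L : fst (ip (B (lscal (RtoC (/ sqrt (n2 y))) y)) (lscal (RtoC (/ sqrt (n2 y))) y)) <= S).
    { apply HS1. eexists; split; [apply (M_scal (RtoC (/ sqrt (n2 y))) y My) | split; [|reflexivity]].
      rewrite n2_scal, Cnorm2_RtoC, Hss. right; field; lra. }
    rewrite B_scal, ip_scal_l, ip_scal_r, Cconj_R in L.
    replace (fst (RtoC (/ sqrt (n2 y)) * (RtoC (/ sqrt (n2 y)) * ip (B y) y))%C)
      with (/ n2 y * fst (ip (B y) y)) in L by (rewrite <- Hss; simpl; ring).
    apply Rmult_le_reg_l with (/ n2 y); [apply Rinv_0_lt_compat; auto|].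
    replace (/ n2 y * (S * n2 y)) with S by (field; lra). auto. }
  destruct S0 as [Spos | Szero].
  - exfalso.
    assert (X : forall n, exists y, M y /\ n2 y <= 1 /\ S - / INR (Datatypes.S n) < fst (ip (B y) y)).
    { intro n. apply NNPP. intro Hn.
      assert (0 < / INR (Datatypes.S n)) by (apply Rinv_0_lt_compat, lt_0_INR; lia).
      assert (S <= S - / INR (Datatypes.S n)); [|lra].
      apply HS2. intros r (y & My & Ny & ->). apply Rnot_lt_le. intro; apply Hn; eauto. }
    set (y := fun n => proj1_sig (constructive_indefinite_description _ (X n))).
    assert (Hy : forall n, M (y n) /\ n2 (y n) <= 1 /\ S - / INR (Datatypes.S n) < fst (ip (B (y n)) (y n))).
    { intro n. apply (proj2_sig (constructive_indefinite_description _ (X n))). }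
    destruct (weak_compactness y 1) as (phi & l & Hp & W); [intro; apply Hy|].
    assert (Ml : M l).
    { intros s e Hs He. apply clim_unique with (1 := W e).
      apply clim_ext with (fun _ => RtoC 0); [|apply clim_const]. intro n. symmetry. apply (proj1 (Hy (phi n)) s e); auto. }
    assert (Nl : n2 l <= 1) by (apply wlim_bound with (1 := W); intro; apply Hy).
    assert (ql : fst (ip (B l) l) = S).
    { assert (L : is_lim_seq (fun n => fst (ip (B (y (phi n))) (y (phi n)))) S).
      { apply is_lim_seq_le_le with (fun n => S - / INR (Datatypes.S n)) (fun _ => S).
        - intro n. destruct (Hy (phi n)) as (My & Ny & Qy). split.
          + eapply Rle_trans; [|apply Rlt_le, Qy]. apply Rplus_le_compat_l, Ropp_le_contravar, Rinv_le_contravar.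
            * apply lt_0_INR; lia.
            * apply le_INR. pose proof (incr_ge _ Hp n). lia.
          + apply HS1. exists (y (phi n)); auto.
        - replace (Finite S) with (Finite (S - 0)) by (f_equal; ring). apply is_lim_seq_minus'; [apply is_lim_seq_const|].
          apply lim_eps. intros eps he. destruct (archimed_cor1 eps he) as [N [HN HN']]. exists N; intros n Hn.
          assert (0 < / INR (Datatypes.S n)) by (apply Rinv_0_lt_compat, lt_0_INR; lia).
          rewrite Rminus_0_r, Rabs_pos_eq by lra. eapply Rle_lt_trans; [|apply HN].
          apply Rinv_le_contravar; [apply lt_0_INR; lia | apply le_INR; lia].
        - apply is_lim_seq_const. }
      pose proof (B_cpt (fun n => y (phi n)) l 1 (fun n => proj1 (proj2 (Hy (phi n)))) W) as L'.
      apply is_lim_seq_unique in L. apply is_lim_seq_unique in L'. rewrite L in L'. injection L'; auto. }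
    assert (Nl1 : n2 l = 1) by (pose proof (Hq l Ml); apply Rle_antisym; auto; apply Rmult_le_reg_l with S; lra).
    (* [S - B] is nonnegative on [M] and vanishes at the maximiser, so [psd_zero] with the test
       vector [G l], again in [M], gives [B l = S l]. *)
    set (G := fun z => lsub (lscal (RtoC S) z) (B z)).
    assert (MG : M (G l)) by (unfold G, lsub; apply M_add; apply M_scal; auto).
    assert (HG : forall z, fst (ip (G z) z) = S * n2 z - fst (ip (B z) z)).
    { intro z. unfold G. rewrite ip_sub_l, ip_scal_l, ip_self. simpl. ring. }
    assert (Z : ip (G l) (G l) = RtoC 0).
    { apply psd_zero.
      - intros a b. unfold G. rewrite B_add. apply l2_ext; intro k. repeat rewrite ?ladd_k, ?lsub_k, ?lscal_k. ring.
      - intros c a. unfold G. rewrite B_scal. apply l2_ext; intro k. repeat rewrite ?ladd_k, ?lsub_k, ?lscal_k. ring.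
      - intros a b. unfold G. rewrite ip_sub_l, ip_sub_r, ip_scal_l, ip_scal_r, B_sym, Cconj_R; auto.
      - intro c. assert (Mz : M (ladd l (lscal c (G l)))) by auto. rewrite HG.
        pose proof (Hq _ Mz). lra.
      - rewrite HG, ql, Nl1. ring. }
    rewrite ip_self in Z. apply (f_equal fst) in Z. simpl in Z. apply n2_eq0, lsub_eq0 in Z.
    pose proof (Ml S l Spos (eq_sym Z)) as F. rewrite ip_self in F. apply (f_equal fst) in F. simpl in F. lra.
  - apply ip_ext. intro z. rewrite ip_zero_l. apply psd_zero; auto.
    pose proof (Hq x Mx). pose proof (B_pos x). rewrite <- Szero in H. lra.
Qed.
End Spectral.

(** * Hankel operators *)

Definition h12 : Type := {u : nat -> C | ex_series (fun k => (1 + INR k) * Cnorm2 (u k))}.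

Lemma weight_ge1 k : 1 <= 1 + INR k.
Proof. pose proof (pos_INR k); lra. Qed.

Lemma h12_l2_ex (u : h12) : ex_series (fun k => Cnorm2 (proj1_sig u k)).
Proof.
  apply ex_series_le' with (2 := proj2_sig u). intro k.
  pose proof (Cnorm2_ge0 (proj1_sig u k)). pose proof (weight_ge1 k). rewrite Rabs_pos_eq by auto. nra.
Qed.
Definition hl (u : h12) : l2 := mkl2 _ (h12_l2_ex u).
Coercion hl : h12 >-> l2.

Definition hs (u : h12) : R := Series (fun k => (1 + INR k) * Cnorm2 (u k)).

Lemma hl_k (u : h12) k : u k = proj1_sig u k.
Proof. exact (lval_mkl2 _ _ _). Qed.

Lemma h12_ex (u : h12) : ex_series (fun k => (1 + INR k) * Cnorm2 (u k)).
Proof. apply ex_series_ext with (2 := proj2_sig u). intro; rewrite hl_k; auto. Qed.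

Lemma h12_ext (u v : h12) : (forall k, u k = v k) -> u = v.
Proof.
  intro H. setoid_rewrite hl_k in H. destruct u as [x Hx], v as [y Hy]. simpl in H.
  assert (x = y) as -> by (apply functional_extensionality; exact H).
  f_equal. apply proof_irrelevance.
Qed.

Lemma shn_ex n (x : l2) : ex_series (fun k => Cnorm2 (x (n + k)%nat)).
Proof. apply (Series_split (fun k => Cnorm2 (x k)) n), l2_ex. Qed.
Definition shn n (x : l2) : l2 := mkl2 _ (shn_ex n x).

Lemma shn_k n x k : shn n x k = x (n + k)%nat.
Proof. exact (lval_mkl2 _ _ _). Qed.

(** Each |u_m|^2 is counted by the tails of index n <= m, that is 1 + m times. As H_u maps the basis
    vector n to [shn n u], the sum is the squared Hilbert-Schmidt norm of H_u. *)
Lemma sum_tails (u : h12) : ex_series (fun n => n2 (shn n u)) /\ Series (fun n => n2 (shn n u)) = hs u.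
Proof.
  set (f := fun m n => if le_dec n m then Cnorm2 (u m) else 0).
  destruct (tonelli f (fun m => (1 + INR m) * Cnorm2 (u m)) (hs u)) as [A B].
  - intros i j. unfold f. destruct le_dec; [apply Cnorm2_ge0 | lra].
  - intro m. apply is_series_psum.
    apply is_lim_seq_ext_loc with (fun _ => (1 + INR m) * Cnorm2 (u m)); [|apply is_lim_seq_const].
    exists (S m). intros n Hn. induction Hn as [|n Hn IH].
    + assert (Q : forall p, (p <= S m)%nat -> psum (f m) p = INR p * Cnorm2 (u m)).
      { intro p; induction p as [|p IH]; intro Hp; [simpl; ring|].
        change (psum (f m) (S p)) with (psum (f m) p + f m p). rewrite S_INR, IH by lia.
        unfold f at 1. destruct le_dec; [ring|lia]. }
      rewrite Q, S_INR by lia. ring.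
    + change (psum (f m) (S n)) with (psum (f m) n + f m n). rewrite <- IH.
      unfold f. destruct le_dec; [lia|ring].
  - apply Series_correct, h12_ex.
  - assert (E : forall n, Series (fun m => f m n) = n2 (shn n u)).
    { intro n. rewrite (proj1 (Series_split _ n (A n))).
      rewrite (psum_ext _ (fun _ => 0 * 0)), psum_scal, Rmult_0_l, Rplus_0_l.
      - rewrite n2_Series. apply Series_ext. intro k. unfold f. rewrite shn_k. destruct le_dec; [auto|lia].
      - intros k Hk. unfold f. destruct le_dec; [lia|ring]. }
    split.
    + apply ex_series_ext with (1 := E). exists (hs u); auto.
    + rewrite <- (Series_ext _ _ E). apply is_series_unique; auto.
Qed.

Lemma hank_ex (u : h12) (x : l2) : ex_series (fun n => Cnorm2 (ip (shn n u) x)).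
Proof.
  apply ex_series_le' with (fun n => n2 x * n2 (shn n u)).
  - intro n. rewrite Rabs_pos_eq by apply Cnorm2_ge0. rewrite Rmult_comm. apply cauchy_schwarz.
  - apply (@ex_series_scal R_AbsRing R_NormedModule), sum_tails.
Qed.
Definition hank (u : h12) (x : l2) : l2 := mkl2 _ (hank_ex u x).

Lemma hank_k u x n : hank u x n = ip (shn n u) x.
Proof. exact (lval_mkl2 _ _ _). Qed.

Lemma hs_ge0 u : 0 <= hs u.
Proof. rewrite <- (proj2 (sum_tails u)). apply Series_pos; [intro; apply n2_ge0 | apply sum_tails]. Qed.

Lemma n2_hank_le u x : n2 (hank u x) <= hs u * n2 x.
Proof.
  rewrite <- (proj2 (sum_tails u)), Rmult_comm, <- Series_scal_l, n2_Series.
  apply Series_le.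
  - intro n. rewrite hank_k. split; [apply Cnorm2_ge0|]. rewrite Rmult_comm. apply cauchy_schwarz.
  - apply (@ex_series_scal R_AbsRing R_NormedModule), sum_tails.
Qed.

Lemma hank_add u x y : hank u (ladd x y) = ladd (hank u x) (hank u y).
Proof. apply l2_ext; intro k. rewrite ladd_k, !hank_k. apply ip_add_r. Qed.

Lemma hank_scal u c x : hank u (lscal c x) = lscal (Cconj c) (hank u x).
Proof. apply l2_ext; intro k. rewrite lscal_k, !hank_k. apply ip_scal_r. Qed.

Lemma hank_sub u x y : hank u (lsub x y) = lsub (hank u x) (hank u y).
Proof. unfold lsub. rewrite hank_add, hank_scal, Cconj_m1; auto. Qed.

Lemma hank_delta u k : hank u (ldelta k) = shn k u.
Proof.
  apply l2_ext; intro n. rewrite hank_k, ip_delta, !shn_k. f_equal; lia.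
Qed.

(** Symmetry of the matrix [u (n + k)], in the form it takes for antilinear operators. Both sides
    are antilinear in [y]; after conjugation it is enough to compare them on basis vectors. *)
Lemma hank_sym u x y : ip (hank u x) y = ip (hank u y) x.
Proof.
  rewrite <- (Cconj_conj (ip (hank u x) y)), <- (Cconj_conj (ip (hank u y) x)). f_equal.
  apply (functional_ext (fun y => Cconj (ip (hank u x) y)) (fun y => Cconj (ip (hank u y) x)) (hs u * n2 x)).
  - intros; rewrite ip_add_r, Cplus_conj; auto.
  - intros; rewrite ip_scal_r, Cmult_conj, Cconj_conj; auto.
  - intro z. rewrite Cnorm2_conj. eapply Rle_trans; [apply cauchy_schwarz|].
    apply Rmult_le_compat_r; [apply n2_ge0 | apply n2_hank_le].
  - intros; rewrite hank_add, ip_add_l, Cplus_conj; auto.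
  - intros; rewrite hank_scal, ip_scal_l, Cmult_conj, Cconj_conj; auto.
  - intro z. rewrite Cnorm2_conj. eapply Rle_trans; [apply cauchy_schwarz|].
    pose proof (n2_hank_le u z). pose proof (n2_ge0 x).
    apply Rle_trans with (hs u * n2 z * n2 x); [apply Rmult_le_compat_r; auto | right; ring].
  - intro k. rewrite hank_delta, ip_delta, hank_k. reflexivity.
Qed.

Lemma hank_sqr_ip u x y : ip (hank u (hank u x)) y = ip (hank u y) (hank u x).
Proof. apply hank_sym. Qed.

(** Each coordinate converges by weak convergence, and the squares are dominated by a fixed multiple
    of the summable tails. *)
Lemma hank_compact u x l M : (forall n, n2 (x n) <= M) -> wlim x l -> slim (fun n => hank u (x n)) (hank u l).
Proof.
  intros B W. unfold slim.
  assert (B' : forall n, n2 (lsub (x n) l) <= 2 * M + 2 * n2 l).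
  { intro n. eapply Rle_trans; [apply n2_sub_le|]. specialize (B n). lra. }
  destruct (dominated_series (fun n k => Cnorm2 (ip (shn k u) (lsub (x n) l)))
    (fun n k => (2 * M + 2 * n2 l) * n2 (shn k u)) (fun _ => 0) (fun k => (2 * M + 2 * n2 l) * n2 (shn k u))) as [_ R].
  - intro k. apply clim_norm2_0. apply clim_eq with (Cconj (ip l (shn k u) - ip l (shn k u))%C);
      [|replace (ip l (shn k u) - ip l (shn k u))%C with (RtoC 0) by ring; apply Cconj_R].
    apply clim_ext with (fun n => Cconj (ip (x n) (shn k u) - ip l (shn k u))%C).
    + intro n. rewrite <- ip_sub_l, <- ip_conj; auto.
    + apply clim_conj, clim_minus; [apply W | apply clim_const].
  - intro; apply is_lim_seq_const.
  - intros n k. rewrite Rabs_pos_eq by apply Cnorm2_ge0. eapply Rle_trans; [apply cauchy_schwarz|].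
    rewrite Rmult_comm. apply Rmult_le_compat_r; [apply n2_ge0 | auto].
  - intro. apply (@ex_series_scal R_AbsRing R_NormedModule), sum_tails.
  - apply (@ex_series_scal R_AbsRing R_NormedModule), sum_tails.
  - apply is_lim_seq_const.
  - rewrite (Series_ext _ (fun k => 0 * 0)), Series_scal_l, Rmult_0_l in R by (intro; ring).
    apply is_lim_seq_ext with (2 := R). intro n. rewrite <- hank_sub, n2_Series. apply Series_ext; intro. rewrite hank_k; auto.
Qed.

(** The spectral theorem for the positive operator H_u^2, whose kernel is that of H_u. *)
Lemma hank_spectral u x :
  (forall s e, 0 < s -> hank u (hank u e) = lscal (RtoC s) e -> ip x e = RtoC 0) -> hank u x = lzero.
Proof.
  intro H.
  assert (Z : hank u (hank u x) = lzero).
  { apply (spectral_theorem (fun x => hank u (hank u x))); auto.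
    - intros; rewrite !hank_add; auto.
    - intros; rewrite !hank_scal, Cconj_conj; auto.
    - intros a b. rewrite hank_sqr_ip, (ip_conj _ a), hank_sqr_ip, <- ip_conj; auto.
    - intro a. rewrite hank_sqr_ip, ip_self. apply n2_ge0.
    - exists (hs u). intro a. rewrite hank_sqr_ip, ip_self. apply n2_hank_le.
    - intros a l M B W. pose proof (slim_n2 _ _ (hank_compact u a l M B W)) as L.
      rewrite hank_sqr_ip, ip_self. apply is_lim_seq_ext with (2 := L).
      intro n. rewrite hank_sqr_ip, ip_self; auto. }
  apply n2_eq0. pose proof (hank_sqr_ip u x x) as E. rewrite Z, ip_zero_l, ip_self in E.
  apply (f_equal fst) in E. simpl in E. auto.
Qed.

Lemma h12_shift_ex (u : h12) : ex_series (fun k => (1 + INR k) * Cnorm2 (u (S k))).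
Proof.
  apply ex_series_le' with (fun k => (1 + INR (S k)) * Cnorm2 (u (S k))).
  - intro k. pose proof (Cnorm2_ge0 (u (S k))). pose proof (weight_ge1 k). rewrite S_INR.
    rewrite Rabs_pos_eq; nra.
  - apply (ex_series_incr_1 (fun k => (1 + INR k) * Cnorm2 (u k))), h12_ex.
Qed.
Definition mkh12 (h : nat -> C) (H : ex_series (fun k => (1 + INR k) * Cnorm2 (h k))) : h12 := exist _ h H.
Definition hshift (u : h12) : h12 := mkh12 _ (h12_shift_ex u).
Lemma hshift_k u k : hshift u k = u (S k).
Proof. rewrite hl_k. reflexivity. Qed.

(** H_u T_z is itself the Hankel operator of the shifted symbol, so that everything proved for
    [hank] applies to K_u. *)
Definition kank (u : h12) := hank (hshift u).

Lemma kank_coord u x n : kank u x n = hank u x (S n).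
Proof.
  unfold kank. rewrite !hank_k. f_equal. apply l2_ext; intro k. rewrite !shn_k, hshift_k. reflexivity.
Qed.

Lemma ip_shift1 (x y : l2) : ip (shn 1 x) (shn 1 y) = (ip x y - x O * Cconj (y O))%C.
Proof.
  destruct (ip_ex x y) as [A B].
  apply injective_projections.
  - change (fst (ip (shn 1 x) (shn 1 y)) = fst (ip x y) + - fst (x O * Cconj (y O))%C).
    rewrite !fst_ip, (Series_incr_1 _ A). rewrite (Series_ext _ (fun k => fst (x (S k) * Cconj (y (S k)))%C));
      [simpl; ring | intro; rewrite !shn_k; auto].
  - change (snd (ip (shn 1 x) (shn 1 y)) = snd (ip x y) + - snd (x O * Cconj (y O))%C).
    rewrite !snd_ip, (Series_incr_1 _ B). rewrite (Series_ext _ (fun k => snd (x (S k) * Cconj (y (S k)))%C));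
      [simpl; ring | intro; rewrite !shn_k; auto].
Qed.

Lemma kank_shift u x : kank u x = shn 1 (hank u x).
Proof. apply l2_ext; intro n. rewrite shn_k. apply kank_coord. Qed.

Lemma hank_0 u x : hank u x O = ip u x.
Proof. rewrite hank_k. f_equal. apply l2_ext; intro. apply shn_k. Qed.

(** K_u x is H_u x shifted backward, so the inner product of two such vectors loses exactly the
    product of the zeroth coefficients, which come from [ip u x] and [ip u y]. *)
Lemma kank_sqr u x : kank u (kank u x) = lsub (hank u (hank u x)) (lscal (ip x u) u).
Proof.
  apply ip_ext. intro y. unfold kank at 1. rewrite hank_sym. fold (kank u y).
  rewrite !kank_shift, ip_shift1, !hank_0, ip_sub_l, ip_scal_l, hank_sqr_ip, <- (ip_conj u x); ring.
Qed.

Lemma hank_one u : hank u (ldelta 0) = u.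
Proof. rewrite hank_delta. apply l2_ext; intro. apply shn_k. Qed.

Lemma hs_shift u : hs (hshift u) = hs u - n2 u.
Proof.
  unfold hs. rewrite (Series_incr_1 _ (h12_ex u)).
  rewrite n2_Series,  (Series_incr_1 _ (l2_ex u)).
  assert (E : forall k, (1 + INR k) * Cnorm2 (hshift u k) = (1 + INR (S k)) * Cnorm2 (u (S k)) - Cnorm2 (u (S k))).
  { intro k. rewrite S_INR. rewrite hshift_k. ring. }
  rewrite (Series_ext _ _ E), Series_minus.
  - simpl INR. ring.
  - apply (ex_series_incr_1 (fun k => (1 + INR k) * Cnorm2 (u k))), h12_ex.
  - apply (ex_series_incr_1 (fun k => Cnorm2 (u k))), l2_ex.
Qed.

(** * Secular equations *)

Lemma is_series_ext_R (f g : nat -> R) (l : R) : (forall k, f k = g k) -> is_series f l -> is_series g l.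
Proof. intros. apply is_series_ext with f; auto. Qed.

Lemma is_series_plus_R (f g : nat -> R) a b : is_series f a -> is_series g b -> is_series (fun k => f k + g k) (a + b).
Proof. intros. apply (is_series_plus (V := R_NormedModule) f g a b); auto. Qed.

Lemma is_series_scal_R c (f : nat -> R) a : is_series f a -> is_series (fun k => c * f k) (c * a).
Proof. intros. apply (is_series_scal (V := R_NormedModule) c f a); auto. Qed.

Lemma ex_series_scal_R c (f : nat -> R) : ex_series f -> ex_series (fun k => c * f k).
Proof. intros. apply (@ex_series_scal R_AbsRing R_NormedModule); auto. Qed.

Lemma is_series_le_single f l j : is_series f l -> (forall k, k <> j -> f k <= 0) -> l <= f j.
Proof.
  intros H N.
  pose proof (Series_single (fun k => if Nat.eq_dec k j then f k else 0) j) as S.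
  simpl in S. destruct (Nat.eq_dec j j) in S; [|congruence].
  rewrite <- (is_series_unique _ _ H).
  rewrite <- (is_series_unique _ _ (S ltac:(intros i Hi; destruct Nat.eq_dec; [congruence|auto]))).
  apply Series_le'; [|exists l; auto|eexists; apply S; intros i Hi; destruct Nat.eq_dec; [congruence|auto]].
  intro k. destruct Nat.eq_dec; [lra | auto].
Qed.

Lemma is_series_ge_single f l j : is_series f l -> (forall k, k <> j -> 0 <= f k) -> f j <= l.
Proof.
  intros H N. apply (is_series_scal_R (-1)) in H.
  apply is_series_le_single with (j := j) in H; [lra|]. intros k Hk. specialize (N k Hk). lra.
Qed.

Section Secular.
Variables x a : nat -> R.
Hypothesis xpos : forall j, 0 < x j.
Hypothesis xdec : forall j, x (S j) < x j.
Hypothesis xlim : is_lim_seq x 0.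
Hypothesis apos : forall j, 0 < a j.
Hypothesis aex : ex_series a.

Lemma xdec_lt i j : (i < j)%nat -> x j < x i.
Proof. intro L; induction L; [apply xdec | specialize (xdec m); lra]. Qed.

Lemma xdec_le i j : (i <= j)%nat -> x j <= x i.
Proof. intro L. destruct (Nat.eq_dec i j) as [->|]; [lra|]. apply Rlt_le, xdec_lt. lia. Qed.

Definition gap j s := x (S j) < s < x j.

Lemma gap_dist j s : gap j s -> exists d, 0 < d /\ forall k, d <= Rabs (x k - s).
Proof.
  intros [A B]. exists (Rmin (x j - s) (s - x (S j))). split; [apply Rmin_glb_lt; lra|].
  intro k. destruct (le_lt_dec k j) as [L|L].
  - apply xdec_le in L. eapply Rle_trans; [apply Rmin_l|]. rewrite Rabs_pos_eq; lra.
  - apply xdec_le in L. eapply Rle_trans; [apply Rmin_r|]. rewrite Rabs_left; lra.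
Qed.

Definition sec s := Series (fun k => a k / (x k - s)).

Lemma sec_term_le d s k : 0 < d -> d <= Rabs (x k - s) -> Rabs (a k / (x k - s)) <= / d * a k.
Proof.
  intros D H. unfold Rdiv. rewrite Rabs_mult, (Rabs_pos_eq (a k)) by (apply Rlt_le; auto).
  rewrite Rabs_inv. rewrite Rmult_comm. apply Rmult_le_compat_r; [apply Rlt_le; auto|].
  apply Rinv_le_contravar; auto.
Qed.

Lemma sec_ex j s : gap j s -> ex_series (fun k => a k / (x k - s)).
Proof.
  intro G. destruct (gap_dist j s G) as (d & D & H).
  apply ex_series_le' with (fun k => / d * a k); [|apply ex_series_scal_R; auto].
  intro k. apply sec_term_le; auto.
Qed.

Lemma sec_sq_ex j s : gap j s -> ex_series (fun k => a k / (x k - s) ^ 2).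
Proof.
  intro G. destruct (gap_dist j s G) as (d & D & H).
  apply ex_series_le' with (fun k => / (d * d) * a k); [|apply ex_series_scal_R; auto].
  intro k. unfold Rdiv. rewrite Rabs_mult, (Rabs_pos_eq (a k)) by (apply Rlt_le; auto).
  rewrite Rmult_comm. apply Rmult_le_compat_r; [apply Rlt_le; auto|].
  rewrite Rabs_inv, <- RPow_abs. apply Rinv_le_contravar; [nra|]. specialize (H k). simpl. rewrite Rmult_1_r.
  apply Rmult_le_compat; lra.
Qed.

Lemma sec_mono j s t : gap j s -> gap j t -> s < t -> sec s < sec t.
Proof.
  intros Gs Gt L. pose proof (sec_ex j s Gs) as Es. pose proof (sec_ex j t Gt) as Et.
  assert (T : forall k, a k / (x k - s) < a k / (x k - t)).
  { intro k. unfold Rdiv. apply Rmult_lt_compat_l; [apply apos|].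
    destruct Gs, Gt. destruct (le_lt_dec k j) as [Q|Q]; apply xdec_le in Q.
    - apply Rinv_lt_contravar; [|lra]. apply Rmult_lt_0_compat; lra.
    - apply Rinv_lt_contravar; [|lra]. nra. }
  assert (D : ex_series (fun k => a k / (x k - t) - a k / (x k - s))).
  { apply (ex_series_minus (V := R_NormedModule)); auto. }
  pose proof (term_le_Series _ 0 (fun k => Rlt_le _ _ (proj2 (Rlt_0_minus _ _) (T k))) D) as H.
  rewrite Series_minus in H by auto. specialize (T O). unfold sec. lra.
Qed.

Lemma sec_cont j s : gap j s -> continuity_pt sec s.
Proof.
  intros G. destruct (gap_dist j s G) as (d & D & H).
  set (A := Series a). assert (A0 : 0 <= A) by (apply Series_pos; auto; intro; apply Rlt_le; auto).
  assert (Lip : forall t, Rabs (t - s) < d / 2 -> gap j t -> Rabs (sec t - sec s) <= 2 / (d * d) * A * Rabs (t - s)).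
  { intros t Ht Gt. unfold sec. rewrite <- Series_minus by (eapply sec_ex; eauto).
    assert (B : forall k, Rabs (a k / (x k - t) - a k / (x k - s)) <= 2 / (d * d) * Rabs (t - s) * a k).
    { intro k. specialize (H k).
      assert (Hk : d / 2 <= Rabs (x k - t)).
      { replace (x k - t) with ((x k - s) - (t - s)) by ring.
        pose proof (Rabs_triang_inv (x k - s) (t - s)). lra. }
      assert (N1 : x k - t <> 0) by (intro Z; rewrite Z, Rabs_R0 in Hk; lra).
      assert (N2 : x k - s <> 0) by (intro Z; rewrite Z, Rabs_R0 in H; lra).
      replace (a k / (x k - t) - a k / (x k - s)) with (a k * (t - s) * (/ (x k - t) * / (x k - s))) by (field; auto).
      rewrite !Rabs_mult, !Rabs_inv, (Rabs_pos_eq (a k)) by (apply Rlt_le; auto).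
      assert (/ Rabs (x k - t) <= 2 / d) by (replace (2 / d) with (/ (d / 2)) by (field; lra); apply Rinv_le_contravar; lra).
      assert (/ Rabs (x k - s) <= / d) by (apply Rinv_le_contravar; lra).
      assert (0 < / Rabs (x k - t)) by (apply Rinv_0_lt_compat; lra).
      assert (0 < / Rabs (x k - s)) by (apply Rinv_0_lt_compat; lra).
      replace (2 / (d * d) * Rabs (t - s) * a k) with (a k * Rabs (t - s) * (2 / d * / d)) by (field; lra).
      apply Rmult_le_compat_l; [apply Rmult_le_pos; [apply Rlt_le; auto | apply Rabs_pos]|].
      apply Rmult_le_compat; lra. }
    eapply Rle_trans; [apply Series_Rabs|].
    - apply ex_series_le' with (fun k => 2 / (d * d) * Rabs (t - s) * a k); [|apply ex_series_scal_R; auto].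
      intro k; rewrite Rabs_Rabsolu; auto.
    - eapply Rle_trans; [apply Series_le with (b := fun k => 2 / (d * d) * Rabs (t - s) * a k)|].
      + intro k; split; [apply Rabs_pos | auto].
      + apply ex_series_scal_R; auto.
      + rewrite Series_scal_l. fold A. right; ring. }
  intros eps he.
  set (K := 2 / (d * d) * A + 1).
  assert (K0 : 0 < K) by (unfold K; assert (0 <= 2 / (d * d) * A) by (apply Rmult_le_pos; auto; apply Rlt_le, Rdiv_lt_0_compat; nra); lra).
  exists (Rmin (Rmin (d / 2) (eps / K)) (Rmin (x j - s) (s - x (S j)))). split.
  - destruct G. repeat apply Rmin_glb_lt; try lra. apply Rdiv_lt_0_compat; lra.
  - intros t [_ Ht]. simpl in *. unfold R_dist in *.
    assert (H1 := Rlt_le_trans _ _ _ Ht (Rmin_l _ _)). assert (H2 := Rlt_le_trans _ _ _ Ht (Rmin_r _ _)).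
    assert (H3 := Rlt_le_trans _ _ _ H1 (Rmin_l _ _)). assert (H4 := Rlt_le_trans _ _ _ H1 (Rmin_r _ _)).
    assert (H5 := Rlt_le_trans _ _ _ H2 (Rmin_l _ _)). assert (H6 := Rlt_le_trans _ _ _ H2 (Rmin_r _ _)).
    apply Rabs_def2 in H5. apply Rabs_def2 in H6.
    eapply Rle_lt_trans; [apply Lip; auto; split; lra|].
    apply Rle_lt_trans with (K * Rabs (t - s)).
    + apply Rmult_le_compat_r; [apply Rabs_pos | unfold K; lra].
    + apply Rmult_lt_reg_l with (/ K); [apply Rinv_0_lt_compat; auto|].
      rewrite <- Rmult_assoc, Rinv_l by lra. unfold Rdiv in H4. lra.
Qed.

(** Near the upper end of the gap the term of index [j] is large and positive, near the lower end
    that of index [S j] is large and negative, while the terms of the unfavourable sign stay bounded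
    by [A / h]; the intermediate value theorem applies. *)
Lemma sec_root j : exists s, gap j s /\ is_series (fun k => a k / (x k - s)) 1.
Proof.
  set (m := (x j + x (S j)) / 2). pose proof (xdec j) as Xd.
  set (h := (x j - x (S j)) / 2).
  assert (h0 : 0 < h) by (unfold h; lra).
  set (A := Series a). assert (A0 : 0 <= A) by (apply Series_pos; auto; intro; apply Rlt_le; auto).
  assert (Hup : exists r, m < r < x j /\ 1 < sec r).
  (* With [t <= a j / q] the term [j] is at least [2 + A / h], and the negative terms sum to at
     least [- A / h] because [t <= h / 2] keeps their poles at distance at least [h]. *)
  { set (q := 2 + A / h). assert (q0 : 2 <= q) by (unfold q; assert (0 <= A / h) by (apply Rmult_le_pos; auto; apply Rlt_le, Rinv_0_lt_compat; auto); lra).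
    set (t := Rmin (h / 2) (a j / q)).
    assert (t0 : 0 < t) by (apply Rmin_glb_lt; [lra | apply Rdiv_lt_0_compat; auto; lra]).
    assert (th : t <= h / 2) by apply Rmin_l. assert (tq : t <= a j / q) by apply Rmin_r.
    exists (x j - t). assert (Gr : gap j (x j - t)) by (unfold gap, h in *; lra).
    split; [unfold m, h in *; lra|].
    pose proof (sec_ex j _ Gr) as E.
    assert (S1 : is_series (fun k => a k / (x k - (x j - t)) + / h * a k) (sec (x j - t) + / h * A)).
    { apply is_series_plus_R; [apply Series_correct; auto | apply is_series_scal_R, Series_correct; auto]. }
    apply is_series_ge_single with (j := j) in S1.
    - replace (x j - (x j - t)) with t in S1 by ring.
      assert (q <= a j / t).
      { apply Rmult_le_reg_r with t; auto. unfold Rdiv. rewrite Rmult_assoc, Rinv_l, Rmult_1_r by lra.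
        apply Rmult_le_compat_l with (r := q) in tq; [|lra]. replace (q * (a j / q)) with (a j) in tq by (field; lra). auto. }
      assert (0 < / h * a j) by (apply Rmult_lt_0_compat; auto; apply Rinv_0_lt_compat; auto).
      unfold q, Rdiv in *. lra.
    - intros k Hk. destruct (le_lt_dec k j) as [Q|Q].
      + assert (x j <= x k) by (apply xdec_le; auto).
        apply Rplus_le_le_0_compat; [apply Rlt_le, Rdiv_lt_0_compat; auto; lra|].
        apply Rmult_le_pos; [apply Rlt_le, Rinv_0_lt_compat; auto | apply Rlt_le; auto].
      + apply xdec_le in Q. 
        assert (U : Rabs (a k / (x k - (x j - t))) <= / h * a k).
        { apply sec_term_le; auto. rewrite Rabs_left; unfold h in *; lra. }
        apply Rabs_le_between in U. lra. }
  assert (Hlo : exists l, x (S j) < l < m /\ sec l < 1).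
  { set (q := A / h). assert (q0 : 0 <= q) by (apply Rmult_le_pos; auto; apply Rlt_le, Rinv_0_lt_compat; auto).
    set (t := Rmin (h / 2) (a (S j) / (q + 1))).
    assert (t0 : 0 < t) by (apply Rmin_glb_lt; [lra | apply Rdiv_lt_0_compat; auto; lra]).
    assert (th : t <= h / 2) by apply Rmin_l. assert (tq : t <= a (S j) / (q + 1)) by apply Rmin_r.
    exists (x (S j) + t). assert (Gr : gap j (x (S j) + t)) by (unfold gap, h in *; lra).
    split; [unfold m, h in *; lra|].
    pose proof (sec_ex j _ Gr) as E.
    assert (S1 : is_series (fun k => a k / (x k - (x (S j) + t)) + - / h * a k) (sec (x (S j) + t) + - / h * A)).
    { apply is_series_plus_R; [apply Series_correct; auto | apply is_series_scal_R, Series_correct; auto]. }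
    apply is_series_le_single with (j := S j) in S1.
    - replace (x (S j) - (x (S j) + t)) with (- t) in S1 by ring.
      assert (q + 1 <= a (S j) / t).
      { apply Rmult_le_reg_r with t; auto. unfold Rdiv. rewrite Rmult_assoc, Rinv_l, Rmult_1_r by lra.
        apply Rmult_le_compat_l with (r := q + 1) in tq; [|lra]. replace ((q + 1) * (a (S j) / (q + 1))) with (a (S j)) in tq by (field; lra). auto. }
      assert (0 < / h * a (S j)) by (apply Rmult_lt_0_compat; auto; apply Rinv_0_lt_compat; auto).
      replace (a (S j) / - t) with (- (a (S j) / t)) in S1 by (field; lra).
      unfold q, Rdiv in *. lra.
    - intros k Hk. destruct (le_lt_dec k j) as [Q|Q].
      + apply xdec_le in Q. 
        assert (U : Rabs (a k / (x k - (x (S j) + t))) <= / h * a k).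
        { apply sec_term_le; auto. rewrite Rabs_pos_eq; unfold h in *; lra. }
        apply Rabs_le_between in U. lra.
      + assert (x k <= x (S j)) by (apply xdec_le; lia).
        assert (0 < / h * a k) by (apply Rmult_lt_0_compat; auto; apply Rinv_0_lt_compat; auto).
        assert (0 < a k / (x (S j) + t - x k)) by (apply Rdiv_lt_0_compat; auto; lra).
        replace (a k / (x k - (x (S j) + t))) with (- (a k / (x (S j) + t - x k))) by (field; lra). lra. }
  destruct Hup as (r & Hr & Sr), Hlo as (l & Hl & Sl).
  destruct (Ranalysis5.IVT_interv (fun s => sec s - 1) l r) as (s & Hs & Zs); try lra.
  - intros t Ht. apply continuity_pt_minus; [|apply continuity_pt_const; intros ? ?; auto].
    apply (sec_cont j). unfold gap; lra.
  - assert (Gs : gap j s) by (unfold gap; lra).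
    exists s. split; auto. replace 1 with (sec s) by lra. apply Series_correct, (sec_ex j); auto.
Qed.

Lemma sec_root_unique j s t : gap j s -> gap j t ->
  is_series (fun k => a k / (x k - s)) 1 -> is_series (fun k => a k / (x k - t)) 1 -> s = t.
Proof.
  intros Gs Gt Ss St. apply is_series_unique in Ss. apply is_series_unique in St.
  fold (sec s) in Ss. fold (sec t) in St.
  destruct (Rtotal_order s t) as [L|[E|L]]; auto.
  - apply (sec_mono j s t) in L; auto. lra.
  - apply (sec_mono j t s) in L; auto. lra.
Qed.

Lemma gap_exists s : 0 < s -> s < x O -> (forall k, x k <> s) -> exists j, gap j s.
Proof.
  intros P L N. rewrite lim_eps in xlim. destruct (xlim s P) as [n Hn].
  specialize (Hn n (le_n n)). rewrite Rminus_0_r in Hn. apply Rabs_def2 in Hn. destruct Hn as [Hn _].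
  clear - Hn L N xdec. induction n as [|n IH]; [lra|].
  destruct (Rlt_le_dec (x n) s) as [Q|Q]; [apply IH; auto|].
  exists n. unfold gap. specialize (N n). lra.
Qed.

(** Above [x 0] every term of the series is negative, so the sum cannot be 1; below it, the points
    [x k] decrease to 0 and enclose [s] in a gap. *)
Lemma sec_root_gap s : 0 < s -> (forall k, x k <> s) ->
  is_series (fun k => a k / (x k - s)) 1 -> exists j, gap j s.
Proof.
  intros P N H. apply gap_exists; auto.
  destruct (Rlt_le_dec s (x O)) as [|Q]; auto. exfalso.
  apply is_series_le_single with (j := O) in H.
  - assert (0 < a O / (s - x O)) by (apply Rdiv_lt_0_compat; auto; specialize (N O); lra).
    replace (a O / (x O - s)) with (- (a O / (s - x O))) in H by (field; specialize (N O); lra). lra.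
  - intros k Hk. assert (x k <= x O) by (apply xdec_le; lia). specialize (N k).
    assert (0 < a k / (s - x k)) by (apply Rdiv_lt_0_compat; auto; lra).
    replace (a k / (x k - s)) with (- (a k / (s - x k))) by (field; lra). lra.
Qed.
End Secular.

(** * Finite products that determine the weights *)

Fixpoint Pf (z w : nat -> R) (M : nat) (t : R) : R :=
  match M with O => 1 | S m => Pf z w m t * ((t - z m) / (t - w m)) end.

Lemma Pf_pos z w M t : (forall i, (i < M)%nat -> 0 < (t - z i) / (t - w i)) -> 0 < Pf z w M t.
Proof. induction M as [|M IH]; intro H; simpl; [lra|]. apply Rmult_lt_0_compat; auto. Qed.

Lemma Pf_zero z w M t i : (i < M)%nat -> t = z i -> Pf z w M t = 0.
Proof.
  induction M as [|M IH]; intros L E; [lia|]. simpl.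
  destruct (Nat.eq_dec i M) as [->|]; [rewrite E; unfold Rdiv; ring|]. rewrite IH; [ring|lia|auto].
Qed.

Lemma ratio_pos_neg p q : p < 0 -> q < 0 -> 0 < p / q.
Proof. intros. replace (p / q) with (- p / - q) by (field; lra). apply Rdiv_lt_0_compat; lra. Qed.

Section Roots.
Variables x a : nat -> R.
Definition sroot r := (forall k, x k <> r) /\ is_series (fun k => a k / (x k - r)) 1.

(** Partial fractions: (x - z)/((x - w)(x - p)) = (1 + c)/(x - p) - c/(x - w) with c = (w - z)/(p -
    w). When [w] and [p] are both roots the two series equal 1, so inserting a factor leaves the
    value (1 + c) - c = 1. *)
Lemma Pf_root_series z w M : (forall i, sroot (w i)) -> (forall i j, (i < j)%nat -> w i <> w j) ->
  forall p, sroot p -> (forall i, (i < M)%nat -> w i <> p) ->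
  is_series (fun k => a k * Pf z w M (x k) / (x k - p)) 1.
Proof.
  intros W I. induction M as [|M IH]; intros p Hp D.
  - apply is_series_ext_R with (2 := proj2 Hp). intro k. simpl. f_equal; ring.
  - assert (A := IH p Hp (fun i Hi => D i (Nat.lt_trans _ _ _ Hi (Nat.lt_succ_diag_r M)))).
    assert (B := IH (w M) (W M) (fun i Hi => I i M Hi)).
    assert (Np : w M <> p) by (apply D; lia).
    set (c := (w M - z M) / (p - w M)).
    replace 1 with ((1 + c) * 1 + - c * 1) by ring.
    apply is_series_ext_R with (fun k => (1 + c) * (a k * Pf z w M (x k) / (x k - p)) + - c * (a k * Pf z w M (x k) / (x k - w M))).
    + intro k. pose proof (proj1 Hp k). pose proof (proj1 (W M) k). simpl. unfold c. field. lra.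
    + apply is_series_plus_R; apply is_series_scal_R; auto.
Qed.

(** Here (x - z)/(x - w) = 1 + (w - z)/(x - w): each factor adds (w - z) times a series equal to 1
    by [Pf_root_series]. *)
Lemma Pf_series z w A : (forall i, sroot (w i)) -> (forall i j, (i < j)%nat -> w i <> w j) -> is_series a A ->
  forall M, is_series (fun k => a k * Pf z w M (x k)) (A + psum (fun i => w i - z i) M).
Proof.
  intros W I HA. induction M as [|M IH].
  - simpl. rewrite Rplus_0_r. apply is_series_ext_R with (2 := HA). intro; ring.
  - assert (B := Pf_root_series z w M W I (w M) (W M) (fun i Hi => I i M Hi)).
    simpl psum. replace (A + (psum (fun i => w i - z i) M + (w M - z M)))
      with ((A + psum (fun i => w i - z i) M) + (w M - z M) * 1) by ring.
    apply is_series_ext_R with (fun k => a k * Pf z w M (x k) + (w M - z M) * (a k * Pf z w M (x k) / (x k - w M))).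
    + intro k. pose proof (proj1 (W M) k). simpl. field. lra.
    + apply is_series_plus_R; auto. apply is_series_scal_R; auto.
Qed.
End Roots.

Definition skip (j i : nat) : nat := if lt_dec i j then i else S i.

Lemma psum_skip x j M : (j <= M)%nat -> psum (fun i => x (skip j i)) M = psum x (S M) - x j.
Proof.
  intro L. induction L as [|M L IH].
  - simpl. rewrite (psum_ext _ x); [ring|]. intros k Hk. unfold skip. destruct lt_dec; [auto|lia].
  - change (psum (fun i => x (skip j i)) M + x (skip j M) = psum x (S M) + x (S M) - x j).
    rewrite IH. unfold skip. destruct lt_dec; [lia|]. ring.
Qed.

Section Bounds.
Variables x y a : nat -> R.
Variable A : R.
Hypothesis xy : forall j, y j < x j.
Hypothesis yx : forall j, x (S j) < y j.
Hypothesis apos : forall j, 0 < a j.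
Hypothesis roots : forall m, is_series (fun k => a k / (x k - y m)) 1.
Hypothesis HA : is_series a A.

Lemma inter_xdec j : x (S j) < x j.
Proof. pose proof (xy j). pose proof (yx j). lra. Qed.
Lemma inter_ydec j : y (S j) < y j.
Proof. pose proof (xy (S j)). pose proof (yx j). lra. Qed.
Lemma inter_lt_xy k m : (m < k)%nat -> x k < y m.
Proof. intro L. pose proof (xdec_le x inter_xdec (S m) k L). pose proof (yx m). lra. Qed.
Lemma inter_gt_xy k m : (k <= m)%nat -> y m < x k.
Proof. intro L. pose proof (xdec_le x inter_xdec k m L). pose proof (xy m). lra. Qed.
Lemma inter_neq k m : x k <> y m.
Proof. destruct (le_lt_dec k m) as [L|L]; [apply inter_gt_xy in L | apply inter_lt_xy in L]; lra. Qed.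
Lemma inter_roots m : sroot x a (y m).
Proof. split; [intro; apply inter_neq | auto]. Qed.
Lemma inter_yneq i j : (i < j)%nat -> y i <> y j.
Proof. intro L. pose proof (xdec_lt y inter_ydec i j L). lra. Qed.

(** [a j * qf j M] tends to [x j] as M grows, once [x] and [y] are summable with [A] the difference
    of their sums. *)
Definition qf j M := Pf (fun i => x (skip j i)) y M (x j).

Lemma qf_pos j M : 0 < qf j M.
Proof.
  apply Pf_pos. intros i _. unfold skip. destruct lt_dec as [L|L].
  - apply ratio_pos_neg; [pose proof (xdec_lt x inter_xdec i j L) | pose proof (inter_lt_xy j i L)]; lra.
  - apply Rdiv_lt_0_compat; [pose proof (xdec_lt x inter_xdec j (S i) ltac:(lia)) | pose proof (inter_gt_xy j i ltac:(lia))]; lra.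
Qed.

Lemma Pf_skip_poles j M t : (j <= M)%nat -> (forall m, t <> y m) ->
  Pf (fun i => x (skip j i)) (fun i => y (skip j i)) M t * (t - y M) = Pf (fun i => x (skip j i)) y M t * (t - y j).
Proof.
  intros L N. induction L as [|M L IH].
  - f_equal. assert (Q : forall m, (m <= j)%nat -> Pf (fun i => x (skip j i)) (fun i => y (skip j i)) m t = Pf (fun i => x (skip j i)) y m t).
    { induction m as [|m IHm]; intro Hm; simpl; auto. rewrite IHm by lia. unfold skip at 3.
      destruct lt_dec; [auto|lia]. }
    apply Q; lia.
  - simpl. replace (y (skip j M)) with (y (S M)) by (unfold skip; destruct lt_dec; [lia|auto]).
    pose proof (N M). pose proof (N (S M)).
    transitivity (Pf (fun i => x (skip j i)) (fun i => y (skip j i)) M t * (t - y M) * (t - x (skip j M)) / (t - y M)); [field; lra|].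
    rewrite IH. field. lra.
Qed.

(* Both estimates compare [a j] with a finite product, so that [a j] is determined by, and depends continuously on, [x] and [y]. *)
Lemma weight_bounds j M : (j <= M)%nat ->
  x j - y M <= a j * qf j M /\
  a j * qf j M <= x j + (A - (psum x (S M) - psum y M)).
Proof.
  intro L.
  (* The zeros of the product remove every term of index [k <= M] other than [j]; only [j] and the
     indices above [M] remain. *)
  assert (Z : forall k (w : nat -> R), k <> j -> (k <= M)%nat -> Pf (fun i => x (skip j i)) w M (x k) = 0).
  { intros k w N H. destruct (lt_dec k j) as [Q|Q].
    - apply Pf_zero with k; [lia|]. unfold skip. destruct lt_dec; [auto|lia].
    - apply Pf_zero with (pred k); [lia|]. unfold skip. destruct lt_dec; [lia|]. f_equal; lia. }
  assert (SM : forall i, (i < M)%nat -> (skip j i <= M)%nat) by (intros i Hi; unfold skip; destruct lt_dec; lia).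
  split.
  (* Lower bound: with the pole [y j] taken out of the product and used as the root, the terms
     beyond [M] are negative, so the term [j] is at least 1. *)
  - assert (S1 := Pf_root_series x a (fun i => x (skip j i)) (fun i => y (skip j i)) M
      (fun i => inter_roots _)).
    assert (I1 : forall i i' : nat, (i < i')%nat -> y (skip j i) <> y (skip j i')).
    { intros i i' H. apply inter_yneq. unfold skip. repeat destruct lt_dec; lia. }
    specialize (S1 I1 (y j) (inter_roots j)).
    assert (I2 : forall i, (i < M)%nat -> y (skip j i) <> y j).
    { intros i Hi. unfold skip. destruct lt_dec; [apply inter_yneq; auto | apply not_eq_sym, inter_yneq; lia]. }
    specialize (S1 I2). apply is_series_le_single with (j := j) in S1.
    + assert (E := Pf_skip_poles j M (x j) L (fun m => inter_neq j m)). fold (qf j M) in E.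
      pose proof (inter_gt_xy j j (le_n j)). pose proof (inter_gt_xy j M L).
      set (P := Pf _ _ M (x j)) in *.
      assert (P = qf j M * (x j - y j) / (x j - y M)) as E2 by (rewrite <- E; field; lra).
      rewrite E2 in S1. replace (a j * (qf j M * (x j - y j) / (x j - y M)) / (x j - y j)) with (a j * qf j M / (x j - y M)) in S1 by (field; lra).
      apply Rmult_le_compat_r with (r := x j - y M) in S1; [|lra].
      replace (a j * qf j M / (x j - y M) * (x j - y M)) with (a j * qf j M) in S1 by (field; lra). lra.
    + intros k Hk. destruct (le_lt_dec k M) as [Q|Q]; [rewrite (Z k _ Hk Q); unfold Rdiv; lra|].
      assert (0 < Pf (fun i => x (skip j i)) (fun i => y (skip j i)) M (x k)).
      { apply Pf_pos. intros i Hi. specialize (SM i Hi). apply ratio_pos_neg.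
        - pose proof (xdec_lt x inter_xdec (skip j i) k ltac:(lia)); lra.
        - pose proof (inter_lt_xy k (skip j i) ltac:(lia)); lra. }
      pose proof (inter_lt_xy k j ltac:(lia)). specialize (apos k).
      assert (0 < a k * Pf (fun i => x (skip j i)) (fun i => y (skip j i)) M (x k) / (y j - x k)) by (apply Rdiv_lt_0_compat; [apply Rmult_lt_0_compat; auto | lra]).
      replace (a k * Pf (fun i => x (skip j i)) (fun i => y (skip j i)) M (x k) / (x k - y j)) with
        (- (a k * Pf (fun i => x (skip j i)) (fun i => y (skip j i)) M (x k) / (y j - x k))) by (field; lra). lra.
  (* Upper bound: with the poles [y i], i < M, the terms beyond [M] are positive, so the term [j] is
     at most the sum computed in [Pf_series]. *)
  - assert (S1 := Pf_series x a (fun i => x (skip j i)) y A inter_roots inter_yneq HA M).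
    apply is_series_ge_single with (j := j) in S1.
    + fold (qf j M) in S1. rewrite psum_minus, psum_skip in S1 by auto. lra.
    + intros k Hk. destruct (le_lt_dec k M) as [Q|Q]; [rewrite (Z k _ Hk Q); lra|].
      apply Rlt_le, Rmult_lt_0_compat; auto. apply Pf_pos. intros i Hi. specialize (SM i Hi). apply ratio_pos_neg.
      * pose proof (xdec_lt x inter_xdec (skip j i) k ltac:(lia)); lra.
      * pose proof (inter_lt_xy k i ltac:(lia)); lra.
Qed.
End Bounds.

Lemma Pf_lim (z w : nat -> nat -> R) (z0 w0 : nat -> R) (t : nat -> R) (t0 : R) M :
  (forall i, is_lim_seq (fun N => z N i) (z0 i)) -> (forall i, is_lim_seq (fun N => w N i) (w0 i)) ->
  is_lim_seq t t0 -> (forall i, t0 <> w0 i) ->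
  is_lim_seq (fun N => Pf (z N) (w N) M (t N)) (Pf z0 w0 M t0).
Proof.
  intros Z W T D. induction M as [|M IH]; simpl; [apply is_lim_seq_const|].
  apply is_lim_seq_mult'; auto. apply is_lim_seq_div'; [| |apply Rminus_eq_contra, D]; apply is_lim_seq_minus'; auto.
Qed.

Lemma is_lim_seq_unit_squeeze (u : nat -> R) (u0 : R) (L U : nat -> nat -> R) (L0 U0 : nat -> R) :
  (forall M N, L M N <= u N <= U M N) -> (forall M, L0 M <= u0 <= U0 M) ->
  (forall M, is_lim_seq (L M) (L0 M)) -> (forall M, is_lim_seq (U M) (U0 M)) ->
  is_lim_seq (fun M => U0 M - L0 M) 0 -> is_lim_seq u u0.
Proof.
  intros B B0 HL HU D. apply lim_eps. intros eps he.
  destruct (proj1 (lim_eps _ _) D (eps / 2)) as [M HM]; [lra|].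
  specialize (HM M (le_n M)). rewrite Rminus_0_r in HM. apply Rabs_def2 in HM.
  destruct (proj1 (lim_eps _ _) (HL M) (eps / 2)) as [N1 H1]; [lra|].
  destruct (proj1 (lim_eps _ _) (HU M) (eps / 2)) as [N2 H2]; [lra|].
  exists (N1 + N2)%nat. intros N HN. specialize (H1 N ltac:(lia)). specialize (H2 N ltac:(lia)).
  specialize (B M N). specialize (B0 M). apply Rabs_def2 in H1. apply Rabs_def2 in H2. apply Rabs_def1; lra.
Qed.

Record weights (x y a : nat -> R) : Prop := {
  wt_xy : forall j, y j < x j;
  wt_yx : forall j, x (S j) < y j;
  wt_xpos : forall j, 0 < x j;
  wt_xex : ex_series x;
  wt_yex : ex_series y;
  wt_apos : forall j, 0 < a j;
  wt_root : forall m, is_series (fun k => a k / (x k - y m)) 1;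
  wt_sum : is_series a (Series x - Series y) }.

Lemma ex_series_lim0 x : ex_series x -> is_lim_seq x 0.
Proof. apply ex_series_lim_0. Qed.

(** For fixed [M] the two bounds of [weight_bounds] are finite expressions in [x N], [y N] and their
    sums, so they converge with N; the bounds for the limit close up as M grows, by summability. The
    index [M + j] guarantees that it is at least [j]. *)
Lemma weights_lim (x y a : nat -> nat -> R) (x0 y0 a0 : nat -> R) :
  (forall N, weights (x N) (y N) (a N)) -> weights x0 y0 a0 ->
  (forall j, is_lim_seq (fun N => x N j) (x0 j)) -> (forall j, is_lim_seq (fun N => y N j) (y0 j)) ->
  is_lim_seq (fun N => Series (x N)) (Series x0) -> is_lim_seq (fun N => Series (y N)) (Series y0) ->
  forall j, is_lim_seq (fun N => a N j) (a0 j).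
Proof.
  intros W W0 X Y SX SY j.
  assert (qp : forall N M, 0 < qf (x N) (y N) j M) by (intros; apply qf_pos; apply W).
  assert (qp0 : forall M, 0 < qf x0 y0 j M) by (intros; apply qf_pos; apply W0).
  assert (bnd : forall x y a, weights x y a -> forall M,
    (x j - y (M + j)%nat) / qf x y j (M + j) <= a j <=
    (x j + (Series x - Series y - (psum x (S (M + j)) - psum y (M + j)))) / qf x y j (M + j)).
  { intros x' y' a' W' M.
    destruct (weight_bounds x' y' a' _ (wt_xy _ _ _ W') (wt_yx _ _ _ W') (wt_apos _ _ _ W') (wt_root _ _ _ W') (wt_sum _ _ _ W') j (M + j)%nat) as [A B]; [lia|].
    pose proof (qf_pos x' y' (wt_xy _ _ _ W') (wt_yx _ _ _ W') j (M + j)).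
    split; apply Rmult_le_reg_r with (qf x' y' j (M + j)); auto; unfold Rdiv; rewrite Rmult_assoc, Rinv_l; lra. }
  assert (ql : forall M, is_lim_seq (fun N => qf (x N) (y N) j M) (qf x0 y0 j M)).
  { intro M. unfold qf. apply Pf_lim; auto. intro i.
    apply inter_neq; apply W0. }
  apply is_lim_seq_unit_squeeze with
    (L := fun M N => (x N j - y N (M + j)%nat) / qf (x N) (y N) j (M + j))
    (U := fun M N => (x N j + (Series (x N) - Series (y N) - (psum (x N) (S (M + j)) - psum (y N) (M + j)))) / qf (x N) (y N) j (M + j))
    (L0 := fun M => (x0 j - y0 (M + j)%nat) / qf x0 y0 j (M + j))
    (U0 := fun M => (x0 j + (Series x0 - Series y0 - (psum x0 (S (M + j)) - psum y0 (M + j)))) / qf x0 y0 j (M + j)).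
  - intros M N. apply bnd. apply W.
  - intro M. apply bnd; auto.
  - intro M. apply is_lim_seq_div'; auto; [|specialize (qp0 (M + j)%nat); lra]. apply is_lim_seq_minus'; auto.
  - intro M. apply is_lim_seq_div'; auto; [|specialize (qp0 (M + j)%nat); lra].
    apply is_lim_seq_plus'; auto. apply is_lim_seq_minus'; [apply is_lim_seq_minus'; auto|].
    apply is_lim_seq_minus'; apply is_lim_seq_psum; auto.
  (* [D M] is the numerator of the gap between the bounds. The inverse of the product is at most
     [c], since [a0 j] times the product is at least [x0 j - y0 (M + j)], hence at least
     [x0 j - y0 j]. *)
  - set (D := fun M => (Series x0 - Series y0 - (psum x0 (S (M + j)) - psum y0 (M + j))) + y0 (M + j)%nat).
    set (c := a0 j / (x0 j - y0 j)).
    assert (c0 : 0 < c) by (apply Rdiv_lt_0_compat; [apply W0 | pose proof (wt_xy _ _ _ W0 j); lra]).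
    assert (Dl : is_lim_seq D 0).
    { replace (Finite 0) with (Finite ((Series x0 - Series y0 - (Series x0 - Series y0)) + 0)) by (f_equal; ring).
      assert (sh : forall u (l : Rbar), is_lim_seq u l -> is_lim_seq (fun M => u (M + j)%nat) l).
      { intros u l. apply lim_subseq. intro; lia. }
      apply is_lim_seq_plus'.
      - apply is_lim_seq_minus'; [apply is_lim_seq_const|]. apply is_lim_seq_minus'.
        + apply (lim_subseq (psum x0) _ (fun M => S (M + j))); [intro; lia|]. apply is_series_psum, Series_correct, W0.
        + apply (sh (psum y0)), is_series_psum, Series_correct, W0.
      - apply (sh y0), ex_series_lim0, W0. }
    apply lim0_le with (fun M => c * D M); [|apply lim_scal0; auto].
    intro M. destruct (weight_bounds x0 y0 a0 _ (wt_xy _ _ _ W0) (wt_yx _ _ _ W0) (wt_apos _ _ _ W0) (wt_root _ _ _ W0) (wt_sum _ _ _ W0) j (M + j)%nat) as [A B]; [lia|].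
    specialize (qp0 (M + j)%nat). set (q := qf x0 y0 j (M + j)) in *.
    replace ((x0 j + (Series x0 - Series y0 - (psum x0 (S (M + j)) - psum y0 (M + j)))) / q - (x0 j - y0 (M + j)%nat) / q)
      with (D M / q) by (unfold D; field; lra).
    assert (D0 : 0 <= D M) by (unfold D; lra).
    split; [apply Rmult_le_pos; auto; apply Rlt_le, Rinv_0_lt_compat; auto|].
    unfold Rdiv. rewrite Rmult_comm. apply Rmult_le_compat_r; auto.
    apply Rmult_le_reg_r with q; auto. rewrite Rinv_l by lra. unfold c.
    pose proof (xdec_le y0 (inter_ydec x0 y0 (wt_xy _ _ _ W0) (wt_yx _ _ _ W0)) j (M + j) ltac:(lia)).
    pose proof (wt_xy _ _ _ W0 j).
    apply Rmult_le_reg_r with (x0 j - y0 j); [lra|].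
    replace (a0 j / (x0 j - y0 j) * q * (x0 j - y0 j)) with (a0 j * q) by (field; lra). lra.
Qed.

(** * Existence of the weights *)

Section WeightsExist.
Variables x y : nat -> R.
Hypothesis xy : forall j, y j < x j.
Hypothesis yx : forall j, x (S j) < y j.
Hypothesis xpos : forall j, 0 < x j.
Hypothesis xex : ex_series x.

(* Residues of the partial fraction expansion of the product of the (s - y i) / (s - x i), i < N. *)
Fixpoint aN (N j : nat) : R :=
  match N with
  | O => 0
  | S n => if lt_dec j n then aN n j * ((x j - y n) / (x j - x n))
           else if Nat.eq_dec j n then (x n - y n) * Pf y x n (x n) else 0
  end.

Let xdec := inter_xdec x y xy yx.

Lemma x_neq i j : i <> j -> x i <> x j.
Proof.
  intro N. destruct (lt_dec i j) as [L|L]; [pose proof (xdec_lt x xdec i j L) | pose proof (xdec_lt x xdec j i ltac:(lia))]; lra.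
Qed.

Lemma ypos j : 0 < y j.
Proof. pose proof (yx j). pose proof (xpos (S j)). lra. Qed.

Lemma aN_out N j : (N <= j)%nat -> aN N j = 0.
Proof. destruct N as [|n]; intro L; simpl; auto. destruct lt_dec; [lia|]. destruct Nat.eq_dec; [lia|auto]. Qed.

Lemma aN_diag n : aN (S n) n = (x n - y n) * Pf y x n (x n).
Proof. simpl. destruct lt_dec; [lia|]. destruct Nat.eq_dec; [auto|lia]. Qed.

Lemma Pf_yx_pos n : 0 < Pf y x n (x n).
Proof.
  apply Pf_pos. intros i Hi. apply ratio_pos_neg.
  - pose proof (inter_lt_xy x y xy yx n i Hi). lra.
  - pose proof (xdec_lt x xdec i n Hi). lra.
Qed.

Lemma aN_factor n j : (j < n)%nat -> 1 <= (x j - y n) / (x j - x n).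
Proof.
  intro L. pose proof (xdec_lt x xdec j n L). pose proof (xy n).
  replace ((x j - y n) / (x j - x n)) with (1 + (x n - y n) / (x j - x n)) by (field; lra).
  assert (0 < (x n - y n) / (x j - x n)) by (apply Rdiv_lt_0_compat; lra). lra.
Qed.

Lemma aN_pos N j : (j < N)%nat -> 0 < aN N j.
Proof.
  induction N as [|n IH]; intro L; [lia|]. simpl. destruct lt_dec as [Q|Q].
  - apply Rmult_lt_0_compat; auto. pose proof (aN_factor n j Q). lra.
  - destruct Nat.eq_dec; [|lia]. apply Rmult_lt_0_compat; [pose proof (xy n); lra | apply Pf_yx_pos].
Qed.

Lemma aN_ge0 N j : 0 <= aN N j.
Proof. destruct (lt_dec j N); [apply Rlt_le, aN_pos; auto | rewrite aN_out by lia; lra]. Qed.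

Lemma aN_incr N j : aN N j <= aN (S N) j.
Proof.
  destruct (lt_dec j N) as [L|L]; [|rewrite (aN_out N j) by lia; apply aN_ge0].
  simpl. destruct lt_dec; [|lia]. pose proof (aN_pos N j L). pose proof (aN_factor N j L). nra.
Qed.

(** The new pole [x n] has the residue [x n - y n] times the old product at [x n], and each old
    residue is multiplied by the new factor at its pole: these are the two clauses of [aN]. *)
Lemma aN_expand N s : (forall i, (i < N)%nat -> s <> x i) ->
  Pf y x N s = 1 + psum (fun j => aN N j / (s - x j)) N.
Proof.
  revert s; induction N as [|n IH]; intros s D; [simpl; ring|].
  assert (Ds : s <> x n) by (apply D; lia).
  assert (E : psum (fun j => aN (S n) j / (s - x j)) n =
     psum (fun j => (s - y n) / (s - x n) * (aN n j / (s - x j)) + (x n - y n) / (s - x n) * (- (aN n j / (x n - x j)))) n).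
  { apply psum_ext. intros k Hk. simpl. destruct lt_dec; [|lia].
    assert (s <> x k) by (apply D; lia). pose proof (x_neq k n ltac:(lia)). field. lra. }
  cbn [psum]. rewrite E, psum_plus, !psum_scal.
  cbn [Pf]. rewrite IH by (intros; apply D; lia).
  rewrite aN_diag.
  rewrite IH by (intros i Hi; apply x_neq; lia).
  rewrite (psum_ext (fun k => - (aN n k / (x n - x k))) (fun k => (-1) * (aN n k / (x n - x k)))) by (intros; ring).
  rewrite psum_scal. field. lra.
Qed.

Lemma aN_sum N : psum (aN N) N = psum (fun j => x j - y j) N.
Proof.
  induction N as [|n IH]; [auto|].
  assert (E : psum (aN (S n)) n = psum (fun j => aN n j + (x n - y n) * (- (aN n j / (x n - x j)))) n).
  { apply psum_ext. intros k Hk. simpl. destruct lt_dec; [|lia].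
    pose proof (x_neq k n ltac:(lia)). field. lra. }
  cbn [psum]. rewrite E, psum_plus, psum_scal, IH.
  rewrite aN_diag.
  rewrite aN_expand by (intros i Hi; apply x_neq; lia).
  rewrite (psum_ext (fun k => - (aN n k / (x n - x k))) (fun k => (-1) * (aN n k / (x n - x k)))) by (intros; ring).
  rewrite psum_scal. ring.
Qed.

(** The residues increase with N and are bounded through [aN_sum], so they have limits. The
    expansion at [y m], where the product vanishes, gives the secular equations by dominated
    convergence; at 0, where the product is positive, it gives the last bound, on which the
    positivity of the reconstructed operator rests. *)
Lemma weights_exist : exists a, (forall j, 0 < a j) /\ ex_series a /\
  (forall m, is_series (fun k => a k / (x k - y m)) 1) /\
  (ex_series (fun k => a k / x k) /\ Series (fun k => a k / x k) <= 1).
Proof.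
  set (X := Series x).
  assert (Bs : forall N m, psum (aN N) m <= X).
  { intros N m. apply Rle_trans with (psum (aN N) N).
    - destruct (le_lt_dec m N) as [L|L]; [apply psum_le_n; auto; apply aN_ge0|].
      clear - L. induction L as [|m L IH]; cbn [psum]; rewrite aN_out by lia; lra.
    - rewrite aN_sum. eapply Rle_trans; [|apply (psum_le_Series x N); auto].
      + apply psum_le. intros k _. pose proof (ypos k). lra.
      + intro; apply Rlt_le; auto. }
  assert (Bt : forall N j, aN N j <= X).
  { intros N j. eapply Rle_trans; [|apply (Bs N (S j))]. simpl.
    assert (0 <= psum (aN N) j) by (apply psum_pos; intros; apply aN_ge0). lra. }
  assert (Lj : forall j, ex_finite_lim_seq (fun N => aN N j)).
  { intro j. apply ex_finite_lim_seq_incr with X; auto. intro; apply aN_incr. }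
  set (a := fun j => real (Lim_seq (fun N => aN N j))).
  assert (La : forall j, is_lim_seq (fun N => aN N j) (a j)) by (intro j; apply Lim_seq_correct', Lj).
  assert (Le : forall N j, aN N j <= a j).
  { intros N j. apply (is_lim_seq_incr_compare (fun N => aN N j)); auto. intro; apply aN_incr. }
  assert (apos : forall j, 0 < a j).
  { intro j. eapply Rlt_le_trans; [apply (aN_pos (S j) j); lia | apply Le]. }
  assert (aex : ex_series a).
  { apply (ex_series_bdd a X); [intro; apply Rlt_le; auto|]. intro m.
    apply (is_lim_seq_le (fun N => psum (aN N) m) (fun _ => X) (psum a m) X); [intro; apply Bs | | apply is_lim_seq_const].
    apply is_lim_seq_psum; auto. }
  exists a. split; auto. split; auto. split.
  - intro m.
    destruct (gap_dist x xdec m (y m)) as (d & D & Hd); [split; auto|].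
    destruct (dominated_series (fun N k => aN N k / (x k - y m)) (fun _ k => / d * a k) (fun k => a k / (x k - y m)) (fun k => / d * a k)) as [E L].
    + intro k. apply is_lim_seq_div'; auto; [apply is_lim_seq_const|].
      apply Rminus_eq_contra, (inter_neq x y xy yx).
    + intro; apply is_lim_seq_const.
    + intros N k. unfold Rdiv. rewrite Rabs_mult, Rabs_inv, (Rabs_pos_eq (aN N k)) by apply aN_ge0.
      rewrite Rmult_comm. specialize (Hd k). apply Rmult_le_compat; try apply aN_ge0; auto.
      * apply Rlt_le, Rinv_0_lt_compat; lra.
      * apply Rinv_le_contravar; auto.
    + intro; apply ex_series_scal_R; auto.
    + apply ex_series_scal_R; auto.
    + apply is_lim_seq_const.
    + replace 1 with (Series (fun k => a k / (x k - y m))); [apply Series_correct; auto|].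
      assert (L1 : is_lim_seq (fun N => Series (fun k => aN N k / (x k - y m))) 1).
      (* For [N > m] the factor of index [m] vanishes at [y m], and the terms of index at least [N]
         are 0, so the sum is exactly 1. *)
      { apply is_lim_seq_ext_loc with (fun _ => 1); [|apply is_lim_seq_const].
        exists (S m). intros N HN. symmetry. apply is_series_unique, is_series_psum.
        apply is_lim_seq_ext_loc with (fun _ => 1); [|apply is_lim_seq_const].
        exists N. intros n Hn.
        assert (E1 : psum (fun k => aN N k / (x k - y m)) N = 1).
        { pose proof (aN_expand N (y m) (fun i _ => not_eq_sym (inter_neq x y xy yx i m))) as Q.
          rewrite (Pf_zero y x N (y m) m) in Q by (auto; lia).
          rewrite (psum_ext _ (fun j => (-1) * (aN N j / (y m - x j)))), psum_scal; [lra|].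
          intros k Hk. pose proof (inter_neq x y xy yx k m). field. lra. }
        rewrite <- E1. clear - Hn. induction Hn as [|n Hn IH]; auto. simpl. rewrite <- IH, (aN_out N n) by auto.
        unfold Rdiv; ring. }
      apply is_lim_seq_unique in L. apply is_lim_seq_unique in L1. rewrite L in L1. injection L1; auto.
  - apply ex_series_bdd.
    + intro; apply Rlt_le, Rdiv_lt_0_compat; auto.
    + intro m. apply (is_lim_seq_le_loc (fun N => psum (fun k => aN N k / x k) m) (fun _ => 1) (psum (fun k => a k / x k) m) 1); [ | | apply is_lim_seq_const].
      * exists m. intros N HN. apply Rle_trans with (psum (fun k => aN N k / x k) N).
        { apply psum_le_n; auto. intro; apply Rmult_le_pos; [apply aN_ge0 | apply Rlt_le, Rinv_0_lt_compat; auto]. }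
        assert (Q := aN_expand N 0 (fun i _ => Rlt_not_eq _ _ (xpos i))).
        assert (0 < Pf y x N 0).
        { apply Pf_pos. intros i _. apply ratio_pos_neg; [pose proof (ypos i) | pose proof (xpos i)]; lra. }
        rewrite (psum_ext (fun j => aN N j / (0 - x j)) (fun j => (-1) * (aN N j / x j))), psum_scal in Q; [lra|].
        intros k _. pose proof (xpos k). field. lra.
      * apply is_lim_seq_psum. intro k. apply is_lim_seq_div'; auto; [apply is_lim_seq_const | pose proof (xpos k); lra].
Qed.
End WeightsExist.

(** If the sequences agree before n, then [f n] is some [g j] with j >= n, whence [f n <= g n];
    equality follows by symmetry. *)
Lemma decreasing_enum_unique (f g : nat -> R) :
  (forall n, f (S n) < f n) -> (forall n, g (S n) < g n) ->
  (forall i, exists j, f i = g j) -> (forall j, exists i, g j = f i) -> forall n, f n = g n.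
Proof.
  intros Df Dg Hf Hg n.
  assert (main : forall f g : nat -> R, (forall n, f (S n) < f n) -> (forall n, g (S n) < g n) ->
    (forall i, exists j, f i = g j) -> forall n, (forall k, (k < n)%nat -> f k = g k) -> f n <= g n).
  { clear. intros f g Df Dg Hf n IH. destruct (Hf n) as [j Hj]. rewrite Hj.
    apply xdec_le; auto. destruct (le_lt_dec n j) as [|L]; auto. exfalso.
    rewrite <- (IH j L) in Hj. pose proof (xdec_lt f Df j n L). lra. }
  induction n as [n IH] using lt_wf_ind.
  apply Rle_antisym; apply main; auto. intros k Hk; symmetry; auto.
Qed.

(** * Antilinear spectral decomposition of a Hankel operator *)

Ltac vec := apply l2_ext; intro; repeat rewrite ?ladd_k, ?lsub_k, ?lscal_k, ?lzero_k; try ring.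

Lemma lscal_lscal c d x : lscal c (lscal d x) = lscal (c * d)%C x.
Proof. vec. Qed.

Lemma lscal_1 x : lscal (RtoC 1) x = x.
Proof. vec. Qed.

Lemma lscal_0 x : lscal (RtoC 0) x = lzero.
Proof. vec. Qed.

Lemma RtoC_neq r : r <> 0 -> RtoC r <> RtoC 0.
Proof. intros H E. apply H. apply (f_equal fst) in E. exact E. Qed.

Lemma lscal_inj c x y : c <> RtoC 0 -> lscal c x = lscal c y -> x = y.
Proof.
  intros H E. rewrite <- (lscal_1 x), <- (lscal_1 y), <- (Cinv_l c H), <- !lscal_lscal, E; auto.
Qed.

Lemma Cmult_neq0_reg (c d z : C) : z <> RtoC 0 -> (c * z = d * z)%C -> c = d.
Proof.
  intros H E. replace c with (c * z * / z)%C by (field; auto). rewrite E. field; auto.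
Qed.

Lemma Cmult_eq0 (a b : C) : (a * b = RtoC 0)%C -> a <> RtoC 0 -> b = RtoC 0.
Proof. intros E H. replace b with (/ a * (a * b))%C by (field; auto). rewrite E. ring. Qed.

Lemma hank_sqr_sym u x y : ip (hank u (hank u x)) y = ip x (hank u (hank u y)).
Proof. rewrite hank_sqr_ip, (ip_conj _ x), hank_sqr_ip, <- ip_conj; auto. Qed.

Lemma hank_zero u : hank u lzero = lzero.
Proof. rewrite <- (lscal_0 lzero), hank_scal, Cconj_R, !lscal_0; auto. Qed.

(** For an antilinear operator, replacing a unit eigenvector by k times it, |k| = 1, multiplies its
    eigenvalue by conj(k)^2. So [c j] is complex, and only its modulus is intrinsic until the phase
    of [e j] is fixed. *)
Record SD (u : h12) (c : nat -> C) (e : nat -> l2) : Prop := {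
  sd_pos : forall j, 0 < Cnorm2 (c j);
  sd_dec : forall j, Cnorm2 (c (S j)) < Cnorm2 (c j);
  sd_eig : forall j, hank u (e j) = lscal (c j) (e j);
  sd_nrm : forall j, n2 (e j) = 1;
  sd_cpl : forall x, (forall j, ip x (e j) = RtoC 0) -> hank u x = lzero }.

Section SDfacts.
Variables (u : h12) (c : nat -> C) (e : nat -> l2).
Hypothesis D : SD u c e.

Lemma sd_sqr j : hank u (hank u (e j)) = lscal (RtoC (Cnorm2 (c j))) (e j).
Proof.
  rewrite (sd_eig _ _ _ D), hank_scal, (sd_eig _ _ _ D), lscal_lscal, <- Cmult_conj_norm2. f_equal. ring.
Qed.

Lemma sd_neq i j : i <> j -> Cnorm2 (c i) <> Cnorm2 (c j).
Proof.
  intro N. pose proof (xdec_lt (fun j => Cnorm2 (c j)) (sd_dec _ _ _ D)) as L. simpl in L.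
  destruct (lt_dec i j) as [Q|Q]; [specialize (L i j Q) | specialize (L j i ltac:(lia))]; lra.
Qed.

Lemma ip_eig_coord s h j : hank u (hank u h) = lscal (RtoC s) h -> s <> Cnorm2 (c j) -> ip h (e j) = RtoC 0.
Proof.
  intros H N. pose proof (hank_sqr_sym u h (e j)) as E.
  rewrite H, sd_sqr, ip_scal_l, ip_scal_r, Cconj_R in E.
  apply NNPP. intro Z. apply N. apply (Cmult_neq0_reg _ _ _ Z) in E. apply (f_equal fst) in E. exact E.
Qed.

Lemma sd_on : on e.
Proof.
  intros i j. destruct Nat.eq_dec as [->|N].
  - rewrite ip_self, (sd_nrm _ _ _ D); auto.
  - apply ip_eig_coord with (Cnorm2 (c i)); [apply sd_sqr | apply sd_neq; auto].
Qed.

(** An eigenvector is orthogonal to every [e j] with a different eigenvalue; were all of them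
    different, completeness would put it in the kernel. What remains after projection on [e j] is in
    the kernel for the same reason and in the eigenspace, so it is 0. *)
Lemma sd_eigvec s h : 0 < s -> hank u (hank u h) = lscal (RtoC s) h -> h <> lzero ->
  exists j, s = Cnorm2 (c j) /\ h = lscal (ip h (e j)) (e j).
Proof.
  intros Hs H N.
  assert (Hj : exists j, s = Cnorm2 (c j)).
  { apply NNPP. intro Q. apply N. apply (lscal_inj (RtoC s)); [apply RtoC_neq; lra|].
    rewrite <- H, (sd_cpl _ _ _ D h), hank_zero; [vec|].
    intro j. apply ip_eig_coord with s; auto. intro; apply Q; eauto. }
  destruct Hj as [j Hj]. exists j. split; auto.
  assert (Z : hank u (lsub h (lscal (ip h (e j)) (e j))) = lzero).
  { apply (sd_cpl _ _ _ D). intro i. rewrite ip_sub_l, ip_scal_l, sd_on. destruct Nat.eq_dec as [->|Q]; [ring|].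
    rewrite (ip_eig_coord s h i); auto; [ring|]. rewrite Hj. apply sd_neq; auto. }
  apply (f_equal (hank u)) in Z. rewrite !hank_sub, !hank_scal, hank_zero, H, sd_sqr, <- Hj, Cconj_conj in Z.
  apply lsub_eq0 in Z. apply (lscal_inj (RtoC s)); [apply RtoC_neq; lra|].
  rewrite Z, !lscal_lscal. f_equal. ring.
Qed.

Lemma sd_span x : inspan e (hank u x).
Proof. intros r Hr. rewrite hank_sym, (sd_cpl _ _ _ D r Hr). apply ip_zero_l. Qed.

Lemma sd_coord x j : ip (hank u x) (e j) = (c j * Cconj (ip x (e j)))%C.
Proof. rewrite hank_sym, (sd_eig _ _ _ D), ip_scal_l, <- ip_conj; auto. Qed.

Lemma sd_hank_n2 x : is_series (fun j => Cnorm2 (c j) * Cnorm2 (ip x (e j))) (n2 (hank u x)).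
Proof.
  rewrite (parseval_n2 e sd_on _ (sd_span x)), n2_Series.
  rewrite (Series_ext _ (fun j => Cnorm2 (c j) * Cnorm2 (ip x (e j)))).
  - apply Series_correct. apply ex_series_ext with (2 := l2_ex (coords e sd_on (hank u x))).
    intro j. rewrite coords_k, sd_coord, Cnorm2_mult, Cnorm2_conj; auto.
  - intro j. rewrite coords_k, sd_coord, Cnorm2_mult, Cnorm2_conj; auto.
Qed.

(** The squared Hilbert-Schmidt norm computed twice: by the columns [hank u (ldelta n)], whose
    squared norms are those of the tails, and along the orthonormal system [e]. *)
Lemma sd_trace : is_series (fun j => Cnorm2 (c j)) (hs u).
Proof.
  destruct (tonelli (fun n j => Cnorm2 (c j) * Cnorm2 (e j n)) (fun n => n2 (shn n u)) (hs u)) as [A B].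
  - intros; apply Rmult_le_pos; apply Cnorm2_ge0.
  - intro n. rewrite <- hank_delta. apply is_series_ext_R with (2 := sd_hank_n2 (ldelta n)).
    intro j. rewrite ip_delta_l, Cnorm2_conj; auto.
  - rewrite <- (proj2 (sum_tails u)). apply Series_correct, sum_tails.
  - apply is_series_ext_R with (2 := B). intro j. rewrite Series_scal_l, <- n2_Series, (sd_nrm _ _ _ D). ring.
Qed.

Lemma sd_rephase (k : nat -> C) : (forall j, Cnorm2 (k j) = 1) ->
  SD u (fun j => Cconj (k j) * Cconj (k j) * c j)%C (fun j => lscal (k j) (e j)).
Proof.
  intro K.
  assert (N : forall j, Cnorm2 (Cconj (k j) * Cconj (k j) * c j)%C = Cnorm2 (c j)).
  { intro j. rewrite !Cnorm2_mult, !Cnorm2_conj, !K. ring. }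
  assert (KK : forall j, (Cconj (k j) * k j)%C = RtoC 1).
  { intro j. rewrite Cmult_comm, Cmult_conj_norm2, K; auto. }
  split.
  - intro j. rewrite N. apply D.
  - intro j. rewrite !N. apply D.
  - intro j. rewrite hank_scal, (sd_eig _ _ _ D), !lscal_lscal. f_equal.
    replace (Cconj (k j) * Cconj (k j) * c j * k j)%C with (Cconj (k j) * k j * Cconj (k j) * c j)%C by ring. rewrite KK. ring.
  - intro j. rewrite n2_scal, K, (sd_nrm _ _ _ D). ring.
  - intros x H. apply (sd_cpl _ _ _ D). intro j. specialize (H j). rewrite ip_scal_r in H.
    replace (ip x (e j)) with (Cconj (k j) * k j * ip x (e j))%C by (rewrite KK; ring).
    replace (Cconj (k j) * k j * ip x (e j))%C with (k j * (Cconj (k j) * ip x (e j)))%C by ring. rewrite H. ring.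
Qed.
End SDfacts.

Lemma unit_phase (z : C) : z <> RtoC 0 -> exists k : C, Cnorm2 k = 1 /\ (Cconj k * z)%C = RtoC (Cmod z).
Proof.
  intro H. assert (M : 0 < Cmod z) by (apply Cmod_gt_0; auto).
  exists (z * RtoC (/ Cmod z))%C. split.
  - rewrite Cnorm2_mult, Cnorm2_RtoC, <- Cmod_sqr. field. lra.
  - rewrite Cmult_conj, Cconj_R.
    replace (Cconj z * RtoC (/ Cmod z) * z)%C with (RtoC (/ Cmod z) * (z * Cconj z))%C by ring.
    rewrite Cmult_conj_norm2, <- Cmod_sqr. apply injective_projections; simpl; field; lra.
Qed.

Lemma sd_normalize u c e g : SD u c e -> (forall j, ip g (e j) <> RtoC 0) ->
  exists c' e', SD u c' e' /\ (forall j, Cnorm2 (c' j) = Cnorm2 (c j)) /\ forall j, exists r, 0 < r /\ ip g (e' j) = RtoC r.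
Proof.
  intros D N.
  set (k := fun j => proj1_sig (constructive_indefinite_description _ (unit_phase _ (N j)))).
  assert (K : forall j, Cnorm2 (k j) = 1 /\ (Cconj (k j) * ip g (e j))%C = RtoC (Cmod (ip g (e j)))).
  { intro j. apply (proj2_sig (constructive_indefinite_description _ (unit_phase _ (N j)))). }
  exists (fun j => Cconj (k j) * Cconj (k j) * c j)%C, (fun j => lscal (k j) (e j)).
  split; [apply sd_rephase; auto; apply K | split].
  - intro j. destruct (K j) as [K1 _]. rewrite !Cnorm2_mult, !Cnorm2_conj, !K1. ring.
  - intro j. exists (Cmod (ip g (e j))). split; [apply Cmod_gt_0; auto|].
    rewrite ip_scal_r. apply K.
Qed.

(** H_u maps each eigenspace of H_u^2 to itself. As it is a line, a unit vector v satisfies H_u v =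
    k v, and H_u^2 v = |k|^2 v identifies |k|^2. Completeness comes from [hank_spectral]. *)
Lemma sd_build u (X : nat -> R) :
  (forall j, 0 < X j) -> (forall j, X (S j) < X j) ->
  (forall s, 0 < s -> ((exists h, hank u (hank u h) = lscal (RtoC s) h /\ h <> lzero) <-> exists j, s = X j)) ->
  (forall j h g, hank u (hank u h) = lscal (RtoC (X j)) h -> h <> lzero ->
     hank u (hank u g) = lscal (RtoC (X j)) g -> exists k, g = lscal k h) ->
  exists c e, SD u c e /\ forall j, Cnorm2 (c j) = X j.
Proof.
  intros P Dc En Si.
  assert (Ex : forall j, exists p : C * l2, n2 (snd p) = 1 /\ hank u (snd p) = lscal (fst p) (snd p) /\ Cnorm2 (fst p) = X j).
  { intro j. destruct (proj2 (En (X j) (P j)) (ex_intro _ j eq_refl)) as (h & Hh & Nh).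
    apply n2_pos in Nh.
    set (v := lscal (RtoC (/ sqrt (n2 h))) h).
    assert (Nv : n2 v = 1).
    { unfold v. rewrite n2_scal, Cnorm2_RtoC, <- Rinv_mult, sqrt_sqrt by lra. field. lra. }
    assert (Hv : hank u (hank u v) = lscal (RtoC (X j)) v).
    { unfold v. rewrite !hank_scal, Hh, !Cconj_R, !lscal_lscal. f_equal. ring. }
    assert (v <> lzero) by (intro Z; rewrite Z, n2_zero in Nv; lra).
    destruct (Si j v (hank u v) Hv H) as [k Hk].
    { rewrite Hv, hank_scal, Cconj_R; auto. }
    exists (k, v). simpl. repeat split; auto.
    rewrite Hk, hank_scal, Hk, lscal_lscal in Hv.
    apply (f_equal (fun w => ip w v)) in Hv. rewrite !ip_scal_l, ip_self, Nv in Hv.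
    rewrite Cmult_comm, (Cmult_comm (Cconj k)), Cmult_conj_norm2 in Hv. apply (f_equal fst) in Hv. simpl in Hv. lra. }
  set (p := fun j => proj1_sig (constructive_indefinite_description _ (Ex j))).
  assert (Hp : forall j, n2 (snd (p j)) = 1 /\ hank u (snd (p j)) = lscal (fst (p j)) (snd (p j)) /\ Cnorm2 (fst (p j)) = X j).
  { intro j. apply (proj2_sig (constructive_indefinite_description _ (Ex j))). }
  exists (fun j => fst (p j)), (fun j => snd (p j)). split; [|intro; apply Hp].
  assert (Hsq : forall j, hank u (hank u (snd (p j))) = lscal (RtoC (X j)) (snd (p j))).
  { intro j. destruct (Hp j) as (_ & E & Q). rewrite E, hank_scal, E, lscal_lscal, <- Q, <- Cmult_conj_norm2. f_equal. ring. }
  assert (Hnz : forall j, snd (p j) <> lzero).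
  { intros j Z. destruct (Hp j) as (Q & _). rewrite Z, n2_zero in Q. lra. }
  split; try (intro j; try destruct (Hp j) as (? & ? & E); try rewrite !(proj2 (proj2 (Hp _))); auto).
  intros H. apply hank_spectral. intros s h Hs Hh.
  destruct (classic (h = lzero)) as [->|N]; [apply ip_zero_r|].
  destruct (proj1 (En s Hs) (ex_intro _ h (conj Hh N))) as [i ->].
  destruct (Si i (snd (p i)) h (Hsq i) (Hnz i) Hh) as [k ->].
  rewrite ip_scal_r, H. ring.
Qed.

(** * The spectrum of K_u from that of H_u *)

Section KPart.
Variables (u : h12) (c : nat -> C) (e : nat -> l2) (al : nat -> R).
Hypothesis D : SD u c e.
Hypothesis alpos : forall j, 0 < al j.
Hypothesis Hal : forall j, ip u (e j) = RtoC (al j).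
Let X j := Cnorm2 (c j).
Let a j := al j * al j.
Let He : on e := sd_on u c e D.

Lemma kp_u_span : inspan e u.
Proof. rewrite <- hank_one. apply (sd_span u c e D). Qed.

Lemma kp_sum_a : is_series a (n2 u).
Proof.
  rewrite (parseval_n2 e He _ kp_u_span), n2_Series.
  rewrite (Series_ext _ a).
  - apply Series_correct. apply ex_series_ext with (2 := l2_ex (coords e He u)).
    intro j. rewrite coords_k, Hal, Cnorm2_RtoC; auto.
  - intro j. rewrite coords_k, Hal, Cnorm2_RtoC; auto.
Qed.

Lemma kp_apos j : 0 < a j.
Proof. apply Rmult_lt_0_compat; auto. Qed.

Lemma kp_coord s h j : kank u (kank u h) = lscal (RtoC s) h ->
  (RtoC (X j - s) * ip h (e j))%C = (ip h u * RtoC (al j))%C.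
Proof.
  intro H. apply (f_equal (fun w => ip w (e j))) in H.
  rewrite kank_sqr, ip_sub_l, !ip_scal_l, hank_sqr_sym, (sd_sqr _ _ _ D), ip_scal_r, Cconj_R, Hal in H.
  rewrite RtoC_minus. unfold X.
  replace (ip h u * RtoC (al j))%C with (RtoC (Cnorm2 (c j)) * ip h (e j) - (RtoC (Cnorm2 (c j)) * ip h (e j) - ip h u * RtoC (al j)))%C by ring.
  rewrite H. ring.
Qed.

(** An eigenvector of K_u^2 orthogonal to [u] is one of H_u^2, hence a multiple of some [e j], and
    (u|e_j) > 0 forces it to vanish. *)
Lemma kp_eig_u s h : 0 < s -> kank u (kank u h) = lscal (RtoC s) h -> h <> lzero -> ip h u <> RtoC 0.
Proof.
  intros Hs H N Z. pose proof H as H'. rewrite kank_sqr, Z in H.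
  assert (H2 : hank u (hank u h) = lscal (RtoC s) h) by (rewrite <- H; vec).
  destruct (sd_eigvec u c e D s h Hs H2 N) as (j & Ej & Eh).
  apply N. rewrite Eh in Z. rewrite ip_scal_l, (ip_conj _ (e j)), Hal, Cconj_R, Cmult_comm in Z.
  apply Cmult_eq0 in Z; [|apply RtoC_neq; specialize (alpos j); lra].
  rewrite Eh, Z. apply lscal_0.
Qed.

Lemma kp_eig_neq s h : 0 < s -> kank u (kank u h) = lscal (RtoC s) h -> h <> lzero -> forall j, X j <> s.
Proof.
  intros Hs H N j E. pose proof (kp_coord s h j H) as Q. rewrite E, Rminus_diag in Q.
  assert (Q2 : (RtoC (al j) * ip h u)%C = RtoC 0) by (rewrite Cmult_comm, <- Q; ring).
  apply (kp_eig_u s h Hs H N). apply Cmult_eq0 in Q2; auto. apply RtoC_neq. specialize (alpos j). lra.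
Qed.

Lemma kp_eig_coord s h : 0 < s -> kank u (kank u h) = lscal (RtoC s) h -> h <> lzero ->
  forall j, ip h (e j) = (ip h u * RtoC (al j / (X j - s)))%C.
Proof.
  intros Hs H N j. pose proof (kp_coord s h j H) as Q. pose proof (kp_eig_neq s h Hs H N j) as E.
  assert (E' : X j - s <> 0) by lra. unfold Rdiv. rewrite RtoC_mult, Cmult_assoc, <- Q, RtoC_inv by auto.
  field. apply RtoC_neq; auto.
Qed.

Lemma kp_eig_span s h : 0 < s -> kank u (kank u h) = lscal (RtoC s) h -> inspan e h.
Proof.
  intros Hs H r Hr. rewrite kank_sqr in H.
  apply (Cmult_eq0 (RtoC s)); [|apply RtoC_neq; lra].
  rewrite <- ip_scal_l, <- H, ip_sub_l, ip_scal_l, (sd_span u c e D _ r Hr), (kp_u_span r Hr). ring.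
Qed.

(** Parseval for (h|u) with the coordinates of [kp_eig_coord], divided by (h|u). *)
Lemma kp_eig_root s h : 0 < s -> kank u (kank u h) = lscal (RtoC s) h -> h <> lzero ->
  is_series (fun j => a j / (X j - s)) 1.
Proof.
  intros Hs H N. pose proof (kp_eig_u s h Hs H N) as Nu.
  pose proof (ip_lim (coords e He h) (coords e He u)) as L.
  rewrite <- (parseval e He _ _ (kp_eig_span s h Hs H)) in L.
  apply is_series_psum.
  assert (L2 : clim (fun n => / ip h u * csum (fun k => coords e He h k * Cconj (coords e He u k))%C n)%C (RtoC 1)).
  { rewrite <- (Cinv_l _ Nu). apply clim_mult; auto. apply clim_const. }
  destruct L2 as [L2 _]. apply is_lim_seq_ext with (2 := L2). intro n.
  rewrite <- csum_scal, fst_csum. apply psum_ext. intros k _.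
  rewrite !coords_k, (kp_eig_coord s h Hs H N), Hal, Cconj_R.
  replace (/ ip h u * (ip h u * RtoC (al k / (X k - s)) * RtoC (al k)))%C with (RtoC (al k / (X k - s)) * RtoC (al k))%C by (field; auto).
  unfold a. simpl. unfold Rdiv. ring.
Qed.

Lemma kp_simple s h g : 0 < s -> kank u (kank u h) = lscal (RtoC s) h -> h <> lzero ->
  kank u (kank u g) = lscal (RtoC s) g -> exists k, g = lscal k h.
Proof.
  intros Hs Hh Nh Hg. destruct (classic (g = lzero)) as [->|Ng].
  - exists (RtoC 0). rewrite lscal_0; auto.
  - pose proof (kp_eig_u s h Hs Hh Nh) as Nu.
    exists (ip g u / ip h u)%C. set (k := (ip g u / ip h u)%C).
    assert (Sp : inspan e (lscal k h)).
    { intros r Hr. rewrite ip_scal_l, (kp_eig_span s h Hs Hh r Hr). ring. }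
    transitivity (syn e He (coords e He g)); [symmetry; apply inspan_syn, (kp_eig_span s g Hs Hg)|].
    transitivity (syn e He (coords e He (lscal k h))); [|apply inspan_syn; auto].
    f_equal. apply l2_ext. intro j.
    rewrite !coords_k, ip_scal_l, (kp_eig_coord s g Hs Hg Ng), (kp_eig_coord s h Hs Hh Nh). unfold k. field; auto.
Qed.

Lemma kp_Xlim : is_lim_seq X 0.
Proof. apply ex_series_lim0. exists (hs u). apply (sd_trace u c e D). Qed.

(** The eigenvector sought has (h|u) = 1, and [kp_eig_coord] then dictates its coordinates; the root
    equation says precisely that this normalisation is consistent. *)
Lemma kp_root_eig j s : gap X j s -> is_series (fun j => a j / (X j - s)) 1 ->
  exists h, kank u (kank u h) = lscal (RtoC s) h /\ h <> lzero.
Proof.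
  intros G R.
  assert (aex : ex_series a) by (exists (n2 u); apply kp_sum_a).
  assert (E : ex_series (fun k => Cnorm2 (RtoC (al k / (X k - s))))).
  { apply ex_series_ext with (2 := sec_sq_ex X a (sd_dec _ _ _ D) kp_apos aex j s G).
    intro k. rewrite Cnorm2_RtoC. unfold a, Rdiv. simpl. rewrite Rmult_1_r, Rinv_mult. ring. }
  set (q := mkl2 (fun k => RtoC (al k / (X k - s))) E).
  set (h := syn e He q).
  assert (Hc : forall k, ip h (e k) = RtoC (al k / (X k - s))).
  { intro k. rewrite <- (coords_k e He h k). unfold h. rewrite coords_syn. exact (lval_mkl2 _ _ _). }
  assert (Hu : ip h u = RtoC 1).
  { unfold h. rewrite ip_syn_l. apply clim_unique with (1 := ip_lim q (coords e He u)).
    apply clim_ext with (fun n => RtoC (psum (fun k => a k / (X k - s)) n)).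
    - intro n. rewrite <- csum_RtoC. apply csum_ext. intros k _.
      rewrite coords_k, Hal. change (q k) with (mkl2 (fun k => RtoC (al k / (X k - s))) E k). rewrite lval_mkl2, Cconj_R, <- RtoC_mult.
      unfold a, Rdiv. f_equal. ring.
    - apply clim_RtoC. apply is_series_psum; auto. }
  assert (Nx : forall k, X k <> s).
  { intros k. destruct (gap_dist X (sd_dec _ _ _ D) j s G) as (d & Hd & Q). specialize (Q k). intro Z.
    rewrite Z, Rminus_diag, Rabs_R0 in Q. lra. }
  exists h. split.
  - assert (Sp : inspan e h).
    { intros r Hr. unfold h. rewrite ip_syn_l.
      replace (coords e He r) with lzero; [apply ip_zero_r|]. apply l2_ext; intro k. rewrite coords_k, Hr, lzero_k; auto. }
    apply lsub_eq0.
    assert (Sp2 : inspan e (lsub (kank u (kank u h)) (lscal (RtoC s) h))).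
    { intros r Hr. rewrite kank_sqr, !ip_sub_l, !ip_scal_l, (sd_span u c e D _ r Hr), (kp_u_span r Hr), (Sp r Hr). ring. }
    apply n2_eq0. rewrite (parseval_n2 e He _ Sp2).
    replace (coords e He (lsub (kank u (kank u h)) (lscal (RtoC s) h))) with lzero; [apply n2_zero|].
    apply l2_ext. intro k. rewrite lzero_k, coords_k, kank_sqr, !ip_sub_l, !ip_scal_l, hank_sqr_sym, (sd_sqr _ _ _ D), ip_scal_r, Cconj_R, Hu, Hc, Hal.
    fold (X k). specialize (Nx k). apply injective_projections; simpl; [field; lra | ring].
  - intro Z. rewrite Z, ip_zero_l in Hu. apply (f_equal fst) in Hu. simpl in Hu. lra.
Qed.

Lemma kp_exists : exists g f be, SD (hshift u) g f /\ forall m, 0 < be m /\ ip u (f m) = RtoC (be m).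
Proof.
  assert (aex : ex_series a) by (exists (n2 u); apply kp_sum_a).
  assert (Rt := sec_root X a (sd_dec _ _ _ D) kp_apos aex).
  set (Y := fun j => proj1_sig (constructive_indefinite_description _ (Rt j))).
  assert (HY : forall j, gap X j (Y j) /\ is_series (fun k => a k / (X k - Y j)) 1).
  { intro j. apply (proj2_sig (constructive_indefinite_description _ (Rt j))). }
  assert (Xp : forall j, 0 < X j) by apply (sd_pos _ _ _ D).
  assert (Yp : forall j, 0 < Y j).
  { intro j. destruct (HY j) as [[A B] _]. specialize (Xp (S j)). lra. }
  destruct (sd_build (hshift u) Y) as (g & f & S & _); auto.
  - intro j. destruct (HY j) as [[A B] _], (HY (S j)) as [[A' B'] _]. lra.
  - intros s Hs. split.
    + intros (h & Hh & Nh). pose proof (kp_eig_root s h Hs Hh Nh) as Rs.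
      destruct (sec_root_gap X a (sd_dec _ _ _ D) kp_Xlim kp_apos s Hs (kp_eig_neq s h Hs Hh Nh) Rs) as [j Gj].
      exists j. apply (sec_root_unique X a (sd_dec _ _ _ D) kp_apos aex j); auto; apply HY.
    + intros [j ->]. apply (kp_root_eig j); apply HY.
  - intros j h g Hh Nh Hg. apply (kp_simple (Y j) h g); auto.
  - assert (Nf : forall m, ip u (f m) <> RtoC 0).
    { intros m Z. apply (kp_eig_u (Cnorm2 (g m)) (f m)).
      - apply S.
      - apply (sd_sqr _ _ _ S).
      - intro Q. pose proof (sd_nrm _ _ _ S m) as N. rewrite Q, n2_zero in N. lra.
      - rewrite ip_conj, Z. apply Cconj_R. }
    destruct (sd_normalize (hshift u) g f u S Nf) as (g' & f' & S' & _ & P).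
    exists g', f', (fun m => proj1_sig (constructive_indefinite_description _ (P m))). split; auto.
    intro m. apply (proj2_sig (constructive_indefinite_description _ (P m))).
Qed.

Section Pair.
Variables (g : nat -> C) (f : nat -> l2) (be : nat -> R).
Hypothesis S : SD (hshift u) g f.
Hypothesis Hbe : forall m, ip u (f m) = RtoC (be m).
Let Y j := Cnorm2 (g j).

Lemma kp_f_neq m : f m <> lzero.
Proof. intro Q. pose proof (sd_nrm _ _ _ S m) as N. rewrite Q, n2_zero in N. lra. Qed.

Lemma kp_f_eig m : kank u (kank u (f m)) = lscal (RtoC (Y m)) (f m).
Proof. apply (sd_sqr _ _ _ S). Qed.

Lemma kp_f_root m : is_series (fun k => a k / (X k - Y m)) 1.
Proof. apply (kp_eig_root (Y m) (f m)); [apply S | apply kp_f_eig | apply kp_f_neq]. Qed.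

(** The roots, one in each gap, and the numbers [Y] both enumerate the positive eigenvalues of K_u^2
    in decreasing order, so they agree index by index. *)
Lemma kp_gap m : gap X m (Y m).
Proof.
  assert (aex : ex_series a) by (exists (n2 u); apply kp_sum_a).
  assert (Rt := sec_root X a (sd_dec _ _ _ D) kp_apos aex).
  set (r := fun j => proj1_sig (constructive_indefinite_description _ (Rt j))).
  assert (Hr : forall j, gap X j (r j) /\ is_series (fun k => a k / (X k - r j)) 1).
  { intro j. apply (proj2_sig (constructive_indefinite_description _ (Rt j))). }
  replace (Y m) with (r m); [apply Hr|].
  apply decreasing_enum_unique.
  - intro j. destruct (Hr j) as [[A B] _], (Hr (Datatypes.S j)) as [[A' B'] _]. lra.
  - apply (sd_dec _ _ _ S).
  - intro j. destruct (Hr j) as [G R]. destruct (kp_root_eig j (r j) G R) as (h & Hh & Nh).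
    destruct (sd_eigvec _ _ _ S (r j) h) as (i & Ei & _); eauto.
    destruct G. pose proof (sd_pos _ _ _ D (Datatypes.S j)). unfold X in *. lra.
  - intro i. pose proof (sd_pos _ _ _ S i) as Yp. fold (Y i) in Yp.
    destruct (sec_root_gap X a (sd_dec _ _ _ D) kp_Xlim kp_apos (Y i) Yp) as [j Gj].
    + apply (kp_eig_neq (Y i) (f i)); auto; [apply kp_f_eig | apply kp_f_neq].
    + apply kp_f_root.
    + exists j. apply (sec_root_unique X a (sd_dec _ _ _ D) kp_apos aex j); auto; try apply Hr. apply kp_f_root.
Qed.

(** The total weight is |u|^2, which is also the difference of the traces of H_u^2 and K_u^2. *)
Lemma kp_weights : weights X Y a.
Proof.
  pose proof (sd_trace _ _ _ D) as TX. pose proof (sd_trace _ _ _ S) as TY.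
  split.
  - intro j. apply (kp_gap j).
  - intro j. apply (kp_gap j).
  - apply (sd_pos _ _ _ D).
  - exists (hs u); auto.
  - exists (hs (hshift u)); auto.
  - apply kp_apos.
  - apply kp_f_root.
  - apply is_series_unique in TX. apply is_series_unique in TY. fold X in TX. fold Y in TY.
    rewrite TX, TY, hs_shift. replace (hs u - (hs u - n2 u)) with (n2 u) by ring. apply kp_sum_a.
Qed.

Lemma kp_overlap m j : ip (f m) (e j) = RtoC (be m * al j / (X j - Y m)).
Proof.
  rewrite (kp_eig_coord (Y m) (f m)); [|apply S|apply kp_f_eig|apply kp_f_neq].
  rewrite (ip_conj u), Hbe, Cconj_R, <- RtoC_mult. f_equal. unfold Rdiv; ring.
Qed.

Lemma kp_f_span m : inspan e (f m).
Proof. apply kp_eig_span with (Y m); [apply S | apply kp_f_eig]. Qed.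

Lemma kp_be_norm m : be m * be m * Series (fun j => a j / (X j - Y m) ^ 2) = 1.
Proof.
  rewrite <- (sd_nrm _ _ _ S m), (parseval_n2 e He _ (kp_f_span m)), n2_Series, <- Series_scal_l.
  apply Series_ext. intro j. rewrite coords_k, kp_overlap, Cnorm2_RtoC. unfold a, Rdiv. simpl. rewrite Rmult_1_r, Rinv_mult. ring.
Qed.
End Pair.
End KPart.

(** * Continuity of the inverse spectral map *)

(** The conjugate appears for H_u only: the phase is read from (1|e_j) there and from (u|f_m) for
    K_u, and (u|e_j) is the eigenvalue times the conjugate of (1|e_j). *)
Record chiD (u : h12) (z g : nat -> C) (e f : nat -> l2) (al be : nat -> R) : Prop := {
  cd_e : SD u (fun j => Cconj (z j)) e;
  cd_f : SD (hshift u) g f;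
  cd_al : forall j, 0 < al j;
  cd_ue : forall j, ip u (e j) = RtoC (al j);
  cd_be : forall m, 0 < be m;
  cd_uf : forall m, ip u (f m) = RtoC (be m) }.

Lemma wlim_of_coords (q : nat -> l2) (q0 : l2) M : (forall n, n2 (q n) <= M) ->
  (forall k, clim (fun n => q n k) (q0 k)) -> wlim q q0.
Proof.
  intros B H y.
  apply clim_ext with (fun n => ip (lsub (q n) q0) y + ip q0 y)%C.
  { intro n. rewrite ip_sub_l. ring. }
  apply clim_eq with (RtoC 0 + ip q0 y)%C; [|ring].
  apply clim_plus; [|apply clim_const].
  apply wlim_of_coord with (2 * M + 2 * n2 q0).
  - intro n. eapply Rle_trans; [apply n2_sub_le|]. specialize (B n). lra.
  - intro k. apply clim_ext with (fun n => q n k - q0 k)%C; [intro; rewrite lsub_k; auto|].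
    apply clim_eq with (q0 k - q0 k)%C; [|ring]. apply clim_minus; [apply H | apply clim_const].
Qed.

Lemma slim_of_coords (p : nat -> l2) (p0 : l2) :
  (forall k, clim (fun N => p N k) (p0 k)) -> is_lim_seq (fun N => n2 (p N)) (n2 p0) -> slim p p0.
Proof.
  intros H L. unfold slim.
  assert (one : forall x : l2, n2 x = Series (fun k => 1 * Cnorm2 (x k))).
  { intro x. rewrite n2_Series. apply Series_ext; intro; ring. }
  assert (onex : forall x : l2, ex_series (fun k => 1 * Cnorm2 (x k))).
  { intro x. apply ex_series_ext with (2 := l2_ex x). intro; simpl; ring. }
  assert (S := scheffe_l2 (fun _ => 1) (fun N k => p N k) p0 (fun _ => Rle_0_1) H (fun N => onex (p N)) (onex p0)).
  apply is_lim_seq_ext with (fun N => Series (fun k => 1 * Cnorm2 (p N k - p0 k)%C)).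
  - intro N. rewrite one. apply Series_ext. intro k. rewrite lsub_k; auto.
  - apply S. rewrite <- one. apply is_lim_seq_ext with (2 := L). intro; apply one.
Qed.

Lemma slim_of_dom (p : nat -> l2) (p0 : l2) (G : nat -> nat -> R) (G0 : nat -> R) :
  (forall k, clim (fun N => p N k) (p0 k)) -> (forall N k, Cnorm2 (p N k) <= G N k) ->
  (forall k, is_lim_seq (fun N => G N k) (G0 k)) -> (forall N, ex_series (G N)) -> ex_series G0 ->
  is_lim_seq (fun N => Series (G N)) (Series G0) -> slim p p0.
Proof.
  intros H B L E E0 S. apply slim_of_coords; auto.
  destruct (dominated_series (fun N k => Cnorm2 (p N k)) G (fun k => Cnorm2 (p0 k)) G0
    (fun k => clim_norm2 _ _ (H k)) L
    (fun N k => eq_ind_r (fun r => r <= G N k) (B N k) (Rabs_pos_eq _ (Cnorm2_ge0 _))) E E0 S) as [_ R].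
  rewrite n2_Series. apply is_lim_seq_ext with (2 := R). intro; rewrite n2_Series; auto.
Qed.

(** Meant for Parseval sums in moving bases, where the coordinates of the expanded vector converge
    strongly and those of the basis vectors [ldelta n] only weakly. *)
Lemma slim_wlim_ip p l q m M : slim p l -> wlim q m -> (forall n, n2 (q n) <= M) ->
  clim (fun n => ip (p n) (q n)) (ip l m).
Proof.
  intros S W B.
  apply clim_ext with (fun n => ip (lsub (p n) l) (q n) + Cconj (ip (q n) l))%C.
  { intro n. rewrite ip_sub_l, <- ip_conj. ring. }
  apply clim_eq with (RtoC 0 + Cconj (ip m l))%C; [|rewrite <- ip_conj; ring].
  apply clim_plus; [|apply clim_conj, W].
  apply clim_norm2_0. apply lim0_le with (fun n => M * n2 (lsub (p n) l)); [|apply lim_scal0; auto].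
  intro n. split; [apply Cnorm2_ge0|]. eapply Rle_trans; [apply cauchy_schwarz|].
  rewrite Rmult_comm. apply Rmult_le_compat_r; [apply n2_ge0 | auto].
Qed.

Lemma clim_inv f (l : C) : clim f l -> l <> RtoC 0 -> clim (fun n => / f n)%C (/ l)%C.
Proof.
  intros [A B] N. apply Cnorm2_pos in N. unfold Cnorm2 in N.
  split; simpl.
  - apply is_lim_seq_div'; auto; [|simpl; lra].
    apply is_lim_seq_plus'; apply is_lim_seq_mult'; auto; apply is_lim_seq_mult'; auto; apply is_lim_seq_const.
  - apply is_lim_seq_div'; [apply (is_lim_seq_opp _ (snd l)) in B; auto| |simpl; lra].
    apply is_lim_seq_plus'; apply is_lim_seq_mult'; auto; apply is_lim_seq_mult'; auto; apply is_lim_seq_const.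
Qed.

Section ChiFacts.
Variables (u : h12) (z g : nat -> C) (e f : nat -> l2) (al be : nat -> R).
Hypothesis D : chiD u z g e f al be.
Let De := cd_e _ _ _ _ _ _ _ D.
Let Df := cd_f _ _ _ _ _ _ _ D.
Let He : on e := sd_on _ _ _ De.
Let Hf : on f := sd_on _ _ _ Df.

Lemma cd_z_neq j : Cconj (z j) <> RtoC 0.
Proof. intro Z. pose proof (sd_pos _ _ _ De j) as P. simpl in P. rewrite Z in P. unfold Cnorm2 in P; simpl in P. lra. Qed.

(** H_u 1 = u turns (u|e_j) = [al j] into a formula for the zeroth coefficient. *)
Lemma cd_e0 j : e j O = (/ Cconj (z j) * RtoC (al j))%C.
Proof.
  pose proof (cd_ue _ _ _ _ _ _ _ D j) as E.
  rewrite <- hank_one, hank_sym, (sd_eig _ _ _ De), ip_scal_l, ip_delta in E.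
  rewrite <- E. field. apply cd_z_neq.
Qed.

Lemma cd_f_coord m n : f m n = ip (coords e He (f m)) (coords e He (ldelta n)).
Proof.
  rewrite <- parseval; [rewrite ip_delta; auto|].
  apply (kp_f_span u _ e De g f Df).
Qed.

(** The coefficient [S n] of H_u e_j is the coefficient [n] of K_u e_j, which is expanded in the
    basis [f]. With [cd_f_coord] this closes the recursion on the coefficients. *)
Lemma cd_e_coord j n : e j (S n) = (/ Cconj (z j) * ip (coords f Hf (kank u (e j))) (coords f Hf (ldelta n)))%C.
Proof.
  rewrite <- parseval by apply (sd_span _ _ _ Df).
  rewrite ip_delta, kank_coord, (sd_eig _ _ _ De), lscal_k. field. apply cd_z_neq.
Qed.

Lemma cd_u_coord n : u n = ip (coords e He u) (coords e He (ldelta n)).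
Proof.
  rewrite <- parseval; [rewrite ip_delta; auto|]. rewrite <- hank_one. apply (sd_span _ _ _ De).
Qed.

Lemma cd_overlap m j : ip (f m) (e j) = RtoC (be m * al j / (Cnorm2 (Cconj (z j)) - Cnorm2 (g m))).
Proof.
  apply (kp_overlap u _ e al De (cd_al _ _ _ _ _ _ _ D) (cd_ue _ _ _ _ _ _ _ D) g f be Df (cd_uf _ _ _ _ _ _ _ D)).
Qed.

Lemma cd_kcoord j m : ip (kank u (e j)) (f m) = (g m * ip (f m) (e j))%C.
Proof. unfold kank. rewrite (sd_coord _ _ _ Df), <- ip_conj; auto. Qed.

Lemma cd_weights : weights (fun j => Cnorm2 (Cconj (z j))) (fun m => Cnorm2 (g m)) (fun j => al j * al j).
Proof.
  apply (kp_weights u _ e al De (cd_al _ _ _ _ _ _ _ D) (cd_ue _ _ _ _ _ _ _ D) g f Df).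
Qed.

(** By [cd_e0] the weight is x_j |e_j(0)|^2, and [e j] is a unit vector. This supplies dominating
    series for the limits below. *)
Lemma cd_al_le j : al j * al j <= Cnorm2 (Cconj (z j)).
Proof.
  pose proof (cd_e0 j) as E. apply (f_equal (fun w => Cconj (z j) * w)%C) in E.
  replace (Cconj (z j) * (/ Cconj (z j) * RtoC (al j)))%C with (RtoC (al j)) in E by (field; apply cd_z_neq).
  apply (f_equal Cnorm2) in E. rewrite Cnorm2_mult, Cnorm2_RtoC in E. rewrite <- E.
  pose proof (coord_le_n2 (e j) O) as B. rewrite (sd_nrm _ _ _ De) in B. pose proof (Cnorm2_ge0 (Cconj (z j))). nra.
Qed.

Lemma cd_be_norm m : be m * be m * Series (fun j => al j * al j / (Cnorm2 (Cconj (z j)) - Cnorm2 (g m)) ^ 2) = 1.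
Proof.
  apply (kp_be_norm u _ e al De (cd_al _ _ _ _ _ _ _ D) (cd_ue _ _ _ _ _ _ _ D) g f be Df (cd_uf _ _ _ _ _ _ _ D)).
Qed.
End ChiFacts.

Lemma lim_Rmin u v (a b : R) : is_lim_seq u a -> is_lim_seq v b -> is_lim_seq (fun n => Rmin (u n) (v n)) (Rmin a b).
Proof.
  intros A B. apply is_lim_seq_ext with (fun n => (u n + v n - Rabs (u n - v n)) / 2).
  { intro n. unfold Rmin. destruct Rle_dec; unfold Rabs; destruct Rcase_abs; lra. }
  replace (Rmin a b) with ((a + b - Rabs (a - b)) / 2) by (unfold Rmin; destruct Rle_dec; unfold Rabs; destruct Rcase_abs; lra).
  apply is_lim_seq_div'; [|apply is_lim_seq_const|lra].
  apply is_lim_seq_minus'; [apply is_lim_seq_plus'; auto|].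
  apply (is_lim_seq_abs _ (a - b)), is_lim_seq_minus'; auto.
Qed.

Section InverseLimit.
Variables (uN : nat -> h12) (zN gN : nat -> nat -> C) (eN fN : nat -> nat -> l2) (aN bN : nat -> nat -> R).
Variables (u : h12) (z g : nat -> C) (e f : nat -> l2) (al be : nat -> R).
Hypothesis DN : forall N, chiD (uN N) (zN N) (gN N) (eN N) (fN N) (aN N) (bN N).
Hypothesis D : chiD u z g e f al be.
Hypothesis Hz : forall j, clim (fun N => zN N j) (z j).
Hypothesis Hg : forall j, clim (fun N => gN N j) (g j).
Hypothesis Sz : is_lim_seq (fun N => Series (fun j => Cnorm2 (zN N j))) (Series (fun j => Cnorm2 (z j))).
Hypothesis Sg : is_lim_seq (fun N => Series (fun j => Cnorm2 (gN N j))) (Series (fun j => Cnorm2 (g j))).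

Let X N j := Cnorm2 (Cconj (zN N j)).
Let Y N j := Cnorm2 (gN N j).
Let X0 j := Cnorm2 (Cconj (z j)).
Let Y0 j := Cnorm2 (g j).

Lemma il_X j : is_lim_seq (fun N => X N j) (X0 j).
Proof. apply clim_norm2, clim_conj, Hz. Qed.
Lemma il_Y j : is_lim_seq (fun N => Y N j) (Y0 j).
Proof. apply clim_norm2, Hg. Qed.
Lemma il_SX : is_lim_seq (fun N => Series (X N)) (Series X0).
Proof.
  unfold X0. rewrite (Series_ext _ (fun j => Cnorm2 (z j))) by (intro; apply Cnorm2_conj).
  apply is_lim_seq_ext with (2 := Sz). intro N. apply Series_ext. intro. symmetry. apply Cnorm2_conj.
Qed.
Lemma il_Xex N : ex_series (X N).
Proof. apply (cd_weights _ _ _ _ _ _ _ (DN N)). Qed.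
Lemma il_X0ex : ex_series X0.
Proof. apply (cd_weights _ _ _ _ _ _ _ D). Qed.

Lemma il_a j : is_lim_seq (fun N => aN N j * aN N j) (al j * al j).
Proof.
  apply (weights_lim X Y (fun N j => aN N j * aN N j) X0 Y0 (fun j => al j * al j)).
  - intro N. apply (cd_weights _ _ _ _ _ _ _ (DN N)).
  - apply (cd_weights _ _ _ _ _ _ _ D).
  - apply il_X.
  - apply il_Y.
  - apply il_SX.
  - apply Sg.
Qed.

Lemma il_al j : is_lim_seq (fun N => aN N j) (al j).
Proof.
  pose proof (clim_cont_sqrt _ _ (il_a j)) as L. rewrite sqrt_square in L by (apply Rlt_le, (cd_al _ _ _ _ _ _ _ D)).
  apply is_lim_seq_ext with (2 := L). intro N. apply sqrt_square, Rlt_le, (cd_al _ _ _ _ _ _ _ (DN N)).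
Qed.

Lemma il_dist (x y a : nat -> R) m k : weights x y a -> Rmin (x m - y m) (y m - x (S m)) <= Rabs (x k - y m).
Proof.
  intro W. pose proof (inter_xdec x y (wt_xy _ _ _ W) (wt_yx _ _ _ W)) as Dx.
  pose proof (wt_xy _ _ _ W m). pose proof (wt_yx _ _ _ W m).
  destruct (le_lt_dec k m) as [L|L].
  - apply (xdec_le x Dx) in L. eapply Rle_trans; [apply Rmin_l|]. rewrite Rabs_pos_eq; lra.
  - apply (xdec_le x Dx) in L. eapply Rle_trans; [apply Rmin_r|]. rewrite Rabs_left; lra.
Qed.

(** The terms of the series that fixes [be m] are at most [X j / d^2], with [d] the distance from
    [Y m] to the nearest [X k]; [d] has a positive limit, so these bounds converge together with
    their sums. *)
Lemma il_be m : is_lim_seq (fun N => bN N m) (be m).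
Proof.
  set (S := fun N => Series (fun j => aN N j * aN N j / (X N j - Y N m) ^ 2)).
  set (S0 := Series (fun j => al j * al j / (X0 j - Y0 m) ^ 2)).
  assert (W := fun N => cd_weights _ _ _ _ _ _ _ (DN N)). assert (W0 := cd_weights _ _ _ _ _ _ _ D).
  set (d := fun N => Rmin (X N m - Y N m) (Y N m - X N (Datatypes.S m))).
  set (d0 := Rmin (X0 m - Y0 m) (Y0 m - X0 (Datatypes.S m))).
  assert (dp : forall N, 0 < d N).
  { intro N. pose proof (wt_xy _ _ _ (W N) m). pose proof (wt_yx _ _ _ (W N) m). apply Rmin_glb_lt; unfold X, Y; lra. }
  assert (d0p : 0 < d0).
  { pose proof (wt_xy _ _ _ W0 m). pose proof (wt_yx _ _ _ W0 m). apply Rmin_glb_lt; unfold X0, Y0; lra. }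
  assert (dl : is_lim_seq d d0) by (apply lim_Rmin; apply is_lim_seq_minus'; [apply il_X | apply il_Y | apply il_Y | apply il_X]).
  assert (dl2 : is_lim_seq (fun N => / (d N * d N)) (/ (d0 * d0))).
  { apply is_lim_seq_ext with (fun N => 1 / (d N * d N)); [intro; unfold Rdiv; ring|].
    replace (/ (d0 * d0)) with (1 / (d0 * d0)) by (unfold Rdiv; ring).
    apply is_lim_seq_div'; [apply is_lim_seq_const | apply is_lim_seq_mult'; auto | nra]. }
  assert (SL : is_lim_seq S S0).
  { apply (dominated_series _ (fun N j => / (d N * d N) * X N j) _ (fun j => / (d0 * d0) * X0 j)).
    - intro j. apply is_lim_seq_div'; [apply il_a| |].
      + simpl. apply is_lim_seq_mult'; [|apply is_lim_seq_mult'; [|apply is_lim_seq_const]]; (apply is_lim_seq_minus'; [apply il_X | apply il_Y]).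
      + apply pow_nonzero, Rminus_eq_contra, (inter_neq X0 Y0); apply W0.
    - intro j. apply is_lim_seq_mult'; auto. apply il_X.
    - intros N j. pose proof (il_dist _ _ _ m j (W N)) as Q. simpl in Q. fold (X N m) (Y N m) (X N (Datatypes.S m)) (X N j) (d N) in Q.
      specialize (dp N). pose proof (cd_al_le _ _ _ _ _ _ _ (DN N) j) as A. fold (X N j) in A.
      unfold Rdiv. rewrite Rabs_mult, Rabs_inv, <- RPow_abs. rewrite (Rabs_pos_eq (aN N j * aN N j)) by apply Rle_0_sqr.
      rewrite Rmult_comm. apply Rmult_le_compat; auto.
      + apply Rlt_le, Rinv_0_lt_compat. apply pow_lt. lra.
      + apply Rle_0_sqr.
      + apply Rinv_le_contravar; [nra|]. simpl. rewrite Rmult_1_r. apply Rmult_le_compat; lra.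
    - intro N. apply ex_series_scal_R, il_Xex.
    - apply ex_series_scal_R, il_X0ex.
    - rewrite Series_scal_l. apply is_lim_seq_ext with (fun N => / (d N * d N) * Series (X N)); [intro; rewrite Series_scal_l; auto|].
      apply is_lim_seq_mult'; auto. apply il_SX. }
  assert (Sb : forall N, bN N m * bN N m = 1 / S N /\ 0 < S N).
  { intro N. pose proof (cd_be_norm _ _ _ _ _ _ _ (DN N) m) as Q. pose proof (cd_be _ _ _ _ _ _ _ (DN N) m) as P. change (bN N m * bN N m * S N = 1) in Q.
    assert (S N <> 0) by (intro Z; rewrite Z in Q; lra).
    assert (0 < S N) by (destruct (Rlt_le_dec 0 (S N)); auto; nra).
    split; auto. rewrite <- Q. field; auto. }
  assert (Sb0 : be m * be m = 1 / S0 /\ 0 < S0).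
  { pose proof (cd_be_norm _ _ _ _ _ _ _ D m) as Q. pose proof (cd_be _ _ _ _ _ _ _ D m) as P. change (be m * be m * S0 = 1) in Q.
    assert (S0 <> 0) by (intro Z; rewrite Z in Q; lra).
    assert (0 < S0) by (destruct (Rlt_le_dec 0 S0); auto; nra).
    split; auto. rewrite <- Q. field; auto. }
  assert (L : is_lim_seq (fun N => bN N m * bN N m) (be m * be m)).
  { rewrite (proj1 Sb0). apply is_lim_seq_ext with (fun N => 1 / S N); [intro N; symmetry; apply Sb|].
    apply is_lim_seq_div'; [apply is_lim_seq_const | auto | lra]. }
  apply clim_cont_sqrt in L. rewrite sqrt_square in L by (apply Rlt_le, (cd_be _ _ _ _ _ _ _ D)).
  apply is_lim_seq_ext with (2 := L). intro N. apply sqrt_square, Rlt_le, (cd_be _ _ _ _ _ _ _ (DN N)).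
Qed.

Lemma il_overlap m j : clim (fun N => ip (fN N m) (eN N j)) (ip (f m) (e j)).
Proof.
  rewrite (cd_overlap _ _ _ _ _ _ _ D).
  apply clim_ext with (fun N => RtoC (bN N m * aN N j / (X N j - Y N m))).
  { intro N. rewrite (cd_overlap _ _ _ _ _ _ _ (DN N)); auto. }
  apply clim_RtoC, is_lim_seq_div'.
  - apply is_lim_seq_mult'; [apply il_be | apply il_al].
  - apply is_lim_seq_minus'; [apply il_X | apply il_Y].
  - apply Rminus_eq_contra, (inter_neq X0 Y0); apply (cd_weights _ _ _ _ _ _ _ D).
Qed.

Let on_e N := sd_on _ _ _ (cd_e _ _ _ _ _ _ _ (DN N)).
Let on_f N := sd_on _ _ _ (cd_f _ _ _ _ _ _ _ (DN N)).
Let on_e0 := sd_on _ _ _ (cd_e _ _ _ _ _ _ _ D).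
Let on_f0 := sd_on _ _ _ (cd_f _ _ _ _ _ _ _ D).

(** The coordinates of [ldelta n] are the conjugate coefficients of the basis vectors, so bounded
    norms and coordinatewise convergence are all that is at hand: the limit is weak. *)
Lemma il_delta (vN : nat -> nat -> l2) (v : nat -> l2) (oN : forall N, on (vN N)) (o : on v) n :
  (forall j, clim (fun N => vN N j n) (v j n)) ->
  wlim (fun N => coords (vN N) (oN N) (ldelta n)) (coords v o (ldelta n)) /\
  forall N, n2 (coords (vN N) (oN N) (ldelta n)) <= 1.
Proof.
  intro H. assert (B : forall N, n2 (coords (vN N) (oN N) (ldelta n)) <= 1).
  { intro N. eapply Rle_trans; [apply n2_coords_le|]. rewrite n2_delta. lra. }
  split; auto. apply wlim_of_coords with 1; auto.
  intro k. rewrite coords_k, ip_delta_l.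
  apply clim_ext with (fun N => Cconj (vN N k n)); [intro N; rewrite coords_k, ip_delta_l; auto|].
  apply clim_conj, H.
Qed.

(** The overlaps converge and the coordinate vectors of [fN N m] in the basis [eN N] all have norm
    1, so they converge strongly and can be paired with the weak limit of [il_delta]. *)
Lemma il_f m n : (forall j, clim (fun N => eN N j n) (e j n)) -> clim (fun N => fN N m n) (f m n).
Proof.
  intro H. destruct (il_delta eN e on_e on_e0 n H) as [W B].
  rewrite (cd_f_coord _ _ _ _ _ _ _ D m n).
  apply clim_ext with (fun N => ip (coords (eN N) (on_e N) (fN N m)) (coords (eN N) (on_e N) (ldelta n))).
  { intro N. rewrite (cd_f_coord _ _ _ _ _ _ _ (DN N) m n). reflexivity. }
  apply slim_wlim_ip with 1; auto.
  apply slim_of_coords.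
  - intro k. rewrite coords_k. apply clim_ext with (2 := il_overlap m k). intro N. rewrite coords_k; auto.
  - assert (Q : forall u z g e f al be (D : chiD u z g e f al be) o, n2 (coords e o (f m)) = 1).
    { clear. intros u z g e f al be D o. rewrite <- (parseval_n2 e o); [apply (cd_f _ _ _ _ _ _ _ D)|].
      apply (kp_f_span u _ e (cd_e _ _ _ _ _ _ _ D) g f (cd_f _ _ _ _ _ _ _ D)). }
    rewrite (Q _ _ _ _ _ _ _ D). apply is_lim_seq_ext with (fun _ => 1); [|apply is_lim_seq_const].
    intro N. rewrite (Q _ _ _ _ _ _ _ (DN N)); auto.
Qed.

Lemma il_zinv j : clim (fun N => / Cconj (zN N j))%C (/ Cconj (z j))%C.
Proof. apply clim_inv; [apply clim_conj, Hz | apply (cd_z_neq _ _ _ _ _ _ _ D)]. Qed.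

(** Induction on the index of the coefficient, for all j at once: the coefficients n of all [e j]
    give those of all [f m], and these give the coefficient n + 1 of [e j]. Strong convergence of
    the coordinates comes here from domination by |g_m|^2. *)
Lemma il_e j n : clim (fun N => eN N j n) (e j n).
Proof.
  revert j; induction n as [|n IH]; intro j.
  - rewrite (cd_e0 _ _ _ _ _ _ _ D).
    apply clim_ext with (fun N => / Cconj (zN N j) * RtoC (aN N j))%C; [intro N; rewrite (cd_e0 _ _ _ _ _ _ _ (DN N)); auto|].
    apply clim_mult; [apply il_zinv | apply clim_RtoC, il_al].
  - destruct (il_delta fN f on_f on_f0 n (fun m => il_f m n IH)) as [W B].
    rewrite (cd_e_coord _ _ _ _ _ _ _ D j n).
    apply clim_ext with (fun N => / Cconj (zN N j) * ip (coords (fN N) (on_f N) (kank (uN N) (eN N j))) (coords (fN N) (on_f N) (ldelta n)))%C.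
    { intro N. rewrite (cd_e_coord _ _ _ _ _ _ _ (DN N) j n). reflexivity. }
    apply clim_mult; [apply il_zinv|].
    apply slim_wlim_ip with 1; auto.
    apply slim_of_dom with Y Y0.
    + intro m. rewrite coords_k, (cd_kcoord _ _ _ _ _ _ _ D).
      apply clim_ext with (fun N => gN N m * ip (fN N m) (eN N j))%C; [intro N; rewrite coords_k, (cd_kcoord _ _ _ _ _ _ _ (DN N)); auto|].
      apply clim_mult; auto. apply il_overlap.
    + intros N m. rewrite coords_k, (cd_kcoord _ _ _ _ _ _ _ (DN N)), Cnorm2_mult. fold (Y N m).
      pose proof (cauchy_schwarz (fN N m) (eN N j)) as Q.
      rewrite (sd_nrm _ _ _ (cd_e _ _ _ _ _ _ _ (DN N))), (sd_nrm _ _ _ (cd_f _ _ _ _ _ _ _ (DN N))) in Q.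
      pose proof (Cnorm2_ge0 (gN N m)). unfold Y. nra.
    + apply il_Y.
    + intro N. apply (cd_weights _ _ _ _ _ _ _ (DN N)).
    + apply (cd_weights _ _ _ _ _ _ _ D).
    + apply Sg.
Qed.

Lemma il_u n : clim (fun N => uN N n) (u n).
Proof.
  destruct (il_delta eN e on_e on_e0 n (fun j => il_e j n)) as [W B].
  rewrite (cd_u_coord _ _ _ _ _ _ _ D n).
  apply clim_ext with (fun N => ip (coords (eN N) (on_e N) (uN N)) (coords (eN N) (on_e N) (ldelta n))).
  { intro N. rewrite (cd_u_coord _ _ _ _ _ _ _ (DN N) n). reflexivity. }
  apply slim_wlim_ip with 1; auto.
  apply slim_of_dom with X X0.
  - intro k. rewrite coords_k, (cd_ue _ _ _ _ _ _ _ D).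
    apply clim_ext with (fun N => RtoC (aN N k)); [intro N; rewrite coords_k, (cd_ue _ _ _ _ _ _ _ (DN N)); auto|].
    apply clim_RtoC, il_al.
  - intros N k. rewrite coords_k, (cd_ue _ _ _ _ _ _ _ (DN N)), Cnorm2_RtoC. apply (cd_al_le _ _ _ _ _ _ _ (DN N)).
  - apply il_X.
  - apply il_Xex.
  - apply il_X0ex.
  - apply il_SX.
Qed.

Theorem inverse_limit : is_lim_seq (fun N => Series (fun k => (1 + INR k) * Cnorm2 (uN N k - u k)%C)) 0.
Proof.
  apply scheffe_l2.
  - intro k. pose proof (weight_ge1 k). lra.
  - apply il_u.
  - intro N. apply h12_ex.
  - apply h12_ex.
  - fold (hs u). rewrite <- (is_series_unique _ _ (sd_trace _ _ _ (cd_e _ _ _ _ _ _ _ D))).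
    apply is_lim_seq_ext with (2 := il_SX). intro N. fold (hs (uN N)).
    rewrite <- (is_series_unique _ _ (sd_trace _ _ _ (cd_e _ _ _ _ _ _ _ (DN N)))). reflexivity.
Qed.
End InverseLimit.

(** * Continuity of the spectral map *)

(** The last unknown is eliminated by a pivot row [p]; if its column vanishes, that unknown alone
    gives a solution. *)
Lemma homogeneous_solution n : forall M : nat -> nat -> C, exists v : nat -> C,
  (exists k, (k <= n)%nat /\ v k <> RtoC 0) /\
  forall i, (i < n)%nat -> csum (fun k => M i k * v k)%C (S n) = RtoC 0.
Proof.
  induction n as [|n IH]; intro M.
  - exists (fun _ => RtoC 1). split; [exists O; split; auto; apply RtoC_neq; lra | intros; lia].
  - destruct (classic (exists p, (p <= n)%nat /\ M p (S n) <> RtoC 0)) as [(p & Hp & Np)|Q].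
    + destruct (IH (fun i k => M (skip p i) k - M (skip p i) (S n) * M p k / M p (S n))%C) as (v & (k & Hk & Nk) & Hv).
      set (w := (- csum (fun k => M p k * v k)%C (S n) / M p (S n))%C).
      set (v' := fun k => if le_dec k n then v k else w).
      assert (V : forall i, csum (fun k => M i k * v' k)%C (S (S n)) = (csum (fun k => M i k * v k)%C (S n) + M i (S n) * w)%C).
      { intro i. cbn [csum]. unfold v' at 3. destruct le_dec; [lia|]. f_equal.
        f_equal; [apply csum_ext; intros j Hj|]; unfold v'; destruct le_dec; auto; lia. }
      exists v'. split.
      * exists k. split; [lia|]. unfold v'. destruct le_dec; [auto|lia].
      * intros i Hi. rewrite V. destruct (Nat.eq_dec i p) as [->|Ni].
        { unfold w. field. auto. }
        assert (exists i', (i' < n)%nat /\ skip p i' = i) as (i' & Hi' & Ei).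
        { destruct (lt_dec i p); [exists i | exists (pred i)]; split; try lia; unfold skip; destruct lt_dec; lia. }
        specialize (Hv i' Hi'). rewrite Ei in Hv.
        rewrite (csum_ext _ (fun k => M i k * v k + (- (M i (S n) / M p (S n))) * (M p k * v k))%C) in Hv by (intros; field; auto).
        rewrite csum_plus, csum_scal in Hv. rewrite <- Hv. unfold w. field. auto.
    + exists (fun k => if Nat.eq_dec k (S n) then RtoC 1 else RtoC 0). split.
      * exists (S n). split; auto. destruct Nat.eq_dec; [apply RtoC_neq; lra | lia].
      * intros i Hi.
        assert (Z : M i (S n) = RtoC 0) by (apply NNPP; intro; apply Q; exists i; split; auto; lia).
        cbn [csum]. rewrite Z.
        assert (E : forall m, (m <= S n)%nat -> csum (fun k => M i k * (if Nat.eq_dec k (S n) then RtoC 1 else RtoC 0))%C m = RtoC 0).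
        { induction m as [|m IHm]; intro Hm; cbn [csum]; auto. rewrite IHm by lia. destruct Nat.eq_dec; [lia|ring]. }
        specialize (E (S n) (le_n _)). cbn [csum] in E. rewrite E. ring.
Qed.

Lemma hsub_ex (u v : h12) : ex_series (fun k => (1 + INR k) * Cnorm2 (u k - v k)%C).
Proof.
  apply ex_series_le' with (fun k => 2 * ((1 + INR k) * Cnorm2 (u k)) + 2 * ((1 + INR k) * Cnorm2 (v k))).
  - intro k. pose proof (weight_ge1 k). pose proof (Cnorm2_ge0 (u k - v k)%C). pose proof (Cnorm2_minus_le (u k) (v k)).
    rewrite Rabs_pos_eq; nra.
  - apply (ex_series_plus (V := R_NormedModule)); apply ex_series_scal_R, h12_ex.
Qed.
Definition hsub (u v : h12) : h12 := mkh12 _ (hsub_ex u v).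

Lemma mkh12_k h H k : mkh12 h H k = h k.
Proof. rewrite hl_k. reflexivity. Qed.

Lemma hsub_k u v k : hsub u v k = (u k - v k)%C.
Proof. apply (mkh12_k (fun k => u k - v k)%C). Qed.

Lemma hs_hsub u v : hs (hsub u v) = Series (fun k => (1 + INR k) * Cnorm2 (u k - v k)%C).
Proof. apply Series_ext. intro; rewrite hsub_k; auto. Qed.

Lemma hank_hsub u v x : hank (hsub u v) x = lsub (hank u x) (hank v x).
Proof.
  apply l2_ext; intro n. rewrite lsub_k, !hank_k, <- ip_sub_l. f_equal.
  apply l2_ext; intro k. rewrite lsub_k, !shn_k, hsub_k; auto.
Qed.

Lemma nrm_hank_le u x : nrm (hank u x) <= sqrt (hs u) * nrm x.
Proof.
  unfold nrm. rewrite <- sqrt_mult by (try apply hs_ge0; apply n2_ge0). apply sqrt_le_1_alt, n2_hank_le.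
Qed.

(* Weyl's inequality, by the min-max argument. *)
Lemma weyl u c e v c' e' j : SD u c e -> SD v c' e' -> Cmod (c j) <= Cmod (c' j) + sqrt (hs (hsub u v)).
Proof.
  intros D D'. set (He := sd_on _ _ _ D). set (He' := sd_on _ _ _ D').
  (* This yields a nonzero vector in the span of e_0, ..., e_j orthogonal to the first j vectors of
     the other system: on it H_u is bounded below by |c_j|, and H_v above by the modulus of the
     eigenvalue of index j of H_v. *)
  destruct (homogeneous_solution j (fun i k => ip (e k) (e' i))) as (w & (k0 & Hk0 & Nk0) & Hw).
  assert (F : forall k, (S j <= k)%nat -> (if le_dec k j then w k else RtoC 0) = RtoC 0) by (intros; destruct le_dec; [lia|auto]).
  set (q := mkl2 (fun k => if le_dec k j then w k else RtoC 0) (finite_ex _ (S j) F)).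
  assert (qk : forall k, q k = if le_dec k j then w k else RtoC 0) by (intro; exact (lval_mkl2 _ _ _)).
  set (x := syn e He q).
  assert (xk : forall k, ip x (e k) = q k) by (intro k; unfold x; rewrite <- (coords_k e He), coords_syn; auto).
  assert (n2x : n2 x = n2 q) by apply n2_syn.
  assert (x0 : 0 < n2 x).
  { rewrite n2x. eapply Rlt_le_trans; [|apply (coord_le_n2 q k0)]. rewrite qk. destruct le_dec; [|lia]. apply Cnorm2_pos; auto. }
  assert (Zx : forall i, (i < j)%nat -> ip x (e' i) = RtoC 0).
  { intros i Hi. unfold x. rewrite ip_syn_l. rewrite <- (Hw i Hi).
    assert (Tq : trunc (S j) q = q) by (apply l2_ext; intro k; rewrite trunc_k; destruct lt_dec; auto; rewrite qk; destruct le_dec; [lia|auto]).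
    rewrite <- Tq. rewrite (linear_trunc (fun y => ip y (coords e He (e' i)))); [|intros; apply ip_add_l | intros; apply ip_scal_l].
    apply csum_ext. intros k Hk. rewrite ip_delta_l, coords_k, <- ip_conj, qk. destruct le_dec; [ring|lia]. }
  assert (L1 : Cnorm2 (c j) * n2 x <= n2 (hank u x)).
  { rewrite <- (is_series_unique _ _ (sd_hank_n2 _ _ _ D x)), n2x, n2_Series, <- Series_scal_l.
    apply Series_le'.
    - intro k. rewrite xk. destruct (le_lt_dec k j) as [L|L].
      + apply Rmult_le_compat_r; [apply Cnorm2_ge0|]. apply (xdec_le (fun j => Cnorm2 (c j)) (sd_dec _ _ _ D)); auto.
      + rewrite qk. destruct le_dec; [lia|]. unfold Cnorm2 at 2 4; simpl. lra.
    - apply ex_series_scal_R, l2_ex.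
    - eexists; apply (sd_hank_n2 _ _ _ D x). }
  assert (L2 : n2 (hank v x) <= Cnorm2 (c' j) * n2 x).
  { rewrite <- (is_series_unique _ _ (sd_hank_n2 _ _ _ D' x)).
    apply Rle_trans with (Series (fun i => Cnorm2 (c' j) * Cnorm2 (ip x (e' i)))).
    - apply Series_le'.
      + intro i. destruct (le_lt_dec j i) as [L|L].
        * apply Rmult_le_compat_r; [apply Cnorm2_ge0|]. apply (xdec_le (fun j => Cnorm2 (c' j)) (sd_dec _ _ _ D')); auto.
        * rewrite Zx by auto. unfold Cnorm2 at 2 4; simpl. lra.
      + eexists; apply (sd_hank_n2 _ _ _ D' x).
      + apply ex_series_scal_R, bessel_ex, He'.
    - rewrite Series_scal_l. apply Rmult_le_compat_l; [apply Cnorm2_ge0|].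
      apply (ex_series_bdd _ (n2 x)); [intro; apply Cnorm2_ge0 | intro; apply bessel, He']. }
  assert (N1 : Cmod (c j) * nrm x <= nrm (hank u x)).
  { rewrite Cmod_sqrt_norm2. unfold nrm. rewrite <- sqrt_mult by (try apply Cnorm2_ge0; apply n2_ge0). apply sqrt_le_1_alt; auto. }
  assert (N2 : nrm (hank v x) <= Cmod (c' j) * nrm x).
  { rewrite Cmod_sqrt_norm2. unfold nrm. rewrite <- sqrt_mult by (try apply Cnorm2_ge0; apply n2_ge0). apply sqrt_le_1_alt; auto. }
  assert (N3 : nrm (hank u x) <= nrm (hank v x) + nrm (hank (hsub u v) x)).
  { eapply Rle_trans; [|apply nrm_triang]. right. f_equal. rewrite hank_hsub. vec. }
  pose proof (nrm_hank_le (hsub u v) x).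
  assert (0 < nrm x) by (apply sqrt_lt_R0; auto).
  apply Rmult_le_reg_r with (nrm x); auto. lra.
Qed.

Lemma hs_hsub_sym u v : hs (hsub u v) = hs (hsub v u).
Proof. apply Series_ext. intro k. rewrite !hsub_k. unfold Cnorm2; simpl; ring. Qed.

Lemma eigenvalue_lim (wN : nat -> h12) w cN c eN e j :
  (forall N, SD (wN N) (cN N) (eN N)) -> SD w c e -> is_lim_seq (fun N => hs (hsub (wN N) w)) 0 ->
  is_lim_seq (fun N => Cmod (cN N j)) (Cmod (c j)).
Proof.
  intros DN D L. apply clim_cont_sqrt in L. rewrite sqrt_0 in L.
  apply is_lim_seq_le_le with (fun N => Cmod (c j) - sqrt (hs (hsub (wN N) w))) (fun N => Cmod (c j) + sqrt (hs (hsub (wN N) w))).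
  - intro N. split.
    + pose proof (weyl _ _ _ _ _ _ j D (DN N)) as Q. rewrite hs_hsub_sym in Q. lra.
    + apply (weyl _ _ _ _ _ _ j (DN N) D).
  - replace (Finite (Cmod (c j))) with (Finite (Cmod (c j) - 0)) by (f_equal; ring). apply is_lim_seq_minus'; auto. apply is_lim_seq_const.
  - replace (Finite (Cmod (c j))) with (Finite (Cmod (c j) + 0)) by (f_equal; ring). apply is_lim_seq_plus'; auto. apply is_lim_seq_const.
Qed.

Lemma isolated (x : nat -> R) j : (forall k, x (S k) < x k) -> exists d, 0 < d /\ forall k, k <> j -> d <= Rabs (x k - x j).
Proof.
  intro Dx. destruct j as [|j].
  - exists (x 0%nat - x 1%nat). split; [specialize (Dx O); lra|]. intros k Hk.
    pose proof (xdec_le x Dx 1 k ltac:(lia)). specialize (Dx O). rewrite Rabs_left; lra.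
  - exists (Rmin (x j - x (S j)) (x (S j) - x (S (S j)))). split.
    + pose proof (Dx j). pose proof (Dx (S j)). apply Rmin_glb_lt; lra.
    + intros k Hk. destruct (lt_dec k (S j)) as [L|L].
      * pose proof (xdec_le x Dx k j ltac:(lia)). pose proof (Dx j). eapply Rle_trans; [apply Rmin_l|]. rewrite Rabs_pos_eq; lra.
      * pose proof (xdec_le x Dx (S (S j)) k ltac:(lia)). pose proof (Dx (S j)). eapply Rle_trans; [apply Rmin_r|]. rewrite Rabs_left; lra.
Qed.

Lemma slim_add x l y m : slim x l -> slim y m -> slim (fun n => ladd (x n) (y n)) (ladd l m).
Proof.
  intros X Y. apply lim0_le with (fun n => 2 * n2 (lsub (x n) l) + 2 * n2 (lsub (y n) m)).
  - intro n. split; [apply n2_ge0|]. eapply Rle_trans; [|apply n2_add_le]. right. f_equal. vec.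
  - replace (Finite 0) with (Finite (2 * 0 + 2 * 0)) by (f_equal; ring).
    apply is_lim_seq_plus'; apply is_lim_seq_mult'; auto; apply is_lim_seq_const.
Qed.

Lemma slim_hank w x l : slim x l -> slim (fun n => hank w (x n)) (hank w l).
Proof.
  intro X. apply lim0_le with (fun n => hs w * n2 (lsub (x n) l)); [|apply lim_scal0; auto].
  intro n. split; [apply n2_ge0|]. rewrite <- hank_sub. apply n2_hank_le.
Qed.

Lemma slim0_of x y : (forall n, 0 <= n2 (lsub (x n) (y n))) -> is_lim_seq (fun n => n2 (lsub (x n) (y n))) 0 ->
  slim (fun n => lsub (x n) (y n)) lzero.
Proof.
  intros _ L. apply is_lim_seq_ext with (2 := L). intro n. f_equal. vec.
Qed.

(** [v N] is an approximate eigenvector of the fixed operator H_w^2 for the isolated eigenvalue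
    [X j], so its coordinates on the other [e k] vanish in the limit. Convergence of the norms of
    [hank w (v N)] excludes a loss of mass to the kernel, and the positive products with [gN] fix
    the phase. *)
Lemma eigenvector_lim (wN : nat -> h12) w cN c eN e (gN : nat -> l2) g j :
  (forall N, SD (wN N) (cN N) (eN N)) -> SD w c e -> is_lim_seq (fun N => hs (hsub (wN N) w)) 0 ->
  slim gN g -> (forall N, exists r, 0 < r /\ ip (gN N) (eN N j) = RtoC r) -> (exists r, 0 < r /\ ip g (e j) = RtoC r) ->
  slim (fun N => eN N j) (e j) /\ clim (fun N => cN N j) (c j).
Proof.
  intros DN D L G PN (r0 & Hr0 & Er0). set (He := sd_on _ _ _ D).
  set (v := fun N => eN N j).
  assert (nv : forall N, n2 (v N) = 1) by (intro N; apply (DN N)).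
  set (X := fun k => Cnorm2 (c k)). set (t := fun N => ip (v N) (e j)).
  assert (XN : is_lim_seq (fun N => Cnorm2 (cN N j)) (X j)).
  { pose proof (eigenvalue_lim _ _ _ _ _ _ j DN D L) as Q. pose proof (is_lim_seq_mult' _ _ _ _ Q Q) as Q2.
    rewrite Cmod_sqr in Q2. apply is_lim_seq_ext with (2 := Q2). intro; rewrite Cmod_sqr; auto. }
  assert (P1 : is_lim_seq (fun N => n2 (lsub (hank w (v N)) (hank (wN N) (v N)))) 0).
  { apply lim0_le with (fun N => hs (hsub (wN N) w)); auto. intro N. split; [apply n2_ge0|].
    rewrite <- hank_hsub. eapply Rle_trans; [apply n2_hank_le|]. rewrite nv, hs_hsub_sym. lra. }
  assert (Sq : forall N, hank (wN N) (hank (wN N) (v N)) = lscal (RtoC (Cnorm2 (cN N j))) (v N)) by (intro N; apply (sd_sqr _ _ _ (DN N))).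
  (* Operator and eigenvalue are replaced one at a time: the error is the sum of H_w applied to the
     first-order error, of the change of operator on H_wN v, and of the change of eigenvalue. *)
  assert (P2 : is_lim_seq (fun N => n2 (lsub (hank w (hank w (v N))) (lscal (RtoC (X j)) (v N)))) 0).
  { apply lim0_le with (fun N => 2 * (2 * (hs w * n2 (lsub (hank w (v N)) (hank (wN N) (v N)))) + 2 * (Cnorm2 (cN N j) * hs (hsub (wN N) w)))
       + 2 * ((Cnorm2 (cN N j) - X j) * (Cnorm2 (cN N j) - X j))).
    - intro N. split; [apply n2_ge0|].
      replace (lsub (hank w (hank w (v N))) (lscal (RtoC (X j)) (v N))) with
        (ladd (ladd (hank w (lsub (hank w (v N)) (hank (wN N) (v N)))) (lscal (RtoC (-1)) (hank (hsub (wN N) w) (hank (wN N) (v N)))))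
           (lscal (RtoC (Cnorm2 (cN N j) - X j)) (v N))).
      + eapply Rle_trans; [apply n2_add_le|]. apply Rplus_le_compat.
        * apply Rmult_le_compat_l; [lra|]. eapply Rle_trans; [apply n2_add_le|]. apply Rplus_le_compat; apply Rmult_le_compat_l; try lra.
          -- apply n2_hank_le.
          -- rewrite n2_scal, Cnorm2_RtoC. replace (-1 * -1) with 1 by ring. rewrite Rmult_1_l.
             eapply Rle_trans; [apply n2_hank_le|]. right.
             unfold v. rewrite (sd_eig _ _ _ (DN N)), n2_scal. fold (v N). rewrite nv. ring.
        * rewrite n2_scal, Cnorm2_RtoC, nv. lra.
      + rewrite hank_hsub, hank_sub, Sq. apply l2_ext; intro k. rewrite RtoC_minus. repeat rewrite ?ladd_k, ?lsub_k, ?lscal_k.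
        replace (RtoC (-1)) with (- (1))%C by (apply injective_projections; simpl; ring). ring.
    - replace (Finite 0) with (Finite (2 * (2 * (hs w * 0) + 2 * (X j * 0)) + 2 * ((X j - X j) * (X j - X j)))) by (f_equal; ring).
      assert (Bx : is_lim_seq (fun N => Cnorm2 (cN N j) - X j) (X j - X j)) by (apply is_lim_seq_minus'; [exact XN | apply is_lim_seq_const]).
      apply is_lim_seq_plus'; (apply is_lim_seq_mult'; [apply is_lim_seq_const|]).
      + apply is_lim_seq_plus'; (apply is_lim_seq_mult'; [apply is_lim_seq_const|]).
        * apply is_lim_seq_mult'; [apply is_lim_seq_const | exact P1].
        * apply is_lim_seq_mult'; [exact XN | exact L].
      + apply is_lim_seq_mult'; exact Bx. }
  (* Spectral gap: the coordinates of (H_w^2 - X j) v of index other than [j] have at least [d]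
     times the modulus of those of v. *)
  destruct (isolated X j (sd_dec _ _ _ D)) as (d & Hd & Id).
  set (q := fun N => Series (fun k => if Nat.eq_dec k j then 0 else Cnorm2 (ip (v N) (e k)))).
  assert (qex : forall N, ex_series (fun k => if Nat.eq_dec k j then 0 else Cnorm2 (ip (v N) (e k)))).
  { intro N. apply ex_series_le' with (2 := bessel_ex e (v N) He). intro k.
    pose proof (Cnorm2_ge0 (ip (v N) (e k))). destruct Nat.eq_dec; [rewrite Rabs_R0|rewrite Rabs_pos_eq]; lra. }
  assert (Pq : is_lim_seq q 0).
  { apply lim0_le with (fun N => / (d * d) * n2 (lsub (hank w (hank w (v N))) (lscal (RtoC (X j)) (v N)))); [|apply lim_scal0; auto].
    intro N. split.
    - apply Series_pos; auto. intro k. destruct Nat.eq_dec; [lra | apply Cnorm2_ge0].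
    - set (y := lsub (hank w (hank w (v N))) (lscal (RtoC (X j)) (v N))).
      assert (yk : forall k, ip y (e k) = (RtoC (X k - X j) * ip (v N) (e k))%C).
      { intro k. unfold y. rewrite ip_sub_l, hank_sqr_sym, (sd_sqr _ _ _ D), ip_scal_r, ip_scal_l, Cconj_R, RtoC_minus. unfold X. ring. }
      apply Rle_trans with (Series (fun k => / (d * d) * Cnorm2 (ip y (e k)))).
      + apply Series_le'; auto; [|apply ex_series_scal_R, bessel_ex, He].
        intro k. rewrite yk, Cnorm2_mult, Cnorm2_RtoC. pose proof (Cnorm2_ge0 (ip (v N) (e k))) as C0.
        destruct Nat.eq_dec as [->|Nk].
        * rewrite Rminus_diag. lra.
        * specialize (Id k Nk). assert (d * d <= (X k - X j) * (X k - X j)).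
          { replace ((X k - X j) * (X k - X j)) with (Rabs (X k - X j) * Rabs (X k - X j)) by (rewrite <- Rabs_mult; apply Rabs_pos_eq, Rle_0_sqr).
            apply Rmult_le_compat; lra. }
          apply Rmult_le_reg_l with (d * d); [nra|].
          replace (d * d * (/ (d * d) * ((X k - X j) * (X k - X j) * Cnorm2 (ip (v N) (e k))))) with ((X k - X j) * (X k - X j) * Cnorm2 (ip (v N) (e k))) by (field; lra).
          apply Rmult_le_compat_r; auto.
      + rewrite Series_scal_l. apply Rmult_le_compat_l; [apply Rlt_le, Rinv_0_lt_compat; nra|].
        apply (ex_series_bdd _ (n2 y)); [intro; apply Cnorm2_ge0 | intro; apply bessel, He]. }
  assert (Xp : 0 < X j) by apply (sd_pos _ _ _ D).
  (* The system [e] spans only the closed range of H_w, so the other coordinates say nothing about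
     the part of [v N] in the kernel; this limit does. *)
  assert (Hn : is_lim_seq (fun N => n2 (hank w (v N))) (X j)).
  { assert (Z : slim (fun N => lsub (hank w (v N)) (hank (wN N) (v N))) lzero) by (apply slim0_of; auto; intro; apply n2_ge0).
    apply lim_eps. intros eps he.
    assert (B : is_lim_seq (fun N => nrm (hank w (v N))) (sqrt (X j))).
    { pose proof (clim_cont_sqrt _ _ P1) as Q1. rewrite sqrt_0 in Q1. pose proof (clim_cont_sqrt _ _ XN) as Q2.
      assert (E : forall N, nrm (hank (wN N) (v N)) = sqrt (Cnorm2 (cN N j))).
      { intro N. unfold nrm, v. rewrite (sd_eig _ _ _ (DN N)), n2_scal. fold (v N). rewrite nv, Rmult_1_r; auto. }
      apply is_lim_seq_le_le with (fun N => sqrt (Cnorm2 (cN N j)) - nrm (lsub (hank w (v N)) (hank (wN N) (v N))))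
        (fun N => sqrt (Cnorm2 (cN N j)) + nrm (lsub (hank w (v N)) (hank (wN N) (v N)))).
      - intro N. rewrite <- E. split.
        + pose proof (nrm_triang_sub (hank w (v N)) (lsub (hank w (v N)) (hank (wN N) (v N)))) as T.
          replace (lsub (hank w (v N)) (lsub (hank w (v N)) (hank (wN N) (v N)))) with (hank (wN N) (v N)) in T by vec. lra.
        + pose proof (nrm_triang (hank (wN N) (v N)) (lsub (hank w (v N)) (hank (wN N) (v N)))) as T.
          replace (ladd (hank (wN N) (v N)) (lsub (hank w (v N)) (hank (wN N) (v N)))) with (hank w (v N)) in T by vec. lra.
      - replace (Finite (sqrt (X j))) with (Finite (sqrt (X j) - 0)) by (f_equal; ring). apply is_lim_seq_minus'; auto.
      - replace (Finite (sqrt (X j))) with (Finite (sqrt (X j) + 0)) by (f_equal; ring). apply is_lim_seq_plus'; auto. }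
    pose proof (is_lim_seq_mult' _ _ _ _ B B) as B2. rewrite sqrt_sqrt in B2 by lra.
    destruct (proj1 (lim_eps _ _) B2 eps he) as [N0 H0]. exists N0. intros N HN. rewrite <- nrm_sqr. apply H0; auto. }
  assert (tl : is_lim_seq (fun N => Cnorm2 (t N)) 1).
  { assert (E : forall N, X j * Cnorm2 (t N) <= n2 (hank w (v N)) <= X j * Cnorm2 (t N) + X O * q N).
    { intro N. pose proof (sd_hank_n2 _ _ _ D (v N)) as Q. split.
      - apply (is_series_ge_single _ _ j Q). intros; apply Rmult_le_pos; apply Cnorm2_ge0.
      - assert (Q2 : is_series (fun k => Cnorm2 (c k) * Cnorm2 (ip (v N) (e k)) + - X O * (if Nat.eq_dec k j then 0 else Cnorm2 (ip (v N) (e k))))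
                   (n2 (hank w (v N)) + - X O * q N)).
        { apply is_series_plus_R; auto. apply is_series_scal_R, Series_correct; auto. }
        apply (is_series_le_single _ _ j) in Q2.
        + cbv beta in Q2. destruct (Nat.eq_dec j j); [|congruence].
          change (n2 (hank w (v N)) + - X O * q N <= X j * Cnorm2 (t N) + - X O * 0) in Q2. lra.
        + intros k Hk. cbv beta. destruct Nat.eq_dec; [congruence|]. pose proof (Cnorm2_ge0 (ip (v N) (e k))).
          pose proof (xdec_le X (sd_dec _ _ _ D) O k ltac:(lia)).
          assert (0 <= (X O - X k) * Cnorm2 (ip (v N) (e k))) by (apply Rmult_le_pos; lra). unfold X in *. lra. }
    apply is_lim_seq_le_le with (fun N => (n2 (hank w (v N)) - X O * q N) / X j) (fun N => n2 (hank w (v N)) / X j).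
    - intro N. specialize (E N). split; apply Rmult_le_reg_r with (X j); auto; unfold Rdiv; rewrite Rmult_assoc, Rinv_l by lra; lra.
    - replace (Finite 1) with (Finite ((X j - X O * 0) / X j)) by (f_equal; field; lra).
      apply is_lim_seq_div'; [|apply is_lim_seq_const|lra]. apply is_lim_seq_minus'; auto. apply is_lim_seq_mult'; auto. apply is_lim_seq_const.
    - replace (Finite 1) with (Finite (X j / X j)) by (f_equal; field; lra).
      apply is_lim_seq_div'; [auto|apply is_lim_seq_const|lra]. }
  (* [v N] is asymptotically [t N *: e j]; the sign condition on [ip g] then forces [t N] to tend to 1. *)
  assert (rl : is_lim_seq (fun N => n2 (lsub (v N) (lscal (t N) (e j)))) 0).
  { apply is_lim_seq_ext with (fun N => 1 - Cnorm2 (t N)).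
    - intro N. rewrite n2_sub, n2_scal, nv, (sd_nrm _ _ _ D), ip_scal_r. fold (t N). unfold Cnorm2; simpl; ring.
    - replace (Finite 0) with (Finite (1 - 1)) by (f_equal; ring). apply is_lim_seq_minus'; auto. apply is_lim_seq_const. }
  assert (ge : clim (fun N => ip (gN N) (e j)) (RtoC r0)).
  { rewrite <- Er0. apply slim_ip; auto. apply slim_const. }
  assert (gr : clim (fun N => ip (gN N) (lsub (v N) (lscal (t N) (e j)))) (RtoC 0)).
  { apply clim_eq with (ip g lzero); [|apply ip_zero_r]. apply slim_ip; auto. apply slim0_of; auto. intro; apply n2_ge0. }
  assert (main : clim (fun N => ip (gN N) (v N) - Cconj (t N) * ip (gN N) (e j))%C (RtoC 0)).
  { apply clim_ext with (2 := gr). intro N. rewrite ip_sub_r, ip_scal_r. auto. }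
  assert (sl : is_lim_seq (fun N => snd (t N)) 0 /\ is_lim_seq (fun N => fst (t N)) 1).
  { set (p := fun N => fst (ip (gN N) (v N))).
    assert (Ep : forall N, ip (gN N) (v N) = RtoC (p N) /\ 0 < p N).
    { intro N. destruct (PN N) as (r & Hr & Er). unfold p, v. rewrite Er. auto. }
    assert (m2 : clim (fun N => RtoC (p N) - Cconj (t N) * RtoC r0)%C (RtoC 0)).
    { apply clim_ext with (fun N => (ip (gN N) (v N) - Cconj (t N) * ip (gN N) (e j)) + Cconj (t N) * (ip (gN N) (e j) - RtoC r0))%C.
      - intro N. rewrite (proj1 (Ep N)). ring.
      - apply clim_eq with (RtoC 0 + RtoC 0)%C; [|ring]. apply clim_plus; auto.
        apply clim_norm2_0. apply is_lim_seq_ext with (fun N => Cnorm2 (t N) * Cnorm2 (ip (gN N) (e j) - RtoC r0)%C).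
        { intro N. rewrite Cnorm2_mult, Cnorm2_conj; auto. }
        replace (Finite 0) with (Finite (1 * 0)) by (f_equal; ring). apply is_lim_seq_mult'; auto.
        apply clim_norm2_0. apply clim_eq with (RtoC r0 - RtoC r0)%C; [|ring]. apply clim_minus; auto. apply clim_const. }
    destruct m2 as [A B]. simpl in A, B.
    assert (S0 : is_lim_seq (fun N => snd (t N)) 0).
    { apply is_lim_seq_ext with (fun N => / r0 * (0 + - (fst (t N) * 0 + - snd (t N) * r0))); [intro; field; lra|]. apply lim_scal0; auto. }
    split; auto.
    assert (F2 : is_lim_seq (fun N => fst (t N) * fst (t N)) 1).
    { apply is_lim_seq_ext with (fun N => Cnorm2 (t N) - snd (t N) * snd (t N)); [intro; unfold Cnorm2; ring|].
      replace (Finite 1) with (Finite (1 - 0 * 0)) by (f_equal; ring). apply is_lim_seq_minus'; auto. apply is_lim_seq_mult'; auto. }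
    assert (F3 : is_lim_seq (fun N => Rabs (fst (t N))) 1).
    { apply clim_cont_sqrt in F2. rewrite sqrt_1 in F2. apply is_lim_seq_ext with (2 := F2). intro N. apply sqrt_Rsqr_abs. }
    rewrite lim_eps in A, F3 |- *. intros eps he.
    destruct (A (r0 / 2)) as [N1 H1]; [lra|]. destruct (F3 (Rmin eps (/2))) as [N2 H2]; [apply Rmin_glb_lt; lra|].
    exists (N1 + N2)%nat. intros N HN. specialize (H1 N ltac:(lia)). specialize (H2 N ltac:(lia)).
    assert (H3 := Rlt_le_trans _ _ _ H2 (Rmin_l _ _)). assert (H4 := Rlt_le_trans _ _ _ H2 (Rmin_r _ _)).
    destruct (Ep N) as [_ Pp].
    assert (0 < fst (t N)).
    { apply Rabs_def2 in H1. apply Rabs_def2 in H4. destruct (Rlt_le_dec 0 (fst (t N))) as [|Q]; auto. exfalso.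
      rewrite Rabs_left1 in H4 by auto. assert (fst (t N) * r0 <= - (/ 2) * r0) by (apply Rmult_le_compat_r; lra). lra. }
    rewrite (Rabs_pos_eq (fst (t N))) in H3 by lra. auto. }
  assert (Sv : slim v (e j)).
  { unfold slim. apply is_lim_seq_ext with (fun N => 2 - 2 * fst (t N)).
    - intro N. rewrite n2_sub, nv, (sd_nrm _ _ _ D). unfold t. ring.
    - replace (Finite 0) with (Finite (2 - 2 * 1)) by (f_equal; ring). apply is_lim_seq_minus'; [apply is_lim_seq_const|].
      apply is_lim_seq_mult'; [apply is_lim_seq_const | apply sl]. }
  split; auto.
  assert (Ec : forall w c e, SD w c e -> c j = ip (hank w (e j)) (e j)).
  { clear. intros w c e D. rewrite (sd_eig _ _ _ D), ip_scal_l, ip_self, (sd_nrm _ _ _ D). ring. }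
  rewrite (Ec _ _ _ D). apply clim_ext with (fun N => ip (ladd (hank w (v N)) (lscal (RtoC (-1)) (lsub (hank w (v N)) (hank (wN N) (v N))))) (v N)).
  { intro N. rewrite (Ec _ _ _ (DN N)). fold (v N). f_equal. vec. }
  apply slim_ip; auto.
  replace (hank w (e j)) with (ladd (hank w (e j)) (lscal (RtoC (-1)) lzero)) by vec.
  apply slim_add; [apply slim_hank; auto|].
  unfold slim. apply is_lim_seq_ext with (2 := P1). intro N. rewrite <- (Rmult_1_l (n2 _)).
  replace 1 with (Cnorm2 (RtoC (-1))) by (rewrite Cnorm2_RtoC; ring). rewrite <- n2_scal. f_equal. vec.
Qed.

Lemma hw_ex (u : h12) : ex_series (fun k => Cnorm2 (RtoC (sqrt (1 + INR k)) * u k)%C).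
Proof.
  apply ex_series_ext with (2 := h12_ex u). intro k. rewrite Cnorm2_mult, Cnorm2_RtoC, sqrt_sqrt; auto.
  pose proof (weight_ge1 k); lra.
Qed.
(** An isometry from the H^{1/2} norm to the norm of l^2, which transports the triangle inequality
    and the continuity of norms. *)
Definition hw (u : h12) : l2 := mkl2 _ (hw_ex u).

Lemma hw_k u k : hw u k = (RtoC (sqrt (1 + INR k)) * u k)%C.
Proof. exact (lval_mkl2 _ _ _). Qed.

Lemma n2_hw u : n2 (hw u) = hs u.
Proof.
  rewrite n2_Series. apply Series_ext. intro k. rewrite hw_k, Cnorm2_mult, Cnorm2_RtoC, sqrt_sqrt; auto.
  pose proof (weight_ge1 k); lra.
Qed.

Lemma hw_hsub u v : hw (hsub u v) = lsub (hw u) (hw v).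
Proof. apply l2_ext; intro k. rewrite lsub_k, !hw_k, hsub_k. ring. Qed.

Lemma hs_lim (uN : nat -> h12) u : is_lim_seq (fun N => hs (hsub (uN N) u)) 0 -> is_lim_seq (fun N => hs (uN N)) (hs u).
Proof.
  intro L. assert (S : slim (fun N => hw (uN N)) (hw u)).
  { apply is_lim_seq_ext with (2 := L). intro N. rewrite <- n2_hw, hw_hsub; auto. }
  apply slim_n2 in S. rewrite n2_hw in S. apply is_lim_seq_ext with (2 := S). intro; apply n2_hw.
Qed.

Lemma n2_le_hs (u : h12) : n2 u <= hs u.
Proof.
  rewrite n2_Series. apply Series_le; [|apply h12_ex]. intro k.
  pose proof (Cnorm2_ge0 (u k)). pose proof (weight_ge1 k). nra.
Qed.

Lemma lsub_hsub (u v : h12) : lsub u v = hsub u v.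
Proof. apply l2_ext; intro k. rewrite lsub_k, hsub_k; auto. Qed.

Lemma hshift_hsub u v : hshift (hsub u v) = hsub (hshift u) (hshift v).
Proof. apply h12_ext; intro k. rewrite hshift_k, !hsub_k, !hshift_k; auto. Qed.

(** Coordinatewise limits come from [eigenvector_lim], used for K_u with the shifted symbols but the
    unshifted test vector [u]; the traces give convergence of the l^2 norms. *)
Theorem forward_limit (uN : nat -> h12) zN gN eN fN aN bN u z g e f al be :
  (forall N, chiD (uN N) (zN N) (gN N) (eN N) (fN N) (aN N) (bN N)) -> chiD u z g e f al be ->
  is_lim_seq (fun N => hs (hsub (uN N) u)) 0 ->
  is_lim_seq (fun N => Series (fun j => Cnorm2 (zN N j - z j)%C) + Series (fun j => Cnorm2 (gN N j - g j)%C)) 0.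
Proof.
  intros DN D L.
  assert (Lu : slim (fun N => hl (uN N)) u).
  { apply lim0_le with (2 := L). intro N. split; [apply n2_ge0|]. rewrite lsub_hsub. apply n2_le_hs. }
  assert (Ls : is_lim_seq (fun N => hs (hsub (hshift (uN N)) (hshift u))) 0).
  { apply lim0_le with (2 := L). intro N. split; [apply hs_ge0|].
    rewrite <- hshift_hsub, hs_shift. pose proof (n2_ge0 (hsub (uN N) u)). lra. }
  assert (Hz : forall j, clim (fun N => zN N j) (z j)).
  { intro j. destruct (eigenvector_lim uN u (fun N j => Cconj (zN N j)) (fun j => Cconj (z j)) eN e (fun N => hl (uN N)) u j) as [_ Q]; auto.
    - intro; apply (cd_e _ _ _ _ _ _ _ (DN N)).
    - apply (cd_e _ _ _ _ _ _ _ D).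
    - intro N. exists (aN N j). split; [apply (cd_al _ _ _ _ _ _ _ (DN N)) | apply (cd_ue _ _ _ _ _ _ _ (DN N))].
    - exists (al j). split; [apply (cd_al _ _ _ _ _ _ _ D) | apply (cd_ue _ _ _ _ _ _ _ D)].
    - apply clim_conj in Q. rewrite Cconj_conj in Q. apply clim_ext with (2 := Q). intro; apply Cconj_conj. }
  assert (Hg : forall j, clim (fun N => gN N j) (g j)).
  { intro j. apply (eigenvector_lim (fun N => hshift (uN N)) (hshift u) gN g fN f (fun N => hl (uN N)) u j); auto.
    - intro; apply (cd_f _ _ _ _ _ _ _ (DN N)).
    - apply (cd_f _ _ _ _ _ _ _ D).
    - intro N. exists (bN N j). split; [apply (cd_be _ _ _ _ _ _ _ (DN N)) | apply (cd_uf _ _ _ _ _ _ _ (DN N))].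
    - exists (be j). split; [apply (cd_be _ _ _ _ _ _ _ D) | apply (cd_uf _ _ _ _ _ _ _ D)]. }
  assert (Tz : forall u z g e f al be, chiD u z g e f al be -> is_series (fun j => 1 * Cnorm2 (z j)) (hs u)).
  { clear. intros u z g e f al be D. apply is_series_ext_R with (2 := sd_trace _ _ _ (cd_e _ _ _ _ _ _ _ D)).
    intro; rewrite Cnorm2_conj. ring. }
  assert (Tg : forall u z g e f al be, chiD u z g e f al be -> is_series (fun j => 1 * Cnorm2 (g j)) (hs (hshift u))).
  { clear. intros u z g e f al be D. apply is_series_ext_R with (2 := sd_trace _ _ _ (cd_f _ _ _ _ _ _ _ D)).
    intro; ring. }
  assert (one : forall h : nat -> R, Series (fun j => 1 * h j) = Series h) by (intro h; apply Series_ext; intro; ring).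
  replace (Finite 0) with (Finite (0 + 0)) by (f_equal; ring).
  apply is_lim_seq_plus'.
  - apply is_lim_seq_ext with (fun N => Series (fun j => 1 * Cnorm2 (zN N j - z j)%C)); [intro; apply one|].
    apply scheffe_l2; auto.
    + intro; lra.
    + intro N. eexists; apply (Tz _ _ _ _ _ _ _ (DN N)).
    + eexists; apply (Tz _ _ _ _ _ _ _ D).
    + rewrite (is_series_unique _ _ (Tz _ _ _ _ _ _ _ D)). apply is_lim_seq_ext with (2 := hs_lim uN u L).
      intro N. rewrite (is_series_unique _ _ (Tz _ _ _ _ _ _ _ (DN N))); auto.
  - apply is_lim_seq_ext with (fun N => Series (fun j => 1 * Cnorm2 (gN N j - g j)%C)); [intro; apply one|].
    apply scheffe_l2; auto.
    + intro; lra.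
    + intro N. eexists; apply (Tg _ _ _ _ _ _ _ (DN N)).
    + eexists; apply (Tg _ _ _ _ _ _ _ D).
    + rewrite (is_series_unique _ _ (Tg _ _ _ _ _ _ _ D)). apply is_lim_seq_ext with (2 := hs_lim (fun N => hshift (uN N)) (hshift u) Ls).
      intro N. rewrite (is_series_unique _ _ (Tg _ _ _ _ _ _ _ (DN N))); auto.
Qed.

(** * Diagonal operators, moments and summable tails *)

Lemma ex_series_ext_R (f g : nat -> R) : (forall k, f k = g k) -> ex_series f -> ex_series g.
Proof. intros. apply ex_series_ext with f; auto. Qed.

(** The value [lzero] on sequences that are not square summable makes it total, so that operators
    can be written as formulas before they are proved bounded. *)
Definition to_l2 (h : nat -> C) : l2 :=
  match excluded_middle_informative (ex_series (fun k => Cnorm2 (h k))) with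
  | left H => mkl2 h H
  | right _ => lzero
  end.

Lemma to_l2_k h k : ex_series (fun k => Cnorm2 (h k)) -> to_l2 h k = h k.
Proof. intro H. unfold to_l2. destruct excluded_middle_informative; [exact (lval_mkl2 _ _ _) | contradiction]. Qed.

Lemma n2_to_l2 h : ex_series (fun k => Cnorm2 (h k)) -> n2 (to_l2 h) = Series (fun k => Cnorm2 (h k)).
Proof. intro H. rewrite n2_Series. apply Series_ext. intro; rewrite to_l2_k; auto. Qed.

Definition cbounded (d : nat -> C) := exists M, forall k, Cnorm2 (d k) <= M.
Definition dg (d : nat -> C) (v : l2) : l2 := to_l2 (fun k => d k * v k)%C.

Lemma bounded_mul_ex d (v : nat -> C) : cbounded d -> ex_series (fun k => Cnorm2 (v k)) -> ex_series (fun k => Cnorm2 (d k * v k)%C).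
Proof.
  intros [M HM] E. apply ex_series_le' with (fun k => M * Cnorm2 (v k)); [|apply ex_series_scal_R; auto].
  intro k. rewrite Rabs_pos_eq, Cnorm2_mult by apply Cnorm2_ge0. apply Rmult_le_compat_r; [apply Cnorm2_ge0 | auto].
Qed.

Lemma dg_k d v k : cbounded d -> dg d v k = (d k * v k)%C.
Proof. intro B. apply (to_l2_k (fun k => d k * v k)%C). apply bounded_mul_ex; auto. apply l2_ex. Qed.

Lemma ip_coord_ext (x y x' y' : l2) : (forall k, x k * Cconj (y k) = x' k * Cconj (y' k))%C -> ip x y = ip x' y'.
Proof.
  intro H. apply clim_unique with (1 := ip_lim x y). apply clim_ext with (2 := ip_lim x' y').
  intro n. apply csum_ext. intros k _. rewrite H; auto.
Qed.

Lemma n2_dg_le d v M : (forall k, Cnorm2 (d k) <= M) -> n2 (dg d v) <= M * n2 v.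
Proof.
  intro B. assert (Bd : cbounded d) by (exists M; auto).
  rewrite !n2_Series, <- Series_scal_l. apply Series_le'.
  - intro k. rewrite dg_k, Cnorm2_mult by auto. apply Rmult_le_compat_r; [apply Cnorm2_ge0 | auto].
  - apply l2_ex.
  - apply ex_series_scal_R, l2_ex.
Qed.

(** Once the coefficients before [j] vanish, dividing by [x j ^ k] and letting k grow leaves only
    [c j], since [x i / x j < 1] for i > j. *)
Lemma moments_zero (x c : nat -> R) : (forall j, 0 < x j) -> (forall j, x (S j) < x j) ->
  ex_series (fun j => Rabs (c j)) -> (forall k, is_series (fun j => x j ^ k * c j) 0) -> forall j, c j = 0.
Proof.
  intros P D E M j. induction j as [j IH] using lt_wf_ind.
  destruct (dominated_series (fun k i => (x i / x j) ^ k * c i) (fun _ i => Rabs (c i))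
    (fun i => if Nat.eq_dec i j then c j else 0) (fun i => Rabs (c i))) as [_ L]; auto.
  - intro i. destruct (lt_eq_lt_dec i j) as [[Q|Q]|Q].
    + destruct Nat.eq_dec; [lia|]. rewrite (IH i Q). apply is_lim_seq_ext with (fun _ => 0); [intro; ring | apply is_lim_seq_const].
    + destruct Nat.eq_dec; [|lia]. subst i. apply is_lim_seq_ext with (fun _ => c j); [|apply is_lim_seq_const].
      intro k. unfold Rdiv. rewrite Rinv_r, pow1 by (specialize (P j); lra). ring.
    + destruct Nat.eq_dec; [lia|]. apply is_lim_seq_ext with (fun k => c i * (x i / x j) ^ k); [intro; ring|].
      apply lim_scal0. apply is_lim_seq_geom. rewrite Rabs_pos_eq by (apply Rlt_le, Rdiv_lt_0_compat; auto).
      apply Rmult_lt_reg_r with (x j); auto. unfold Rdiv. rewrite Rmult_assoc, Rinv_l by (specialize (P j); lra).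
      pose proof (xdec_lt x D j i Q). lra.
  - intro i. apply is_lim_seq_const.
  - intros k i. destruct (lt_dec i j) as [Q|Q]; [rewrite (IH i Q), Rmult_0_r; apply Rle_refl|].
    rewrite Rabs_mult. rewrite <- (Rmult_1_l (Rabs (c i))) at 2. apply Rmult_le_compat_r; [apply Rabs_pos|].
    assert (0 < x i / x j) by (apply Rdiv_lt_0_compat; auto).
    rewrite Rabs_pos_eq by (apply pow_le; lra). rewrite <- (pow1 k). apply pow_incr. split; [lra|].
    apply Rmult_le_reg_r with (x j); auto. unfold Rdiv. rewrite Rmult_assoc, Rinv_l by (specialize (P j); lra).
    pose proof (xdec_le x D j i ltac:(lia)). lra.
  - apply is_lim_seq_const.
  - assert (Z : forall k, Series (fun i => (x i / x j) ^ k * c i) = 0).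
    { intro k. apply is_series_unique. replace 0 with ((/ x j) ^ k * 0) by ring.
      apply is_series_ext_R with (fun i => (/ x j) ^ k * (x i ^ k * c i)).
      - intro i. unfold Rdiv. rewrite Rpow_mult_distr. ring.
      - apply is_series_scal_R, M. }
    apply (is_lim_seq_ext _ (fun _ => 0) _ Z) in L.
    pose proof (Series_single (fun i => if Nat.eq_dec i j then c j else 0) j) as Q. simpl in Q.
    rewrite (is_series_unique _ (c j)) in L.
    + apply is_lim_seq_unique in L. rewrite Lim_seq_const in L. injection L; auto.
    + destruct (Nat.eq_dec j j) in Q; [|congruence]. apply Q. intros i Hi. destruct Nat.eq_dec; [congruence|auto].
Qed.

Lemma ip_abs_ex (x y : l2) : ex_series (fun k => Rabs (fst (x k * Cconj (y k))%C)) /\ ex_series (fun k => Rabs (snd (x k * Cconj (y k))%C)).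
Proof.
  split; apply ex_series_le' with (fun k => Cnorm2 (x k) + Cnorm2 (y k));
    try (apply (ex_series_plus (V := R_NormedModule)); apply l2_ex);
    intro k; rewrite Rabs_Rabsolu; unfold Cnorm2; simpl; destruct (x k) as [a b], (y k) as [c d]; simpl;
    pose proof (Rle_0_sqr (a - c)); pose proof (Rle_0_sqr (a + c)); pose proof (Rle_0_sqr (b - d));
    pose proof (Rle_0_sqr (b + d)); pose proof (Rle_0_sqr (a - d)); pose proof (Rle_0_sqr (a + d)); pose proof (Rle_0_sqr (b - c));
    pose proof (Rle_0_sqr (b + c)); unfold Rsqr in *; apply Rabs_le; split; lra.
Qed.

(** Converse of [sum_tails]. On partial sums: the first K tails, cut at K, contain each coefficient
    of index k < K exactly 1 + k times. *)
Lemma h12_of_tails (u : l2) : ex_series (fun n => n2 (shn n u)) -> ex_series (fun k => (1 + INR k) * Cnorm2 (u k)).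
Proof.
  intro E. set (c := fun k => Cnorm2 (u k)).
  apply (ex_series_bdd _ (Series (fun n => n2 (shn n u)))).
  - intro k. apply Rmult_le_pos; [pose proof (weight_ge1 k); lra | apply Cnorm2_ge0].
  - intro K. eapply Rle_trans; [|apply (psum_le_Series (fun n => n2 (shn n u)) K); auto; intro; apply n2_ge0].
    assert (Q : forall K, psum (fun k => (1 + INR k) * c k) K = psum (fun n => psum c K - psum c n) K).
    { clear. induction K as [|K IH]; simpl; auto. rewrite IH.
      rewrite (psum_ext (fun n => psum c K + c K - psum c n) (fun n => (psum c K - psum c n) + c K)) by (intros; ring).
      rewrite psum_plus. assert (N : forall m r, psum (fun _ => r) m = INR m * r).
      { intros m r. induction m as [|m IHm]; [simpl; ring|]. rewrite S_INR. simpl psum. rewrite IHm. ring. }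
      rewrite N. ring. }
    rewrite Q. apply psum_le. intros n Hn. rewrite n2_Series.
    destruct (Series_split c n (l2_ex u)) as [S1 _].
    rewrite (Series_ext (fun k => Cnorm2 (shn n u k)) (fun k => c (n + k)%nat)) by (intro; rewrite shn_k; auto).
    pose proof (psum_le_Series c K (fun k => Cnorm2_ge0 _) (l2_ex u)). lra.
Qed.

(** * Unimodular multipliers and derivatives in norm *)

Definition expi (th : R) : C := (cos th, sin th).

Lemma expi_norm2 th : Cnorm2 (expi th) = 1.
Proof. unfold Cnorm2, expi; simpl. pose proof (sin2_cos2 th). unfold Rsqr in *. lra. Qed.

Lemma expi_conj th : Cconj (expi th) = expi (- th).
Proof. unfold expi, Cconj; simpl. rewrite cos_neg, sin_neg; auto. Qed.

Lemma expi_add s t : expi (s + t) = (expi s * expi t)%C.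
Proof. unfold expi. apply injective_projections; simpl; [rewrite cos_plus | rewrite sin_plus]; ring. Qed.

Lemma expi_0 : expi 0 = RtoC 1.
Proof. unfold expi. rewrite cos_0, sin_0; auto. Qed.

Lemma sin_abs_le th : Rabs (sin th) <= Rabs th.
Proof.
  assert (P : forall t, 0 <= t -> - t <= sin t <= t).
  { intros t Ht. destruct (Rle_lt_dec t 1) as [L|L].
    - destruct (Req_dec t 0) as [->|N]; [rewrite sin_0; lra|].
      pose proof (sin_lt_x t ltac:(lra)). pose proof (sin_gt_0 t ltac:(lra) ltac:(pose proof PI2_1; lra)). lra.
    - pose proof (SIN_bound t). lra. }
  destruct (Rle_lt_dec 0 th) as [L|L].
  - rewrite (Rabs_pos_eq th) by auto. apply Rabs_le. apply P; auto.
  - rewrite (Rabs_left th) by auto. specialize (P (- th) ltac:(lra)). rewrite sin_neg in P. apply Rabs_le. lra.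
Qed.

Lemma expi_lip th : Cnorm2 (expi th - RtoC 1)%C <= th * th.
Proof.
  replace (Cnorm2 (expi th - RtoC 1)%C) with (4 * (sin (th / 2) * sin (th / 2))).
  - pose proof (sin_abs_le (th / 2)) as S. apply (Rmult_le_compat _ _ _ _ (Rabs_pos _) (Rabs_pos _) S) in S.
    rewrite <- !Rabs_mult, !Rabs_pos_eq in S by apply Rle_0_sqr. lra.
  - unfold Cnorm2, expi; simpl. pose proof (sin2_cos2 th) as E. unfold Rsqr in E.
    assert (C : cos th = 1 - 2 * sin (th / 2) * sin (th / 2)) by (rewrite <- cos_2a_sin; f_equal; field).
    replace ((cos th + - (1)) * (cos th + - (1)) + (sin th + - 0) * (sin th + - 0)) with (sin th * sin th + cos th * cos th + 1 - 2 * cos th) by ring.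
    rewrite E, C. ring.
Qed.

Lemma sin_sub_le th : Rabs (sin th - th) <= th * th.
Proof.
  assert (P : forall t, 0 < t -> Rabs (sin t - t) <= t * t).
  { intros t Ht. destruct (MVT_cor2 sin cos 0 t Ht) as (c & E & Hc); [intros; apply derivable_pt_lim_sin|].
    rewrite sin_0, !Rminus_0_r in E. rewrite E.
    replace (cos c * t - t) with (- (t * (2 * (sin (c / 2) * sin (c / 2))))).
    - rewrite Rabs_Ropp, Rabs_mult, (Rabs_pos_eq t) by lra. apply Rmult_le_compat_l; [lra|].
      pose proof (sin_abs_le (c / 2)) as S. rewrite (Rabs_pos_eq (c / 2)) in S by lra.
      pose proof (SIN_bound (c / 2)) as B. rewrite Rabs_mult, (Rabs_pos_eq 2), Rabs_mult by lra.
      assert (Rabs (sin (c / 2)) <= 1) by (apply Rabs_le; lra). pose proof (Rabs_pos (sin (c / 2))). nra.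
    - assert (C : cos c = 1 - 2 * sin (c / 2) * sin (c / 2)) by (rewrite <- cos_2a_sin; f_equal; field). rewrite C. ring. }
  destruct (Rtotal_order th 0) as [L|[->|L]].
  - specialize (P (- th) ltac:(lra)). rewrite sin_neg in P. replace (sin th - th) with (- (- sin th - - th)) by ring.
    rewrite Rabs_Ropp. lra.
  - rewrite sin_0, Rminus_diag, Rabs_R0. lra.
  - apply P; auto.
Qed.

Lemma expi_taylor th : Cnorm2 (expi th - RtoC 1 - Ci * RtoC th)%C <= 2 * (th * th) * (th * th).
Proof.
  pose proof (sin_sub_le th) as S. pose proof (sin_abs_le (th / 2)) as S2.
  assert (C : cos th = 1 - 2 * sin (th / 2) * sin (th / 2)) by (rewrite <- cos_2a_sin; f_equal; field).
  apply (Rmult_le_compat _ _ _ _ (Rabs_pos _) (Rabs_pos _) S2) in S2.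
  rewrite <- !Rabs_mult, !Rabs_pos_eq in S2 by apply Rle_0_sqr.
  pose proof (Rmult_le_compat _ _ _ _ (Rabs_pos _) (Rabs_pos _) S S) as S3.
  rewrite <- Rabs_mult, Rabs_pos_eq in S3 by apply Rle_0_sqr.
  pose proof (Rle_0_sqr (sin (th / 2))) as P. pose proof (Rle_0_sqr th) as P2. unfold Rsqr in P, P2.
  assert (S4 : (cos th - 1) * (cos th - 1) <= th * th * (th * th)).
  { rewrite C. set (q := sin (th / 2) * sin (th / 2)) in *.
    replace ((1 - 2 * sin (th / 2) * sin (th / 2) - 1) * (1 - 2 * sin (th / 2) * sin (th / 2) - 1)) with ((2 * q) * (2 * q)) by (unfold q; ring).
    apply Rmult_le_compat; lra. }
  unfold Cnorm2, expi; simpl. lra.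
Qed.

Definition lderiv (p : R -> l2) (t : R) (d : l2) :=
  forall eps, 0 < eps -> exists del, 0 < del /\ forall h, Rabs h < del ->
    nrm (lsub (lsub (p (t + h)) (p t)) (lscal (RtoC h) d)) <= eps * Rabs h.

Lemma lderiv_bdd p t d (T : l2 -> l2) M : 0 <= M ->
  (forall v w, T (ladd v w) = ladd (T v) (T w)) -> (forall c v, T (lscal c v) = lscal c (T v)) ->
  (forall v, n2 (T v) <= M * n2 v) -> lderiv p t d -> lderiv (fun s => T (p s)) t (T d).
Proof.
  intros M0 A S B H eps he.
  assert (sM : 0 <= sqrt M) by apply sqrt_pos.
  destruct (H (eps / (sqrt M + 1))) as (del & Hd & K); [apply Rdiv_lt_0_compat; lra|].
  exists del. split; auto. intros h Hh. specialize (K h Hh).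
  assert (E : lsub (lsub (T (p (t + h))) (T (p t))) (lscal (RtoC h) (T d)) = T (lsub (lsub (p (t + h)) (p t)) (lscal (RtoC h) d))).
  { unfold lsub. rewrite !A, !S; auto. }
  rewrite E. unfold nrm at 1. eapply Rle_trans; [apply sqrt_le_1_alt, B|].
  rewrite sqrt_mult by (auto; apply n2_ge0). fold (nrm (lsub (lsub (p (t + h)) (p t)) (lscal (RtoC h) d))).
  eapply Rle_trans; [apply Rmult_le_compat_l; [auto | apply K]|].
  pose proof (Rabs_pos h). rewrite <- Rmult_assoc. apply Rmult_le_compat_r; auto.
  apply Rmult_le_reg_r with (sqrt M + 1); [lra|].
  replace (sqrt M * (eps / (sqrt M + 1)) * (sqrt M + 1)) with (sqrt M * eps) by (field; lra). nra.
Qed.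

Lemma lderiv_add p q t d e : lderiv p t d -> lderiv q t e -> lderiv (fun s => ladd (p s) (q s)) t (ladd d e).
Proof.
  intros P Q eps he. destruct (P (eps / 2)) as (d1 & H1 & K1); [lra|]. destruct (Q (eps / 2)) as (d2 & H2 & K2); [lra|].
  exists (Rmin d1 d2). split; [apply Rmin_glb_lt; auto|]. intros h Hh.
  specialize (K1 h (Rlt_le_trans _ _ _ Hh (Rmin_l _ _))). specialize (K2 h (Rlt_le_trans _ _ _ Hh (Rmin_r _ _))).
  replace (lsub (lsub (ladd (p (t + h)) (q (t + h))) (ladd (p t) (q t))) (lscal (RtoC h) (ladd d e)))
    with (ladd (lsub (lsub (p (t + h)) (p t)) (lscal (RtoC h) d)) (lsub (lsub (q (t + h)) (q t)) (lscal (RtoC h) e))) by vec.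
  eapply Rle_trans; [apply nrm_triang|]. lra.
Qed.

Lemma lderiv_const v t : lderiv (fun _ => v) t lzero.
Proof.
  intros eps he. exists 1. split; [lra|]. intros h _.
  replace (lsub (lsub v v) (lscal (RtoC h) lzero)) with lzero by vec.
  unfold nrm. rewrite n2_zero, sqrt_0. pose proof (Rabs_pos h). nra.
Qed.

Lemma lderiv_eq p t d e : lderiv p t d -> d = e -> lderiv p t e.
Proof. intros H <-; exact H. Qed.

Lemma lderiv_ext p q t d : (forall s, p s = q s) -> lderiv p t d -> lderiv q t d.
Proof. intros E H eps he. destruct (H eps he) as (del & Hd & K). exists del. split; auto. intros h Hh. rewrite <- !E. auto. Qed.

Lemma nrm_dg_le d v r : 0 <= r -> (forall k, Cnorm2 (d k) <= r * r) -> nrm (dg d v) <= r * nrm v.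
Proof.
  intros R B. unfold nrm. eapply Rle_trans; [apply sqrt_le_1_alt, (n2_dg_le d v (r * r) B)|].
  rewrite sqrt_mult, sqrt_square by (auto using n2_ge0; nra). lra.
Qed.

Lemma expi_bounded (d : nat -> R) t : cbounded (fun k => expi (d k * t)).
Proof. exists 1. intro k. rewrite expi_norm2. lra. Qed.

Lemma cbounded_RtoC (d : nat -> R) M : (forall k, Rabs (d k) <= M) -> cbounded (fun k => RtoC (d k)).
Proof.
  intro B. exists (M * M). intro k. rewrite Cnorm2_RtoC. specialize (B k).
  pose proof (Rmult_le_compat _ _ _ _ (Rabs_pos _) (Rabs_pos _) B B) as Q. rewrite <- Rabs_mult, Rabs_pos_eq in Q by apply Rle_0_sqr. auto.
Qed.

(** Boundedness of [d] makes the second-order remainder of the exponential uniform in the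
    coordinate, so the product rule holds in norm. *)
Lemma lderiv_expi (d : nat -> R) M p t dp : (forall k, Rabs (d k) <= M) -> lderiv p t dp ->
  lderiv (fun s => dg (fun k => expi (d k * s)) (p s)) t
    (ladd (dg (fun k => expi (d k * t)) dp) (lscal Ci (dg (fun k => RtoC (d k)) (dg (fun k => expi (d k * t)) (p t))))).
Proof.
  intros B H eps he.
  assert (M0 : 0 <= M) by (eapply Rle_trans; [apply Rabs_pos | apply (B O)]).
  assert (B2 : forall k, d k * d k <= M * M).
  { intro k. pose proof (Rmult_le_compat _ _ _ _ (Rabs_pos _) (Rabs_pos _) (B k) (B k)) as Q. rewrite <- Rabs_mult, Rabs_pos_eq in Q by apply Rle_0_sqr. auto. }
  pose proof (nrm_ge0 (p t)) as np. pose proof (nrm_ge0 dp) as nd.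
  set (Q := 2 * (M * M) * nrm (p t) + M * nrm dp + 1).
  assert (Q0 : 0 < Q) by (unfold Q; assert (0 <= M * M) by nra; assert (0 <= M * M * nrm (p t)) by (apply Rmult_le_pos; auto); assert (0 <= M * nrm dp) by (apply Rmult_le_pos; auto); lra).
  destruct (H (eps / 2)) as (del & Hd & K); [lra|].
  exists (Rmin del (eps / (2 * Q))). split; [apply Rmin_glb_lt; auto; apply Rdiv_lt_0_compat; lra|].
  intros h Hh. specialize (K h (Rlt_le_trans _ _ _ Hh (Rmin_l _ _))). assert (Hq := Rlt_le_trans _ _ _ Hh (Rmin_r _ _)).
  pose proof (Rabs_pos h) as h0.
  set (E := fun s => dg (fun k => expi (d k * s))).
  set (r := lsub (lsub (p (t + h)) (p t)) (lscal (RtoC h) dp)).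
  set (d1 := fun k => (expi (d k * h) - RtoC 1 - Ci * RtoC (d k * h))%C).
  set (d2 := fun k => (expi (d k * h) - RtoC 1)%C).
  assert (hh : h * h = Rabs h * Rabs h) by (rewrite <- Rabs_mult, Rabs_pos_eq; auto; apply Rle_0_sqr).
  assert (N1 : forall k, Cnorm2 (d1 k) <= (2 * (M * M) * (Rabs h * Rabs h)) * (2 * (M * M) * (Rabs h * Rabs h))).
  { intro k. eapply Rle_trans; [apply expi_taylor|]. rewrite <- hh.
    replace (d k * h * (d k * h)) with (d k * d k * (h * h)) by ring.
    assert (h2 : 0 <= h * h) by (apply Rle_0_sqr). specialize (B2 k). pose proof (Rle_0_sqr (d k)) as dk; unfold Rsqr in dk.
    assert (X : 0 <= d k * d k * (h * h) <= M * M * (h * h)) by (split; [apply Rmult_le_pos; auto | apply Rmult_le_compat_r; auto]).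
    assert (Y : d k * d k * (h * h) * (d k * d k * (h * h)) <= M * M * (h * h) * (M * M * (h * h))) by (apply Rmult_le_compat; apply X).
    assert (0 <= M * M * (h * h) * (M * M * (h * h))) by (apply Rle_0_sqr). lra. }
  assert (N2 : forall k, Cnorm2 (d2 k) <= (M * Rabs h) * (M * Rabs h)).
  { intro k. eapply Rle_trans; [apply expi_lip|]. replace (M * Rabs h * (M * Rabs h)) with (M * M * (Rabs h * Rabs h)) by ring.
    rewrite <- hh. replace (d k * h * (d k * h)) with (d k * d k * (h * h)) by ring. apply Rmult_le_compat_r; auto. apply Rle_0_sqr. }
  assert (C1 : cbounded d1) by (eexists; apply N1). assert (C2 : cbounded d2) by (eexists; apply N2).
  assert (C3 := cbounded_RtoC d M B).
  assert (nE : forall s v, nrm (E s v) <= nrm v).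
  { intros s v. rewrite <- (Rmult_1_l (nrm v)). apply nrm_dg_le; [lra|]. intro k. rewrite expi_norm2. lra. }
  (* The three remainders of the product rule: that of [p] under the new phase, the Taylor remainder
     [d1] acting on [p t], and the increment [d2] of the phase acting on [dp]. *)
  replace (lsub (lsub (dg (fun k => expi (d k * (t + h))) (p (t + h))) (dg (fun k => expi (d k * t)) (p t)))
    (lscal (RtoC h) (ladd (dg (fun k => expi (d k * t)) dp) (lscal Ci (dg (fun k => RtoC (d k)) (dg (fun k => expi (d k * t)) (p t)))))))
    with (ladd (E (t + h) r) (ladd (dg d1 (E t (p t))) (lscal (RtoC h) (dg d2 (E t dp))))).
  - eapply Rle_trans; [apply nrm_triang|].
    assert (T1 : nrm (E (t + h) r) <= eps / 2 * Rabs h) by (eapply Rle_trans; [apply nE | apply K]).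
    assert (T2 : nrm (dg d1 (E t (p t))) <= 2 * (M * M) * (Rabs h * Rabs h) * nrm (p t)).
    { eapply Rle_trans; [apply nrm_dg_le with (2 := N1)|]; [repeat apply Rmult_le_pos; auto; lra|].
      apply Rmult_le_compat_l; [repeat apply Rmult_le_pos; auto; lra | apply nE]. }
    assert (T3 : nrm (lscal (RtoC h) (dg d2 (E t dp))) <= Rabs h * (M * Rabs h * nrm dp)).
    { rewrite nrm_scal, Cmod_R. apply Rmult_le_compat_l; auto.
      eapply Rle_trans; [apply nrm_dg_le with (2 := N2)|]; [apply Rmult_le_pos; auto|].
      apply Rmult_le_compat_l; [apply Rmult_le_pos; auto | apply nE]. }
    pose proof (nrm_triang (dg d1 (E t (p t))) (lscal (RtoC h) (dg d2 (E t dp)))).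
    assert (T4 : Q * Rabs h <= eps / 2).
    { apply Rlt_le in Hq. apply Rmult_le_compat_l with (r := Q) in Hq; [|lra].
      replace (Q * (eps / (2 * Q))) with (eps / 2) in Hq by (field; lra). auto. }
    assert (T5 : Q * Rabs h * Rabs h <= eps / 2 * Rabs h) by (apply Rmult_le_compat_r; auto).
    assert (T6 : 2 * (M * M) * (Rabs h * Rabs h) * nrm (p t) + Rabs h * (M * Rabs h * nrm dp) <= Q * Rabs h * Rabs h).
    { unfold Q. assert (0 <= Rabs h * Rabs h) by (apply Rmult_le_pos; auto).
      replace ((2 * (M * M) * nrm (p t) + M * nrm dp + 1) * Rabs h * Rabs h) with (2 * (M * M) * (Rabs h * Rabs h) * nrm (p t) + Rabs h * (M * Rabs h * nrm dp) + Rabs h * Rabs h) by ring. lra. }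
    lra.
  - unfold E, r. apply l2_ext; intro k. assert (Ct := expi_bounded d t). assert (Ch := expi_bounded d (t + h)).
    repeat rewrite ?ladd_k, ?lsub_k, ?lscal_k, ?(dg_k _ _ _ C1), ?(dg_k _ _ _ C2), ?(dg_k _ _ _ C3), ?(dg_k _ _ _ Ct), ?(dg_k _ _ _ Ch).
    unfold d1, d2. rewrite Rmult_plus_distr_l, expi_add, RtoC_mult. ring.
Qed.

Lemma lderiv_ip p t d v : lderiv p t d -> Cderiv (fun s => ip v (p s)) t (ip v d).
Proof.
  intro H.
  assert (K : forall eps, 0 < eps -> exists del : posreal, forall h, h <> 0 -> Rabs h < del ->
    Cmod ((ip v (p (t + h)%R) - ip v (p t)) * RtoC (/ h)%R - ip v d)%C < eps).
  { intros eps he. pose proof (nrm_ge0 v) as nv.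
    destruct (H (eps / (2 * (nrm v + 1)))) as (del & Hd & K); [apply Rdiv_lt_0_compat; lra|].
    exists (mkposreal del Hd). simpl. intros h Nh Hh. specialize (K h Hh).
    assert (E : ((ip v (p (t + h)%R) - ip v (p t)) * RtoC (/ h)%R - ip v d)%C =
      (ip v (lsub (lsub (p (t + h)%R) (p t)) (lscal (RtoC h) d)) * RtoC (/ h)%R)%C).
    { rewrite !ip_sub_r, ip_scal_r, Cconj_R, RtoC_inv by auto. field. apply RtoC_neq; auto. }
    rewrite E, Cmod_mult, Cmod_R, Rabs_inv.
    assert (h0 : 0 < Rabs h) by (apply Rabs_pos_lt; auto).
    apply Rle_lt_trans with (nrm v * (eps / (2 * (nrm v + 1)) * Rabs h) * / Rabs h).
    - apply Rmult_le_compat_r; [apply Rlt_le, Rinv_0_lt_compat; auto|].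
      eapply Rle_trans; [apply Cmod_ip_le|]. apply Rmult_le_compat_l; auto.
    - replace (nrm v * (eps / (2 * (nrm v + 1)) * Rabs h) * / Rabs h) with (nrm v / (nrm v + 1) * (eps / 2)) by (field; lra).
      assert (nrm v / (nrm v + 1) <= 1) by (apply Rmult_le_reg_r with (nrm v + 1); [lra|]; unfold Rdiv; rewrite Rmult_assoc, Rinv_l; lra).
      assert (0 <= nrm v / (nrm v + 1)) by (apply Rmult_le_pos; auto; apply Rlt_le, Rinv_0_lt_compat; lra). nra. }
  split; intros eps he; destruct (K eps he) as [del Hdel]; exists del; intros h Nh Hh; specialize (Hdel h Nh Hh);
    (eapply Rle_lt_trans; [|apply Hdel]).
  - eapply Rle_trans; [|apply fst_le_Cmod]. right. f_equal. simpl. field; auto.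
  - eapply Rle_trans; [|apply (Rle_trans _ _ _ (Rmax_r _ _) (Rmax_Cmod _))]. right. f_equal. simpl. field; auto.
Qed.

(** * Uniqueness for the Szego equation *)

Lemma csum_cauchy_weighted (f : nat -> C) (s : nat -> R) n : (forall k, 0 < s k) ->
  Cnorm2 (csum f n) <= psum s n * psum (fun k => Cnorm2 (f k) / s k) n.
Proof.
  intro P. induction n as [|n IH]; [simpl; unfold Cnorm2; simpl; lra|].
  cbn [csum psum].
  set (S := psum s n) in *. set (T := psum (fun k => Cnorm2 (f k) / s k) n) in *.
  assert (S0 : 0 <= S) by (apply psum_pos; intros; apply Rlt_le; auto).
  assert (T0 : 0 <= T) by (apply psum_pos; intros; apply Rmult_le_pos; [apply Cnorm2_ge0 | apply Rlt_le, Rinv_0_lt_compat; auto]).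
  set (A := csum f n) in *. specialize (P n).
  rewrite <- !Cmod_sqr in *. set (al := Cmod A) in *. set (ph := Cmod (f n)).
  assert (a0 : 0 <= al) by apply Cmod_ge_0. assert (p0 : 0 <= ph) by apply Cmod_ge_0.
  assert (Tr : Cmod (A + f n) <= al + ph) by apply Cmod_triangle.
  apply Rle_trans with ((al + ph) * (al + ph)); [apply Rmult_le_compat; auto; apply Cmod_ge_0|].
  set (X := S * (ph * ph / s n)). set (Y := s n * T).
  assert (X0 : 0 <= X) by (apply Rmult_le_pos; auto; apply Rmult_le_pos; [nra | apply Rlt_le, Rinv_0_lt_compat; auto]).
  assert (Y0 : 0 <= Y) by (apply Rmult_le_pos; lra).
  assert (XY : X * Y = S * T * (ph * ph)) by (unfold X, Y; field; lra).
  assert (K : 2 * (al * ph) <= X + Y).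
  { apply Rsqr_incr_0_var; [|lra]. unfold Rsqr.
    assert (al * al * (ph * ph) <= X * Y) by (rewrite XY; apply Rmult_le_compat_r; [nra | auto]).
    pose proof (Rle_0_sqr (X - Y)) as Q. unfold Rsqr in Q. nra. }
  replace ((S + s n) * (T + ph * ph / s n)) with (S * T + X + Y + ph * ph) by (unfold X, Y; field; lra). nra.
Qed.

Definition harm := psum (fun k => / (1 + INR k)).

Lemma INR1_pos k : 0 < 1 + INR k.
Proof. pose proof (pos_INR k); lra. Qed.

Lemma harm_ge0 n : 0 <= harm n.
Proof. apply psum_pos. intros; apply Rlt_le, Rinv_0_lt_compat, INR1_pos. Qed.

(** Each dyadic block adds at most 1. *)
Lemma harm_pow2 m : harm (2 ^ m) <= 1 + INR m.
Proof.
  induction m as [|m IH]; [unfold harm; simpl; lra|].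
  assert (Q : forall n j, harm (n + j) <= harm n + INR j * / (1 + INR n)).
  { intros n j. induction j as [|j IHj]; [rewrite Nat.add_0_r; simpl; lra|].
    rewrite Nat.add_succ_r, S_INR. change (harm (S (n + j))) with (harm (n + j) + / (1 + INR (n + j))).
    assert (/ (1 + INR (n + j)) <= / (1 + INR n)) by (apply Rinv_le_contravar; [apply INR1_pos | rewrite plus_INR; pose proof (pos_INR j); lra]).
    lra. }
  rewrite Nat.pow_succ_r', S_INR. replace (2 * 2 ^ m)%nat with (2 ^ m + 2 ^ m)%nat by lia.
  specialize (Q (2 ^ m)%nat (2 ^ m)%nat). pose proof (INR1_pos (2 ^ m)).
  assert (INR (2 ^ m) * / (1 + INR (2 ^ m)) <= 1).
  { apply Rmult_le_reg_r with (1 + INR (2 ^ m)); auto. rewrite Rmult_assoc, Rinv_l; lra. }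
  lra.
Qed.

Lemma harm_sqrt n : harm n <= 2 * sqrt (INR n).
Proof.
  induction n as [|n IH]; [unfold harm; simpl; rewrite sqrt_0; lra|].
  change (harm (S n)) with (harm n + / (1 + INR n)). rewrite S_INR.
  set (a := INR n) in *. assert (a0 : 0 <= a) by apply pos_INR.
  assert (h : / (1 + a) <= 2 * (sqrt (a + 1) - sqrt a)); [|lra].
  pose proof (sqrt_pos a) as s0. assert (s1 : 1 <= sqrt (a + 1)) by (rewrite <- sqrt_1 at 1; apply sqrt_le_1_alt; lra).
  assert (e0 : sqrt a * sqrt a = a) by (apply sqrt_sqrt; auto). assert (e1 : sqrt (a + 1) * sqrt (a + 1) = a + 1) by (apply sqrt_sqrt; lra).
  assert (l : sqrt a <= sqrt (a + 1)) by (apply sqrt_le_1_alt; lra).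
  set (p := sqrt (a + 1)) in *. set (q := sqrt a) in *.
  apply Rmult_le_reg_r with (1 + a); [lra|]. rewrite Rinv_l by lra.
  replace (1 + a) with (p * p) by lra.
  assert (k : (p - q) * (p + q) = 1) by (ring_simplify; simpl; lra).
  assert (p + q <= 2 * p) by lra. assert (0 <= p - q) by lra.
  assert (1 <= (p - q) * (2 * p)) by (rewrite <- k; apply Rmult_le_compat_l; auto).
  assert ((p - q) * (2 * p) <= (p - q) * (2 * p) * p) by nra. lra.
Qed.

Lemma psum_rev f n : psum (fun p => f (n - p)%nat) (S n) = psum f (S n).
Proof.
  assert (Q : forall m k, psum (fun p => f (m + k - p)%nat) (S m) = psum (fun p => f (k + p)%nat) (S m)).
  { induction m as [|m IH]; intro k.
    - simpl. replace (k - 0)%nat with (k + 0)%nat by lia. auto.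
    - change (psum (fun p => f (S m + k - p)%nat) (S m) + f (S m + k - S m)%nat = psum (fun p => f (k + p)%nat) (S (S m))).
      assert (L : forall g n, psum g (S n) = g O + psum (fun i => g (S i)) n).
      { intros g n0. induction n0 as [|n0 IHn]; [simpl; ring|]. change (psum g (S (S n0))) with (psum g (S n0) + g (S n0)). rewrite IHn. simpl. ring. }
      rewrite (L (fun p => f (k + p)%nat)), (psum_ext _ (fun p => f (m + S k - p)%nat)), IH by (intros; f_equal; lia).
      replace (S m + k - S m)%nat with (k + 0)%nat by lia.
      rewrite (psum_ext (fun i => f (k + S i)%nat) (fun p => f (S k + p)%nat)) by (intros; f_equal; lia). ring. }
  specialize (Q n O). rewrite (psum_ext _ (fun p => f (n + 0 - p)%nat)), Q; [apply psum_ext; auto|].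
  intros; f_equal; lia.
Qed.

(** Partial fractions in p reduce the sum to 2 [harm (S n)] / (2 + n). The square root bound for
    [harm] is crude, but leaves the negative power of n that the frequency splitting needs. *)
Lemma kernel_bound n : psum (fun p => / ((1 + INR p) * (1 + INR (n - p)))) (S n) <= 4 / sqrt (1 + INR n).
Proof.
  assert (E : psum (fun p => / ((1 + INR p) * (1 + INR (n - p)))) (S n) = / (2 + INR n) * (2 * harm (S n))).
  { rewrite (psum_ext _ (fun p => / (2 + INR n) * (/ (1 + INR p) + / (1 + INR (n - p))))).
    - rewrite psum_scal, psum_plus, (psum_rev (fun p => / (1 + INR p))). unfold harm. ring.
    - intros p Hp. rewrite minus_INR by lia. assert (INR p <= INR n) by (apply le_INR; lia). pose proof (pos_INR p). field. lra. }
  rewrite E. pose proof (harm_sqrt (S n)) as H. rewrite S_INR in H. replace (INR n + 1) with (1 + INR n) in H by ring.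
  pose proof (INR1_pos n) as P. assert (s : 0 < sqrt (1 + INR n)) by (apply sqrt_lt_R0; auto).
  assert (e : sqrt (1 + INR n) * sqrt (1 + INR n) = 1 + INR n) by (apply sqrt_sqrt; lra).
  set (q := sqrt (1 + INR n)) in *. replace (2 + INR n) with (q * q + 1) by lra.
  apply Rmult_le_reg_r with (q * (q * q + 1)); [apply Rmult_lt_0_compat; nra|].
  replace (/ (q * q + 1) * (2 * harm (S n)) * (q * (q * q + 1))) with (2 * harm (S n) * q) by (field; nra).
  replace (4 / q * (q * (q * q + 1))) with (4 * (q * q + 1)) by (field; lra). nra.
Qed.

Definition cconv (a b : nat -> C) (n : nat) : C := csum (fun p => a p * b (n - p)%nat)%C (S n).

Lemma cauchy_product_le (A B : nat -> R) M : (forall k, 0 <= A k) -> (forall k, 0 <= B k) ->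
  psum (fun n => psum (fun p => A p * B (n - p)%nat) (S n)) M <= psum A M * psum B M.
Proof.
  intros HA HB.
  assert (E : forall n, (n < M)%nat -> psum (fun p => A p * B (n - p)%nat) (S n) = psum (fun p => A p * (if le_dec p n then B (n - p)%nat else 0)) M).
  { intros n Hn. assert (Q : forall m, (S n <= m)%nat -> psum (fun p => A p * B (n - p)%nat) (S n) = psum (fun p => A p * (if le_dec p n then B (n - p)%nat else 0)) m).
    { intros m Hm. induction Hm as [|m Hm IH].
      - apply psum_ext. intros k Hk. destruct le_dec; [auto|lia].
      - rewrite IH. cbn [psum]. destruct le_dec; [lia|ring]. }
    apply Q; lia. }
  rewrite (psum_ext _ _ _ E), (psum_swap (fun n p => A p * (if le_dec p n then B (n - p)%nat else 0))).
  rewrite (Rmult_comm (psum A M)), <- psum_scal. apply psum_le. intros p Hp.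
  rewrite psum_scal, Rmult_comm. apply Rmult_le_compat_r; auto.
  assert (Q : forall m, psum (fun n => if le_dec p n then B (n - p)%nat else 0) m = psum B (m - p)).
  { induction m as [|m IH]; auto. cbn [psum]. rewrite IH. destruct le_dec as [L|L].
    - replace (S m - p)%nat with (S (m - p)) by lia. auto.
    - replace (S m - p)%nat with (m - p)%nat by lia. ring. }
  rewrite Q. apply psum_le_n; auto. lia.
Qed.

(** Cauchy-Schwarz with the weights of both H^{1/2} norms. If the first factor starts at frequency
    [N], so does the product, and the kernel bound is used for n >= N only. *)
Lemma cconv_bound (a b : h12) N M : (forall p, (p < N)%nat -> a p = RtoC 0) ->
  psum (fun n => Cnorm2 (cconv a b n)) M <= 4 / sqrt (1 + INR N) * (hs a * hs b).
Proof.
  intro Z.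
  assert (sN : 0 < sqrt (1 + INR N)) by (apply sqrt_lt_R0, INR1_pos).
  set (A := fun p => (1 + INR p) * Cnorm2 (a p)). set (B := fun p => (1 + INR p) * Cnorm2 (b p)).
  assert (HA : forall k, 0 <= A k) by (intro; apply Rmult_le_pos; [apply Rlt_le, INR1_pos | apply Cnorm2_ge0]).
  assert (HB : forall k, 0 <= B k) by (intro; apply Rmult_le_pos; [apply Rlt_le, INR1_pos | apply Cnorm2_ge0]).
  assert (c4 : 0 <= 4 / sqrt (1 + INR N)) by (apply Rlt_le, Rdiv_lt_0_compat; lra).
  apply Rle_trans with (4 / sqrt (1 + INR N) * psum (fun n => psum (fun p => A p * B (n - p)%nat) (S n)) M).
  - rewrite <- psum_scal. apply psum_le. intros n _.
    assert (C0 : 0 <= psum (fun p => A p * B (n - p)%nat) (S n)) by (apply psum_pos; intros; apply Rmult_le_pos; auto).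
    destruct (lt_dec n N) as [L|L].
    + unfold cconv. rewrite (csum_ext _ (fun _ => RtoC 0 * RtoC 0)%C), csum_scal, Cmult_0_l.
      * replace (Cnorm2 (RtoC 0)) with 0 by (unfold Cnorm2; simpl; ring). apply Rmult_le_pos; auto.
      * intros p Hp. rewrite Z by lia. ring.
    + unfold cconv. eapply Rle_trans; [apply (csum_cauchy_weighted _ (fun p => / ((1 + INR p) * (1 + INR (n - p)))))|].
      * intro p. apply Rinv_0_lt_compat, Rmult_lt_0_compat; apply INR1_pos.
      * rewrite (psum_ext (fun k => Cnorm2 (a k * b (n - k)%nat)%C / / ((1 + INR k) * (1 + INR (n - k)))) (fun p => A p * B (n - p)%nat)).
        -- apply Rmult_le_compat_r; auto. eapply Rle_trans; [apply kernel_bound|].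
           unfold Rdiv. apply Rmult_le_compat_l; [lra|]. apply Rinv_le_contravar; auto.
           apply sqrt_le_1_alt, Rplus_le_compat_l, le_INR. lia.
        -- intros k _. rewrite Cnorm2_mult. unfold A, B. pose proof (INR1_pos k). pose proof (INR1_pos (n - k)). field. lra.
  - apply Rmult_le_compat_l; auto. eapply Rle_trans; [apply cauchy_product_le; auto|].
    apply Rmult_le_compat; try (apply psum_pos; auto); apply psum_le_Series; auto; apply h12_ex.
Qed.

Lemma cconv_ex (a b : h12) : ex_series (fun n => Cnorm2 (cconv a b n)).
Proof.
  apply (ex_series_bdd _ (4 / sqrt (1 + INR 0) * (hs a * hs b))); [intro; apply Cnorm2_ge0|].
  intro; apply cconv_bound; intros; lia.
Qed.
Definition conv (a b : h12) : l2 := mkl2 _ (cconv_ex a b).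
Lemma conv_k a b n : conv a b n = cconv a b n.
Proof. exact (lval_mkl2 _ _ _). Qed.

Lemma n2_conv_high (a b : h12) N : (forall p, (p < N)%nat -> a p = RtoC 0) ->
  n2 (conv a b) <= 4 / sqrt (1 + INR N) * (hs a * hs b).
Proof.
  intro Z. rewrite n2_Series, (Series_ext _ (fun n => Cnorm2 (cconv a b n))) by (intro; rewrite conv_k; auto).
  apply ex_series_bdd; [intro; apply Cnorm2_ge0 | intro; apply cconv_bound; auto].
Qed.

Lemma csum_rev f n : csum (fun p => f (n - p)%nat) (S n) = csum f (S n).
Proof.
  apply injective_projections; [rewrite !fst_csum, (psum_rev (fun k => fst (f k))) | rewrite !snd_csum, (psum_rev (fun k => snd (f k)))]; auto.
Qed.

Lemma conv_comm a b : conv a b = conv b a.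
Proof.
  apply l2_ext; intro n. rewrite !conv_k. unfold cconv. rewrite <- csum_rev. apply csum_ext.
  intros k Hk. replace (n - (n - k))%nat with k by lia. ring.
Qed.

(** Multiplication by z^p, the adjoint of [shn p]. *)
Definition tsh (p : nat) (v : l2) : l2 := to_l2 (fun n => if le_dec p n then v (n - p)%nat else RtoC 0).
Lemma tsh_ex p (v : l2) : is_series (fun n => Cnorm2 (if le_dec p n then v (n - p)%nat else RtoC 0)) (n2 v).
Proof.
  apply is_series_psum. rewrite n2_Series.
  apply is_lim_seq_ext with (fun m => psum (fun k => Cnorm2 (v k)) (m - p)).
  - induction n as [|m IH]; auto. cbn [psum]. rewrite <- IH. destruct le_dec as [L|L].
    + replace (S m - p)%nat with (S (m - p)) by lia. auto.
    + replace (S m - p)%nat with (m - p)%nat by lia. unfold Cnorm2; simpl; ring.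
  - pose proof (proj1 (is_series_psum _ _) (Series_correct _ (l2_ex v))) as L.
    rewrite lim_eps in L |- *. intros eps he. destruct (L eps he) as [N HN]. exists (N + p)%nat. intros n Hn. apply HN. lia.
Qed.
Lemma tsh_k p v n : tsh p v n = if le_dec p n then v (n - p)%nat else RtoC 0.
Proof. apply (to_l2_k (fun n => if le_dec p n then v (n - p)%nat else RtoC 0)). eexists; apply tsh_ex. Qed.
Lemma n2_tsh p v : n2 (tsh p v) = n2 v.
Proof. unfold tsh. rewrite n2_to_l2 by (eexists; apply tsh_ex). apply is_series_unique, tsh_ex. Qed.

Lemma ip_tsh p v w : ip (shn p v) w = ip v (tsh p w).
Proof.
  rewrite <- (Cconj_conj (ip (shn p v) w)), <- (Cconj_conj (ip v (tsh p w))). f_equal.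
  apply (functional_ext (fun w => Cconj (ip (shn p v) w)) (fun w => Cconj (ip v (tsh p w))) (n2 v)).
  - intros; rewrite ip_add_r, Cplus_conj; auto.
  - intros; rewrite ip_scal_r, Cmult_conj, Cconj_conj; auto.
  - intro q. rewrite Cnorm2_conj. eapply Rle_trans; [apply cauchy_schwarz|]. apply Rmult_le_compat_r; [apply n2_ge0|].
    rewrite !n2_Series. destruct (Series_split _ p (l2_ex v)) as [E _]. rewrite E.
    rewrite (Series_ext (fun k => Cnorm2 (shn p v k)) (fun k => Cnorm2 (v (p + k)%nat))) by (intro; rewrite shn_k; auto).
    assert (0 <= psum (fun k => Cnorm2 (v k)) p) by (apply psum_pos; intros; apply Cnorm2_ge0). lra.
  - intros a b. rewrite <- Cplus_conj, <- ip_add_r. f_equal. f_equal. apply l2_ext; intro n. rewrite ladd_k, !tsh_k, ladd_k. destruct le_dec; auto. ring.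
  - intros c a. replace (tsh p (lscal c a)) with (lscal c (tsh p a)).
    + rewrite ip_scal_r, Cmult_conj, Cconj_conj; auto.
    + apply l2_ext; intro n. rewrite lscal_k, !tsh_k, lscal_k. destruct le_dec; auto. ring.
  - intro q. rewrite Cnorm2_conj, <- (n2_tsh p q). apply cauchy_schwarz.
  - intro k. rewrite ip_delta, shn_k. f_equal. rewrite <- ip_delta. f_equal. apply l2_ext; intro n.
    rewrite tsh_k, !ldelta_k. destruct le_dec; repeat destruct Nat.eq_dec; auto; lia.
Qed.

Fixpoint vsum (f : nat -> l2) (n : nat) : l2 := match n with O => lzero | S k => ladd (vsum f k) (f k) end.
Lemma vsum_k f n k : vsum f n k = csum (fun i => f i k) n.
Proof. induction n as [|n IH]; simpl; [apply lzero_k | rewrite ladd_k, IH; auto]. Qed.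
Lemma ip_vsum_r f n v : ip v (vsum f n) = csum (fun i => ip v (f i)) n.
Proof. induction n as [|n IH]; simpl; [apply ip_zero_r | rewrite ip_add_r, IH; auto]. Qed.
Lemma ip_vsum_l f n v : ip (vsum f n) v = csum (fun i => ip (f i) v) n.
Proof. induction n as [|n IH]; simpl; [apply ip_zero_l | rewrite ip_add_l, IH; auto]. Qed.
Lemma nrm_vsum f n : nrm (vsum f n) <= psum (fun i => nrm (f i)) n.
Proof.
  induction n as [|n IH]; simpl; [unfold nrm; rewrite n2_zero, sqrt_0; lra|].
  eapply Rle_trans; [apply nrm_triang | lra].
Qed.

Lemma conv_low (a b : h12) N : (forall p, (N <= p)%nat -> a p = RtoC 0) ->
  conv a b = vsum (fun p => lscal (a p) (tsh p b)) N.
Proof.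
  intro Z. apply l2_ext; intro n. rewrite conv_k, vsum_k. unfold cconv.
  rewrite (csum_ext (fun i => lscal (a i) (tsh i b) n) (fun i => a i * (if le_dec i n then b (n - i)%nat else RtoC 0))%C)
    by (intros; rewrite lscal_k, tsh_k; auto).
  set (f := fun i => (a i * (if le_dec i n then b (n - i)%nat else RtoC 0))%C).
  rewrite (csum_ext _ f) by (intros k Hk; unfold f; destruct le_dec; [auto|lia]).
  assert (Q : forall m, (Nat.min (S n) N <= m)%nat -> csum f m = csum f (Nat.min (S n) N)).
  { intros m Hm. induction Hm as [|m Hm IH]; auto. cbn [csum]. rewrite IH. unfold f at 2.
    destruct le_dec; [rewrite Z by lia|]; ring. }
  rewrite (Q (S n)), (Q N); auto; lia.
Qed.

Lemma nrm_conv_low (a b : h12) N : (forall p, (N <= p)%nat -> a p = RtoC 0) ->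
  nrm (conv a b) <= psum (fun p => Cmod (a p)) N * nrm b.
Proof.
  intro Z. rewrite (conv_low a b N Z). eapply Rle_trans; [apply nrm_vsum|].
  rewrite Rmult_comm, <- psum_scal. apply psum_le. intros k _. rewrite nrm_scal. unfold nrm. rewrite n2_tsh. lra.
Qed.

(** Cauchy-Schwarz with the weights 1 + k. The factor [harm N], of the size of log N, is the price
    for H^{1/2} not being contained in the absolutely convergent Fourier series. *)
Lemma l1_low (a : h12) N : psum (fun p => Cmod (a p)) N * psum (fun p => Cmod (a p)) N <= harm N * hs a.
Proof.
  pose proof (csum_cauchy_weighted (fun p => RtoC (Cmod (a p))) (fun k => / (1 + INR k)) N (fun k => Rinv_0_lt_compat _ (INR1_pos k))) as H.
  rewrite csum_RtoC, Cnorm2_RtoC in H. eapply Rle_trans; [apply H|]. apply Rmult_le_compat_l; [apply harm_ge0|].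
  rewrite (psum_ext _ (fun k => (1 + INR k) * Cnorm2 (a k))).
  - apply psum_le_Series; [|apply h12_ex]. intro k. apply Rmult_le_pos; [apply Rlt_le, INR1_pos | apply Cnorm2_ge0].
  - intros k _. rewrite Cnorm2_RtoC, Cmod_sqr. field. pose proof (INR1_pos k). lra.
Qed.

Lemma hfilter_ex (P : nat -> bool) (a : h12) : ex_series (fun k => (1 + INR k) * Cnorm2 (if P k then a k else RtoC 0)).
Proof.
  apply ex_series_le' with (2 := h12_ex a). intro k.
  pose proof (Rmult_le_pos _ _ (Rlt_le _ _ (INR1_pos k)) (Cnorm2_ge0 (a k))).
  destruct (P k); [rewrite Rabs_pos_eq; lra|]. unfold Cnorm2 at 1; simpl. rewrite Rmult_0_l, Rplus_0_l, Rmult_0_r, Rabs_R0. auto.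
Qed.
Definition hfilter P (a : h12) : h12 := mkh12 _ (hfilter_ex P a).
Lemma hfilter_k P a k : hfilter P a k = if P k then a k else RtoC 0.
Proof. apply (mkh12_k (fun k => if P k then a k else RtoC 0)). Qed.
Lemma hs_hfilter P a : hs (hfilter P a) <= hs a.
Proof.
  apply Series_le; [|apply h12_ex]. intro k. rewrite hfilter_k.
  pose proof (Rmult_le_pos _ _ (Rlt_le _ _ (INR1_pos k)) (Cnorm2_ge0 (a k))).
  destruct (P k); [lra|]. unfold Cnorm2 at 1 2; simpl. rewrite Rmult_0_l, Rplus_0_l, Rmult_0_r. lra.
Qed.
Definition hlow N := hfilter (fun k => Nat.ltb k N).
Definition hhigh N := hfilter (fun k => negb (Nat.ltb k N)).
Lemma hlow_k N a k : hlow N a k = if lt_dec k N then a k else RtoC 0.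
Proof.
  unfold hlow. rewrite hfilter_k. destruct (Nat.ltb_spec k N), lt_dec; auto; lia.
Qed.
Lemma hhigh_k N a k : hhigh N a k = if lt_dec k N then RtoC 0 else a k.
Proof. unfold hhigh. rewrite hfilter_k. destruct (Nat.ltb_spec k N), lt_dec; auto; lia. Qed.
Lemma hlow_out N a p : (N <= p)%nat -> hlow N a p = RtoC 0.
Proof. intro. rewrite hlow_k. destruct lt_dec; [lia|auto]. Qed.
Lemma hhigh_out N a p : (p < N)%nat -> hhigh N a p = RtoC 0.
Proof. intro. rewrite hhigh_k. destruct lt_dec; [auto|lia]. Qed.

Lemma cconv_lin_l (a a1 a2 b : nat -> C) n : (forall k, a k = a1 k + a2 k)%C -> (cconv a b n = cconv a1 b n + cconv a2 b n)%C.
Proof. intro H. unfold cconv. rewrite <- csum_plus. apply csum_ext. intros k _. rewrite H. ring. Qed.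
Lemma cconv_lin_r (a b b1 b2 : nat -> C) n : (forall k, b k = b1 k + b2 k)%C -> (cconv a b n = cconv a b1 n + cconv a b2 n)%C.
Proof. intro H. unfold cconv. rewrite <- csum_plus. apply csum_ext. intros k _. rewrite H. ring. Qed.

Lemma conv_split N a b : conv a b = ladd (conv (hlow N a) b) (conv (hhigh N a) b).
Proof.
  apply l2_ext; intro n. rewrite ladd_k, !conv_k. apply cconv_lin_l. intro k. rewrite hlow_k, hhigh_k. destruct lt_dec; ring.
Qed.

Lemma l1_hlow (a : h12) N : psum (fun p => Cmod (hlow N a p)) N * psum (fun p => Cmod (hlow N a p)) N <= harm N * hs a.
Proof.
  eapply Rle_trans; [apply l1_low|]. apply Rmult_le_compat_l; [apply harm_ge0 | apply hs_hfilter].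
Qed.

Lemma nrm_conv_high (a b : h12) N : nrm (conv (hhigh N a) b) <= sqrt (4 / sqrt (1 + INR N) * (hs a * hs b)).
Proof.
  apply sqrt_le_1_alt. eapply Rle_trans; [apply n2_conv_high with (N := N); apply hhigh_out|].
  assert (0 < sqrt (1 + INR N)) by (apply sqrt_lt_R0, INR1_pos).
  apply Rmult_le_compat_l; [apply Rlt_le, Rdiv_lt_0_compat; lra|]. apply Rmult_le_compat_r; [apply hs_ge0 | apply hs_hfilter].
Qed.

(* Splitting [a] at frequency [N]: the low part costs only a logarithm, the high part is small in N. *)
Lemma nrm_conv_split (a b : h12) N : nrm (conv a b) <= sqrt (harm N * hs a) * nrm b + sqrt (4 / sqrt (1 + INR N) * (hs a * hs b)).
Proof.
  rewrite (conv_split N a b). eapply Rle_trans; [apply nrm_triang|]. apply Rplus_le_compat; [|apply nrm_conv_high].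
  eapply Rle_trans; [apply nrm_conv_low with (N := N); apply hlow_out|]. apply Rmult_le_compat_r; [apply nrm_ge0|].
  rewrite <- (sqrt_square (psum _ N)) by (apply psum_pos; intros; apply Cmod_ge_0). apply sqrt_le_1_alt, l1_hlow.
Qed.

Lemma psum_zero_tail f n m : (n <= m)%nat -> (forall k, (n <= k)%nat -> f k = 0) -> psum f m = psum f n.
Proof. intros H Z. induction H as [|m H IH]; auto. cbn [psum]. rewrite IH, Z by auto. ring. Qed.

(** Each coefficient of the product is the inner product of [a] with a reflected, conjugated piece
    of [b]. *)
Lemma cconv_sup (a b : h12) n : Cmod (cconv a b n) <= nrm a * nrm b.
Proof.
  rewrite Cmod_sqrt_norm2. unfold nrm. rewrite <- sqrt_mult by apply n2_ge0. apply sqrt_le_1_alt.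
  assert (E : cconv a b n = ip a (to_l2 (fun p => if le_dec p n then Cconj (b (n - p)%nat) else RtoC 0))).
  { assert (F : ex_series (fun p => Cnorm2 (if le_dec p n then Cconj (b (n - p)%nat) else RtoC 0))).
    { apply (finite_ex (fun p => if le_dec p n then Cconj (b (n - p)%nat) else RtoC 0) (S n)). intros; destruct le_dec; [lia|auto]. }
    set (w := to_l2 _). assert (wk : forall k, w k = if le_dec k n then Cconj (b (n - k)%nat) else RtoC 0) by (intro; apply (to_l2_k (fun p => if le_dec p n then Cconj (b (n - p)%nat) else RtoC 0)), F).
    assert (T : trunc (S n) w = w) by (apply l2_ext; intro k; rewrite trunc_k; destruct lt_dec; auto; rewrite wk; destruct le_dec; [lia|auto]).
    rewrite <- T, <- ip_trunc, (linear_trunc (fun v => ip v w)); [|intros; apply ip_add_l|intros; apply ip_scal_l].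
    unfold cconv. apply csum_ext. intros k Hk. rewrite ip_delta_l, wk. destruct le_dec; [rewrite Cconj_conj; auto|lia]. }
  rewrite E. eapply Rle_trans; [apply cauchy_schwarz|]. apply Rmult_le_compat_l; [apply n2_ge0|].
  rewrite n2_to_l2.
  - apply ex_series_bdd; [intro; apply Cnorm2_ge0|]. intro m.
    apply Rle_trans with (psum (fun p => Cnorm2 (if le_dec p n then Cconj (b (n - p)%nat) else RtoC 0)) (S n)).
    + destruct (le_lt_dec m (S n)) as [L|L]; [apply psum_le_n; auto; intro; apply Cnorm2_ge0|].
      right. apply psum_zero_tail; [lia|]. intros k Hk. destruct le_dec; [lia|]. unfold Cnorm2; simpl; ring.
    + rewrite (psum_ext _ (fun p => Cnorm2 (b (n - p)%nat))), (psum_rev (fun p => Cnorm2 (b p))).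
      * rewrite n2_Series. apply psum_le_Series; [intro; apply Cnorm2_ge0 | apply l2_ex].
      * intros k Hk. destruct le_dec; [apply Cnorm2_conj|lia].
  - apply (finite_ex (fun p => if le_dec p n then Cconj (b (n - p)%nat) else RtoC 0) (S n)). intros; destruct le_dec; [lia|auto].
Qed.

Lemma Cmod_csum f n : Cmod (csum f n) <= psum (fun k => Cmod (f k)) n.
Proof. induction n as [|n IH]; simpl; [rewrite Cmod_0; lra|]. eapply Rle_trans; [apply Cmod_triangle | lra]. Qed.

(** Here [b] and [c] stand in the same product, whose L^2 norm is not controlled by their L^2 norms.
    The two low-frequency factors are therefore moved across at the cost of their absolute sums, and
    what remains are single coefficients of the product, bounded by [cconv_sup]. *)
Lemma ip_low_low (a : h12) (b c : h12) N :
  Cmod (ip (conv (hlow N a) (hlow N a)) (conv b c)) <= harm N * hs a * (nrm b * nrm c).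
Proof.
  set (s := psum (fun p => Cmod (hlow N a p)) N).
  assert (s0 : 0 <= s) by (apply psum_pos; intros; apply Cmod_ge_0).
  assert (r0 : 0 <= nrm b * nrm c) by (apply Rmult_le_pos; apply nrm_ge0).
  apply Rle_trans with (s * (s * (nrm b * nrm c))).
  - rewrite (conv_low _ _ N (hlow_out N a)), ip_vsum_l. eapply Rle_trans; [apply Cmod_csum|].
    unfold s at 1. rewrite Rmult_comm, <- psum_scal. apply psum_le. intros p _.
    rewrite ip_scal_l, Cmod_mult, Rmult_comm. apply Rmult_le_compat_r; [apply Cmod_ge_0|].
    assert (E : Cmod (ip (tsh p (hlow N a)) (conv b c)) = Cmod (ip (hlow N a) (shn p (conv b c)))).
    { rewrite <- Cmod_conj, <- ip_conj, <- ip_tsh, (ip_conj _ (hlow N a)), Cmod_conj. auto. }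
    rewrite E.
    assert (T : trunc N (hlow N a) = hlow N a) by (apply l2_ext; intro k; rewrite trunc_k; destruct lt_dec; auto; rewrite hlow_out; auto; lia).
    rewrite <- T, (linear_trunc (fun v => ip v (shn p (conv b c)))); [|intros; apply ip_add_l|intros; apply ip_scal_l].
    eapply Rle_trans; [apply Cmod_csum|]. unfold s. rewrite Rmult_comm, <- psum_scal. apply psum_le. intros k _.
    rewrite Cmod_mult, ip_delta_l, Cmod_conj, shn_k, conv_k, Rmult_comm. apply Rmult_le_compat_r; [apply Cmod_ge_0 | apply cconv_sup].
  - rewrite <- Rmult_assoc. apply Rmult_le_compat_r; auto. apply l1_hlow.
Qed.

(* Fourier coefficients of Pi(|u|^2 u), written as the projection of u^2 times the conjugate of u. *)
Definition NL (u : h12) (k : nat) : C := ip (shn k (conv u u)) u.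

Lemma NL_diff u v k : (NL u k - NL v k)%C =
  (ip (shn k (conv u u)) (hsub u v) + ip (shn k (conv u (hsub u v))) v + ip (shn k (conv (hsub u v) v)) v)%C.
Proof.
  unfold NL. rewrite <- lsub_hsub at 1. rewrite ip_sub_r, <- (Cplus_assoc (_ - _)%C), <- ip_add_l.
  replace (ladd (shn k (conv u (hsub u v))) (shn k (conv (hsub u v) v))) with (lsub (shn k (conv u u)) (shn k (conv v v))).
  - rewrite ip_sub_l. ring.
  - apply l2_ext; intro n. rewrite ladd_k, lsub_k, !shn_k, !conv_k.
    rewrite (cconv_lin_r u u v (hsub u v)) by (intro; rewrite hsub_k; ring).
    rewrite (cconv_lin_l u v (hsub u v) v) by (intro; rewrite hsub_k; ring). ring.
Qed.

Lemma ip_test (z : h12) n q (c : h12) :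
  csum (fun k => Cconj (z k) * ip (shn k q) c)%C n = ip q (conv (hlow n z) c).
Proof.
  rewrite (conv_low _ c n (hlow_out n z)), ip_vsum_r. apply csum_ext. intros k Hk.
  rewrite ip_scal_r, ip_tsh, hlow_k. destruct lt_dec; [auto|lia].
Qed.

(** Of the three terms of [NL_diff], two pair a product containing [z] with one containing [y], and
    each product is estimated by [nrm_conv_split]. In the other term [z] and [y] meet in the same
    product, which calls for [ip_low_low] after splitting u^2. The cut at [n] is there because
    finite sums are what will be differentiated in time. *)
Lemma energy_bound (u v : h12) M n N : hs u <= M -> hs v <= M ->
  Cmod (csum (fun k => Cconj (hsub u v k) * (NL u k - NL v k))%C n) <=
  5 * (harm N * M) * n2 (hsub u v) + 128 * (M * M) / sqrt (sqrt (1 + INR N)).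
Proof.
  intros Hu Hv. set (z := hsub u v). set (y := hlow n z).
  assert (M0 : 0 <= M) by (pose proof (hs_ge0 u); lra).
  assert (Hz : hs z <= 4 * M).
  { unfold z, hsub. rewrite <- !n2_hw. fold (hsub u v). rewrite hw_hsub. eapply Rle_trans; [apply n2_sub_le|]. rewrite !n2_hw. lra. }
  assert (Hy : hs y <= 4 * M) by (eapply Rle_trans; [apply hs_hfilter | auto]).
  set (r := nrm z). assert (r0 : 0 <= r) by apply nrm_ge0.
  assert (ry : nrm y <= r).
  { apply sqrt_le_1_alt. replace (hl y) with (trunc n z) by (apply l2_ext; intro k; rewrite trunc_k; unfold y; rewrite hlow_k; auto). apply n2_trunc_le. }
  assert (ry0 := nrm_ge0 y).
  set (d := sqrt (1 + INR N)). assert (d1 : 1 <= d) by (unfold d; rewrite <- sqrt_1 at 1; apply sqrt_le_1_alt; pose proof (pos_INR N); lra).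
  set (dd := sqrt d). assert (dd1 : 1 <= dd) by (unfold dd; rewrite <- sqrt_1 at 1; apply sqrt_le_1_alt; auto).
  assert (ddd : dd * dd = d) by (apply sqrt_sqrt; lra).
  set (l := sqrt (harm N * M)). assert (hN := harm_ge0 N). assert (hM : 0 <= harm N * M) by (apply Rmult_le_pos; auto).
  assert (l0 : 0 <= l) by apply sqrt_pos. assert (ll : l * l = harm N * M) by (apply sqrt_sqrt; auto).
  (* The high-frequency error: for factors bounded by [M] and [4 * M],
     [sqrt (4 / d * (M * (4 * M)))] is [4 * M / dd]. *)
  set (ep := 4 * M / dd). assert (ep0 : 0 <= ep) by (apply Rmult_le_pos; [lra | apply Rlt_le, Rinv_0_lt_compat; lra]).
  assert (sq : forall a b, 0 <= a -> a <= M -> 0 <= b -> b <= 4 * M -> sqrt (4 / d * (a * b)) <= ep).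
  { intros a b A0 A1 B0 B1. rewrite <- (sqrt_square ep) by auto. apply sqrt_le_1_alt.
    replace (ep * ep) with (4 / d * (4 * M * M)) by (unfold ep; rewrite <- ddd; field; lra).
    apply Rmult_le_compat_l; [apply Rlt_le, Rdiv_lt_0_compat; lra|]. nra. }
  assert (cv : forall a b, hs a <= M -> hs b <= 4 * M -> nrm b <= r -> nrm (conv a b) <= l * r + ep).
  { intros a b A B R. eapply Rle_trans; [apply (nrm_conv_split a b N)|]. apply Rplus_le_compat.
    - apply Rmult_le_compat; auto; [apply sqrt_pos | apply nrm_ge0 |]. apply sqrt_le_1_alt. apply Rmult_le_compat_l; auto.
    - apply sq; auto; apply hs_ge0. }
  assert (lr : (l * r + ep) * (l * r + ep) <= 2 * (harm N * M) * n2 z + 2 * (ep * ep)).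
  { rewrite <- ll, <- nrm_sqr. fold r. pose proof (Rle_0_sqr (l * r - ep)) as Q. unfold Rsqr in Q. nra. }
  assert (e2 : ep * ep <= 16 * (M * M) / dd).
  { unfold ep. replace (4 * M / dd * (4 * M / dd)) with (16 * (M * M) / dd * / dd) by (field; lra).
    rewrite <- (Rmult_1_r (16 * (M * M) / dd)) at 2. apply Rmult_le_compat_l.
    - apply Rmult_le_pos; [nra | apply Rlt_le, Rinv_0_lt_compat; lra].
    - rewrite <- Rinv_1. apply Rinv_le_contravar; lra. }
  rewrite (csum_ext _ (fun k => Cconj (z k) * ip (shn k (conv u u)) z + (Cconj (z k) * ip (shn k (conv u z)) v + Cconj (z k) * ip (shn k (conv z v)) v))%C)
    by (intros; rewrite NL_diff; fold z; ring).
  rewrite !csum_plus, !ip_test. fold y.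
  assert (T2 : Cmod (ip (conv u z) (conv y v)) <= (l * r + ep) * (l * r + ep)).
  { eapply Rle_trans; [apply Cmod_ip_le|]. apply Rmult_le_compat; try apply nrm_ge0; [apply cv; auto; apply Rle_refl|].
    rewrite conv_comm. apply cv; auto. }
  assert (T3 : Cmod (ip (conv z v) (conv y v)) <= (l * r + ep) * (l * r + ep)).
  { eapply Rle_trans; [apply Cmod_ip_le|]. apply Rmult_le_compat; try apply nrm_ge0; rewrite conv_comm; apply cv; auto; apply Rle_refl. }
  assert (Wn : nrm (conv y z) <= 8 * M).
  { rewrite <- (sqrt_square (8 * M)) by lra. apply sqrt_le_1_alt.
    eapply Rle_trans; [apply n2_conv_high with (N := O); intros; lia|]. simpl. rewrite Rplus_0_r, sqrt_1.
    pose proof (hs_ge0 y). pose proof (hs_ge0 z). assert (hs y * hs z <= 4 * M * (4 * M)) by (apply Rmult_le_compat; auto). lra. }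
  assert (T1 : Cmod (ip (conv u u) (conv y z)) <= (harm N * M) * n2 z + 2 * (ep * (8 * M))).
  { rewrite (conv_split N u u), (conv_comm (hlow N u) u), (conv_split N u (hlow N u)), !ip_add_l.
    eapply Rle_trans; [apply Cmod_triangle|]. eapply Rle_trans; [apply Rplus_le_compat_r, Cmod_triangle|].
    assert (A1 := ip_low_low u y z N).
    assert (A2 : Cmod (ip (conv (hhigh N u) (hlow N u)) (conv y z)) <= ep * (8 * M)).
    { eapply Rle_trans; [apply Cmod_ip_le|]. apply Rmult_le_compat; try apply nrm_ge0; auto.
      eapply Rle_trans; [apply nrm_conv_high|]. apply sq; auto; try apply hs_ge0. eapply Rle_trans; [apply hs_hfilter|]. lra. }
    assert (A3 : Cmod (ip (conv (hhigh N u) u) (conv y z)) <= ep * (8 * M)).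
    { eapply Rle_trans; [apply Cmod_ip_le|]. apply Rmult_le_compat; try apply nrm_ge0; auto.
      eapply Rle_trans; [apply nrm_conv_high|]. apply sq; auto; try apply hs_ge0. lra. }
    assert (A4 : harm N * hs u * (nrm y * nrm z) <= harm N * M * n2 z).
    { apply Rmult_le_compat; [apply Rmult_le_pos; auto; apply hs_ge0 | apply Rmult_le_pos; apply nrm_ge0 | apply Rmult_le_compat_l; auto |].
      rewrite <- nrm_sqr. fold r. apply Rmult_le_compat_r; auto. }
    lra. }
  eapply Rle_trans; [apply Cmod_triangle|]. eapply Rle_trans; [apply Rplus_le_compat_l, Cmod_triangle|].
  assert (e3 : 2 * (ep * (8 * M)) = 64 * (M * M) / dd) by (unfold ep; field; lra).
  replace (128 * (M * M) / dd) with (64 * (M * M) / dd + 4 * (16 * (M * M) / dd)) by (field; lra).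
  lra.
Qed.

(** * Uniqueness on short time intervals *)

Lemma derivable_pt_lim_psum (f : nat -> R -> R) (d : nat -> R) t n :
  (forall k, derivable_pt_lim (f k) t (d k)) -> derivable_pt_lim (fun s => psum (fun k => f k s) n) t (psum d n).
Proof.
  intro H. induction n as [|n IH]; simpl; [apply derivable_pt_lim_const|].
  apply (derivable_pt_lim_plus (fun s => psum (fun k => f k s) n) (f n)); auto.
Qed.

Lemma nonneg_of_deriv (f f' : R -> R) s : 0 <= s -> f 0 = 0 -> (forall t, 0 <= t <= s -> derivable_pt_lim f t (f' t)) ->
  (forall t, 0 <= t <= s -> 0 <= f' t) -> 0 <= f s.
Proof.
  intros Hs F0 D P. destruct Hs as [Hs|<-]; [|lra].
  destruct (MVT_cor2 f f' 0 s Hs D) as (c & E & Hc). specialize (P c ltac:(lra)). rewrite F0 in E.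
  assert (0 <= f' c * (s - 0)) by (apply Rmult_le_pos; lra). lra.
Qed.

Section LocalUniqueness.
Variables (u v : R -> h12) (M tau sg : R).
Hypothesis M1 : 1 <= M.
Hypothesis Ht : 0 <= tau.
Hypothesis Htau : 160 * M * tau <= 1.
Hypothesis Hsg : Rabs sg <= 1.
Hypothesis Hu : forall s, 0 <= s <= tau -> hs (u s) <= M.
Hypothesis Hv : forall s, 0 <= s <= tau -> hs (v s) <= M.
Hypothesis H0 : u 0 = v 0.
Hypothesis Du : forall s k, 0 <= s <= tau -> Cderiv (fun t => u t k) s (RtoC sg * (- Ci * NL (u s) k))%C.
Hypothesis Dv : forall s k, 0 <= s <= tau -> Cderiv (fun t => v t k) s (RtoC sg * (- Ci * NL (v s) k))%C.

Let gap s := n2 (hsub (u s) (v s)).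
Let part n s := psum (fun k => Cnorm2 (hsub (u s) (v s) k)) n.
Let rate n s := psum (fun k => 2 * fst (Cconj (hsub (u s) (v s) k) * (RtoC sg * (- Ci * (NL (u s) k - NL (v s) k))))%C) n.

Lemma part_deriv n s : 0 <= s <= tau -> derivable_pt_lim (part n) s (rate n s).
Proof.
  intro Hs. apply (derivable_pt_lim_psum (fun k s => Cnorm2 (hsub (u s) (v s) k))). intro k.
  destruct (Du s k Hs) as [U1 U2], (Dv s k Hs) as [V1 V2].
  pose proof (derivable_pt_lim_minus _ _ _ _ _ U1 V1) as D1. pose proof (derivable_pt_lim_minus _ _ _ _ _ U2 V2) as D2.
  pose proof (derivable_pt_lim_plus _ _ _ _ _ (derivable_pt_lim_mult _ _ _ _ _ D1 D1) (derivable_pt_lim_mult _ _ _ _ _ D2 D2)) as D.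
  match type of D with derivable_pt_lim _ _ ?l =>
    replace (2 * fst (Cconj (hsub (u s) (v s) k) * (RtoC sg * (- Ci * (NL (u s) k - NL (v s) k))))%C) with l end.
  - apply derivable_pt_lim_ext with (2 := D). intro t. rewrite hsub_k. reflexivity.
  - rewrite hsub_k. unfold minus_fct. simpl. ring.
Qed.

(** The cut-off [2 ^ (4 * p)] is chosen so that [harm] of it is at most 1 + 4p while its fourth root
    is [2 ^ p]. *)
Lemma rate_bound p n s : 0 <= s <= tau ->
  rate n s <= 10 * M * (1 + 4 * INR p) * gap s + 256 * (M * M) / 2 ^ p.
Proof.
  intro Hs. pose proof (energy_bound (u s) (v s) M n (2 ^ (4 * p)) (Hu s Hs) (Hv s Hs)) as E. fold (gap s) in E.
  assert (R1 : rate n s <= 2 * Cmod (csum (fun k => Cconj (hsub (u s) (v s) k) * (NL (u s) k - NL (v s) k))%C n)).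
  { unfold rate. rewrite psum_scal, <- fst_csum.
    rewrite (csum_ext _ (fun k => (RtoC sg * - Ci) * (Cconj (hsub (u s) (v s) k) * (NL (u s) k - NL (v s) k)))%C) by (intros; ring).
    rewrite csum_scal. apply Rmult_le_compat_l; [lra|]. eapply Rle_trans; [apply Rle_abs|]. eapply Rle_trans; [apply fst_le_Cmod|].
    rewrite Cmod_mult, Cmod_mult, Cmod_R, Cmod_opp, Cmod_Ci, Rmult_1_r.
    rewrite <- (Rmult_1_l (Cmod (csum _ n))) at 2. apply Rmult_le_compat_r; [apply Cmod_ge_0 | auto]. }
  assert (G0 : 0 <= gap s) by apply n2_ge0.
  pose proof (harm_pow2 (4 * p)) as Hh. 
  rewrite mult_INR in Hh. replace (INR 4) with 4 in Hh by (simpl; ring).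
  assert (S1 : 2 ^ p <= sqrt (sqrt (1 + INR (2 ^ (4 * p))))).
  { assert (P : 0 < 2 ^ p) by (apply pow_lt; lra).
    rewrite <- (sqrt_square (2 ^ p)) by lra. apply sqrt_le_1_alt.
    rewrite <- (sqrt_square (2 ^ p * 2 ^ p)) by nra. apply sqrt_le_1_alt.
    rewrite pow_INR. replace (INR 2) with 2 by (simpl; ring). rewrite <- !pow_add. replace (p + p + (p + p))%nat with (4 * p)%nat by lia. lra. }
  assert (P : 0 < 2 ^ p) by (apply pow_lt; lra).
  assert (E2 : 128 * (M * M) / sqrt (sqrt (1 + INR (2 ^ (4 * p)))) <= 128 * (M * M) / 2 ^ p).
  { apply Rmult_le_compat_l; [nra|]. apply Rinv_le_contravar; auto. }
  assert (E3 : 5 * (harm (2 ^ (4 * p)) * M) * gap s <= 5 * M * (1 + 4 * INR p) * gap s).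
  { apply Rmult_le_compat_r; auto. assert (harm (2 ^ (4 * p)) * M <= (1 + 4 * INR p) * M) by (apply Rmult_le_compat_r; [lra | exact Hh]). lra. }
  replace (256 * (M * M) / 2 ^ p) with (2 * (128 * (M * M) / 2 ^ p)) by (field; lra). lra.
Qed.

Lemma gap_le_of_part s B : (forall n, part n s <= B) -> gap s <= B.
Proof.
  intro H. unfold gap. rewrite n2_Series. apply ex_series_bdd; [intro; apply Cnorm2_ge0 | exact H].
Qed.

Lemma part_0 n : part n 0 = 0.
Proof.
  unfold part. rewrite (psum_ext _ (fun _ => 0 * 0)), psum_scal; [ring|]. intros k _. rewrite hsub_k, H0.
  unfold Cnorm2; simpl. ring.
Qed.

(** Integrating L P e^(2Ls) yields (P/2)(e^(2Ls) - 1): with the exponent 2L each application halves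
    the constant. The comparison is made on the partial sums [part n], whose derivatives are
    available, and then passed to [gap]. *)
Lemma gronwall_step p P : (forall s, 0 <= s <= tau -> gap s <= P * exp (2 * (10 * M * (1 + 4 * INR p)) * s)) ->
  forall s, 0 <= s <= tau -> gap s <= (P / 2 + 256 * (M * M) / 2 ^ p) * exp (2 * (10 * M * (1 + 4 * INR p)) * s).
Proof.
  intros HP s Hs. set (L := 10 * M * (1 + 4 * INR p)) in *. set (ep := 256 * (M * M) / 2 ^ p).
  assert (p0 := pos_INR p). assert (L1 : 1 <= L) by (unfold L; nra).
  assert (ep0 : 0 < ep) by (apply Rdiv_lt_0_compat; [nra | apply pow_lt; lra]).
  assert (P0 : 0 <= P).
  { specialize (HP 0 ltac:(lra)). rewrite Rmult_0_r, exp_0, Rmult_1_r in HP. pose proof (n2_ge0 (hsub (u 0) (v 0))). fold (gap 0) in H. lra. }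
  apply gap_le_of_part. intro n.
  assert (Q : 0 <= P / 2 * (exp (2 * L * s) - 1) + ep * s - part n s).
  { apply (nonneg_of_deriv (fun s => P / 2 * (exp (2 * L * s) - 1) + ep * s - part n s) (fun s => L * P * exp (2 * L * s) + ep - rate n s)); [lra| | |].
    - rewrite part_0, !Rmult_0_r, exp_0. ring.
    - intros t Ht'. apply (derivable_pt_lim_minus (fun s => P / 2 * (exp (2 * L * s) - 1) + ep * s) (part n)); [|apply part_deriv; lra].
      apply is_derive_Reals. auto_derive; auto. field.
    - intros t Ht'. pose proof (rate_bound p n t ltac:(lra)) as R. fold L ep in R. specialize (HP t ltac:(lra)).
      assert (L * gap t <= L * (P * exp (2 * L * t))) by (apply Rmult_le_compat_l; lra). lra. }
  assert (s <= exp (2 * L * s)).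
  { pose proof (exp_ineq1_le (2 * L * s)). nra. }
  assert (ep * s <= ep * exp (2 * L * s)) by (apply Rmult_le_compat_l; lra). lra.
Qed.

Lemma local_uniqueness s : 0 <= s <= tau -> u s = v s.
Proof.
  intro Hs.
  assert (Gp : forall p, gap s <= (2 * (256 * (M * M) / 2 ^ p)) * exp (2 * (10 * M * (1 + 4 * INR p)) * s)).
  { intro p. set (L := 10 * M * (1 + 4 * INR p)). set (ep := 256 * (M * M) / 2 ^ p).
    assert (p0 := pos_INR p). assert (L1 : 1 <= L) by (unfold L; nra).
    assert (ep0 : 0 < ep) by (apply Rdiv_lt_0_compat; [nra | apply pow_lt; lra]).
    (* Iterating from the a priori bound [4 * M] brings the initial constant to 0 and leaves the
       fixed point [2 * ep] of the recursion. *)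
    assert (It : forall k t, 0 <= t <= tau -> gap t <= (4 * M / 2 ^ k + 2 * ep) * exp (2 * L * t)).
    { induction k as [|k IH].
      - intros t Ht'. assert (gap t <= 4 * M).
        { unfold gap. eapply Rle_trans; [apply n2_le_hs|]. rewrite <- n2_hw, hw_hsub. eapply Rle_trans; [apply n2_sub_le|].
          rewrite !n2_hw. specialize (Hu t Ht'). specialize (Hv t Ht'). lra. }
        assert (1 <= exp (2 * L * t)) by (pose proof (exp_ineq1_le (2 * L * t)); nra). simpl. nra.
      - intros t Ht'. pose proof (gronwall_step p _ IH t Ht') as G. fold L ep in G.
        replace ((4 * M / 2 ^ k + 2 * ep) / 2 + ep) with (4 * M / 2 ^ S k + 2 * ep) in G; auto.
        simpl. field. apply pow_nonzero; lra. }
    assert (Lm : is_lim_seq (fun k => (4 * M / 2 ^ k + 2 * ep) * exp (2 * L * s)) ((0 + 2 * ep) * exp (2 * L * s))).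
    { apply is_lim_seq_mult'; [|apply is_lim_seq_const]. apply is_lim_seq_plus'; [|apply is_lim_seq_const].
      apply is_lim_seq_ext with (fun k => 4 * M * (/ 2) ^ k); [intro; rewrite pow_inv; auto|].
      apply lim_scal0, is_lim_seq_geom. rewrite Rabs_pos_eq; lra. }
    pose proof (is_lim_seq_le (fun _ => gap s) _ (gap s) _ (fun k => It k s Hs) (is_lim_seq_const _) Lm) as R. simpl in R. lra. }
  assert (Z : gap s = 0).
  { apply Rle_antisym; [|apply n2_ge0].
    (* As 160 M s <= 1, the exponential factor is at most e^(1/8) e^(p/2), and e^(1/2) < 7/4 < 2
       lets the factor 2^(-p) win. *)
    assert (e12 : exp (/ 2) < 7 / 4).
    { assert (exp (/ 2) * exp (/ 2) <= 3) by (rewrite <- exp_plus; replace (/ 2 + / 2) with 1 by field; apply exp_le_3).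
      destruct (Rlt_le_dec (exp (/ 2)) (7 / 4)); auto. nra. }
    assert (Lm : is_lim_seq (fun p => 512 * (M * M) * exp (/ 8) * (exp (/ 2) / 2) ^ p) 0).
    { apply lim_scal0, is_lim_seq_geom. pose proof (exp_pos (/ 2)). rewrite Rabs_pos_eq; lra. }
    apply (is_lim_seq_le (fun _ => gap s) _ (gap s) 0) with (2 := is_lim_seq_const _) (3 := Lm).
    intro p. eapply Rle_trans; [apply Gp|].
    assert (X : 2 * (10 * M * (1 + 4 * INR p)) * s <= / 8 + INR p * / 2).
    { assert (p0 := pos_INR p). assert (M * s <= M * tau) by (apply Rmult_le_compat_l; lra).
      replace (2 * (10 * M * (1 + 4 * INR p)) * s) with (20 * (M * s) * (1 + 4 * INR p)) by ring.
      assert (20 * (M * s) <= / 8) by lra.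
      assert (20 * (M * s) * (1 + 4 * INR p) <= / 8 * (1 + 4 * INR p)) by (apply Rmult_le_compat_r; lra). lra. }
    assert (Y : exp (2 * (10 * M * (1 + 4 * INR p)) * s) <= exp (/ 8) * exp (/ 2) ^ p).
    { replace (exp (/ 2) ^ p) with (exp (INR p * / 2)).
      - rewrite <- exp_plus. destruct X as [X| ->]; [left; apply exp_increasing; auto | right; auto].
      - clear. induction p as [|p IH]; [simpl; rewrite Rmult_0_l; apply exp_0|].
        rewrite S_INR, Rmult_plus_distr_r, exp_plus, IH, Rmult_1_l. simpl. ring. }
    assert (P2 : 0 < 2 ^ p) by (apply pow_lt; lra).
    unfold Rdiv. rewrite Rpow_mult_distr, pow_inv.
    replace (512 * (M * M) * exp (/ 8) * (exp (/ 2) ^ p * / 2 ^ p)) with (2 * (256 * (M * M) * / 2 ^ p) * (exp (/ 8) * exp (/ 2) ^ p)) by ring.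
    apply Rmult_le_compat_l; auto. apply Rmult_le_pos; [lra|]. apply Rmult_le_pos; [nra | apply Rlt_le, Rinv_0_lt_compat; auto]. }
  apply n2_eq0 in Z. apply h12_ext; intro k. apply (f_equal (fun w : l2 => w k)) in Z. rewrite hsub_k, lzero_k in Z.
  replace (u s k) with (u s k - v s k + v s k)%C by ring. rewrite Z. ring.
Qed.
End LocalUniqueness.

Lemma Cderiv_affine (f : R -> C) t0 sg s d : Cderiv f (t0 + sg * s) d -> Cderiv (fun r => f (t0 + sg * r)) s (RtoC sg * d)%C.
Proof.
  intros [A B].
  assert (L : derivable_pt_lim (fun r => t0 + sg * r) s sg).
  { apply is_derive_Reals. auto_derive; auto. ring. }
  split.
  - replace (fst (RtoC sg * d)%C) with (fst d * sg) by (simpl; ring).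
    apply (derivable_pt_lim_comp (fun r => t0 + sg * r) (fun r => fst (f r)) s sg (fst d)); auto.
  - replace (snd (RtoC sg * d)%C) with (snd d * sg) by (simpl; ring).
    apply (derivable_pt_lim_comp (fun r => t0 + sg * r) (fun r => snd (f r)) s sg (snd d)); auto.
Qed.

(** Intervals of length [tau] are chained outward from 0; the bound [M] holds on all of [-|t|, |t|],
    so [tau] does not shrink. The sign [sg] treats both directions of time at once. *)
Theorem uniqueness (U V : R -> h12) :
  (forall t k, Cderiv (fun s => U s k) t (- Ci * NL (U t) k)%C) ->
  (forall t k, Cderiv (fun s => V s k) t (- Ci * NL (V t) k)%C) ->
  (forall T, exists M, forall t, Rabs t <= T -> hs (U t) <= M /\ hs (V t) <= M) ->
  U 0 = V 0 -> forall t, U t = V t.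
Proof.
  intros DU DV B H0 t. destruct (B (Rabs t)) as [M0 HM0].
  set (M := Rmax 1 M0). assert (M1 : 1 <= M) by apply Rmax_l.
  assert (HM : forall r, Rabs r <= Rabs t -> hs (U r) <= M /\ hs (V r) <= M).
  { intros r Hr. destruct (HM0 r Hr). pose proof (Rmax_r 1 M0). unfold M. lra. }
  set (tau := / (160 * M)). assert (tau0 : 0 < tau) by (apply Rinv_0_lt_compat; lra).
  assert (Q : forall k r, Rabs r <= Rabs t -> Rabs r <= INR k * tau -> U r = V r).
  { induction k as [|k IH]; intros r R1 R2.
    - simpl in R2. rewrite Rmult_0_l in R2. assert (r = 0) as -> by (unfold Rabs in R2; destruct Rcase_abs in R2; lra). auto.
    - destruct (Rle_lt_dec (Rabs r) (INR k * tau)) as [L|L]; [apply IH; auto|].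
      rewrite S_INR in R2. assert (k0 : 0 <= INR k * tau) by (apply Rmult_le_pos; [apply pos_INR | lra]).
      set (sg := if Rle_dec 0 r then 1 else -1).
      assert (Es : r = sg * Rabs r) by (unfold sg; destruct Rle_dec; [rewrite Rabs_pos_eq | rewrite Rabs_left]; lra).
      assert (As : forall q, 0 <= q -> Rabs (sg * (INR k * tau) + sg * q) = INR k * tau + q).
      { intros q Hq. rewrite <- Rmult_plus_distr_l, Rabs_mult. replace (Rabs sg) with 1 by (unfold sg; destruct Rle_dec; [rewrite Rabs_pos_eq | rewrite Rabs_left]; lra).
        rewrite Rabs_pos_eq; lra. }
      set (t0 := sg * (INR k * tau)). set (s1 := Rabs r - INR k * tau).
      assert (X : U (t0 + sg * s1) = V (t0 + sg * s1)).
      { apply (local_uniqueness (fun s => U (t0 + sg * s)) (fun s => V (t0 + sg * s)) M s1 sg); unfold s1; try lra.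
        - assert (160 * M * (Rabs r - INR k * tau) <= 160 * M * tau) by (apply Rmult_le_compat_l; lra).
          replace (160 * M * tau) with 1 in H by (unfold tau; field; lra). lra.
        - unfold sg; destruct Rle_dec; [rewrite Rabs_pos_eq | rewrite Rabs_left]; lra.
        - intros s Hs. apply HM. unfold t0. rewrite As; lra.
        - intros s Hs. apply HM. unfold t0. rewrite As; lra.
        - apply IH; unfold t0; rewrite As; lra.
        - intros s j Hs. apply (Cderiv_affine (fun r => U r j)), DU.
        - intros s j Hs. apply (Cderiv_affine (fun r => V r j)), DV. }
      replace (t0 + sg * s1) with r in X; auto. unfold t0, s1. rewrite Es at 1. ring. }
  destruct (INR_unbounded (Rabs t / tau)) as [k Hk].
  apply (Q k t); [lra|]. apply Rmult_lt_compat_r with (r := tau) in Hk; auto.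
  unfold Rdiv in Hk. rewrite Rmult_assoc, Rinv_l in Hk; lra.
Qed.

(** * Operators on coefficient sequences *)

(** The sums of the statement are chosen by [epsilon]; uniqueness of limits makes the choice the
    actual sum as soon as the series converges. *)
Lemma Rsum_unique f (l : R) : is_series f l -> Rsum f = l.
Proof.
  intro H. assert (E : infinite_sum f (Rsum f)).
  { apply (epsilon_spec (inhabits 0) (fun l => infinite_sum f l)). exists l. apply is_series_Reals, H. }
  apply is_series_Reals, is_series_unique in E. rewrite <- E. apply is_series_unique, H.
Qed.

Lemma Rsum_Series f : ex_series f -> Rsum f = Series f.
Proof. intro H. apply Rsum_unique, Series_correct, H. Qed.

Lemma CSeries_clim (f : nat -> C) (l : C) : clim (csum f) l <-> CSeries f l.
Proof.
  unfold clim, CSeries. rewrite <- !is_series_Reals, !is_series_psum.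
  split; intros [A B]; (split; [apply is_lim_seq_ext with (2 := A) | apply is_lim_seq_ext with (2 := B)]);
    intro n; rewrite ?fst_csum, ?snd_csum; auto.
Qed.

Lemma Csum_unique (f : nat -> C) (l : C) : clim (csum f) l -> Csum f = l.
Proof.
  intro H. assert (E : CSeries f (Csum f)).
  { apply (epsilon_spec (inhabits C0) (fun l => CSeries f l)). exists l. apply CSeries_clim, H. }
  apply CSeries_clim in E. apply (clim_unique _ _ _ E H).
Qed.

Lemma is_l2_ex (h : nat -> C) : is_l2 h <-> ex_series (fun k => Cnorm2 (h k)).
Proof. split; intros [l H]; exists l; apply is_series_Reals, H. Qed.

Lemma is_H12_ex (h : nat -> C) : is_H12 h <-> ex_series (fun k => (1 + INR k) * Cnorm2 (h k)).
Proof. split; intros [l H]; exists l; apply is_series_Reals, H. Qed.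

Lemma is_l2_lval (h : nat -> C) : is_l2 h <-> exists x : l2, lval x = h.
Proof.
  rewrite is_l2_ex. split; [|intros [x <-]; apply l2_ex].
  intro H. exists (mkl2 h H). apply functional_extensionality. intro; apply lval_mkl2.
Qed.

Lemma is_H12_lval (h : nat -> C) : is_H12 h <-> exists u : h12, lval u = h.
Proof.
  rewrite is_H12_ex. split; [|intros [x <-]; apply h12_ex].
  intro H. exists (mkh12 h H). apply functional_extensionality. intro; apply mkh12_k.
Qed.

Lemma lval_inj (x y : l2) : lval x = lval y -> x = y.
Proof. intro H. apply l2_ext. intro k. rewrite H; auto. Qed.

Lemma hval_inj (u v : h12) : lval u = lval v -> u = v.
Proof. intro H. apply h12_ext. intro k. rewrite H; auto. Qed.

Lemma nonzero_lval (x : l2) : Defs.nonzero x <-> x <> lzero.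
Proof.
  split.
  - intros [n H] ->. apply H. apply lzero_k.
  - intro H. destruct (classic (Defs.nonzero x)) as [|N]; auto. destruct H. apply l2_ext. intro k. rewrite lzero_k.
    destruct (classic (x k = RtoC 0)) as [|E]; auto. destruct N. exists k. exact E.
Qed.

Lemma inner_ip (x y : l2) : inner x y = ip x y.
Proof. apply Csum_unique, ip_lim. Qed.

Lemma l2norm2_n2 (x : l2) : l2norm2 x = n2 x.
Proof. unfold l2norm2. rewrite n2_Series. apply Rsum_Series, l2_ex. Qed.

Lemma one_lval : Defs.one = lval (ldelta 0).
Proof. apply functional_extensionality. intro k. rewrite ldelta_k. destruct k; auto. Qed.

Lemma hankel_hank (u : h12) (x : l2) : hankel u x = hank u x.
Proof.
  apply functional_extensionality. intro n. rewrite hank_k. apply Csum_unique.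
  refine (clim_ext _ _ _ _ (ip_lim (shn n u) x)). intro m. apply csum_ext. intros k _. rewrite shn_k. auto.
Qed.

Lemma Tz_tsh (x : l2) : Tz x = tsh 1 x.
Proof.
  apply functional_extensionality. intros [|n]; rewrite tsh_k; destruct le_dec; try lia; auto.
  replace (S n - 1)%nat with n by lia. auto.
Qed.

Lemma kop_hank (u : h12) (x : l2) : kop u x = hank (hshift u) x.
Proof.
  unfold kop. rewrite Tz_tsh, hankel_hank. apply functional_extensionality. intro n. rewrite !hank_k, <- ip_tsh.
  f_equal. apply l2_ext. intro k. rewrite !shn_k, hshift_k. f_equal. lia.
Qed.

Lemma dH12_hs (u v : h12) : dH12 u v = sqrt (hs (hsub u v)).
Proof. unfold dH12. rewrite hs_hsub. f_equal. apply Rsum_Series. exact (hsub_ex u v). Qed.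

Lemma dXi_n2 (z g z' g' : l2) : dXi (lval z, lval g) (lval z', lval g') = sqrt (n2 (lsub z z') + n2 (lsub g g')).
Proof.
  unfold dXi. cbn [fst snd]. f_equal.
  assert (Q : forall x y : l2, Rsum (fun j => Cnorm2 (Csub (x j) (y j))) = n2 (lsub x y)); [|rewrite !Q; auto].
  intros x y. apply Rsum_unique. rewrite n2_Series.
  apply is_series_ext_R with (fun k => Cnorm2 (lsub x y k)); [intro; rewrite lsub_k; auto | apply Series_correct, l2_ex].
Qed.

Lemma nrm_shn_le n x : nrm (shn n x) <= nrm x.
Proof.
  apply sqrt_le_1_alt. rewrite !n2_Series. destruct (Series_split _ n (l2_ex x)) as [E _]. rewrite E.
  rewrite (Series_ext (fun k => Cnorm2 (shn n x k)) (fun k => Cnorm2 (x (n + k)%nat))) by (intro; rewrite shn_k; auto).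
  assert (0 <= psum (fun k => Cnorm2 (x k)) n) by (apply psum_pos; intros; apply Cnorm2_ge0). lra.
Qed.

Lemma shn_tsh_le k p x : (p <= k)%nat -> shn k (tsh p x) = shn (k - p) x.
Proof. intro H. apply l2_ext. intro n. rewrite !shn_k, tsh_k. destruct le_dec; [f_equal; lia | lia]. Qed.

Lemma shn_tsh_ge k p x : (k <= p)%nat -> shn k (tsh p x) = tsh (p - k) x.
Proof. intro H. apply l2_ext. intro n. rewrite !shn_k, !tsh_k. repeat destruct le_dec; auto; try lia. f_equal; lia. Qed.

Lemma ip_tsh_self m x : ip (tsh m x) x = Cconj (ip (shn m x) x).
Proof. rewrite ip_tsh. apply ip_conj. Qed.

(** Both branches of [wcoef] are one formula: [shn k] after [tsh p] is a shift by the difference, in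
    one direction or the other. *)
Lemma wcoef_ip (u : h12) k p : wcoef u k p = ip (shn k (tsh p u)) u.
Proof.
  unfold wcoef. destruct (Nat.leb_spec p k) as [L|L].
  - rewrite shn_tsh_le by auto. apply Csum_unique. refine (clim_ext _ _ _ _ (ip_lim (shn (k - p) u) u)).
    intro n. apply csum_ext. intros q _. rewrite shn_k, Nat.add_comm. auto.
  - rewrite shn_tsh_ge, ip_tsh_self, <- ip_conj by lia. apply Csum_unique. refine (clim_ext _ _ _ _ (ip_lim u (shn (p - k) u))).
    intro n. apply csum_ext. intros q _. rewrite shn_k, Nat.add_comm. auto.
Qed.

Lemma szego_partial (u : h12) k P :
  csum (fun p => Cmul (u p) (wcoef u k p)) P = ip (shn k (conv (hlow P u) u)) u.
Proof.
  rewrite (conv_low _ _ P (hlow_out P u)), ip_tsh, ip_vsum_l. apply csum_ext. intros p Hp.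
  rewrite wcoef_ip, ip_scal_l, ip_tsh, hlow_k. destruct lt_dec; [auto|lia].
Qed.

(** The partial sums are the nonlinearity with one factor cut at frequency [P], and the missing part
    is small by [n2_conv_high]. *)
Lemma szego_clim (u : h12) k : clim (csum (fun p => Cmul (u p) (wcoef u k p))) (NL u k).
Proof.
  apply clim_of_norm2. 
  apply lim0_le with (fun P => 4 * (hs u * hs u) * n2 u * / sqrt (1 + INR P)).
  - intro P. split; [apply Cnorm2_ge0|].
    replace (csum (fun p => Cmul (u p) (wcoef u k p)) P - NL u k)%C with (- ip (shn k (conv (hhigh P u) u)) u)%C.
    + replace (Cnorm2 (- ip (shn k (conv (hhigh P u) u)) u)%C) with (Cnorm2 (ip (shn k (conv (hhigh P u) u)) u)) by (unfold Cnorm2; simpl; ring).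
      eapply Rle_trans; [apply cauchy_schwarz|].
      assert (A : n2 (shn k (conv (hhigh P u) u)) <= n2 (conv (hhigh P u) u)).
      { rewrite <- !nrm_sqr. apply Rmult_le_compat; try apply nrm_ge0; apply nrm_shn_le. }
      pose proof (n2_conv_high (hhigh P u) u P (hhigh_out P u)) as B.
      assert (s0 : 0 < sqrt (1 + INR P)) by apply sqrt_lt_R0, INR1_pos.
      assert (Cc : 4 / sqrt (1 + INR P) * (hs (hhigh P u) * hs u) <= 4 / sqrt (1 + INR P) * (hs u * hs u)).
      { apply Rmult_le_compat_l; [apply Rlt_le, Rdiv_lt_0_compat; lra|]. apply Rmult_le_compat_r; [apply hs_ge0 | apply hs_hfilter]. }
      replace (4 * (hs u * hs u) * n2 u * / sqrt (1 + INR P)) with (4 / sqrt (1 + INR P) * (hs u * hs u) * n2 u) by (field; lra).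
      apply Rmult_le_compat_r; [apply n2_ge0 | lra].
    + rewrite szego_partial. unfold NL. rewrite (conv_split P u u).
      replace (shn k (ladd (conv (hlow P u) u) (conv (hhigh P u) u))) with (ladd (shn k (conv (hlow P u) u)) (shn k (conv (hhigh P u) u))).
      * rewrite ip_add_l. ring.
      * apply l2_ext. intro n. rewrite ladd_k, !shn_k, ladd_k. auto.
  - apply lim_scal0. apply is_lim_seq_ext with (fun P => sqrt (/ (1 + INR P))); [intro; rewrite sqrt_inv; auto|].
    rewrite <- sqrt_0. apply clim_cont_sqrt.
    apply is_lim_seq_ext with (fun n => / (INR (S n))); [intro; rewrite S_INR, Rplus_comm; auto|].
    apply (is_lim_seq_incr_1 (fun n => / INR n)). replace (Finite 0) with (Rbar_inv p_infty) by auto.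
    apply is_lim_seq_inv; [apply is_lim_seq_INR | discriminate].
Qed.

Lemma szego_nl_NL (u : h12) k : szego_nl u k = NL u k.
Proof. apply Csum_unique, szego_clim. Qed.

Lemma csum_add f m n : csum f (m + n) = (csum f m + csum (fun k => f (m + k)%nat) n)%C.
Proof. induction n as [|n IH]; [rewrite Nat.add_0_r; simpl; ring|]. rewrite Nat.add_succ_r. simpl. rewrite IH. ring. Qed.

(** The coefficients of |u|^2 of nonnegative index are those of H_u u, and those of negative index
    are conjugates of these. Splitting the convolution at p = n therefore gives H_u^2 u plus a
    finite sum, the form in which the explicit flow will be differentiated. *)
Lemma NL_hank (u : h12) n : NL u n = (hank u (hank u u) n + csum (fun k => hank u u (n - k)%nat * u k) n)%C.
Proof.
  apply (clim_unique (fun Q => csum (fun p => Cmul (u p) (wcoef u n p)) (n + Q))).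
  - apply (clim_subseq (csum (fun p => Cmul (u p) (wcoef u n p))) (NL u n) (fun Q => (n + Q)%nat)); [intro; lia | apply szego_clim].
  - rewrite Cplus_comm, (hank_k _ (hank u u)).
    apply clim_ext with (fun Q => csum (fun k => hank u u (n - k)%nat * u k) n + csum (fun q => shn n u q * Cconj (hank u u q)) Q)%C.
    + intro Q. rewrite csum_add. f_equal; apply csum_ext; intros p Hp; rewrite wcoef_ip.
      * rewrite shn_tsh_le, hank_k by lia. apply Cmult_comm.
      * rewrite shn_tsh_ge, ip_tsh_self, shn_k, hank_k by lia. replace (n + p - n)%nat with p by lia. auto.
    + apply clim_plus; [apply clim_const | apply ip_lim].
Qed.

Section Operator.
Variables (A : seqC -> seqC) (w : h12).
Hypothesis HA : forall x : l2, A x = hank w x.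

Lemma eigsp2_hank s (x : l2) : eigsp2 A s x <-> hank w (hank w x) = lscal (RtoC s) x.
Proof.
  unfold eigsp2. rewrite !HA. split.
  - intros [_ H]. apply l2_ext. intro k. rewrite lscal_k, H. unfold Cscale. apply injective_projections; simpl; ring.
  - intro H. split; [apply is_l2_lval; eauto|]. intro n. rewrite H, lscal_k. unfold Cscale. apply injective_projections; simpl; ring.
Qed.

Lemma eigsp2_lval s h : eigsp2 A s h <-> exists x : l2, h = lval x /\ hank w (hank w x) = lscal (RtoC s) x.
Proof.
  split.
  - intro H. destruct (proj1 (is_l2_lval h) (proj1 H)) as [x E]. subst h. exists x. split; auto. apply eigsp2_hank, H.
  - intros (x & -> & H). apply eigsp2_hank, H.
Qed.

Lemma is_eigval2_hank s : is_eigval2 A s <-> exists x : l2, hank w (hank w x) = lscal (RtoC s) x /\ x <> lzero.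
Proof.
  split.
  - intros (h & H & N). apply eigsp2_lval in H. destruct H as (x & -> & H). exists x. split; auto. apply nonzero_lval, N.
  - intros (x & H & N). exists (lval x). split; [apply eigsp2_hank, H | apply nonzero_lval, N].
Qed.

Section Spectrum.
Variables (c : nat -> C) (e : nat -> l2).
Hypothesis D : SD w c e.

Lemma sd_e_neq j : e j <> lzero.
Proof. intro E. pose proof (sd_nrm _ _ _ D j) as N. rewrite E, n2_zero in N. lra. Qed.

Lemma sd_enum s : 0 < s -> is_eigval2 A s <-> exists j, s = Cnorm2 (c j).
Proof.
  intro Hs. rewrite is_eigval2_hank. split.
  - intros (x & H & N). destruct (sd_eigvec _ _ _ D s x Hs H N) as (j & E & _). eauto.
  - intros [j ->]. exists (e j). split; [apply (sd_sqr _ _ _ D) | apply sd_e_neq].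
Qed.

Lemma sd_enumerates : enumerates A (fun j => Cmod (c j)).
Proof.
  assert (P : forall j, 0 < Cmod (c j)).
  { intro j. rewrite Cmod_sqrt_norm2. apply sqrt_lt_R0, (sd_pos _ _ _ D). }
  split; [auto | split].
  - intro j. rewrite !Cmod_sqrt_norm2. apply sqrt_lt_1_alt. split; [apply Cnorm2_ge0 | apply (sd_dec _ _ _ D)].
  - intros s Hs. rewrite sd_enum by auto. split; intros [j ->]; exists j; rewrite <- Cmod_sqr; ring.
Qed.

Lemma sd_enumerates_unique lam : enumerates A lam -> forall j, lam j = Cmod (c j).
Proof.
  intros (L0 & L1 & L2) j.
  assert (E : lam j ^ 2 = Cnorm2 (c j)).
  { apply (decreasing_enum_unique (fun j => lam j ^ 2) (fun j => Cnorm2 (c j))).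
    - intro n. specialize (L1 n). pose proof (L0 (S n)). pose proof (L0 n). simpl. rewrite !Rmult_1_r. apply Rmult_le_0_lt_compat; lra.
    - apply (sd_dec _ _ _ D).
    - intro i. apply sd_enum; [apply pow_lt; auto|]. apply L2; [apply pow_lt; auto | eauto].
    - intro i. apply L2; [apply (sd_pos _ _ _ D)|]. apply sd_enum; [apply (sd_pos _ _ _ D) | eauto]. }
  rewrite Cmod_sqrt_norm2, <- E. simpl. rewrite Rmult_1_r, sqrt_square; auto. apply Rlt_le; auto.
Qed.

Lemma sd_line j (x : l2) : hank w (hank w x) = lscal (RtoC (Cnorm2 (c j))) x -> x = lscal (ip x (e j)) (e j).
Proof.
  intro H. destruct (classic (x = lzero)) as [->|N]; [rewrite ip_zero_l, lscal_0; auto|].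
  destruct (sd_eigvec _ _ _ D _ x (sd_pos _ _ _ D j) H N) as (i & E & E').
  destruct (Nat.eq_dec i j) as [->|NE]; auto. destruct (sd_neq _ _ _ D i j NE). auto.
Qed.

Lemma sd_simple j : simple_space (eigsp2 A (Cmod (c j) ^ 2)).
Proof.
  replace (Cmod (c j) ^ 2) with (Cnorm2 (c j)) by (rewrite <- Cmod_sqr; ring).
  intros h g Hh Nh Hg. apply eigsp2_lval in Hh, Hg. destruct Hh as (x & -> & Hx), Hg as (y & -> & Hy).
  apply nonzero_lval in Nh. apply sd_line in Hx, Hy.
  assert (N : ip x (e j) <> RtoC 0) by (intro E; rewrite E, lscal_0 in Hx; auto).
  exists (ip y (e j) / ip x (e j))%C. intro n. rewrite Hy at 1. rewrite Hx at 2. rewrite !lscal_k.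
  change (@eq C (ip y (e j) * e j n)%C (ip y (e j) / ip x (e j) * (ip x (e j) * e j n))%C). field. auto.
Qed.

(** The eigenspace is the line of [e j], so the projection of [v] is (v|e_j) e_j. *)
Lemma sd_proj_nonzero j (v : l2) : proj_nonzero (eigsp2 A (Cmod (c j) ^ 2)) v <-> ip v (e j) <> RtoC 0.
Proof.
  replace (Cmod (c j) ^ 2) with (Cnorm2 (c j)) by (rewrite <- Cmod_sqr; ring).
  assert (Q : forall p y : l2, inner (fun n => Csub (v n) (p n)) y = (ip v y - ip p y)%C).
  { intros p y. replace (fun n => Csub (v n) (p n)) with (lval (lsub v p)); [rewrite inner_ip; apply ip_sub_l|].
    apply functional_extensionality. intro n. apply lsub_k. }
  split.
  (* If (v|e_j) = 0 the zero vector, written as a multiple of [e j], qualifies as the projection. *)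
  - intros H E. set (p := lscal (RtoC 0) (e j)).
    assert (Np : Defs.nonzero p).
    { apply H; [apply eigsp2_hank; unfold p; rewrite lscal_0, hank_zero, hank_zero; vec|].
      intros h Hh. apply eigsp2_lval in Hh. destruct Hh as (y & -> & Hy). apply sd_line in Hy. rewrite Q, Hy, !ip_scal_r.
      unfold p. rewrite ip_scal_l, E. change (@eq C (Cconj (ip y (e j)) * 0 - Cconj (ip y (e j)) * (0 * ip (e j) (e j)))%C (RtoC 0)). ring. }
    apply nonzero_lval in Np. apply Np. apply lscal_0.
  - intros H p Hp O. apply eigsp2_lval in Hp. destruct Hp as (y & -> & Hy). apply nonzero_lval. intros ->.
    specialize (O (lval (e j)) (proj2 (eigsp2_hank _ _) (sd_sqr _ _ _ D j))). rewrite Q, ip_zero_l in O.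
    apply H. replace (ip v (e j)) with (ip v (e j) - 0)%C by ring. exact O.
Qed.
End Spectrum.

Lemma sd_of_enumerates lam : enumerates A lam -> (forall j, simple_space (eigsp2 A (lam j ^ 2))) ->
  exists c e, SD w c e /\ forall j, Cnorm2 (c j) = lam j ^ 2.
Proof.
  intros (L0 & L1 & L2) S. apply sd_build.
  - intro; apply pow_lt; auto.
  - intro n. specialize (L1 n). pose proof (L0 (Datatypes.S n)). pose proof (L0 n). simpl. rewrite !Rmult_1_r. apply Rmult_le_0_lt_compat; lra.
  - intros s Hs. rewrite <- is_eigval2_hank. apply L2, Hs.
  - intros j h g Hh Nh Hg. destruct (S j (lval h) (lval g)) as [k Hk]; [apply eigsp2_hank, Hh | apply nonzero_lval, Nh | apply eigsp2_hank, Hg |].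
    exists k. apply l2_ext. intro n. rewrite lscal_k. apply Hk.
Qed.
End Operator.

(** * Phases and the map [chi] *)

Lemma ip_u_eig (u : h12) (c : C) (x : l2) : hank u x = lscal c x -> ip u x = (c * Cconj (ip (ldelta 0) x))%C.
Proof. intro H. rewrite <- (hank_one u) at 1. rewrite hank_sym, H, ip_scal_l, <- ip_conj. auto. Qed.

Lemma phase_core (z w : C) r : 0 < r -> z <> RtoC 0 -> w = (RtoC r * Cconj z)%C ->
  w <> C0 /\ Cscale (Cmod z) (Cexp_minus_i_arg w) = z.
Proof.
  intros r0 Nz ->. assert (z0 : 0 < Cmod z) by (apply Cmod_gt_0; auto). split.
  - intro E. assert (Cmod (RtoC r * Cconj z)%C = 0) by (rewrite E; apply Cmod_0).
    rewrite Cmod_mult, Cmod_R, Cmod_conj, Rabs_pos_eq in H by lra. assert (0 < r * Cmod z) by (apply Rmult_lt_0_compat; auto). lra.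
  - unfold Cexp_minus_i_arg. rewrite Cabs_Cmod, Cmod_mult, Cmod_R, Cmod_conj, Rabs_pos_eq by lra.
    unfold Cscale. apply injective_projections; simpl; field; lra.
Qed.

(** [k] is a square root of c/|c|, obtained from the half-angle formulas: [p] and [q] are the moduli
    of the cosine and sine of half the argument, and [sg] is the sign of the imaginary part. *)
Lemma phase_sqrt (c : C) : c <> RtoC 0 -> exists k : C, Cnorm2 k = 1 /\ (Cconj k * Cconj k * c = RtoC (Cmod c))%C.
Proof.
  intro N. assert (c0 : 0 < Cmod c) by (apply Cmod_gt_0; auto).
  set (r := Cmod c) in *. destruct c as [a b].
  assert (R2 : a * a + b * b = r * r) by (unfold r; rewrite Cmod_sqr; auto).
  assert (A : - r <= a <= r) by (split; nra).
  set (p := sqrt ((r + a) / (2 * r))). set (q := sqrt ((r - a) / (2 * r))).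
  assert (pp : p * p = (r + a) / (2 * r)) by (apply sqrt_sqrt; apply Rmult_le_pos; [lra | apply Rlt_le, Rinv_0_lt_compat; lra]).
  assert (qq : q * q = (r - a) / (2 * r)) by (apply sqrt_sqrt; apply Rmult_le_pos; [lra | apply Rlt_le, Rinv_0_lt_compat; lra]).
  assert (p0 : 0 <= p) by apply sqrt_pos. assert (q0 : 0 <= q) by apply sqrt_pos.
  assert (pq : p * q = Rabs b / (2 * r)).
  { unfold p, q. rewrite <- sqrt_mult_alt by (apply Rmult_le_pos; [lra | apply Rlt_le, Rinv_0_lt_compat; lra]).
    replace ((r + a) / (2 * r) * ((r - a) / (2 * r))) with (Rsqr (b / (2 * r))).
    - rewrite sqrt_Rsqr_abs. unfold Rdiv. rewrite Rabs_mult, (Rabs_pos_eq (/ (2 * r))); auto. apply Rlt_le, Rinv_0_lt_compat; lra.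
    - unfold Rsqr. replace (b / (2 * r) * (b / (2 * r))) with (b * b / (4 * (r * r))) by (field; lra).
      replace (b * b) with (r * r - a * a) by lra. field; lra. }
  assert (F : exists sg, sg * sg = 1 /\ sg * Rabs b = b).
  { destruct (Rle_dec 0 b); [exists 1; rewrite Rabs_pos_eq by auto | exists (-1); rewrite Rabs_left by lra]; lra. }
  destruct F as (sg & s1 & s2). exists (p, sg * q). split.
  - unfold Cnorm2; simpl. replace (sg * q * (sg * q)) with (sg * sg * (q * q)) by ring. rewrite s1, pp, qq. field; lra.
  - assert (E : sg * (p * q) = b / (2 * r)) by (rewrite pq; rewrite <- s2 at 2; field; lra).
    assert (E1 : p * p - q * q = a / r) by (rewrite pp, qq; field; lra).
    unfold RtoC. apply injective_projections; simpl.
    + replace (_ - _) with ((p * p - sg * sg * (q * q)) * a + 2 * (sg * (p * q)) * b) by ring.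
      rewrite s1, Rmult_1_l, E, E1. replace (a / r * a + 2 * (b / (2 * r)) * b) with ((a * a + b * b) / r) by (field; lra). rewrite R2. field; lra.
    + replace (_ + _) with ((p * p - sg * sg * (q * q)) * b - 2 * (sg * (p * q)) * a) by ring.
      rewrite s1, Rmult_1_l, E, E1. field; lra.
Qed.

Section Chi.
Variables (u : h12) (z g : nat -> C) (e f : nat -> l2) (al be : nat -> R).
Hypothesis D : chiD u z g e f al be.
Let De := cd_e _ _ _ _ _ _ _ D.
Let Df := cd_f _ _ _ _ _ _ _ D.

Lemma cd_g_neq m : g m <> RtoC 0.
Proof. intro E. pose proof (sd_pos _ _ _ Df m) as P. rewrite E in P. unfold Cnorm2 in P; simpl in P. lra. Qed.

Lemma cd_zn_neq j : z j <> RtoC 0.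
Proof. intro E. pose proof (sd_pos _ _ _ De j) as P. cbv beta in P. rewrite E in P. unfold Cnorm2 in P; simpl in P. lra. Qed.

Lemma chi_e_phase j k : k <> RtoC 0 -> hank u (lscal k (e j)) = lscal (RtoC (Cmod (z j))) (lscal k (e j)) ->
  let w := Cmul (inner Defs.one (lscal k (e j))) (inner Defs.one (lscal k (e j))) in
  w <> C0 /\ Cscale (Cmod (z j)) (Cexp_minus_i_arg w) = z j.
Proof.
  intros Nk H w. rewrite hank_scal, (sd_eig _ _ _ De j), !lscal_lscal in H.
  assert (Hk : (Cconj k * Cconj (z j) = RtoC (Cmod (z j)) * k)%C).
  { apply (f_equal (fun y => ip y (e j))) in H. rewrite !ip_scal_l, ip_self, (sd_nrm _ _ _ De), !Cmult_1_r in H. exact H. }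
  pose proof (ip_u_eig u _ _ (sd_eig _ _ _ De j)) as Y. rewrite (cd_ue _ _ _ _ _ _ _ D) in Y.
  set (y := ip (ldelta 0) (e j)) in *.
  assert (Y' : (y * z j = RtoC (al j))%C).
  { apply (f_equal Cconj) in Y. rewrite Cmult_conj, !Cconj_conj, Cconj_R in Y. rewrite Y. ring. }
  assert (Nz := cd_zn_neq j). assert (z0 : 0 < Cmod (z j)) by (apply Cmod_gt_0; auto).
  assert (k0 : 0 < Cmod k) by (apply Cmod_gt_0; auto). assert (a0 := cd_al _ _ _ _ _ _ _ D j).
  set (r := Cmod k * Cmod k * (al j * al j) / (Cmod (z j) * Cmod (z j) * Cmod (z j))).
  apply (phase_core _ _ r); auto.
  { unfold r. apply Rdiv_lt_0_compat; repeat apply Rmult_lt_0_compat; auto. }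
  assert (Ew : w = (Cconj k * y * (Cconj k * y))%C).
  { unfold w. rewrite one_lval, inner_ip, ip_scal_r. reflexivity. }
  rewrite Ew.
  assert (ZZ : (z j * Cconj (z j) = RtoC (Cmod (z j)) * RtoC (Cmod (z j)))%C) by (rewrite <- RtoC_mult, Cmod_sqr; apply injective_projections; unfold Cnorm2; simpl; ring).
  assert (KK : (k * Cconj k = RtoC (Cmod k) * RtoC (Cmod k))%C) by (rewrite <- RtoC_mult, Cmod_sqr; apply injective_projections; unfold Cnorm2; simpl; ring).
  assert (NC : Cconj (z j) <> RtoC 0) by apply (cd_z_neq _ _ _ _ _ _ _ D).
  assert (NM : RtoC (Cmod (z j)) <> RtoC 0) by (apply RtoC_neq; lra).
  unfold r. rewrite RtoC_div, !RtoC_mult by (repeat apply Rmult_integral_contrapositive_currified; lra).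
  rewrite <- Y', <- KK.
  apply (Cmult_neq0_reg _ _ (Cconj (z j))); auto.
  replace (Cconj k * y * (Cconj k * y) * Cconj (z j))%C with (Cconj k * Cconj (z j) * (Cconj k * y * y))%C by ring. rewrite Hk.
  set (Z := RtoC (Cmod (z j))) in *.
  replace (k * Cconj k * (y * z j * (y * z j)) / (Z * Z * Z) * Cconj (z j) * Cconj (z j))%C
    with (k * Cconj k * (y * y) * ((z j * Cconj (z j)) * (z j * Cconj (z j))) / (Z * Z * Z))%C by (field; auto).
  rewrite ZZ. field. auto.
Qed.

(** Here (u|f_m) is real, so the phase of the square of (u|k f_m) comes from [k] alone. *)
Lemma chi_f_phase m k : k <> RtoC 0 -> hank (hshift u) (lscal k (f m)) = lscal (RtoC (Cmod (g m))) (lscal k (f m)) ->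
  let w := Cmul (inner u (lscal k (f m))) (inner u (lscal k (f m))) in
  w <> C0 /\ Cscale (Cmod (g m)) (Cexp_minus_i_arg w) = g m.
Proof.
  intros Nk H w. rewrite hank_scal, (sd_eig _ _ _ Df m), !lscal_lscal in H.
  assert (Hk : (Cconj k * g m = RtoC (Cmod (g m)) * k)%C).
  { apply (f_equal (fun y => ip y (f m))) in H. rewrite !ip_scal_l, ip_self, (sd_nrm _ _ _ Df), !Cmult_1_r in H. exact H. }
  assert (Ng := cd_g_neq m). assert (z0 : 0 < Cmod (g m)) by (apply Cmod_gt_0; auto).
  assert (k0 : 0 < Cmod k) by (apply Cmod_gt_0; auto). assert (a0 := cd_be _ _ _ _ _ _ _ D m).
  set (r := Cmod k * Cmod k * (be m * be m) / Cmod (g m)).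
  apply (phase_core _ _ r); auto.
  { unfold r. apply Rdiv_lt_0_compat; repeat apply Rmult_lt_0_compat; auto. }
  assert (Ew : w = (Cconj k * RtoC (be m) * (Cconj k * RtoC (be m)))%C).
  { unfold w. rewrite inner_ip, ip_scal_r, (cd_uf _ _ _ _ _ _ _ D). reflexivity. }
  rewrite Ew.
  assert (ZZ : (g m * Cconj (g m) = RtoC (Cmod (g m)) * RtoC (Cmod (g m)))%C) by (rewrite <- RtoC_mult, Cmod_sqr; apply injective_projections; unfold Cnorm2; simpl; ring).
  assert (KK : (k * Cconj k = RtoC (Cmod k) * RtoC (Cmod k))%C) by (rewrite <- RtoC_mult, Cmod_sqr; apply injective_projections; unfold Cnorm2; simpl; ring).
  assert (NM : RtoC (Cmod (g m)) <> RtoC 0) by (apply RtoC_neq; lra).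
  unfold r. rewrite RtoC_div, !RtoC_mult by lra. rewrite <- KK.
  apply (Cmult_neq0_reg _ _ (g m)); auto.
  replace (Cconj k * RtoC (be m) * (Cconj k * RtoC (be m)) * g m)%C with (Cconj k * g m * (Cconj k * RtoC (be m) * RtoC (be m)))%C by ring. rewrite Hk.
  set (Z := RtoC (Cmod (g m))) in *.
  replace (k * Cconj k * (RtoC (be m) * RtoC (be m)) / Z * Cconj (g m) * g m)%C
    with (k * Cconj k * (RtoC (be m) * RtoC (be m)) * (g m * Cconj (g m)) / Z)%C by (field; auto).
  rewrite ZZ. field. auto.
Qed.

Lemma Cscale_lscal r (x : l2) n : Cscale r (x n) = lscal (RtoC r) x n.
Proof. rewrite lscal_k. unfold Cscale. apply injective_projections; simpl; ring. Qed.

Lemma sd_real_vectors (A : seqC -> seqC) w c v : (forall x : l2, A x = hank w x) -> SD w c v ->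
  exists k : nat -> C, forall j, k j <> RtoC 0 /\ is_l2 (lscal (k j) (v j)) /\ l2norm2 (lscal (k j) (v j)) = 1 /\
    hank w (lscal (k j) (v j)) = lscal (RtoC (Cmod (c j))) (lscal (k j) (v j)) /\
    forall n, A (lscal (k j) (v j)) n = Cscale (Cmod (c j)) (lscal (k j) (v j) n).
Proof.
  intros HA S.
  assert (Q : forall j, exists k : C, Cnorm2 k = 1 /\ (Cconj k * Cconj k * c j = RtoC (Cmod (c j)))%C).
  { intro j. apply phase_sqrt. intro E. pose proof (sd_pos _ _ _ S j) as P. rewrite E in P. unfold Cnorm2 in P; simpl in P. lra. }
  exists (fun j => proj1_sig (constructive_indefinite_description _ (Q j))). intro j.
  destruct constructive_indefinite_description as (k & K1 & K2). cbn [proj1_sig].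
  assert (H : hank w (lscal k (v j)) = lscal (RtoC (Cmod (c j))) (lscal k (v j))).
  { rewrite hank_scal, (sd_eig _ _ _ S), !lscal_lscal. f_equal. rewrite <- K2.
    replace (Cconj k * Cconj k * c j * k)%C with (Cconj k * c j * (k * Cconj k))%C by ring.
    replace (k * Cconj k)%C with (RtoC 1) by (rewrite <- K1; apply injective_projections; unfold Cnorm2; simpl; ring). ring. }
  split; [|split; [|split; [|split]]]; auto.
  - intros ->. unfold Cnorm2 in K1; simpl in K1; lra.
  - apply is_l2_lval; eauto.
  - rewrite l2norm2_n2, n2_scal, K1, (sd_nrm _ _ _ S). ring.
  - intro n. rewrite HA, H. symmetry. apply Cscale_lscal.
Qed.

Lemma Cmod_z j : Cmod (Cconj (z j)) = Cmod (z j).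
Proof. apply Cmod_conj. Qed.

Theorem chi_rel_exists : chi_rel u (z, g).
Proof.
  destruct (sd_real_vectors _ _ _ _ (hankel_hank u) De) as [k Hk].
  destruct (sd_real_vectors _ _ _ _ (kop_hank u) Df) as [l Hl].
  exists (fun j => Cmod (Cconj (z j))), (fun m => Cmod (g m)), (fun j => lval (lscal (k j) (e j))), (fun m => lval (lscal (l m) (f m))).
  split; [apply (sd_enumerates _ _ (hankel_hank u) _ _ De)|]. split; [apply (sd_enumerates _ _ (kop_hank u) _ _ Df)|].
  split; [intro j; destruct (Hk j) as (_ & ? & ? & _ & ?); auto|]. split; [intro j; destruct (Hl j) as (_ & ? & ? & _ & ?); auto|].
  split; intro j; cbn [fst snd].
  - destruct (Hk j) as (N & _ & _ & H & _). rewrite Cmod_z in *. destruct (chi_e_phase j (k j) N H). auto.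
  - destruct (Hl j) as (N & _ & _ & H & _). destruct (chi_f_phase j (l j) N H). auto.
Qed.

Lemma sd_real_unique (A : seqC -> seqC) w c v j (x : l2) : (forall x : l2, A x = hank w x) -> SD w c v -> l2norm2 x = 1 ->
  (forall n, A x n = Cscale (Cmod (c j)) (x n)) ->
  exists k, k <> RtoC 0 /\ x = lscal k (v j) /\ hank w x = lscal (RtoC (Cmod (c j))) x.
Proof.
  intros HA S N1 H.
  assert (Hx : hank w x = lscal (RtoC (Cmod (c j))) x) by (apply l2_ext; intro n; rewrite <- Cscale_lscal, <- H, HA; auto).
  assert (E : x = lscal (ip x (v j)) (v j)).
  { apply (sd_line _ _ _ S). rewrite Hx, hank_scal, Hx, lscal_lscal, Cconj_R, <- RtoC_mult, Cmod_sqr. auto. }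
  exists (ip x (v j)). split; auto. intro Z. rewrite Z, lscal_0 in E. rewrite l2norm2_n2, E, n2_zero in N1. lra.
Qed.

Theorem chi_rel_unique p : chi_rel u p -> p = (z, g).
Proof.
  intros (lam & mu & e' & f' & L & M & He & Hf & Pe & Pf).
  pose proof (sd_enumerates_unique _ _ (hankel_hank u) _ _ De lam L) as EL.
  pose proof (sd_enumerates_unique _ _ (kop_hank u) _ _ Df mu M) as EM.
  apply injective_projections; apply functional_extensionality; intro j; cbn [fst snd].
  - destruct (He j) as (I & N1 & H). destruct (Pe j) as [_ P]. apply is_l2_lval in I. destruct I as [x Ex].
    rewrite <- Ex in *. rewrite EL in *.
    destruct (sd_real_unique _ _ _ _ j x (hankel_hank u) De N1 H) as (k & Nk & Ek & Hk).
    rewrite P. rewrite Cmod_z in *. rewrite Ek in *. apply chi_e_phase; auto.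
  - destruct (Hf j) as (I & N1 & H). destruct (Pf j) as [_ P]. apply is_l2_lval in I. destruct I as [x Ex].
    rewrite <- Ex in *. rewrite EM in *.
    destruct (sd_real_unique _ _ _ _ j x (kop_hank u) Df N1 H) as (k & Nk & Ek & Hk).
    rewrite P. rewrite Ek in *. apply chi_f_phase; auto.
Qed.

Theorem chiD_chi : chi u = (z, g).
Proof.
  apply chi_rel_unique. apply (epsilon_spec (inhabits ((fun _ => C0), (fun _ => C0))) (chi_rel u)). exists (z, g). apply chi_rel_exists.
Qed.

Theorem chiD_gen : gen u.
Proof.
  split; [apply is_H12_lval; eauto|]. exists (fun j => Cmod (Cconj (z j))).
  split; [apply (sd_enumerates _ _ (hankel_hank u) _ _ De)|]. intro j. split; [apply (sd_simple _ _ (hankel_hank u) _ _ De)|].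
  rewrite one_lval. apply (sd_proj_nonzero _ _ (hankel_hank u) _ _ De). intro E.
  pose proof (ip_u_eig u _ _ (sd_eig _ _ _ De j)) as Y. rewrite (cd_ue _ _ _ _ _ _ _ D), E in Y.
  pose proof (cd_al _ _ _ _ _ _ _ D j). apply (f_equal fst) in Y. simpl in Y. lra.
Qed.
End Chi.

(** A symbol bundled with its normalised spectral data, so that sequences of symbols can be taken
    together with all their data. *)
Record datum := { dt_u : h12; dt_z : nat -> C; dt_g : nat -> C; dt_e : nat -> l2; dt_f : nat -> l2; dt_al : nat -> R; dt_be : nat -> R;
  dt_chiD : chiD dt_u dt_z dt_g dt_e dt_f dt_al dt_be }.

(** The condition on the projections of 1 means that (1|e_j) is nonzero; by [ip_u_eig] so is
    (u|e_j), which a change of phase of [e j] then makes positive. *)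
Theorem gen_datum (h : seqC) : gen h -> exists P : datum, lval (dt_u P) = h.
Proof.
  intros (Hh & lam & L & S). apply is_H12_lval in Hh. destruct Hh as [u <-].
  destruct (sd_of_enumerates _ _ (hankel_hank u) lam L (fun j => proj1 (S j))) as (c & e & D & Ec).
  assert (Mc : forall j, lam j = Cmod (c j)) by (apply (sd_enumerates_unique _ _ (hankel_hank u) _ _ D lam L)).
  destruct (sd_normalize u c e u D) as (c' & e' & D' & _ & R).
  { intros j E. rewrite (ip_u_eig u _ _ (sd_eig _ _ _ D j)) in E.
    destruct (S j) as [_ P]. rewrite Mc, one_lval in P. apply (sd_proj_nonzero _ _ (hankel_hank u) _ _ D) in P.
    apply Cmult_eq0 in E.
    - apply P. rewrite <- (Cconj_conj (ip (ldelta 0) (e j))), E. apply Cconj_R.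
    - intro Z. pose proof (sd_pos _ _ _ D j) as Q. rewrite Z in Q. unfold Cnorm2 in Q; simpl in Q. lra. }
  set (al := fun j => proj1_sig (constructive_indefinite_description _ (R j))).
  assert (Hal : forall j, 0 < al j /\ ip u (e' j) = RtoC (al j)) by (intro j; unfold al; destruct constructive_indefinite_description; auto).
  destruct (kp_exists u c' e' al D' (fun j => proj1 (Hal j)) (fun j => proj2 (Hal j))) as (g & f & be & Df & Hbe).
  assert (X : chiD u (fun j => Cconj (c' j)) g e' f al be).
  { constructor; auto; try (intro j; apply Hal); try (intro j; apply Hbe).
    replace (fun j => Cconj (Cconj (c' j))) with c'; auto. apply functional_extensionality. intro; rewrite Cconj_conj; auto. }
  exists (Build_datum _ _ _ _ _ _ _ X). auto.
Qed.

(** * Construction of the inverse and of the flow *)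

Section Base.
Variables x y a : nat -> R.
Hypothesis xy : forall j, y j < x j.
Hypothesis yx : forall j, x (S j) < y j.
Hypothesis xpos : forall j, 0 < x j.
Hypothesis xex : ex_series x.
Hypothesis apos : forall j, 0 < a j.
Hypothesis aex : ex_series a.
Hypothesis aroot : forall m, is_series (fun k => a k / (x k - y m)) 1.
Hypothesis axex : ex_series (fun k => a k / x k).
Hypothesis axle : Series (fun k => a k / x k) <= 1.

Let xdec := inter_xdec x y xy yx.
Let ydec := inter_ydec x y xy yx.
Let xy_neq := inter_neq x y xy yx.
Let y_pos : forall j, 0 < y j := ypos x y yx xpos.

Definition al j := sqrt (a j).
Lemma al_pos j : 0 < al j.
Proof. apply sqrt_lt_R0, apos. Qed.
Lemma al_sqr j : al j * al j = a j.
Proof. apply sqrt_sqrt, Rlt_le, apos. Qed.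

Definition alv : l2 := to_l2 (fun k => RtoC (al k)).
Lemma alv_k k : alv k = RtoC (al k).
Proof.
  apply (to_l2_k (fun k => RtoC (al k))). apply ex_series_ext_R with (2 := aex). intro; rewrite Cnorm2_RtoC, al_sqr; auto.
Qed.

Lemma x_bounded : cbounded (fun k => RtoC (x k)).
Proof.
  exists (x O * x O). intro k. rewrite Cnorm2_RtoC. pose proof (xdec_le x xdec O k ltac:(lia)). pose proof (xpos k). nra.
Qed.

Lemma y_bounded : cbounded (fun k => RtoC (y k)).
Proof.
  exists (y O * y O). intro k. rewrite Cnorm2_RtoC. pose proof (xdec_le y ydec O k ltac:(lia)). pose proof (y_pos k). nra.
Qed.

Lemma sqx_bounded : cbounded (fun k => RtoC (sqrt (x k))).
Proof.
  exists (x O). intro k. rewrite Cnorm2_RtoC, sqrt_sqrt by (apply Rlt_le; auto). apply (xdec_le x xdec); lia.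
Qed.

(** The future K_u^2 in the basis of the [e j], where H_u^2 is diagonal and [u] has the coordinates
    [al]. *)
Definition Bop (v : l2) : l2 := lsub (dg (fun k => RtoC (x k)) v) (lscal (ip v alv) alv).

Lemma Bop_k v k : Bop v k = (RtoC (x k) * v k - ip v alv * RtoC (al k))%C.
Proof. unfold Bop. rewrite lsub_k, lscal_k, dg_k, alv_k by apply x_bounded. auto. Qed.

Lemma Bop_add v w : Bop (ladd v w) = ladd (Bop v) (Bop w).
Proof. apply l2_ext; intro k. rewrite ladd_k, !Bop_k, ladd_k, ip_add_l. ring. Qed.

Lemma Bop_scal c v : Bop (lscal c v) = lscal c (Bop v).
Proof. apply l2_ext; intro k. rewrite lscal_k, !Bop_k, lscal_k, ip_scal_l. ring. Qed.

Lemma dgx_sym v w : ip (dg (fun k => RtoC (x k)) v) w = ip v (dg (fun k => RtoC (x k)) w).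
Proof. apply ip_coord_ext. intro k. rewrite !dg_k, Cmult_conj, Cconj_R by apply x_bounded. ring. Qed.

Lemma Bop_sym v w : ip (Bop v) w = ip v (Bop w).
Proof.
  unfold Bop. rewrite ip_sub_l, ip_sub_r, ip_scal_l, ip_scal_r, dgx_sym, <- ip_conj. ring.
Qed.

Definition xnorm (v : l2) := Series (fun k => x k * Cnorm2 (v k)).

Lemma xnorm_ex (v : l2) : ex_series (fun k => x k * Cnorm2 (v k)).
Proof.
  apply ex_series_le' with (fun k => x O * Cnorm2 (v k)); [|apply ex_series_scal_R, l2_ex].
  intro k. pose proof (Cnorm2_ge0 (v k)). pose proof (xdec_le x xdec O k ltac:(lia)). pose proof (xpos k).
  rewrite Rabs_pos_eq; nra.
Qed.

Lemma n2_dgsq v : n2 (dg (fun k => RtoC (sqrt (x k))) v) = xnorm v.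
Proof.
  rewrite n2_Series. apply Series_ext. intro k. rewrite dg_k, Cnorm2_mult, Cnorm2_RtoC, sqrt_sqrt; auto using sqx_bounded.
  apply Rlt_le; auto.
Qed.

Lemma ip_dgx v : ip (dg (fun k => RtoC (x k)) v) v = RtoC (xnorm v).
Proof.
  rewrite <- n2_dgsq, <- ip_self. apply ip_coord_ext. intro k.
  rewrite !dg_k, Cmult_conj, Cconj_R by (try apply x_bounded; apply sqx_bounded).
  replace (RtoC (x k)) with (RtoC (sqrt (x k)) * RtoC (sqrt (x k)))%C by (rewrite <- RtoC_mult, sqrt_sqrt; auto; apply Rlt_le; auto). ring.
Qed.

Lemma Bop_quad v : fst (ip (Bop v) v) = xnorm v - Cnorm2 (ip v alv).
Proof.
  unfold Bop. rewrite ip_sub_l, ip_scal_l, ip_dgx, (ip_conj v alv), Cmult_conj_norm2. simpl. auto.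
Qed.

Lemma alx_ex : ex_series (fun k => Cnorm2 (RtoC (al k / sqrt (x k)))).
Proof.
  apply ex_series_ext_R with (2 := axex). intro k. rewrite Cnorm2_RtoC, <- al_sqr.
  rewrite <- (sqrt_sqrt (x k)) at 1 by (apply Rlt_le; auto). field. apply Rgt_not_eq, sqrt_lt_R0; auto.
Qed.

(** Cauchy-Schwarz after moving sqrt(x_k) from one factor to the other, with the sum of the a_k /
    x_k at most 1; [Bop] is nonnegative as a consequence. *)
Lemma ip_alv_le v : Cnorm2 (ip v alv) <= xnorm v.
Proof.
  set (q := to_l2 (fun k => RtoC (al k / sqrt (x k)))).
  assert (qk : forall k, q k = RtoC (al k / sqrt (x k))) by (intro; apply (to_l2_k (fun k => RtoC (al k / sqrt (x k)))), alx_ex).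
  assert (E : ip v alv = ip (dg (fun k => RtoC (sqrt (x k))) v) q).
  { apply ip_coord_ext. intro k. rewrite dg_k, qk, alv_k, !Cconj_R by apply sqx_bounded.
    assert (0 < sqrt (x k)) by (apply sqrt_lt_R0; auto).
    replace (RtoC (al k)) with (RtoC (sqrt (x k)) * RtoC (al k / sqrt (x k)))%C by (rewrite <- RtoC_mult; f_equal; field; lra). ring. }
  rewrite E. eapply Rle_trans; [apply cauchy_schwarz|]. rewrite n2_dgsq.
  assert (n2 q <= 1).
  { rewrite n2_Series. eapply Rle_trans; [|apply axle]. right. apply Series_ext. intro k. rewrite qk, Cnorm2_RtoC, <- al_sqr.
    rewrite <- (sqrt_sqrt (x k)) at 3 by (apply Rlt_le; auto). field. apply Rgt_not_eq, sqrt_lt_R0; auto. }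
  assert (0 <= xnorm v) by (rewrite <- n2_dgsq; apply n2_ge0). nra.
Qed.

Lemma xnorm_compact (v : nat -> l2) (l : l2) M : (forall n, n2 (v n) <= M) -> (forall k, clim (fun n => v n k) (l k)) ->
  is_lim_seq (fun n => xnorm (v n)) (xnorm l).
Proof.
  intros B W. apply (dominated_series _ (fun n k => M * x k) _ (fun k => M * x k)).
  - intro k. apply is_lim_seq_mult'; [apply is_lim_seq_const | apply clim_norm2, W].
  - intro; apply is_lim_seq_const.
  - intros n k. pose proof (Cnorm2_ge0 (v n k)). pose proof (coord_le_n2 (v n) k). specialize (B n). pose proof (xpos k).
    rewrite Rabs_pos_eq by (apply Rmult_le_pos; lra). rewrite Rmult_comm. apply Rmult_le_compat_r; lra.
  - intro; apply ex_series_scal_R; auto.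
  - apply ex_series_scal_R; auto.
  - apply is_lim_seq_const.
Qed.

Definition bS m := Series (fun k => a k / (x k - y m) ^ 2).
Lemma bS_ex m : ex_series (fun k => a k / (x k - y m) ^ 2).
Proof. apply (sec_sq_ex x a xdec apos aex m). split; auto. Qed.
Lemma bS_pos m : 0 < bS m.
Proof.
  assert (T : forall k, 0 < a k / (x k - y m) ^ 2).
  { intro k. apply Rdiv_lt_0_compat; auto. apply pow2_gt_0, Rminus_eq_contra, xy_neq. }
  eapply Rlt_le_trans; [apply (T O)|]. apply (term_le_Series (fun k => a k / (x k - y m) ^ 2) O).
  - intro; apply Rlt_le; auto.
  - apply bS_ex.
Qed.
Definition be m := / sqrt (bS m).
Lemma be_pos m : 0 < be m.
Proof. apply Rinv_0_lt_compat, sqrt_lt_R0, bS_pos. Qed.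

(** The overlaps computed in [kp_overlap], now taken as a definition. *)
Definition fv m : l2 := to_l2 (fun k => RtoC (be m * al k / (x k - y m))).
Lemma fv_ex m : is_series (fun k => Cnorm2 (RtoC (be m * al k / (x k - y m)))) 1.
Proof.
  replace 1 with (be m * be m * bS m).
  - apply is_series_ext_R with (fun k => be m * be m * (a k / (x k - y m) ^ 2)).
    + intro k. rewrite Cnorm2_RtoC, <- al_sqr. pose proof (Rminus_eq_contra _ _ (xy_neq k m)). field. auto.
    + apply is_series_scal_R, Series_correct, bS_ex.
  - unfold be. pose proof (bS_pos m). rewrite <- Rinv_mult, sqrt_sqrt by lra. field. lra.
Qed.
Lemma fv_k m k : fv m k = RtoC (be m * al k / (x k - y m)).
Proof. apply (to_l2_k (fun k => RtoC (be m * al k / (x k - y m)))). eexists; apply fv_ex. Qed.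
Lemma fv_n2 m : n2 (fv m) = 1.
Proof.
  rewrite n2_Series, (Series_ext _ (fun k => Cnorm2 (RtoC (be m * al k / (x k - y m))))) by (intro; rewrite fv_k; auto).
  apply is_series_unique, fv_ex.
Qed.
Lemma fv_alv m : ip (fv m) alv = RtoC (be m).
Proof.
  apply clim_unique with (1 := ip_lim _ _).
  apply clim_ext with (fun n => RtoC (be m * psum (fun k => a k / (x k - y m)) n)).
  - intro n. rewrite <- psum_scal, <- csum_RtoC. apply csum_ext. intros k _. rewrite fv_k, alv_k, Cconj_R, <- RtoC_mult, <- al_sqr.
    f_equal. unfold Rdiv; ring.
  - apply clim_RtoC. replace (Finite (be m)) with (Finite (be m * 1)) by (f_equal; ring).
    apply is_lim_seq_mult'; [apply is_lim_seq_const | apply is_series_psum; auto].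
Qed.
Lemma Bop_fv m : Bop (fv m) = lscal (RtoC (y m)) (fv m).
Proof.
  apply l2_ext; intro k. rewrite Bop_k, lscal_k, fv_alv, fv_k, <- !RtoC_mult, <- RtoC_minus. f_equal.
  pose proof (Rminus_eq_contra _ _ (xy_neq k m)). field. auto.
Qed.
Lemma fv_on : on fv.
Proof.
  intros i j. destruct Nat.eq_dec as [->|N]; [rewrite ip_self, fv_n2; auto|].
  pose proof (Bop_sym (fv i) (fv j)) as E. rewrite !Bop_fv, ip_scal_l, ip_scal_r, Cconj_R in E.
  apply NNPP. intro Z. apply (Cmult_neq0_reg _ _ _ Z) in E. apply (f_equal fst) in E. simpl in E.
  destruct (lt_dec i j) as [L|L]; [pose proof (xdec_lt y ydec i j L) | pose proof (xdec_lt y ydec j i ltac:(lia))]; lra.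
Qed.

(** If h were orthogonal to [alv] it would be supported on one coordinate, as the [x k] are
    distinct, and [al] does not vanish there. Otherwise the equation forces the coordinates of h up
    to a factor, and [s] is a root, hence some [y m]. *)
Lemma Bop_eig s h : 0 < s -> Bop h = lscal (RtoC s) h -> h <> lzero -> exists m k, h = lscal k (fv m).
Proof.
  intros Hs H N.
  assert (E : forall k, (RtoC (x k - s) * h k = ip h alv * RtoC (al k))%C).
  { intro k. apply (f_equal (fun v : l2 => v k)) in H. rewrite Bop_k, lscal_k in H. rewrite RtoC_minus.
    replace (ip h alv * RtoC (al k))%C with (RtoC (x k) * h k - (RtoC (x k) * h k - ip h alv * RtoC (al k)))%C by ring.
    rewrite H. ring. }
  assert (Nu : ip h alv <> RtoC 0).
  { intro Z. apply N.
    assert (F : forall k, x k <> s -> h k = RtoC 0).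
    { intros k Hk. specialize (E k). rewrite Z, Cmult_0_l in E. apply Cmult_eq0 in E; auto. apply RtoC_neq. lra. }
    apply l2_ext; intro k. rewrite lzero_k. destruct (Req_dec (x k) s) as [Q|Q]; auto.
    assert (Hd : h = lscal (h k) (ldelta k)).
    { apply l2_ext; intro i. rewrite lscal_k, ldelta_k. destruct Nat.eq_dec as [->|Ni]; [ring|].
      rewrite (F i); [ring|]. rewrite <- Q. apply (x_neq x y xy yx); auto. }
    rewrite Hd, ip_scal_l, ip_delta_l, alv_k, Cconj_R, Cmult_comm in Z.
    apply Cmult_eq0 in Z; auto. apply RtoC_neq. pose proof (al_pos k). lra. }
  assert (Nx : forall k, x k <> s).
  { intros k Q. specialize (E k). rewrite Q, Rminus_diag, Cmult_0_l in E. symmetry in E. rewrite Cmult_comm in E.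
    apply Cmult_eq0 in E; [contradiction|]. apply RtoC_neq. pose proof (al_pos k). lra. }
  assert (Hk : forall k, h k = (ip h alv * RtoC (al k / (x k - s)))%C).
  { intro k. assert (x k - s <> 0) by (apply Rminus_eq_contra; auto).
    unfold Rdiv. rewrite RtoC_mult, Cmult_assoc, <- E, RtoC_inv by auto. field. apply RtoC_neq; auto. }
  assert (R : is_series (fun k => a k / (x k - s)) 1).
  { apply is_series_psum.
    assert (L2 : clim (fun n => / ip h alv * csum (fun k => h k * Cconj (alv k))%C n)%C (RtoC 1)).
    { rewrite <- (Cinv_l _ Nu). apply clim_mult; [apply clim_const | apply ip_lim]. }
    destruct L2 as [L2 _]. apply is_lim_seq_ext with (2 := L2). intro n.
    rewrite <- csum_scal, fst_csum. apply psum_ext. intros k _. rewrite Hk, alv_k, Cconj_R.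
    replace (/ ip h alv * (ip h alv * RtoC (al k / (x k - s)) * RtoC (al k)))%C with (RtoC (al k / (x k - s)) * RtoC (al k))%C by (field; auto).
    rewrite <- al_sqr. simpl. unfold Rdiv. ring. }
  destruct (sec_root_gap x a xdec (ex_series_lim0 x xex) apos s Hs Nx R) as [m Gm].
  assert (s = y m) as -> by (apply (sec_root_unique x a xdec apos aex m); auto; split; auto).
  exists m, (ip h alv * RtoC (/ be m))%C. apply l2_ext; intro k. rewrite lscal_k, fv_k, Hk.
  pose proof (be_pos m).
  replace (RtoC (al k / (x k - y m))) with (RtoC (/ be m) * RtoC (be m * al k / (x k - y m)))%C; [ring|].
  rewrite <- RtoC_mult. f_equal. pose proof (Rminus_eq_contra _ _ (xy_neq k m)). field. split; auto. lra.
Qed.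

(** By [Bop_eig] every eigenvector with positive eigenvalue is a multiple of some [fv m], so the
    spectral theorem applies to [v]. *)
Lemma Bop_complete v : (forall m, ip v (fv m) = RtoC 0) -> Bop v = lzero.
Proof.
  intro H. apply (spectral_theorem Bop).
  - apply Bop_add.
  - apply Bop_scal.
  - apply Bop_sym.
  - intro w. rewrite Bop_quad. pose proof (ip_alv_le w). lra.
  - exists (x O). intro w. rewrite Bop_quad. pose proof (Cnorm2_ge0 (ip w alv)).
    assert (xnorm w <= x O * n2 w); [|lra]. rewrite n2_Series, <- Series_scal_l. apply Series_le'.
    + intro k. apply Rmult_le_compat_r; [apply Cnorm2_ge0 | apply (xdec_le x xdec); lia].
    + apply xnorm_ex.
    + apply ex_series_scal_R, l2_ex.
  - intros w l M B W. rewrite Bop_quad. apply is_lim_seq_ext with (fun n => xnorm (w n) - Cnorm2 (ip (w n) alv)); [intro; rewrite Bop_quad; auto|].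
    apply is_lim_seq_minus'; [apply xnorm_compact with M; auto; apply wlim_coord; auto | apply clim_norm2, W].
  - intros s h Hs Hh. destruct (classic (h = lzero)) as [->|N]; [apply ip_zero_r|].
    destruct (Bop_eig s h Hs Hh N) as (m & k & ->). rewrite ip_scal_r, H. ring.
Qed.

Section Phases.
Variables z g : nat -> C.
Hypothesis zx : forall j, Cnorm2 (z j) = x j.
Hypothesis gy : forall j, Cnorm2 (g j) = y j.

Lemma z_neq j : z j <> RtoC 0.
Proof. intro Q. specialize (zx j). rewrite Q, Cnorm2_RtoC in zx. pose proof (xpos j). lra. Qed.

Definition Hp (v : l2) : l2 := to_l2 (fun k => Cconj (z k) * Cconj (v k))%C.
Lemma Hp_k v k : Hp v k = (Cconj (z k) * Cconj (v k))%C.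
Proof.
  apply (to_l2_k (fun k => Cconj (z k) * Cconj (v k))%C). apply ex_series_ext_R with (2 := xnorm_ex v).
  intro; rewrite Cnorm2_mult, !Cnorm2_conj, zx; auto.
Qed.
Lemma Hp_add v w : Hp (ladd v w) = ladd (Hp v) (Hp w).
Proof. apply l2_ext; intro k. rewrite ladd_k, !Hp_k, ladd_k, Cplus_conj. ring. Qed.
Lemma Hp_scal c v : Hp (lscal c v) = lscal (Cconj c) (Hp v).
Proof. apply l2_ext; intro k. rewrite lscal_k, !Hp_k, lscal_k, Cmult_conj. ring. Qed.
Lemma Hp_sub v w : Hp (lsub v w) = lsub (Hp v) (Hp w).
Proof. unfold lsub. rewrite Hp_add, Hp_scal, Cconj_m1; auto. Qed.
Lemma Hp_sym v w : ip (Hp v) w = ip (Hp w) v.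
Proof. apply ip_coord_ext. intro k. rewrite !Hp_k. ring. Qed.
Lemma Hp_sqr v : Hp (Hp v) = dg (fun k => RtoC (x k)) v.
Proof.
  apply l2_ext; intro k. rewrite !Hp_k, dg_k, Cmult_conj, !Cconj_conj, <- zx, <- Cmult_conj_norm2 by apply x_bounded. ring.
Qed.
Lemma n2_Hp v : n2 (Hp v) = xnorm v.
Proof. rewrite n2_Series. apply Series_ext. intro k. rewrite Hp_k, Cnorm2_mult, !Cnorm2_conj, zx; auto. Qed.
Lemma Hp_inj v w : Hp v = Hp w -> v = w.
Proof.
  intro H. apply l2_ext; intro k. apply (f_equal (fun v : l2 => v k)) in H. rewrite !Hp_k in H.
  rewrite <- (Cconj_conj (v k)), <- (Cconj_conj (w k)). f_equal.
  replace (Cconj (v k)) with (/ Cconj (z k) * (Cconj (z k) * Cconj (v k)))%C; [rewrite H|]; field;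
    intro Q; apply (z_neq k); rewrite <- (Cconj_conj (z k)), Q; apply Cconj_R.
Qed.
Lemma Hp_compact v l M : (forall n, n2 (v n) <= M) -> wlim v l -> slim (fun n => Hp (v n)) (Hp l).
Proof.
  intros B W. apply slim_of_coords.
  - intro k. rewrite Hp_k. apply clim_ext with (fun n => Cconj (z k) * Cconj (v n k))%C; [intro; rewrite Hp_k; auto|].
    apply clim_mult; [apply clim_const | apply clim_conj, wlim_coord, W].
  - rewrite n2_Hp. apply is_lim_seq_ext with (fun n => xnorm (v n)); [intro; rewrite n2_Hp; auto|].
    apply xnorm_compact with M; auto. apply wlim_coord; auto.
Qed.

Definition Gm (c : l2) : l2 := to_l2 (fun m => g m * Cconj (c m))%C.
Lemma g_bounded : cbounded g.
Proof. exists (y O). intro k. rewrite gy. apply (xdec_le y ydec); lia. Qed.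
Lemma Gm_k c k : Gm c k = (g k * Cconj (c k))%C.
Proof.
  apply (to_l2_k (fun m => g m * Cconj (c m))%C). apply (bounded_mul_ex g (fun m => Cconj (c m))); [apply g_bounded|].
  apply ex_series_ext_R with (2 := l2_ex c). intro; rewrite Cnorm2_conj; auto.
Qed.

Definition Kp (v : l2) : l2 := syn fv fv_on (Gm (coords fv fv_on v)).
Lemma Kp_coords v : coords fv fv_on (Kp v) = Gm (coords fv fv_on v).
Proof. apply coords_syn. Qed.
Lemma Kp_sym v w : ip (Kp v) w = ip (Kp w) v.
Proof. unfold Kp. rewrite !ip_syn_l. apply ip_coord_ext. intro k. rewrite !Gm_k. ring. Qed.
Lemma Kp_add v w : Kp (ladd v w) = ladd (Kp v) (Kp w).
Proof.
  apply ip_ext. intro q. unfold Kp. rewrite ip_add_l, !ip_syn_l, <- ip_add_l. f_equal.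
  apply l2_ext; intro k. rewrite ladd_k, !Gm_k, coords_add, ladd_k, Cplus_conj. ring.
Qed.
Lemma Kp_scal c v : Kp (lscal c v) = lscal (Cconj c) (Kp v).
Proof.
  apply ip_ext. intro q. unfold Kp. rewrite ip_scal_l, !ip_syn_l, <- ip_scal_l. f_equal.
  apply l2_ext; intro k. rewrite lscal_k, !Gm_k, coords_scal, lscal_k, Cmult_conj. ring.
Qed.
Lemma Kp_sqr v : Kp (Kp v) = Bop v.
Proof.
  assert (Sp : inspan fv (Bop v)) by (intros r Hr; rewrite Bop_sym, (Bop_complete r Hr); apply ip_zero_r).
  apply ip_ext. intro q. rewrite (parseval fv fv_on _ q Sp). unfold Kp at 1. rewrite ip_syn_l, Kp_coords. f_equal.
  apply l2_ext; intro k. rewrite !Gm_k, !coords_k, Bop_sym, Bop_fv, ip_scal_r, Cconj_R, Cmult_conj, Cconj_conj, <- gy, <- Cmult_conj_norm2. ring.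
Qed.
Lemma Kp_fv m : Kp (fv m) = lscal (g m) (fv m).
Proof.
  apply ip_ext. intro q. unfold Kp. rewrite ip_syn_l, ip_scal_l, coords_e.
  replace (Gm (ldelta m)) with (lscal (g m) (ldelta m)).
  - rewrite ip_scal_l, ip_delta_l, coords_k, <- ip_conj; auto.
  - apply l2_ext; intro k. rewrite lscal_k, Gm_k, ldelta_k. destruct Nat.eq_dec as [->|]; rewrite Cconj_R; ring.
Qed.
Lemma n2_Kp v : n2 (Kp v) = n2 (Hp v) - Cnorm2 (ip v alv).
Proof.
  pose proof (ip_self (Kp v)) as E. rewrite Kp_sym, Kp_sqr in E. apply (f_equal fst) in E. rewrite Bop_quad in E. simpl in E.
  rewrite n2_Hp. lra.
Qed.

(* [Rp] is the adjoint of the compressed backward shift: it is defined by [Hp (Rp v) = Kp v]. *)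
Definition Rp (v : l2) : l2 := to_l2 (fun j => Cconj (Kp v j) / z j)%C.
(** Duality: K is symmetric and |K q| <= |H q|, so |(K v|q)| <= |v| |H q|. The test vector [q] is
    chosen so that [Hp q] is the truncation of [Rp v], and (K v|q) is then the squared norm of that
    truncation. *)
Lemma Rp_bound v n : psum (fun j => Cnorm2 (Cconj (Kp v j) / z j)%C) n <= n2 v.
Proof.
  set (h := fun j => (Cconj (Kp v j) / z j)%C).
  assert (F : forall k, (n <= k)%nat -> (if lt_dec k n then (Kp v k / (z k * Cconj (z k)))%C else RtoC 0) = RtoC 0) by (intros; destruct lt_dec; [lia|auto]).
  set (q := mkl2 (fun k => if lt_dec k n then (Kp v k / (z k * Cconj (z k)))%C else RtoC 0) (finite_ex _ n F)).
  assert (qk : forall k, q k = if lt_dec k n then (Kp v k / (z k * Cconj (z k)))%C else RtoC 0) by (intro; exact (lval_mkl2 _ _ _)).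
  set (P := psum (fun j => Cnorm2 (h j)) n).
  assert (zc : forall k, Cconj (z k) <> RtoC 0) by (intros k Q; apply (z_neq k); rewrite <- (Cconj_conj (z k)), Q; apply Cconj_R).
  assert (N1 : n2 (Hp q) = P).
  { transitivity (n2 (trunc n (Hp q))).
    - f_equal. apply l2_ext; intro k. rewrite trunc_k, Hp_k, qk. destruct lt_dec; auto. rewrite Cconj_R. ring.
    - rewrite n2_trunc. apply psum_ext. intros k Hk. rewrite Hp_k, qk. destruct lt_dec; [|lia]. unfold h.
      rewrite Cdiv_conj by (apply Cmult_neq_0; auto using z_neq). f_equal. rewrite Cmult_conj, Cconj_conj.
      match goal with |- ?a = ?b => change (@eq C a b) end. field. split; auto using z_neq. }
  assert (N2 : ip (Kp v) q = RtoC P).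
  { assert (Tq : trunc n q = q) by (apply l2_ext; intro k; rewrite trunc_k, qk; destruct lt_dec; auto).
    rewrite <- Tq, <- ip_trunc, (linear_trunc (fun w => ip w q)); [|intros; apply ip_add_l | intros; apply ip_scal_l].
    unfold P. rewrite <- csum_RtoC. apply csum_ext. intros k Hk. rewrite ip_delta_l, qk. destruct lt_dec; [|lia].
    rewrite <- Cmult_conj_norm2. unfold h.
    rewrite !Cdiv_conj by (try apply Cmult_neq_0; auto using z_neq). rewrite Cmult_conj, !Cconj_conj. field. split; auto using z_neq. }
  assert (CS : P * P <= P * n2 v).
  { assert (E : Cnorm2 (ip (Kp v) q) = P * P) by (rewrite N2; apply Cnorm2_RtoC).
    rewrite <- E, Kp_sym. eapply Rle_trans; [apply cauchy_schwarz|].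
    apply Rmult_le_compat_r; [apply n2_ge0|]. rewrite n2_Kp, N1. pose proof (Cnorm2_ge0 (ip q alv)). lra. }
  assert (P0 : 0 <= P) by (apply psum_pos; intros; apply Cnorm2_ge0).
  change (P <= n2 v). destruct P0 as [P0|P0]; [apply (Rmult_le_reg_l P); auto | rewrite <- P0; apply n2_ge0].
Qed.
Lemma Rp_ex v : ex_series (fun j => Cnorm2 (Cconj (Kp v j) / z j)%C) /\ Series (fun j => Cnorm2 (Cconj (Kp v j) / z j)%C) <= n2 v.
Proof. apply ex_series_bdd; [intro; apply Cnorm2_ge0 | apply Rp_bound]. Qed.
Lemma Rp_k v k : Rp v k = (Cconj (Kp v k) / z k)%C.
Proof. apply (to_l2_k (fun j => Cconj (Kp v j) / z j)%C), Rp_ex. Qed.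
Lemma n2_Rp v : n2 (Rp v) <= n2 v.
Proof. unfold Rp. rewrite n2_to_l2 by apply Rp_ex. apply Rp_ex. Qed.
Lemma Rp_add v w : Rp (ladd v w) = ladd (Rp v) (Rp w).
Proof. apply l2_ext; intro k. rewrite ladd_k, !Rp_k, Kp_add, ladd_k, Cplus_conj. unfold Cdiv. ring. Qed.
Lemma Rp_scal c v : Rp (lscal c v) = lscal c (Rp v).
Proof. apply l2_ext; intro k. rewrite lscal_k, !Rp_k, Kp_scal, lscal_k, Cmult_conj, Cconj_conj. unfold Cdiv. ring. Qed.
Lemma Hp_Rp v : Hp (Rp v) = Kp v.
Proof.
  apply l2_ext; intro k. rewrite Hp_k, Rp_k, Cdiv_conj, Cconj_conj by apply z_neq. field.
  intro Q; apply (z_neq k); rewrite <- (Cconj_conj (z k)), Q; apply Cconj_R.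
Qed.

Lemma Ap_exists v : exists s, n2 s <= n2 v /\ forall w, ip (Rp w) v = ip w s.
Proof.
  apply (riesz (fun w => ip (Rp w) v)).
  - intros. rewrite Rp_add, ip_add_l; auto.
  - intros. rewrite Rp_scal, ip_scal_l; auto.
  - intro w. eapply Rle_trans; [apply cauchy_schwarz|]. rewrite Rmult_comm. apply Rmult_le_compat_l; [apply n2_ge0 | apply n2_Rp].
Qed.
Definition Ap v : l2 := proj1_sig (constructive_indefinite_description _ (Ap_exists v)).
Lemma ip_Ap v w : ip (Ap v) w = ip v (Rp w).
Proof.
  unfold Ap. destruct constructive_indefinite_description as [s [? H]]; simpl.
  rewrite ip_conj, <- H, <- ip_conj; auto.
Qed.
Lemma n2_Ap_le v : n2 (Ap v) <= n2 v.
Proof. unfold Ap. destruct constructive_indefinite_description as [s [? H]]; simpl. auto. Qed.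
Lemma Ap_add v w : Ap (ladd v w) = ladd (Ap v) (Ap w).
Proof. apply ip_ext; intro q. rewrite ip_add_l, !ip_Ap, ip_add_l; auto. Qed.
Lemma Ap_scal c v : Ap (lscal c v) = lscal c (Ap v).
Proof. apply ip_ext; intro q. rewrite ip_scal_l, !ip_Ap, ip_scal_l; auto. Qed.
Lemma Ap_Hp v : Ap (Hp v) = Kp v.
Proof. apply ip_ext; intro q. rewrite ip_Ap, Hp_sym, Hp_Rp, Kp_sym; auto. Qed.

(** The future constant function 1: [Hp wv = alv] is H_u 1 = u. *)
Definition wv : l2 := to_l2 (fun k => RtoC (al k) / z k)%C.
Lemma wv_k k : wv k = (RtoC (al k) / z k)%C.
Proof.
  apply (to_l2_k (fun k => RtoC (al k) / z k)%C). apply ex_series_ext_R with (2 := axex). intro j.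
  unfold Cdiv. rewrite Cnorm2_mult, Cnorm2_RtoC, al_sqr.
  replace (Cnorm2 (/ z j)%C) with (/ x j); auto.
  apply Rmult_eq_reg_r with (Cnorm2 (z j)); [|rewrite zx; apply Rgt_not_eq, xpos].
  rewrite <- Cnorm2_mult, Cinv_l by apply z_neq. rewrite zx, Rinv_l, Cnorm2_RtoC by (apply Rgt_not_eq, xpos). ring.
Qed.
Lemma Hp_wv : Hp wv = alv.
Proof.
  apply l2_ext; intro k. rewrite Hp_k, wv_k, alv_k, Cdiv_conj, Cconj_R by apply z_neq. field.
  intro Q; apply (z_neq k); rewrite <- (Cconj_conj (z k)), Q; apply Cconj_R.
Qed.
Lemma delta_Hp k : Hp (lscal (/ z k)%C (ldelta k)) = ldelta k.
Proof.
  apply l2_ext; intro i. rewrite Hp_k, lscal_k, ldelta_k. destruct Nat.eq_dec as [->|].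
  - rewrite Cmult_conj, Cinv_conj, Cconj_R by apply z_neq. field.
    intro Q; apply (z_neq k); rewrite <- (Cconj_conj (z k)), Q; apply Cconj_R.
  - rewrite Cmult_0_r, Cconj_R. ring.
Qed.
Lemma Rp_Kp q : Rp (Kp q) = lsub (Hp q) (lscal (ip (Hp q) wv) wv).
Proof.
  apply Hp_inj. rewrite Hp_Rp, Kp_sqr, Hp_sub, Hp_scal, Hp_wv, Hp_sqr. unfold Bop. f_equal. f_equal.
  rewrite Hp_sym, Hp_wv, <- ip_conj; auto.
Qed.
(** The analogue of shifting backward and then forward, which removes the zeroth coefficient. On the
    range of [Hp] it follows from K^2 = H^2 - (.|u)u, and every basis vector lies in this range. *)
Lemma Rp_Ap v : Rp (Ap v) = lsub v (lscal (ip v wv) wv).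
Proof.
  apply l2_ext; intro k. rewrite <- !ip_delta.
  assert (E : ip (Rp (Ap v)) (ldelta k) = ip v (Rp (Ap (ldelta k)))).
  { rewrite ip_conj, <- ip_Ap, <- ip_conj, ip_Ap; auto. }
  rewrite E. rewrite <- (delta_Hp k) at 1. rewrite Ap_Hp, Rp_Kp, delta_Hp.
  rewrite ip_sub_r, ip_scal_r, ip_sub_l, ip_scal_l, <- ip_conj. ring.
Qed.
Lemma ip_Ap_Ap v w : ip (Ap v) (Ap w) = (ip v w - ip v wv * Cconj (ip w wv))%C.
Proof. rewrite ip_Ap, Rp_Ap, ip_sub_r, ip_scal_r. ring. Qed.
Lemma n2_Ap v : n2 (Ap v) = n2 v - Cnorm2 (ip v wv).
Proof.
  pose proof (ip_Ap_Ap v v) as E. rewrite !ip_self, Cmult_conj_norm2 in E. apply (f_equal fst) in E. simpl in E. lra.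
Qed.

(** * Powers of the compressed shift tend to 0 *)

Definition An n v := Nat.iter n Ap v.
Definition Rn n v := Nat.iter n Rp v.
Lemma An_S n v : An (S n) v = An n (Ap v).
Proof. apply Nat.iter_succ_r. Qed.
Lemma Rn_S n v : Rn (S n) v = Rn n (Rp v).
Proof. apply Nat.iter_succ_r. Qed.
Lemma An_add m n v : An (m + n) v = An m (An n v).
Proof. apply Nat.iter_add. Qed.
Lemma ip_An n v w : ip (An n v) w = ip v (Rn n w).
Proof. revert v; induction n as [|n IH]; intro v; auto. rewrite An_S, IH, ip_Ap. auto. Qed.
Lemma An_Hp n v : An n (Hp v) = Hp (Rn n v).
Proof. induction n as [|n IH]; auto. change (Ap (An n (Hp v)) = Hp (Rp (Rn n v))). rewrite IH, Ap_Hp, Hp_Rp; auto. Qed.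
Lemma n2_An_dec n v : n2 (An (S n) v) = n2 (An n v) - Cnorm2 (ip (An n v) wv).
Proof. apply n2_Ap. Qed.
Lemma n2_An_le n v : n2 (An n v) <= n2 v.
Proof. induction n as [|n IH]; [apply Rle_refl|]. change (An (S n) v) with (Ap (An n v)). apply Rle_trans with (n2 (An n v)); [apply n2_Ap_le | exact IH]. Qed.
Lemma n2_Rn_le n v : n2 (Rn n v) <= n2 v.
Proof. induction n as [|n IH]; [apply Rle_refl|]. change (Rn (S n) v) with (Rp (Rn n v)). apply Rle_trans with (n2 (Rn n v)); [apply n2_Rp | exact IH]. Qed.
Lemma An_linear n v w c : An n (ladd v (lscal c w)) = ladd (An n v) (lscal c (An n w)).
Proof.
  revert v w; induction n as [|n IH]; intros v w; auto. rewrite !An_S, Ap_add, Ap_scal. apply IH.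
Qed.
Lemma Rn_linear n v w c : Rn n (ladd v (lscal c w)) = ladd (Rn n v) (lscal c (Rn n w)).
Proof.
  revert v w; induction n as [|n IH]; intros v w; auto. rewrite !Rn_S, Rp_add, Rp_scal. apply IH.
Qed.
Lemma slim_An n v l : slim v l -> slim (fun k => An n (v k)) (An n l).
Proof.
  intro S. apply lim0_le with (2 := S). intro k. split; [apply n2_ge0|].
  eapply Rle_trans; [|apply n2_An_le with (n := n)]. right. f_equal. unfold lsub. rewrite An_linear; auto.
Qed.
Lemma slim_Rn n v l : slim v l -> slim (fun k => Rn n (v k)) (Rn n l).
Proof.
  intro S. apply lim0_le with (2 := S). intro k. split; [apply n2_ge0|].
  eapply Rle_trans; [|apply n2_Rn_le with (n := n)]. right. f_equal. unfold lsub. rewrite Rn_linear; auto.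
Qed.
Lemma An_psum v N : psum (fun n => Cnorm2 (ip (An n v) wv)) N = n2 v - n2 (An N v).
Proof. induction N as [|N IH]; [simpl; ring|]. cbn [psum]. rewrite IH, n2_An_dec. ring. Qed.

(* The sum is the squared Hilbert-Schmidt norm of the Hankel operator under construction. *)
Lemma An_alv_ex : ex_series (fun n => n2 (An n alv)).
Proof.
  apply (ex_series_bdd _ (Series x)); [intro; apply n2_ge0|]. intro N.
  assert (L : is_lim_seq (fun J => psum (fun n => psum (fun j => Cnorm2 (An n alv j)) J) N) (psum (fun n => n2 (An n alv)) N)).
  { apply is_lim_seq_psum with (f := fun J n => psum (fun j => Cnorm2 (An n alv j)) J). intro n. apply is_series_psum, Series_correct, l2_ex. }
  apply (is_lim_seq_le _ (fun _ => Series x) (psum (fun n => n2 (An n alv)) N) (Series x)) with (2 := L) (3 := is_lim_seq_const _).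
  intro J. rewrite psum_swap. eapply Rle_trans; [|apply (psum_le_Series x J); auto; intro; apply Rlt_le; auto].
  apply psum_le. intros j _.
  (* The coordinate [j] of A^n u has modulus sqrt(x_j) times that of the product of A^n delta_j with
     [wv], whose squares telescope to at most 1. *)
  rewrite (psum_ext _ (fun n => x j * Cnorm2 (ip (An n (ldelta j)) wv))).
  - rewrite psum_scal, An_psum, n2_delta. pose proof (n2_ge0 (An N (ldelta j))). pose proof (xpos j). nra.
  - intros n _. rewrite <- ip_delta, <- Hp_wv, An_Hp, Hp_sym.
    replace (Hp (ldelta j)) with (lscal (Cconj (z j)) (ldelta j)).
    + rewrite ip_scal_l, Cnorm2_mult, Cnorm2_conj, zx, ip_An; auto.
    + apply l2_ext; intro k. rewrite lscal_k, Hp_k, ldelta_k. destruct Nat.eq_dec as [->|]; rewrite Cconj_R; ring.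
Qed.

(** By [n2_An_dec], A preserves the norm along the whole forward orbit of [v]. *)
Definition Zs v := forall n, ip (An n v) wv = RtoC 0.
(** Norm preservation also after going backward with [Rn]: the part on which A would act as a
    unitary, to be shown trivial. *)
Definition Ys v := forall n, Zs (Rn n v).

Lemma Zs_RA n v : Zs v -> Rn n (An n v) = v.
Proof.
  intro Z. induction n as [|n IH]; auto. rewrite Rn_S. change (An (S n) v) with (Ap (An n v)).
  rewrite Rp_Ap, (Z n), lscal_0. replace (lsub (An n v) lzero) with (An n v) by vec. auto.
Qed.
(** Isometry gives (u|v) = (A^n u|A^n v) for all n, and A^n u tends to 0 because [An_alv_ex] makes
    its squared norms summable. *)
Lemma Zs_alv v : Zs v -> ip alv v = RtoC 0.
Proof.
  intro Z. apply clim_unique with (fun n => ip (An n alv) (An n v)).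
  - apply clim_ext with (fun _ => ip alv v); [|apply clim_const]. intro n. rewrite ip_An, Zs_RA; auto.
  - apply clim_norm2_0. apply lim0_le with (fun n => n2 v * n2 (An n alv)).
    + intro n. split; [apply Cnorm2_ge0|]. eapply Rle_trans; [apply cauchy_schwarz|]. rewrite Rmult_comm.
      apply Rmult_le_compat_r; [apply n2_ge0 | apply n2_An_le].
    + apply lim_scal0, ex_series_lim0, An_alv_ex.
Qed.
Lemma Ys_A v : Ys v -> Ys (Ap v).
Proof.
  intros Y [|n].
  - intro m. change (Rn 0 (Ap v)) with (Ap v). rewrite <- An_S. apply (Y O).
  - rewrite Rn_S, Rp_Ap. assert (ip v wv = RtoC 0) as -> by apply (Y O O).
    rewrite lscal_0. replace (lsub v lzero) with v by vec. apply Y.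
Qed.
Lemma Ys_An n v : Ys v -> Ys (An n v).
Proof. intro Y. induction n as [|n IH]; auto. apply Ys_A, IH. Qed.
Lemma Ys_Zs_Hp v : Ys v -> Zs (Hp v).
Proof. intros Y n. rewrite An_Hp, Hp_sym, Hp_wv. apply Zs_alv, Y. Qed.
(** On this part R^n H v = H A^n v: H carries forward orbits to backward ones, so it respects the
    two-sided condition. *)
Lemma Ys_Hp v : Ys v -> Ys (Hp v).
Proof.
  intros Y n. assert (Z : Zs (Hp (An n v))) by (apply Ys_Zs_Hp, Ys_An; auto).
  assert (E : Hp v = An n (Hp (An n v))) by (rewrite An_Hp, Zs_RA; auto; apply (Y O)).
  rewrite E, Zs_RA; auto.
Qed.
(** Invariance under the diagonal operator H^2 gives sum_j x_j^k v_j conj(w_j) = 0 for every k; the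
    [x j] are distinct and no coordinate of [wv] vanishes. *)
Lemma Ys_zero v : Ys v -> v = lzero.
Proof.
  intro Y.
  assert (Q : forall k, Ys (Nat.iter k (dg (fun k => RtoC (x k))) v)).
  { induction k as [|k IH]; auto. simpl. rewrite <- Hp_sqr. apply Ys_Hp, Ys_Hp; auto. }
  assert (P : forall k j, Nat.iter k (dg (fun k => RtoC (x k))) v j = (RtoC (x j ^ k) * v j)%C).
  { induction k as [|k IH]; intro j; [simpl; ring|]. change (dg (fun k => RtoC (x k)) (Nat.iter k (dg (fun k => RtoC (x k))) v) j = (RtoC (x j ^ S k) * v j)%C).
    rewrite dg_k, IH by apply x_bounded. simpl. rewrite RtoC_mult. ring. }
  assert (M : forall k, ip (Nat.iter k (dg (fun k => RtoC (x k))) v) wv = RtoC 0) by (intro k; apply (Q k O O)).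
  assert (Z : forall j, (v j * Cconj (wv j))%C = RtoC 0).
  { intro j. destruct (ip_abs_ex v wv) as [E1 E2]. apply injective_projections.
    - apply (moments_zero x (fun j => fst (v j * Cconj (wv j))%C)); auto. intro k.
      specialize (M k). apply (f_equal fst) in M. rewrite fst_ip in M. simpl in M.
      rewrite <- M. apply is_series_ext_R with (2 := Series_correct _ (proj1 (ip_ex _ _))). intro i. rewrite P. simpl. ring.
    - apply (moments_zero x (fun j => snd (v j * Cconj (wv j))%C)); auto. intro k.
      specialize (M k). apply (f_equal snd) in M. rewrite snd_ip in M. simpl in M.
      rewrite <- M. apply is_series_ext_R with (2 := Series_correct _ (proj2 (ip_ex _ _))). intro i. rewrite P. simpl. ring. }
  apply l2_ext; intro j. rewrite lzero_k. specialize (Z j). rewrite Cmult_comm in Z. apply Cmult_eq0 in Z; auto.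
  intro W. apply (f_equal Cconj) in W. rewrite Cconj_conj, Cconj_R, wv_k in W.
  assert (E : RtoC (al j) = RtoC 0).
  { replace (RtoC (al j)) with (RtoC (al j) / z j * z j)%C by (field; apply z_neq). rewrite W. ring. }
  revert E. apply RtoC_neq. pose proof (al_pos j). lra.
Qed.

Lemma const_norm_Zs v r : (forall n, n2 (An n v) = r) -> Zs v.
Proof.
  intros H n. apply Cnorm2_eq0. pose proof (n2_An_dec n v) as E. rewrite !H in E. lra.
Qed.

(** A^n H q = H R^n q and H is compact, so a subsequence converges in norm to some [l]. The squared
    norms along the orbit decrease to [r], hence A is isometric along the orbits of [l] and of all
    R^m l; such an [l] is 0, and so is [r]. *)
Lemma An_lim_Hp q : is_lim_seq (fun n => n2 (An n (Hp q))) 0.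
Proof.
  set (v := Hp q).
  destruct (ex_finite_lim_seq_decr (fun n => n2 (An n v)) 0) as [r Hr].
  { intro n. rewrite n2_An_dec. pose proof (Cnorm2_ge0 (ip (An n v) wv)). lra. }
  { intro; apply n2_ge0. }
  destruct (weak_compactness (fun n => Rn n q) (n2 q)) as (phi & p & Hphi & W); [intro; apply n2_Rn_le|].
  assert (Hge := incr_ge _ Hphi).
  set (l := Hp p).
  assert (S : slim (fun n => An (phi n) v) l).
  { assert (S := Hp_compact (fun n => Rn (phi n) q) p (n2 q) (fun n => n2_Rn_le _ _) W).
    apply is_lim_seq_ext with (2 := S). intro n. unfold v. rewrite An_Hp; auto. }
  assert (nl : forall m, n2 (An m l) = r).
  { intro m. assert (L1 := slim_n2 _ _ (slim_An m _ _ S)).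
    assert (L2 : is_lim_seq (fun n => n2 (An m (An (phi n) v))) r).
    { apply is_lim_seq_ext with (fun n => n2 (An (m + phi n) v)); [intro; rewrite An_add; auto|].
      apply (lim_subseq (fun n => n2 (An n v)) r (fun n => (m + phi n)%nat)); auto. intro n. specialize (Hge n). lia. }
    apply is_lim_seq_unique in L1. apply is_lim_seq_unique in L2. rewrite L1 in L2. injection L2; auto. }
  assert (Yl : Ys l).
  { intro m.
    (* [w n] is the orbit stopped [m] steps before the time [phi (n + m)]. A^m is nearly isometric
       on it, so R^m A^m [w n] is close to [w n], which therefore converges to R^m l. The index
       [n + m] makes [phi (n + m) - m] a true difference. *)
    set (w := fun n => An (phi (n + m)%nat - m) v).
    assert (Hw : forall n, An (phi (n + m)%nat) v = An m (w n)).
    { intro n. unfold w. rewrite <- An_add. f_equal. specialize (Hge (n + m)%nat). lia. }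
    assert (nw : forall k, is_lim_seq (fun n => n2 (An k (w n))) r).
    { intro k. apply is_lim_seq_ext with (fun n => n2 (An (k + (phi (n + m)%nat - m)) v)); [intro; rewrite An_add; auto|].
      apply (lim_subseq (fun n => n2 (An n v)) r (fun n => (k + (phi (n + m)%nat - m))%nat)); auto. intro n. specialize (Hge (n + m)%nat). lia. }
    assert (D : is_lim_seq (fun n => n2 (lsub (Rn m (An m (w n))) (w n))) 0).
    { apply lim0_le with (fun n => n2 (w n) - n2 (An m (w n))).
      - intro n. split; [apply n2_ge0|]. rewrite n2_sub.
        assert (E : ip (Rn m (An m (w n))) (w n) = RtoC (n2 (An m (w n)))) by (rewrite ip_conj, <- ip_An, ip_self; apply Cconj_R).
        rewrite E. simpl. pose proof (n2_Rn_le m (An m (w n))). lra.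
      - replace (Finite 0) with (Finite (r - r)) by (f_equal; ring). apply is_lim_seq_minus'; [apply (nw O) | apply nw]. }
    assert (Sm : slim (fun n => Rn m (An m (w n))) (Rn m l)).
    { apply slim_Rn. assert (S2 := slim_subseq _ _ (fun n => (n + m)%nat) (fun n => Nat.le_add_r n m) S). simpl in S2.
      apply is_lim_seq_ext with (2 := S2). intro n. simpl. rewrite Hw; auto. }
    assert (Sw : slim w (Rn m l)).
    { apply lim0_le with (fun n => 2 * n2 (lsub (Rn m (An m (w n))) (Rn m l)) + 2 * n2 (lsub (Rn m (An m (w n))) (w n))).
      - intro n. split; [apply n2_ge0|]. eapply Rle_trans; [|apply n2_sub_le]. right. f_equal. vec.
      - replace (Finite 0) with (Finite (2 * 0 + 2 * 0)) by (f_equal; ring).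
        apply is_lim_seq_plus'; (apply is_lim_seq_mult'; [apply is_lim_seq_const | auto]). }
    apply const_norm_Zs with r. intro k.
    assert (L1 := slim_n2 _ _ (slim_An k _ _ Sw)). specialize (nw k).
    apply is_lim_seq_unique in L1. apply is_lim_seq_unique in nw. rewrite L1 in nw. injection nw; auto. }
  apply Ys_zero in Yl. specialize (nl O). change (n2 l = r) in nl. rewrite Yl, n2_zero in nl. rewrite nl. exact Hr.
Qed.

(** Finitely supported vectors lie in the range of [Hp], and the powers of A are contractions. *)
Lemma An_lim v : is_lim_seq (fun n => n2 (An n v)) 0.
Proof.
  assert (T : forall m, exists q, Hp q = trunc m v).
  { induction m as [|m [q Hq]].
    - exists lzero. apply l2_ext; intro k. rewrite trunc_k, Hp_k, lzero_k, Cconj_R. destruct lt_dec; [lia|]. ring.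
    - exists (ladd q (lscal (Cconj (v m)) (lscal (/ z m)%C (ldelta m)))).
      rewrite trunc_S, Hp_add, Hp_scal, delta_Hp, Hq, Cconj_conj; auto. }
  apply lim_eps. intros eps he.
  destruct (proj1 (lim_eps _ _) (trunc_lim v) (eps / 4)) as [m Hm]; [lra|]. specialize (Hm m (le_n m)).
  destruct (T m) as [q Hq]. destruct (proj1 (lim_eps _ _) (An_lim_Hp q) (eps / 4)) as [N HN]; [lra|].
  exists N. intros n Hn. specialize (HN n Hn). rewrite Rminus_0_r, Rabs_pos_eq in * by apply n2_ge0.
  replace v with (ladd (trunc m v) (lscal (RtoC 1) (lsub v (trunc m v)))) by vec.
  rewrite An_linear, lscal_1. eapply Rle_lt_trans; [apply n2_add_le|].
  pose proof (n2_An_le n (lsub v (trunc m v))). rewrite <- Hq at 1. lra.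
Qed.

(** * The isometry that turns [Ap] into the backward shift *)

Lemma V_ex v : is_series (fun n => Cnorm2 (ip (An n v) wv)) (n2 v).
Proof.
  apply is_series_psum. apply is_lim_seq_ext with (fun N => n2 v - n2 (An N v)); [intro; rewrite An_psum; auto|].
  replace (Finite (n2 v)) with (Finite (n2 v - 0)) by (f_equal; ring). apply is_lim_seq_minus'; [apply is_lim_seq_const | apply An_lim].
Qed.
(** In the Hardy space the coefficient n of a function is the product of its n-th backward shift
    with 1; here A and [wv] play these roles. *)
Definition V v : l2 := to_l2 (fun n => ip (An n v) wv).
Lemma V_k v n : V v n = ip (An n v) wv.
Proof. apply (to_l2_k (fun n => ip (An n v) wv)). eexists; apply V_ex. Qed.
(** By [ip_Ap_Ap] the partial sums telescope to (v|w) - (A^N v|A^N w), and A^N w tends to 0. *)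
Lemma V_isom v w : ip (V v) (V w) = ip v w.
Proof.
  apply clim_unique with (1 := ip_lim (V v) (V w)).
  apply clim_ext with (fun N => ip v w - ip (An N v) (An N w))%C.
  - intro N. induction N as [|N IH]; [simpl; ring|]. cbn [csum]. rewrite <- IH, !V_k.
    change (An (S N) v) with (Ap (An N v)). change (An (S N) w) with (Ap (An N w)). rewrite ip_Ap_Ap. ring.
  - apply clim_eq with (ip v w - RtoC 0)%C; [|ring]. apply clim_minus; [apply clim_const|].
    apply clim_norm2_0. apply lim0_le with (fun n => n2 v * n2 (An n w)); [|apply lim_scal0, An_lim].
    intro n. split; [apply Cnorm2_ge0|]. eapply Rle_trans; [apply cauchy_schwarz|].
    apply Rmult_le_compat_r; [apply n2_ge0 | apply n2_An_le].
Qed.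
Lemma V_n2 v : n2 (V v) = n2 v.
Proof. pose proof (V_isom v v) as E. rewrite !ip_self in E. apply (f_equal fst) in E. exact E. Qed.
Lemma V_scal c v : V (lscal c v) = lscal c (V v).
Proof.
  apply l2_ext; intro n. rewrite lscal_k, !V_k, !ip_An, ip_scal_l. auto.
Qed.
Lemma shn_V n v : shn n (V v) = V (An n v).
Proof. apply l2_ext; intro k. rewrite shn_k, !V_k, Nat.add_comm, An_add; auto. Qed.

Lemma usol_ex : ex_series (fun k => (1 + INR k) * Cnorm2 (V alv k)).
Proof.
  apply h12_of_tails. apply ex_series_ext_R with (2 := An_alv_ex). intro n. rewrite shn_V, V_n2; auto.
Qed.
Definition usol : h12 := mkh12 _ usol_ex.
Lemma usol_V : hl usol = V alv.
Proof. apply l2_ext; intro k. apply mkh12_k. Qed.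

Lemma An_alv_ip n v : ip (An n alv) v = ip (An n (Hp v)) wv.
Proof. rewrite <- Hp_wv, An_Hp, Hp_sym, ip_An; auto. Qed.

(** [s] is the adjoint of [V] applied to [h]; it gives access to the Hankel operator on all of l^2,
    as the completeness clauses of the spectral data require. *)
Lemma Vadj_exists h : exists s, n2 s <= n2 h /\ forall v, Cconj (ip h (V v)) = ip v s.
Proof.
  apply (riesz (fun v => Cconj (ip h (V v)))).
  - intros v w. rewrite <- Cplus_conj, <- ip_add_r. f_equal. f_equal. apply l2_ext; intro k.
    rewrite ladd_k, !V_k, !ip_An, ip_add_l; auto.
  - intros c v. rewrite V_scal, ip_scal_r, Cmult_conj, Cconj_conj; auto.
  - intro v. rewrite Cnorm2_conj, <- (V_n2 v). apply cauchy_schwarz.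
Qed.

Lemma hank_usol h s : (forall v, Cconj (ip h (V v)) = ip v s) -> hank usol h = V (Hp s).
Proof.
  intro Hs. apply l2_ext; intro n. rewrite hank_k, V_k, usol_V, shn_V, <- An_alv_ip, <- Hs, <- ip_conj; auto.
Qed.
Lemma hank_usol_V v : hank usol (V v) = V (Hp v).
Proof. apply hank_usol. intro w. rewrite V_isom, <- ip_conj; auto. Qed.
Lemma kank_usol_V v : kank usol (V v) = V (Kp v).
Proof. rewrite kank_shift, hank_usol_V, shn_V. change (An 1 (Hp v)) with (Ap (Hp v)). rewrite Ap_Hp; auto. Qed.
Lemma V_zero : V lzero = lzero.
Proof. apply n2_eq0. rewrite V_n2. apply n2_zero. Qed.

Theorem usol_chiD : chiD usol z g (fun j => V (ldelta j)) (fun m => V (fv m)) al be.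
Proof.
  split.
  - split.
    + intro j. rewrite Cnorm2_conj, zx; auto.
    + intro j. rewrite !Cnorm2_conj, !zx; auto.
    + intro j. rewrite hank_usol_V, <- V_scal. f_equal. apply l2_ext; intro k. rewrite Hp_k, lscal_k, ldelta_k.
      destruct Nat.eq_dec as [->|]; rewrite Cconj_R; ring.
    + intro j. rewrite V_n2. apply n2_delta.
    + intros h Hh. destruct (Vadj_exists h) as (s & _ & Hs). rewrite (hank_usol h s Hs).
      replace s with lzero; [|apply l2_ext; intro k].
      * replace (Hp lzero) with lzero; [apply V_zero|]. apply l2_ext; intro k. rewrite Hp_k, lzero_k, Cconj_R. ring.
      * rewrite lzero_k, <- (Cconj_conj (s k)), <- ip_delta_l, <- Hs, Hh, !Cconj_R; auto.
  - split.
    + intro j. rewrite gy; auto.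
    + intro j. rewrite !gy; auto.
    + intro j. change (kank usol (V (fv j)) = lscal (g j) (V (fv j))). rewrite kank_usol_V, Kp_fv, V_scal; auto.
    + intro j. rewrite V_n2. apply fv_n2.
    + intros h Hh. destruct (Vadj_exists h) as (s & _ & Hs). change (kank usol h = lzero).
      rewrite kank_shift, (hank_usol h s Hs), shn_V. change (An 1 (Hp s)) with (Ap (Hp s)). rewrite Ap_Hp.
      replace (Kp s) with lzero; [apply V_zero|]. apply ip_ext. intro q. rewrite ip_zero_l. unfold Kp. rewrite ip_syn_l.
      replace (Gm (coords fv fv_on s)) with lzero; [rewrite ip_zero_l; auto|].
      apply l2_ext; intro k. rewrite lzero_k, Gm_k, coords_k, <- ip_conj, <- Hs, Hh, Cconj_R. ring.
  - apply al_pos.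
  - intro j. rewrite usol_V, V_isom, ip_delta, alv_k; auto.
  - apply be_pos.
  - intro m. rewrite usol_V, V_isom, ip_conj, fv_alv, Cconj_R; auto.
Qed.
End Phases.

(** * The explicit flow and its time derivative *)

Lemma syn_add e He c d : syn e He (ladd c d) = ladd (syn e He c) (syn e He d).
Proof. apply ip_ext; intro q. rewrite ip_add_l, !ip_syn_l, ip_add_l; auto. Qed.
Lemma syn_scal e He k c : syn e He (lscal k c) = lscal k (syn e He c).
Proof. apply ip_ext; intro q. rewrite ip_scal_l, !ip_syn_l, ip_scal_l; auto. Qed.

Lemma Bop_ip v q : ip (Bop v) q = ip (dg (fun m => RtoC (y m)) (coords fv fv_on v)) (coords fv fv_on q).
Proof.
  assert (Sp : inspan fv (Bop v)) by (intros r Hr; rewrite Bop_sym, (Bop_complete r Hr); apply ip_zero_r).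
  rewrite (parseval fv fv_on _ q Sp). f_equal. apply l2_ext; intro k.
  rewrite dg_k, !coords_k, Bop_sym, Bop_fv, ip_scal_r, Cconj_R by apply y_bounded. auto.
Qed.

Lemma coords_Bop v : coords fv fv_on (Bop v) = dg (fun m => RtoC (y m)) (coords fv fv_on v).
Proof. apply l2_ext; intro k. rewrite dg_k, !coords_k, Bop_sym, Bop_fv, ip_scal_r, Cconj_R by apply y_bounded. auto. Qed.

Lemma csum_S_l f n : csum f (S n) = (f O + csum (fun k => f (S k)) n)%C.
Proof. induction n as [|n IH]; [simpl; ring|]. change (csum f (S (S n))) with (csum f (S n) + f (S n))%C. rewrite IH. simpl. ring. Qed.

Section Flow.
Variables z0 g0 : nat -> C.
Hypothesis zx0 : forall j, Cnorm2 (z0 j) = x j.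
Hypothesis gy0 : forall j, Cnorm2 (g0 j) = y j.

Definition zt t j : C := (z0 j * Cconj (expi (x j * t)))%C.
Definition gt t m : C := (g0 m * expi (y m * t))%C.
Lemma zxt t j : Cnorm2 (zt t j) = x j.
Proof. unfold zt. rewrite Cnorm2_mult, Cnorm2_conj, expi_norm2, zx0. ring. Qed.
Lemma gyt t j : Cnorm2 (gt t j) = y j.
Proof. unfold gt. rewrite Cnorm2_mult, expi_norm2, gy0. ring. Qed.

(** The unitary group exp(-i t K^2): phases on the span of the [fv m], the identity on its
    complement, where [Bop] vanishes. *)
Definition Pt t v := ladd v (syn fv fv_on (lsub (dg (fun m => expi (- y m * t)) (coords fv fv_on v)) (coords fv fv_on v))).
Lemma coords_Pt t v : coords fv fv_on (Pt t v) = dg (fun m => expi (- y m * t)) (coords fv fv_on v).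
Proof. unfold Pt. rewrite coords_add, coords_syn. vec. Qed.

Lemma Kt_eq t v : Kp (gt t) v = Kp g0 (Pt t v).
Proof.
  apply ip_ext; intro q. unfold Kp. rewrite !ip_syn_l. f_equal. apply l2_ext; intro k.
  rewrite (Gm_k _ (gyt t)), (Gm_k _ gy0), coords_Pt, dg_k, Cmult_conj, expi_conj by apply (expi_bounded (fun m => - y m)).
  unfold gt. replace (- (- y k * t)) with (y k * t) by ring. ring.
Qed.
(** Thus R_t = exp(i t H^2) R_0 exp(-i t K^2): all dependence on time sits in two groups with
    bounded generators, which can be differentiated in norm. *)
Lemma Rt_eq t v : Rp (zt t) (gt t) v = dg (fun k => expi (x k * t)) (Rp z0 g0 (Pt t v)).
Proof.
  apply (Hp_inj (zt t) (zxt t)). rewrite (Hp_Rp _ _ (zxt t) (gyt t)), Kt_eq, <- (Hp_Rp z0 g0 zx0 gy0).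
  apply l2_ext; intro k. rewrite (Hp_k _ (zxt t)), (Hp_k _ zx0), dg_k by apply expi_bounded.
  unfold zt. rewrite !Cmult_conj, Cconj_conj.
  replace (Cconj (z0 k) * expi (x k * t) * (Cconj (expi (x k * t)) * Cconj (Rp z0 g0 (Pt t v) k)))%C with
    ((expi (x k * t) * Cconj (expi (x k * t))) * (Cconj (z0 k) * Cconj (Rp z0 g0 (Pt t v) k)))%C by ring.
  rewrite Cmult_conj_norm2, expi_norm2. ring.
Qed.

Lemma y_abs k : Rabs (- y k) <= y O.
Proof. rewrite Rabs_Ropp, Rabs_pos_eq by (apply Rlt_le, y_pos). apply (xdec_le y ydec); lia. Qed.
Lemma x_abs k : Rabs (x k) <= x O.
Proof. rewrite Rabs_pos_eq by (apply Rlt_le, xpos). apply (xdec_le x xdec); lia. Qed.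

Lemma lderiv_Pt p t d : lderiv p t d -> lderiv (fun s => Pt s (p s)) t (Pt t (lsub d (lscal Ci (Bop (p t))))).
Proof.
  intro H.
  assert (Hc : lderiv (fun s => coords fv fv_on (p s)) t (coords fv fv_on d)).
  { apply (lderiv_bdd p t d (coords fv fv_on) 1); auto; [lra|apply coords_add|apply coords_scal|].
    intro v. rewrite Rmult_1_l. apply n2_coords_le. }
  pose proof (lderiv_expi (fun m => - y m) (y O) _ t _ y_abs Hc) as He.
  assert (Hm : lderiv (fun s => lscal (- (1))%C (coords fv fv_on (p s))) t (lscal (- (1))%C (coords fv fv_on d))).
  { apply (lderiv_bdd _ t _ (lscal (- (1))%C) 1); auto; [lra|intros; vec|intros; vec|].
    intro v. rewrite n2_scal. unfold Cnorm2; simpl; lra. }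
  pose proof (lderiv_add _ _ _ _ _ He Hm) as Hs.
  apply (lderiv_bdd _ t _ (syn fv fv_on) 1) in Hs; [|lra|apply syn_add|apply syn_scal|intro; rewrite n2_syn; lra].
  pose proof (lderiv_add _ _ _ _ _ H Hs) as Ht.
  apply lderiv_eq with (1 := Ht). apply ip_ext; intro q. unfold Pt.
  set (cq := coords fv fv_on q). set (cp := coords fv fv_on (p t)). set (cd := coords fv fv_on d).
  assert (E : coords fv fv_on (lsub d (lscal Ci (Bop (p t)))) = lsub cd (lscal Ci (dg (fun m => RtoC (y m)) cp))).
  { unfold lsub. rewrite !coords_add, !coords_scal, coords_Bop; auto. }
  rewrite !ip_add_l, ip_sub_l, ip_scal_l, Bop_ip, !ip_syn_l, E. fold cq cp.
  set (E1 := lsub (dg _ (lsub cd _)) _).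
  match goal with |- (?a + ip ?L cq = ?a - Ci * ip ?Y cq + ip E1 cq)%C =>
    assert (Q : L = ladd (lscal (- Ci)%C Y) E1) end.
  { unfold E1. apply l2_ext; intro k.
    assert (C1 := expi_bounded (fun m => - y m) t). assert (C2 := cbounded_RtoC (fun m => - y m) (y O) y_abs). assert (C3 := y_bounded).
    repeat rewrite ?ladd_k, ?lsub_k, ?lscal_k, ?(dg_k _ _ _ C1), ?(dg_k _ _ _ C2), ?(dg_k _ _ _ C3). rewrite RtoC_opp. ring. }
  rewrite Q, ip_add_l, ip_scal_l. ring.
Qed.

(** Applying the injective [Hp] turns the left side into (H^2 - K^2) K v, which is a multiple of
    [alv]. The derivative of R_t is explicit because of this rank-one identity. *)
Lemma commutator t v : lsub (dg (fun k => RtoC (x k)) (Rp (zt t) (gt t) v)) (Rp (zt t) (gt t) (Bop v)) =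
  lscal (ip v (Kp (gt t) alv)) (wv (zt t)).
Proof.
  assert (G := gyt t).
  apply (Hp_inj (zt t) (zxt t)).
  rewrite (Hp_sub _ (zxt t)), (Hp_scal _ (zxt t)), (Hp_wv _ (zxt t)), (Hp_Rp _ _ (zxt t) G), <- (Hp_sqr _ (zxt t)), (Hp_Rp _ _ (zxt t) G), (Hp_sqr _ (zxt t)).
  rewrite <- (Kp_sqr _ G v), (Kp_sqr _ G (Kp (gt t) v)). unfold Bop.
  rewrite (Kp_sym _ G v alv), <- ip_conj. vec.
Qed.

Lemma lderiv_Rt p t d : lderiv p t d ->
  lderiv (fun s => Rp (zt s) (gt s) (p s)) t
    (ladd (Rp (zt t) (gt t) d) (lscal (Ci * ip (p t) (Kp (gt t) alv))%C (wv (zt t)))).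
Proof.
  intro H. apply lderiv_Pt in H.
  apply (lderiv_bdd _ t _ (Rp z0 g0) 1) in H; [|lra|apply (Rp_add z0 g0 zx0 gy0)|apply (Rp_scal z0 g0 zx0 gy0)|intro; rewrite Rmult_1_l; apply (n2_Rp z0 g0 zx0 gy0)].
  apply (lderiv_expi x (x O) _ t _ x_abs) in H.
  apply lderiv_ext with (q := fun s => Rp (zt s) (gt s) (p s)) in H; [|intro s; rewrite Rt_eq; auto].
  apply lderiv_eq with (1 := H). rewrite <- !Rt_eq.
  rewrite <- lscal_lscal, <- commutator. unfold lsub.
  rewrite (Rp_add _ _ (zxt t) (gyt t)), !(Rp_scal _ _ (zxt t) (gyt t)). vec.
Qed.

Definition psi n t := Rn (zt t) (gt t) n (wv (zt t)).
(** The derivative of [psi n] by the product rule: each application of [Rp] contributes one rank-one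
    term of the commutator. *)
Fixpoint Dn n t : l2 :=
  match n with
  | O => lscal Ci (dg (fun k => RtoC (x k)) (wv (zt t)))
  | S m => ladd (Rp (zt t) (gt t) (Dn m t)) (lscal (Ci * ip (psi m t) (Kp (gt t) alv))%C (wv (zt t)))
  end.

Lemma wt_eq t : wv (zt t) = dg (fun k => expi (x k * t)) (wv z0).
Proof.
  apply l2_ext; intro k. rewrite (wv_k _ (zxt t)), dg_k, (wv_k _ zx0) by apply expi_bounded. unfold zt.
  assert (E : (expi (x k * t) * Cconj (expi (x k * t)))%C = RtoC 1) by (rewrite Cmult_conj_norm2, expi_norm2; auto).
  assert (N : Cconj (expi (x k * t)) <> RtoC 0) by (intro Q; rewrite Q, Cmult_0_r in E; apply (f_equal fst) in E; simpl in E; lra).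
  pose proof (z_neq z0 zx0 k) as Nz.
  replace (RtoC (al k) / (z0 k * Cconj (expi (x k * t))))%C with (RtoC 1 * RtoC (al k) / (z0 k * Cconj (expi (x k * t))))%C by (field; auto).
  rewrite <- E. field. auto.
Qed.

Lemma lderiv_psi n t : lderiv (psi n) t (Dn n t).
Proof.
  induction n as [|n IH].
  - apply lderiv_ext with (fun s => dg (fun k => expi (x k * s)) (wv z0)); [intro s; symmetry; apply wt_eq|].
    apply lderiv_eq with (1 := lderiv_expi x (x O) (fun _ => wv z0) t lzero x_abs (lderiv_const (wv z0) t)).
    rewrite <- wt_eq. simpl. apply l2_ext; intro k. rewrite ladd_k, dg_k, lzero_k by apply expi_bounded. ring.
  - apply (lderiv_Rt _ _ _ IH).
Qed.

(** Unrolled and taken at [v = alv], the recursion has the shape of [NL_hank]: a term in H_u^2 u and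
    a finite convolution. *)
Lemma ip_Dn n t v : ip v (Dn n t) = (- Ci * (ip (An (zt t) (gt t) (zxt t) (gyt t) n v) (Hp (zt t) alv) +
  csum (fun k => Cconj (ip (psi (n - 1 - k) t) (Kp (gt t) alv)) * ip v (psi k t)) n))%C.
Proof.
  revert v; induction n as [|n IH]; intro v.
  - simpl Dn. rewrite ip_scal_r, <- (Hp_sqr _ (zxt t)), (Hp_wv _ (zxt t)). simpl csum.
    replace (Cconj Ci) with (- Ci)%C by (apply injective_projections; simpl; ring). change (An (zt t) (gt t) (zxt t) (gyt t) 0 v) with v. ring.
  - simpl Dn. rewrite ip_add_r, ip_scal_r, <- (ip_Ap _ _ (zxt t) (gyt t)), IH, Cmult_conj.
    replace (Cconj Ci) with (- Ci)%C by (apply injective_projections; simpl; ring).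
    rewrite csum_S_l. rewrite An_S. replace (S n - 1 - 0)%nat with n by lia. change (psi 0 t) with (wv (zt t)).
    rewrite (csum_ext (fun k => Cconj (ip (psi (S n - 1 - S k) t) (Kp (gt t) alv)) * ip v (psi (S k) t))%C
      (fun k => Cconj (ip (psi (n - 1 - k) t) (Kp (gt t) alv)) * ip (Ap (zt t) (gt t) (zxt t) (gyt t) v) (psi k t))%C).
    + ring.
    + intros k Hk. replace (S n - 1 - S k)%nat with (n - 1 - k)%nat by lia. rewrite ip_Ap. reflexivity.
Qed.

Definition vt t : h12 := usol (zt t) (gt t) (zxt t) (gyt t).

Lemma vt_k t n : vt t n = ip alv (psi n t).
Proof. unfold vt. rewrite usol_V, V_k, ip_An. reflexivity. Qed.

Theorem vt_deriv t n : Cderiv (fun s => vt s n) t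
  (- Ci * (hank (vt t) (hank (vt t) (vt t)) n + csum (fun k => hank (vt t) (vt t) (n - k)%nat * vt t k) n))%C.
Proof.
  assert (Eh : hank (vt t) (vt t) = V (zt t) (gt t) (zxt t) (gyt t) (Hp (zt t) alv)).
  { unfold vt. rewrite usol_V. apply hank_usol_V. }
  pose proof (lderiv_ip _ _ _ alv (lderiv_psi n t)) as H. rewrite ip_Dn in H.
  replace (hank (vt t) (hank (vt t) (vt t)) n + csum (fun k => hank (vt t) (vt t) (n - k)%nat * vt t k) n)%C
    with (ip (An (zt t) (gt t) (zxt t) (gyt t) n alv) (Hp (zt t) alv) +
      csum (fun k => Cconj (ip (psi (n - 1 - k) t) (Kp (gt t) alv)) * ip alv (psi k t)) n)%C.
  - destruct H as [H1 H2]. split; [eapply derivable_pt_lim_ext with (2 := H1) | eapply derivable_pt_lim_ext with (2 := H2)];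
      intro s; rewrite vt_k; auto.
  - f_equal.
    + rewrite hank_k, Eh. unfold vt. rewrite usol_V, shn_V, V_isom; auto.
    + apply csum_ext. intros k Hk. rewrite vt_k, Eh, V_k. f_equal.
      rewrite <- ip_conj. replace (n - k)%nat with (S (n - 1 - k)) by lia.
      rewrite An_S, Ap_Hp, ip_An. reflexivity.
Qed.
End Flow.
End Base.

(** * The clauses of the theorem in terms of data *)

Lemma datum_gen P : gen (dt_u P).
Proof. exact (chiD_gen _ _ _ _ _ _ _ (dt_chiD P)). Qed.

Lemma datum_chi P : chi (dt_u P) = (dt_z P, dt_g P).
Proof. exact (chiD_chi _ _ _ _ _ _ _ (dt_chiD P)). Qed.

Lemma datum_weights P : weights (fun j => Cnorm2 (dt_z P j)) (fun m => Cnorm2 (dt_g P m)) (fun j => dt_al P j * dt_al P j).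
Proof.
  pose proof (cd_weights _ _ _ _ _ _ _ (dt_chiD P)) as W.
  replace (fun j => Cnorm2 (dt_z P j)) with (fun j => Cnorm2 (Cconj (dt_z P j))); auto.
  apply functional_extensionality. intro. apply Cnorm2_conj.
Qed.

Definition dt_zl P : l2 := mkl2 _ (wt_xex _ _ _ (datum_weights P)).
Definition dt_gl P : l2 := mkl2 _ (wt_yex _ _ _ (datum_weights P)).
Lemma dt_zl_k P k : dt_zl P k = dt_z P k.
Proof. exact (lval_mkl2 _ _ _). Qed.
Lemma dt_gl_k P k : dt_gl P k = dt_g P k.
Proof. exact (lval_mkl2 _ _ _). Qed.

Lemma datum_chi_l2 P : chi (dt_u P) = (lval (dt_zl P), lval (dt_gl P)).
Proof.
  rewrite datum_chi. apply injective_projections; apply functional_extensionality; intro k; symmetry; [exact (dt_zl_k P k) | exact (dt_gl_k P k)].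
Qed.

Lemma weights_ypos x y a : weights x y a -> forall m, 0 < y m.
Proof. intros W m. pose proof (wt_yx _ _ _ W m). pose proof (wt_xpos _ _ _ W (S m)). lra. Qed.

Lemma datum_Xi P : Xi (dt_z P, dt_g P).
Proof.
  pose proof (datum_weights P) as W. split; [apply is_l2_ex, (wt_xex _ _ _ W)|]. split; [apply is_l2_ex, (wt_yex _ _ _ W)|].
  intro j. cbn [fst snd]. unfold Cabs. pose proof (weights_ypos _ _ _ W j) as Y.
  repeat split; apply Rlt_gt.
  - apply sqrt_lt_1_alt. split; [apply Cnorm2_ge0 | apply (wt_xy _ _ _ W)].
  - apply sqrt_lt_1_alt. split; [apply Cnorm2_ge0 | apply (wt_yx _ _ _ W)].
  - apply sqrt_lt_R0, Y.
Qed.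

Theorem Xi_datum z g : Xi (z, g) -> exists P : datum, dt_z P = z /\ dt_g P = g.
Proof.
  intros (Lz & Lg & H). cbn [fst snd] in *. apply is_l2_ex in Lz.
  assert (xy : forall j, Cnorm2 (g j) < Cnorm2 (z j)) by (intro j; destruct (H j) as (A & _); apply sqrt_lt_0_alt, A).
  assert (yx : forall j, Cnorm2 (z (S j)) < Cnorm2 (g j)) by (intro j; destruct (H j) as (_ & A & _); apply sqrt_lt_0_alt, A).
  assert (xpos : forall j, 0 < Cnorm2 (z j)).
  { intro j. eapply Rle_lt_trans; [|apply xy]. apply Cnorm2_ge0. }
  destruct (weights_exist _ _ xy yx xpos Lz) as (a & A1 & A2 & A3 & A4 & A5).
  exists (Build_datum _ _ _ _ _ _ _ (usol_chiD _ _ a xy yx xpos Lz A1 A2 A3 A4 A5 z g (fun _ => eq_refl) (fun _ => eq_refl))). auto.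
Qed.

(** Both limit theorems are sequential; an [eps] that admits no [delta] yields, by choice, a
    sequence with [a] below 1/(n+1) and [b] at least [eps]. *)
Lemma sequential_continuity {T : Type} (a b : T -> R) : (forall Q, 0 <= a Q) ->
  (forall q : nat -> T, is_lim_seq (fun n => a (q n)) 0 -> is_lim_seq (fun n => b (q n)) 0) ->
  forall eps, 0 < eps -> exists delta, 0 < delta /\ forall Q, a Q < delta -> b Q < eps.
Proof.
  intros A0 H eps He. destruct (classic (exists delta, 0 < delta /\ forall Q, a Q < delta -> b Q < eps)) as [|N]; auto.
  assert (Q : forall n, exists q, a q < / (INR n + 1) /\ eps <= b q).
  { intro n. destruct (classic (exists q, a q < / (INR n + 1) /\ eps <= b q)) as [|M]; auto.
    destruct N. exists (/ (INR n + 1)). split; [apply RinvN_pos|]. intros q Hq.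
    destruct (Rlt_le_dec (b q) eps); auto. destruct M; eauto. }
  set (q := fun n => proj1_sig (constructive_indefinite_description _ (Q n))).
  assert (Hq : forall n, a (q n) < / (INR n + 1) /\ eps <= b (q n)) by (intro n; apply (proj2_sig (constructive_indefinite_description _ (Q n)))).
  assert (L : is_lim_seq (fun n => b (q n)) 0).
  { apply H. apply lim0_le with (fun n => / (INR n + 1)); [intro n; split; [auto | apply Rlt_le, Hq]|].
    apply is_lim_seq_ext with (fun n => / (INR (S n))); [intro; rewrite S_INR; auto|].
    apply (is_lim_seq_incr_1 (fun n => / INR n)). replace (Finite 0) with (Rbar_inv p_infty) by auto.
    apply is_lim_seq_inv; [apply is_lim_seq_INR | discriminate]. }
  rewrite lim_eps in L. destruct (L eps He) as [n Hn]. specialize (Hn n (Nat.le_refl n)). destruct (Hq n) as [_ E].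
  rewrite Rminus_0_r in Hn. pose proof (Rle_abs (b (q n))). lra.
Qed.

Lemma lim0_of_sqrt (x : nat -> R) : (forall n, 0 <= x n) -> is_lim_seq (fun n => sqrt (x n)) 0 -> is_lim_seq x 0.
Proof.
  intros P H. apply is_lim_seq_ext with (fun n => sqrt (x n) * sqrt (x n)); [intro; apply sqrt_sqrt; auto|].
  replace 0 with (0 * 0) by ring. apply is_lim_seq_mult'; auto.
Qed.

Lemma lim0_sqrt (x : nat -> R) : is_lim_seq x 0 -> is_lim_seq (fun n => sqrt (x n)) 0.
Proof. intro H. rewrite <- sqrt_0. apply clim_cont_sqrt, H. Qed.

Lemma n2_lsub_sym x y : n2 (lsub x y) = n2 (lsub y x).
Proof. rewrite !n2_sub, (ip_conj y x). simpl. ring. Qed.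

Lemma Series_diff (x y : l2) (f g : nat -> C) : (forall k, x k = f k) -> (forall k, y k = g k) ->
  Series (fun k => Cnorm2 (f k - g k)%C) = n2 (lsub x y).
Proof. intros F G. rewrite n2_Series. apply Series_ext. intro k. rewrite lsub_k, F, G. auto. Qed.

Section Continuity.
Variable P : datum.
Let dh (Q : datum) := dH12 (dt_u P) (dt_u Q).
Let dx (Q : datum) := dXi (chi (dt_u P)) (chi (dt_u Q)).

Lemma dh_eq Q : dh Q = sqrt (hs (hsub (dt_u Q) (dt_u P))).
Proof. unfold dh. rewrite dH12_hs, hs_hsub_sym. auto. Qed.

Lemma dx_eq Q : dx Q = sqrt (n2 (lsub (dt_zl Q) (dt_zl P)) + n2 (lsub (dt_gl Q) (dt_gl P))).
Proof. unfold dx. rewrite !datum_chi_l2, dXi_n2, (n2_lsub_sym (dt_zl P)), (n2_lsub_sym (dt_gl P)). auto. Qed.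

Lemma forward_datum (q : nat -> datum) : is_lim_seq (fun n => dh (q n)) 0 -> is_lim_seq (fun n => dx (q n)) 0.
Proof.
  intro H. apply (is_lim_seq_ext _ _ _ (fun n => dh_eq (q n))), lim0_of_sqrt in H; [|intro; apply hs_ge0].
  pose proof (forward_limit _ _ _ _ _ _ _ _ _ _ _ _ _ _ (fun n => dt_chiD (q n)) (dt_chiD P) H) as F.
  apply is_lim_seq_ext with (1 := fun n => eq_sym (dx_eq (q n))). apply lim0_sqrt.
  refine (is_lim_seq_ext _ _ _ _ F). intro n. f_equal; apply Series_diff; intro; first [apply dt_zl_k | apply dt_gl_k].
Qed.

Lemma inverse_datum (q : nat -> datum) : is_lim_seq (fun n => dx (q n)) 0 -> is_lim_seq (fun n => dh (q n)) 0.
Proof.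
  intro H. apply (is_lim_seq_ext _ _ _ (fun n => dx_eq (q n))), lim0_of_sqrt in H.
  2:{ intro n. pose proof (n2_ge0 (lsub (dt_zl (q n)) (dt_zl P))). pose proof (n2_ge0 (lsub (dt_gl (q n)) (dt_gl P))). lra. }
  assert (Lz : slim (fun n => dt_zl (q n)) (dt_zl P)).
  { unfold slim. refine (lim0_le _ _ _ H). intro n. pose proof (n2_ge0 (lsub (dt_zl (q n)) (dt_zl P))). pose proof (n2_ge0 (lsub (dt_gl (q n)) (dt_gl P))). lra. }
  assert (Lg : slim (fun n => dt_gl (q n)) (dt_gl P)).
  { unfold slim. refine (lim0_le _ _ _ H). intro n. pose proof (n2_ge0 (lsub (dt_zl (q n)) (dt_zl P))). pose proof (n2_ge0 (lsub (dt_gl (q n)) (dt_gl P))). lra. }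
  assert (Sz : forall Q, n2 (dt_zl Q) = Series (fun j => Cnorm2 (dt_z Q j))) by (intro; rewrite n2_Series; apply Series_ext; intro; rewrite dt_zl_k; auto).
  assert (Sg : forall Q, n2 (dt_gl Q) = Series (fun j => Cnorm2 (dt_g Q j))) by (intro; rewrite n2_Series; apply Series_ext; intro; rewrite dt_gl_k; auto).
  apply is_lim_seq_ext with (1 := fun n => eq_sym (dh_eq (q n))). apply lim0_sqrt.
  apply is_lim_seq_ext with (1 := fun n => eq_sym (hs_hsub (dt_u (q n)) (dt_u P))).
  apply (inverse_limit _ _ _ _ _ _ _ _ _ _ _ _ _ _ (fun n => dt_chiD (q n)) (dt_chiD P)).
  - intro j. rewrite <- dt_zl_k. refine (clim_ext _ _ _ _ (wlim_coord _ _ (slim_wlim _ _ Lz) j)). intro; apply dt_zl_k.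
  - intro j. rewrite <- dt_gl_k. refine (clim_ext _ _ _ _ (wlim_coord _ _ (slim_wlim _ _ Lg) j)). intro; apply dt_gl_k.
  - rewrite <- Sz. apply is_lim_seq_ext with (1 := fun n => Sz (q n)). apply slim_n2, Lz.
  - rewrite <- Sg. apply is_lim_seq_ext with (1 := fun n => Sg (q n)). apply slim_n2, Lg.
Qed.

(** Continuity of the inverse applied to a constant sequence: equal images force distance 0. *)
Lemma datum_injective Q : chi (dt_u Q) = chi (dt_u P) -> dt_u Q = dt_u P.
Proof.
  intro E.
  assert (X : is_lim_seq (fun _ : nat => dx Q) 0).
  { rewrite dx_eq. rewrite !datum_chi_l2 in E. injection E as Ez Eg. apply lval_inj in Ez, Eg. rewrite Ez, Eg.
    assert (Z : forall x, n2 (lsub x x) = 0) by (intro x; rewrite n2_sub, ip_self; simpl; ring).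
    rewrite !Z, Rplus_0_r, sqrt_0. apply is_lim_seq_const. }
  apply (inverse_datum (fun _ => Q)) in X.
  assert (dh Q = 0) by (pose proof (is_lim_seq_unique _ _ X) as U; rewrite Lim_seq_const in U; injection U; auto).
  rewrite dh_eq in H. apply sqrt_eq_0 in H; [|apply hs_ge0].
  assert (N : n2 (hsub (dt_u Q) (dt_u P)) = 0) by (pose proof (n2_ge0 (hsub (dt_u Q) (dt_u P))); pose proof (n2_le_hs (hsub (dt_u Q) (dt_u P))); lra).
  apply n2_eq0 in N. rewrite <- lsub_hsub in N. apply lsub_eq0 in N. apply h12_ext. intro k. rewrite N. auto.
Qed.
End Continuity.

Section Dynamics.
Variable U : R -> seqC.
Hypothesis HU : szego_solution U.
Variable P : datum.
Hypothesis HP : lval (dt_u P) = U 0.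

Lemma flow_exists : exists V : R -> datum, forall t,
  lval (dt_u (V t)) = U t /\ dt_z (V t) = zt (fun j => Cnorm2 (dt_z P j)) (dt_z P) t /\ dt_g (V t) = gt (fun j => Cnorm2 (dt_g P j)) (dt_g P) t.
Proof.
  destruct HU as (H1 & Hc & Hd).
  set (u := fun t => proj1_sig (constructive_indefinite_description _ (proj1 (is_H12_lval _) (H1 t)))).
  assert (Hu : forall t, lval (u t) = U t) by (intro t; unfold u; destruct constructive_indefinite_description; auto).
  pose proof (datum_weights P) as W.
  set (x := fun j => Cnorm2 (dt_z P j)) in *. set (y := fun j => Cnorm2 (dt_g P j)) in *.
  destruct (weights_exist _ _ (wt_xy _ _ _ W) (wt_yx _ _ _ W) (wt_xpos _ _ _ W) (wt_xex _ _ _ W)) as (a & A1 & A2 & A3 & A4 & A5).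
  set (V := fun t => Build_datum _ _ _ _ _ _ _ (usol_chiD x y a (wt_xy _ _ _ W) (wt_yx _ _ _ W) (wt_xpos _ _ _ W) (wt_xex _ _ _ W) A1 A2 A3 A4 A5
    (zt x (dt_z P) t) (gt y (dt_g P) t) (zxt x (dt_z P) (fun _ => eq_refl) t) (gyt y (dt_g P) (fun _ => eq_refl) t))).
  exists V. intro t. split; [|auto]. rewrite <- Hu. symmetry. f_equal. f_equal.
  apply (uniqueness u (fun t => dt_u (V t))); clear t.
  - intros t k. destruct (Hd t k) as (d & D & E). replace (fun s => u s k) with (fun s => U s k) by (apply functional_extensionality; intro; rewrite Hu; auto).
    replace (- Ci * NL (u t) k)%C with d; auto. rewrite <- szego_nl_NL, Hu, <- E. apply injective_projections; simpl; ring.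
  - intros t k. rewrite NL_hank. 
    exact (vt_deriv x y a (wt_xy _ _ _ W) (wt_yx _ _ _ W) (wt_xpos _ _ _ W) (wt_xex _ _ _ W) A1 A2 A3 A4 A5 (dt_z P) (dt_g P) (fun _ => eq_refl) (fun _ => eq_refl) t k).
  - intro T.
    (* The squared H^{1/2} norm of the explicit solution is a trace, constant because the moduli of
       [zt] are. *)
    assert (Hv : forall t, hs (dt_u (V t)) = Series x).
    { intro t. pose proof (sd_trace _ _ _ (cd_e _ _ _ _ _ _ _ (dt_chiD (V t)))) as S. rewrite <- (is_series_unique _ _ S).
      apply Series_ext. intro j. rewrite Cnorm2_conj. apply (zxt x (dt_z P) (fun _ => eq_refl)). }
    destruct (Rle_lt_dec 0 T) as [T0|T0]; [|exists 0; intros t Ht; pose proof (Rabs_pos t); lra].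
    (* For the given solution the bound on [-T, T] comes from continuity in H^{1/2} on a compact
       interval. *)
    set (N := fun t => nrm (hw (u t))).
    destruct (continuity_ab_maj N (- T) T ltac:(lra)) as (m & Hm & _).
    { intros c _ eps He. destruct (Hc c eps He) as (delta & D0 & D). exists delta. split; auto.
      intros s [_ Hs]. simpl in Hs |- *. unfold R_dist in *. specialize (D s Hs). rewrite <- !Hu, dH12_hs, <- n2_hw, hw_hsub in D.
      fold (nrm (lsub (hw (u s)) (hw (u c)))) in D. unfold N.
      assert (E1 : hw (u s) = ladd (lsub (hw (u s)) (hw (u c))) (hw (u c))) by vec.
      assert (E2 : hw (u c) = lsub (hw (u s)) (lsub (hw (u s)) (hw (u c)))) by vec.
      pose proof (nrm_triang (lsub (hw (u s)) (hw (u c))) (hw (u c))) as T1. rewrite <- E1 in T1.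
      pose proof (nrm_triang_sub (hw (u s)) (lsub (hw (u s)) (hw (u c)))) as T2. rewrite <- E2 in T2.
      apply Rabs_def1; lra. }
    exists (Rmax (N m * N m) (Series x)). intros t Ht. rewrite Hv. split; [|apply Rmax_r].
    eapply Rle_trans; [|apply Rmax_l]. rewrite <- n2_hw, <- nrm_sqr. apply Rabs_le_between in Ht.
    apply Rmult_le_compat; try apply nrm_ge0; apply Hm; lra.
  (* At time 0 the explicit solution has the spectral data of [P], and these determine the
     symbol. *)
  - apply hval_inj. rewrite Hu, <- HP. f_equal. f_equal. symmetry. apply datum_injective. rewrite !datum_chi. cbn [dt_z dt_g V].
    f_equal; apply functional_extensionality; intro j; [unfold zt | unfold gt]; rewrite Rmult_0_r, expi_0.
    + rewrite Cconj_R. apply Cmult_1_r.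
    + apply Cmult_1_r.
Qed.
End Dynamics.

Lemma zt_deriv x (z : nat -> C) t j : Cderiv (fun s => zt x z s j) t (- Ci * (RtoC (x j) * zt x z t j))%C.
Proof.
  unfold zt, expi, Cderiv. split; apply is_derive_Reals; simpl; auto_derive; auto; ring.
Qed.

Lemma gt_deriv y (g : nat -> C) t j : Cderiv (fun s => gt y g s j) t (Ci * (RtoC (y j) * gt y g t j))%C.
Proof.
  unfold gt, expi, Cderiv. split; apply is_derive_Reals; simpl; auto_derive; auto; ring.
Qed.

Require Import Defs.
From Stdlib Require Import Reals ClassicalEpsilon.
Open Scope R_scope.

Theorem theorem2 :
  (* chi is well defined on H^{1/2}_{+,gen} (independent of choices) *)
  (forall u, gen u -> exists! p, chi_rel u p) /\
  (* chi maps gen into Xi *)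
  (forall u, gen u -> Xi (chi u)) /\
  (* injective *)
  (forall u v, gen u -> gen v -> chi u = chi v -> u = v) /\
  (* onto Xi *)
  (forall p, Xi p -> exists u, gen u /\ chi u = p) /\
  (* continuous for the H^{1/2} topology *)
  (forall u eps, gen u -> 0 < eps -> exists delta, 0 < delta /\
     forall v, gen v -> dH12 u v < delta -> dXi (chi u) (chi v) < eps) /\
  (* the inverse is continuous *)
  (forall u eps, gen u -> 0 < eps -> exists delta, 0 < delta /\
     forall v, gen v -> dXi (chi u) (chi v) < delta -> dH12 u v < eps) /\
  (* dynamics *)
  (forall U : R -> seqC, szego_solution U -> gen (U 0) ->
     forall t, gen (U t) /\
       (forall j, exists z, Cderiv (fun s => fst (chi (U s)) j) t z /\
          Cmul Ci z = Cscale (Cnorm2 (fst (chi (U t)) j)) (fst (chi (U t)) j)) /\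
       (forall m, exists z, Cderiv (fun s => snd (chi (U s)) m) t z /\
          Cmul Ci z = Copp (Cscale (Cnorm2 (snd (chi (U t)) m)) (snd (chi (U t)) m)))).
Proof.
  split; [|split; [|split; [|split; [|split; [|split]]]]].
  - intros h G. destruct (gen_datum h G) as [P <-]. exists (dt_z P, dt_g P). split.
    + exact (chi_rel_exists _ _ _ _ _ _ _ (dt_chiD P)).
    + intros p Hp. symmetry. exact (chi_rel_unique _ _ _ _ _ _ _ (dt_chiD P) p Hp).
  - intros h G. destruct (gen_datum h G) as [P <-]. rewrite datum_chi. apply datum_Xi.
  - intros h k G G' E. destruct (gen_datum h G) as [P <-], (gen_datum k G') as [Q <-].
    rewrite (datum_injective Q P E). auto.
  - intros [z g] H. destruct (Xi_datum z g H) as (P & <- & <-). exists (lval (dt_u P)). split; [apply datum_gen | apply datum_chi].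
  - intros h eps G He. destruct (gen_datum h G) as [P <-].
    destruct (sequential_continuity (fun Q => dH12 (lval (dt_u P)) (lval (dt_u Q))) (fun Q => dXi (chi (lval (dt_u P))) (chi (lval (dt_u Q))))
      (fun Q => sqrt_pos _) (forward_datum P) eps He) as (d & d0 & H).
    exists d. split; auto. intros v G' Hv. destruct (gen_datum v G') as [Q <-]. apply H, Hv.
  - intros h eps G He. destruct (gen_datum h G) as [P <-].
    destruct (sequential_continuity (fun Q => dXi (chi (lval (dt_u P))) (chi (lval (dt_u Q)))) (fun Q => dH12 (lval (dt_u P)) (lval (dt_u Q)))
      (fun Q => sqrt_pos _) (inverse_datum P) eps He) as (d & d0 & H).
    exists d. split; auto. intros v G' Hv. destruct (gen_datum v G') as [Q <-]. apply H, Hv.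
  - intros U HU G. destruct (gen_datum _ G) as [P HP]. destruct (flow_exists U HU P HP) as [V HV].
    assert (E : forall t, chi (U t) = (zt (fun j => Cnorm2 (dt_z P j)) (dt_z P) t, gt (fun j => Cnorm2 (dt_g P j)) (dt_g P) t)).
    { intro t. destruct (HV t) as (<- & <- & <-). apply datum_chi. }
    intro t. split; [destruct (HV t) as (<- & _); apply datum_gen|]. rewrite E. cbn [fst snd]. split; intro j.
    + replace (fun s => fst (chi (U s)) j) with (fun s => zt (fun j => Cnorm2 (dt_z P j)) (dt_z P) s j) by (apply functional_extensionality; intro; rewrite E; auto).
      eexists. split; [apply zt_deriv|]. rewrite (zxt (fun j => Cnorm2 (dt_z P j)) (dt_z P) (fun _ => eq_refl)).
      apply injective_projections; simpl; ring.
    + replace (fun s => snd (chi (U s)) j) with (fun s => gt (fun j => Cnorm2 (dt_g P j)) (dt_g P) s j) by (apply functional_extensionality; intro; rewrite E; auto).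
      eexists. split; [apply gt_deriv|]. rewrite (gyt (fun j => Cnorm2 (dt_g P j)) (dt_g P) (fun _ => eq_refl)).
      apply injective_projections; simpl; ring.
Qed.
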